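(* Let $\mathbb{D}$ denote $S^2$, $\mathbb{C}$ or the unit disk of $\mathbb{C}$. Let $\mathcal{F}:\mathbb{D}\rightarrow SO^+(1,2m-1)/SO^+(1,3)\times SO(2m-4)$ be a strongly conformally harmonic map whose normalized potential is of the form $\eta=\lambda^{-1}\eta_{-1}dz$ with $$\eta_{-1}=\begin{pmatrix}0&\hat B_1\\-\hat B_1^tI_{1,3}&0\end{pmatrix},\qquad \hat B_1=\begin{pmatrix}f_{11}&f_{12}&\cdots&f_{m-2,1}&f_{m-2,2}\\ f_{11}&f_{12}&\cdots&f_{m-2,1}&f_{m-2,2}\\ f_{13}&f_{14}&\cdots&f_{m-2,3}&f_{m-2,4}\\ if_{13}&if_{14}&\cdots&if_{m-2,3}&if_{m-2,4}\end{pmatrix},$$ where the $f_{ij}$ are meromorphic functions on $\mathbb{D}$. Then $\mathcal F$ contains a constant lightlike vector. Moreover, if $\mathcal F$ is the conformal Gauss map of a strong Willmore map $y:\mathbb{D}\rightarrow S^{2m-2}$, then $\mathrm{rank}(\hat B_1)\le 1$ and $y$ is Möbius equivalent to a minimal surface in $\mathbb{R}^{2m-2}$.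
   Context: Put $n=2m-4$, so $n+4=2m$. Groups. $I_{1,k}=\mathrm{diag}(-1,1,\dots,1)$ with $k$ entries equal to $1$; $\mathbb{R}^{1,n+3}$ is $\mathbb{R}^{n+4}$ with $\langle x,y\rangle=x^tI_{1,n+3}y$. $G=SO^+(1,n+3)$ is the identity component of $\{A\in Mat(n+4,\mathbb{R}): A^tI_{1,n+3}A=I_{1,n+3},\ \det A=1\}$; $K=SO^+(1,3)\times SO(n)$ is embedded block-diagonally. $G/K$ is the Grassmannian of oriented 4-dimensional Lorentzian subspaces of $\mathbb{R}^{1,n+3}$, $gK$ corresponding to the span of the first four columns of $g$. $G^{\mathbb{C}}=SO(1,n+3,\mathbb{C})$, $\sigma(A)=DAD^{-1}$ with $D=\mathrm{diag}(-I_4,I_n)$, and $\mathfrak{g}=\mathfrak{k}\oplus\mathfrak{p}$ is the eigenspace decomposition of $\sigma$. Strongly conformally harmonic maps. For a (local) lift $F$ into $G$ of $\mathcal F$ with complex coordinate $z$, write $\alpha=F^{-1}dF=\begin{pmatrix}A_1&B_1\\-B_1^tI_{1,3}&A_2\end{pmatrix}dz+\begin{pmatrix}\bar A_1&\bar B_1\\-\bar B_1^tI_{1,3}&\bar A_2\end{pmatrix}d\bar z$ with $B_1\in Mat(4\times n,\mathbb{C})$. A harmonic map $\mathcal F$ is strongly conformal (then called a strongly conformally harmonic map) if $B_1^tI_{1,3}B_1=0$. $\mathcal F$ contains a constant lightlike vector if there is a nonzero $a\in\mathbb{R}^{1,n+3}$ with $\langle a,a\rangle=0$ and $a\in\mathcal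 F(q)$ for all $q$. Normalized potential. With $\alpha=\alpha_{\mathfrak p}'+\alpha_{\mathfrak k}+\alpha_{\mathfrak p}''$ (the $\mathfrak k$-part and the $(1,0)$, $(0,1)$ parts of the $\mathfrak p$-part), harmonicity means $\alpha_\lambda=\lambda^{-1}\alpha_{\mathfrak p}'+\alpha_{\mathfrak k}+\lambda\alpha_{\mathfrak p}''$ is flat for all $\lambda\in S^1$. Fix a base point $p$ (with $z(p)=0$ and $\mathcal F(p)=IK$); an extended frame is a solution $F(z,\bar z,\lambda)$ of $F^{-1}dF=\alpha_\lambda$ with $F|_{p}=I$. Loops $\gamma$ in $G^{\mathbb{C}}$ are twisted if $\gamma(-\lambda)=\sigma(\gamma(\lambda))$. Near $p$ there is a unique Birkhoff decomposition $F=F_-F_+$ into twisted loops, $F_+$ extending holomorphically (in $G^{\mathbb{C}}$) to $|\lambda|<1$ and $F_-$ extending holomorphically to $|\lambda|>1$ including $\infty$ with $F_-|_{\lambda=\infty}=I$. $F_-$ is meromorphic in $z$ and extends meromorphically to $\mathbb{D}$; $\eta=F_-^{-1}dF_-=\lambda^{-1}\eta_{-1}dz$ is the normalized potential. Willmore maps. For a conformal immersion $y:M\to S^{n+2}$ with $z=u+iv$, put $Y=e^{-\rho}(1,y)\in\mathbb{R}^{1,n+3}$ with $\rho$ any real function; the conformal Gauss map of $y$ sends a point to the 4-dimensional Lorentzian subspace spanned by $Y,Y_{z\bar z},Y_u,Y_v$, oriented by this ordered basis (independent of the choices). $y$ is Willmore if it is a critical immersion of the Willmore functional; equivalently its conformal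 Gauss map is harmonic. A smooth map $y:M\to S^{n+2}$ is a Willmore map if it is a conformal Willmore immersion on an open dense subset $\hat M\subset M$; it is a strong Willmore map if moreover the conformal Gauss map on $\hat M$ extends smoothly to $M$ (the extension is then called the conformal Gauss map of $y$). $y$ is Möbius equivalent to a minimal surface in $\mathbb{R}^{n+2}$ if, after some Möbius transformation of $S^{n+2}$ followed by stereographic projection, it is (on the open dense set where it is an immersion avoiding the point at infinity) a minimal surface in $\mathbb{R}^{n+2}$. $\mathrm{rank}(\hat B_1)$ is the maximal (generic) rank of the meromorphic matrix function $\hat B_1$. *)

(* Defs.v *)
From HB Require Import structures.
From mathcomp Require Import all_boot all_order all_algebra complex.
From mathcomp Require Import all_classical all_reals all_analysis.

Set Implicit Arguments.
Unset Strict Implicit.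
Unset Printing Implicit Defensive.

Import Order.TTheory GRing.Theory Num.Theory.
Import numFieldNormedType.Exports.

Local Open Scope classical_set_scope.
Local Open Scope complex_scope.
Local Open Scope ring_scope.

Section Smooth.
Variable R : realType.

Definition iter_deriv (V : normedModType R) (s : seq V) (f : V -> R) : V -> R :=
  foldr (fun v g => fun x => 'D_v g x) f s.

(* C^oo on an open set U: iterated directional derivatives of all orders exist
   and are continuous at the points of U. *)
Definition smooth_on (V : normedModType R) (U : set V) (f : V -> R) : Prop :=
  forall (s : seq V) (x : V), U x ->
    {for x, continuous (iter_deriv s f)} /\
    (forall v : V, derivable (iter_deriv s f) x v).

End Smooth.

Notation Cplane R := (R[i]^o).
Notation Rsphere R := (one_point_compactification (R[i]^o)).

Section Plane.
Variable R : realType.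
Local Notation C := (Cplane R).

Definition toC (p : R * R) : C := p.1 +i* p.2.
Definition ofC (z : C) : R * R := (complex.Re z, complex.Im z).

Definition smoothR (U : set C) (f : C -> R) : Prop :=
  smooth_on (toC @^-1` U) (f \o toC).

Definition smoothRmx p q (U : set C) (f : C -> 'M[R]_(p, q)) : Prop :=
  forall i j, smoothR U (fun z => f z i j).

Definition smoothCmx p q (U : set C) (f : C -> 'M[C]_(p, q)) : Prop :=
  forall i j, smoothR U (fun z => complex.Re (f z i j)) /\
              smoothR U (fun z => complex.Im (f z i j)).

(* partial derivatives with respect to u and v, where z = u + iv *)
Definition du (f : C -> R) (z : C) : R := 'D_((1, 0) : R * R) (f \o toC) (ofC z).
Definition dv (f : C -> R) (z : C) : R := 'D_((0, 1) : R * R) (f \o toC) (ofC z).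

Definition dumx p q (f : C -> 'M[R]_(p, q)) (z : C) : 'M[R]_(p, q) :=
  \matrix_(i, j) du (fun w => f w i j) z.
Definition dvmx p q (f : C -> 'M[R]_(p, q)) (z : C) : 'M[R]_(p, q) :=
  \matrix_(i, j) dv (fun w => f w i j) z.

Definition duC (f : C -> C) (z : C) : C :=
  du (fun w => complex.Re (f w)) z +i* du (fun w => complex.Im (f w)) z.
Definition dvC (f : C -> C) (z : C) : C :=
  dv (fun w => complex.Re (f w)) z +i* dv (fun w => complex.Im (f w)) z.

(* Wirtinger derivatives, entrywise *)
Definition dz p q (f : C -> 'M[C]_(p, q)) (z : C) : 'M[C]_(p, q) :=
  \matrix_(i, j) (2^-1 * (duC (fun w => f w i j) z - 'i * dvC (fun w => f w i j) z)).
Definition dzbar p q (f : C -> 'M[C]_(p, q)) (z : C) : 'M[C]_(p, q) :=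
  \matrix_(i, j) (2^-1 * (duC (fun w => f w i j) z + 'i * dvC (fun w => f w i j) z)).

Definition cmx p q (A : 'M[R]_(p, q)) : 'M[C]_(p, q) := map_mx (real_complex R) A.

Definition holomorphic_on (U : set C) (f : C -> C) : Prop :=
  forall z, U z -> derivable f z 1.

(* The two affine charts z and 1/z of the Riemann sphere. *)
Definition chart (b : bool) (w : C) : Rsphere R :=
  if b then (if w == 0 then None else Some (w^-1 : C)) else Some w.

(* S^2, C, or the unit disk, as an open subset of the Riemann sphere *)
Definition is_sphere_plane_or_disk (D : set (Rsphere R)) : Prop :=
  [\/ D = setT,
      D = (Some @` [set: C] : set (Rsphere R)) |
      D = (Some @` [set z : C | `|z| < 1] : set (Rsphere R))].

Definition holomorphic_at (f : Rsphere R -> C) (q : Rsphere R) : Prop :=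
  forall b w0, chart b w0 = q -> \forall w \near w0, derivable (f \o chart b) w 1.

(* A meromorphic function is a total function; its values at the poles are
   irrelevant. *)
Definition meromorphic_at (f : Rsphere R -> C) (q : Rsphere R) : Prop :=
  forall b w0, chart b w0 = q ->
    exists (k : nat) (g : C -> C),
      (\forall w \near w0, derivable g w 1) /\
      (\forall w \near w0, w != w0 -> f (chart b w) = g w / (w - w0) ^+ k).

Definition meromorphic (D : set (Rsphere R)) (f : Rsphere R -> C) : Prop :=
  forall q, D q -> meromorphic_at f q.

(* maximal rank over the points where all the entries are holomorphic *)
Definition is_generic_rank p q (D : set (Rsphere R))
    (B : Rsphere R -> 'M[C]_(p, q)) (r : nat) : Prop :=
  let regular x := D x /\ forall i j, holomorphic_at (fun s => B s i j) x in
  (exists2 x, regular x & \rank (B x) = r) /\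
  (forall x, regular x -> (\rank (B x) <= r)%N).

End Plane.

(* I_{1,k} with N = 1 + k *)
Definition I1 (T : nzRingType) (N : nat) : 'M[T]_N :=
  diag_mx (\row_(j < N) if val j == 0%N then -1 else 1).

Section Groups.
Variable R : realType.
Local Notation C := (Cplane R).

Definition O1 (N : nat) : set 'M[R]_N := [set A | A^T *m I1 R N *m A = I1 R N].

(* SO^+(1, N-1) *)
Definition SO1plus (N : nat) : set 'M[R]_N :=
  connected_component (@O1 N `&` [set A | \det A = 1]) 1%:M.

Definition SO (N : nat) : set 'M[R]_N := [set A | A^T *m A = 1%:M /\ \det A = 1].

(* SO(1, N-1, C) *)
Definition SO1C (N : nat) : set 'M[C]_N :=
  [set A | A^T *m I1 C N *m A = I1 C N /\ \det A = 1].

Variable n : nat.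

Definition Ksub : set 'M[R]_(4 + n) :=
  [set k | exists A B, [/\ SO1plus A, SO B & k = block_mx A 0 0 B]].

(* Points of G/K are represented by the cosets themselves, as sets of matrices. *)
Definition Kcoset (g : 'M[R]_(4 + n)) : set 'M[R]_(4 + n) :=
  [set g *m k | k in Ksub].

(* the 4-dimensional subspace of R^{1,n+3} attached to a point of G/K *)
Definition subspace_of (X : set 'M[R]_(4 + n)) : set 'cV[R]_(4 + n) :=
  [set a | exists g c, X g /\ a = lsubmx g *m c].

Definition sigma (A : 'M[C]_(4 + n)) : 'M[C]_(4 + n) :=
  let D := block_mx (- 1%:M) 0 0 1%:M in D *m A *m invmx D.

(* projections onto the +1 and -1 eigenspaces of sigma *)
Definition kpart (A : 'M[C]_(4 + n)) := 2^-1 *: (A + sigma A).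
Definition ppart (A : 'M[C]_(4 + n)) := 2^-1 *: (A - sigma A).

End Groups.

Section Harmonic.
Variables (R : realType) (n : nat).
Local Notation C := (Cplane R).
Local Notation S := (Rsphere R).
Local Notation GKmap := (S -> set 'M[R]_(4 + n)).

Definition is_lift (D : set S) (FF : GKmap) (b : bool) (U : set C)
    (F : C -> 'M[R]_(4 + n)) : Prop :=
  [/\ open U,
      (forall w, U w -> D (chart b w)),
      smoothRmx U F &
      forall w, U w -> SO1plus (F w) /\ FF (chart b w) = Kcoset (F w)].

Definition smooth_GKmap (D : set S) (FF : GKmap) : Prop :=
  forall b w, D (chart b w) -> exists U F, is_lift D FF b U F /\ U w.

(* alpha = F^-1 dF = mc_z F dz + mc_zbar F dzbar *)
Definition mc_z (F : C -> 'M[R]_(4 + n)) (z : C) : 'M[C]_(4 + n) :=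
  invmx (cmx (F z)) *m dz (fun w => cmx (F w)) z.
Definition mc_zbar (F : C -> 'M[R]_(4 + n)) (z : C) : 'M[C]_(4 + n) :=
  invmx (cmx (F z)) *m dzbar (fun w => cmx (F w)) z.

(* alpha_lambda = alpha_z dz + alpha_zbar dzbar *)
Definition alpha_z (F : C -> 'M[R]_(4 + n)) (l z : C) : 'M[C]_(4 + n) :=
  l^-1 *: ppart (mc_z F z) + kpart (mc_z F z).
Definition alpha_zbar (F : C -> 'M[R]_(4 + n)) (l z : C) : 'M[C]_(4 + n) :=
  l *: ppart (mc_zbar F z) + kpart (mc_zbar F z).

(* d a + a /\ a = (Q_z - P_zbar + [P, Q]) dz /\ dzbar for a = P dz + Q dzbar *)
Definition flat_on (U : set C) (P Q : C -> 'M[C]_(4 + n)) : Prop :=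
  forall z, U z -> dz Q z - dzbar P z + (P z *m Q z - Q z *m P z) = 0.

Definition harmonic (D : set S) (FF : GKmap) : Prop :=
  smooth_GKmap D FF /\
  forall b U F, is_lift D FF b U F ->
    forall l : C, `|l| = 1 -> flat_on U (alpha_z F l) (alpha_zbar F l).

Definition strongly_conformal (D : set S) (FF : GKmap) : Prop :=
  forall b U F, is_lift D FF b U F ->
    forall z, U z ->
      let B1 := ursubmx (mc_z F z) in B1^T *m I1 C 4 *m B1 = 0.

Definition strongly_conformally_harmonic (D : set S) (FF : GKmap) : Prop :=
  harmonic D FF /\ strongly_conformal D FF.

Definition contains_constant_lightlike (D : set S) (FF : GKmap) : Prop :=
  exists a : 'cV[R]_(4 + n),
    [/\ a != 0, a^T *m I1 R (4 + n) *m a = 0 &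
        forall q, D q -> subspace_of (FF q) a].

(* twisted loops in G^C extending holomorphically to the open unit disk,
   continuously up to the unit circle *)
Definition plus_loop (g : C -> 'M[C]_(4 + n)) : Prop :=
  [/\ (forall l : C, `|l| <= 1 -> SO1C (g l)),
      (forall l : C, `|l| = 1 -> g (- l) = sigma (g l)),
      (forall i j, holomorphic_on [set l : C | `|l| < 1] (fun l => g l i j)) &
      (forall i j, {within [set l : C | `|l| <= 1],
                      continuous (fun l => g l i j : C)})].

(* twisted loops extending holomorphically to |l| > 1 including infinity,
   where the value is I: l |-> d (1 / l) with d as above and d 0 = I *)
Definition minus_loop_based (g : C -> 'M[C]_(4 + n)) : Prop :=
  exists d, [/\ plus_loop d, d 0 = 1%:M &
                forall l : C, 1 <= `|l| -> g l = d l^-1].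

(* F is the extended frame on U with F = I at the base point z = 0, obtained
   from the lift F0. *)
Definition is_extended_frame (U : set C) (F0 : C -> 'M[R]_(4 + n))
    (F : C -> C -> 'M[C]_(4 + n)) : Prop :=
  forall l : C, `|l| = 1 ->
    [/\ smoothCmx U (F^~ l), F 0 l = 1%:M &
        forall z, U z ->
          dz (F^~ l) z = F z l *m alpha_z F0 l z /\
          dzbar (F^~ l) z = F z l *m alpha_zbar F0 l z].

(* eta = l^-1 eta1 dz is the normalized potential of FF with base point z = 0:
   eta1 is meromorphic on D and, near the base point, F_-^-1 dF_- = eta for
   the Birkhoff factor F_- of the extended frame. *)
Definition is_normalized_potential (D : set S) (FF : GKmap)
    (eta1 : S -> 'M[C]_(4 + n)) : Prop :=
  (forall i j, meromorphic D (fun q => eta1 q i j)) /\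
  exists (U : set C) (F0 : C -> 'M[R]_(4 + n)) (F Fm Fp : C -> C -> 'M[C]_(4 + n)),
    [/\ [/\ connected U, U 0, is_lift D FF false U F0 & F0 0 = 1%:M],
        is_extended_frame U F0 F,
        (forall z, U z -> [/\ minus_loop_based (Fm z), plus_loop (Fp z) &
           forall l : C, `|l| = 1 -> F z l = Fm z l *m Fp z l]) &
        (forall z, U z -> forall l : C, `|l| = 1 -> forall i j,
           is_derive z 1 (fun w => Fm w l i j : C)
             ((Fm z l *m (l^-1 *: eta1 (Some z))) i j))].

Definition potential_mx (B : 'M[C]_(4, n)) : 'M[C]_(4 + n) :=
  block_mx 0 B (- (B^T *m I1 C 4)) 0.

(* The columns 2i-1 and 2i (counted from 1) of the matrix are
   (f_i1, f_i1, f_i3, 'i f_i3) and (f_i2, f_i2, f_i4, 'i f_i4). *)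
Definition Bhat (f : nat -> nat -> S -> C) (q : S) : 'M[C]_(4, n) :=
  \matrix_(r < 4, c < n)
    let i := (c./2).+1 in
    let e := odd c : nat in
    if (r < 2)%N then f i e.+1 q
    else if val r == 2%N then f i e.+3 q
    else 'i * f i e.+3 q.

End Harmonic.

Section Surfaces.
Variable R : realType.
Local Notation C := (Cplane R).
Local Notation S := (Rsphere R).

Definition dot N (x y : 'cV[R]_N) : R := (x^T *m y) 0 0.

Definition tangent N (h : C -> 'cV[R]_N) (z : C) : 'M[R]_(N, 1 + 1) :=
  row_mx (dumx h z) (dvmx h z).

Definition immersion_at N (h : C -> 'cV[R]_N) (z : C) : Prop :=
  \rank (tangent h z) = 2%N.

Definition conformal_at N (h : C -> 'cV[R]_N) (z : C) : Prop :=
  dot (dumx h z) (dumx h z) = dot (dvmx h z) (dvmx h z) /\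
  dot (dumx h z) (dvmx h z) = 0.

(* orthogonal projection onto the complement of the column space of J *)
Definition nproj N k (J : 'M[R]_(N, k)) : 'M[R]_N :=
  1%:M - J *m invmx (J^T *m J) *m J^T.

Definition det_metric N (h : C -> 'cV[R]_N) (z : C) : R :=
  \det ((tangent h z)^T *m tangent h z).

(* the mean curvature vector (1/2) tr_g II of h, where P is the projection onto
   the normal space *)
Definition mean_curvature N (P : 'M[R]_N) (h : C -> 'cV[R]_N) (z : C) : 'cV[R]_N :=
  let hu := dumx h z in let hv := dvmx h z in
  (2 * det_metric h z)^-1 *:
    (P *m (dot hv hv *: dumx (dumx h) z - (2 * dot hu hv) *: dumx (dvmx h) z
           + dot hu hu *: dvmx (dvmx h) z)).

Definition minimal_immersion_at N (x : C -> 'cV[R]_N) (z : C) : Prop :=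
  immersion_at x z /\ mean_curvature (nproj (tangent x z)) x z = 0.

(* (|H|^2 - K + 1) dA for an immersion h into the unit sphere; by the Gauss
   equation K - 1 = (<II_uu, II_vv> - |II_uv|^2) / det g. *)
Definition willmore_density N (h : C -> 'cV[R]_N) (z : C) : R :=
  let P := nproj (row_mx (h z) (tangent h z)) in
  let H := mean_curvature P h z in
  let II_uu := P *m dumx (dumx h) z in
  let II_uv := P *m dumx (dvmx h) z in
  let II_vv := P *m dvmx (dvmx h) z in
  (dot H H - (dot II_uu II_vv - dot II_uv II_uv) / det_metric h z)
    * Num.sqrt (det_metric h z).

Definition unit_sphere N : set 'cV[R]_N := [set x | dot x x = 1].

(* y is a critical point of the Willmore functional on the open set M, with
   respect to variations through maps into the unit sphere that are supported in
   a compact subset k of a chart.  By a partition of unity and the linearity of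
   the first variation these suffice. *)
Definition willmore_critical N (M : set S) (y : S -> 'cV[R]_N) : Prop :=
  forall (b : bool) (k : set (R * R)) (h : R -> C -> 'cV[R]_N),
    compact k -> (forall p, k p -> M (chart b (toC p))) ->
    (forall i, smooth_on [set p : R * (R * R) | M (chart b (toC p.2))]
                 (fun p => h p.1 (toC p.2) i 0)) ->
    (forall t p, M (chart b (toC p)) -> unit_sphere (h t (toC p))) ->
    (forall p, M (chart b (toC p)) -> h 0 (toC p) = y (chart b (toC p))) ->
    (forall t p, M (chart b (toC p)) -> ~ k p -> h t (toC p) = y (chart b (toC p))) ->
    is_derive (0 : R) 1
      (fun t : R => Rintegral (@lebesgue_measure R \x @lebesgue_measure R)%E k
                      (fun p => willmore_density (h t) (toC p)))
      (0 : R).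

Definition smooth_sphere_map N (D : set S) (y : S -> 'cV[R]_N) : Prop :=
  (forall q, D q -> unit_sphere (y q)) /\
  (forall b, smoothRmx (chart b @^-1` D) (y \o chart b)).

Definition immersion_at_point N (y : S -> 'cV[R]_N) (q : S) : Prop :=
  forall b w, chart b w = q -> immersion_at (y \o chart b) w.

Definition open_dense_in (D M : set S) : Prop :=
  [/\ open M, M `<=` D & D `<=` closure M].

Definition conformal_Willmore_immersion N (M : set S) (y : S -> 'cV[R]_N) : Prop :=
  [/\ (forall q, M q -> immersion_at_point y q),
      (forall b w, M (chart b w) -> conformal_at (y \o chart b) w) &
      willmore_critical M y].

Variable n : nat.

(* Y = e^{-rho} (1, y), for the map h = y in a chart *)
Definition light_lift (rho : C -> R) (h : C -> 'cV[R]_(3 + n)) (z : C) :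
    'cV[R]_(4 + n) :=
  expR (- rho z) *: (col_mx (1%:M : 'cV[R]_1) (h z) : 'cV[R]_(1 + (3 + n))).

(* the ordered basis Y, Y_{z zbar} = (Y_uu + Y_vv) / 4, Y_u, Y_v *)
Definition gauss_frame (rho : C -> R) (h : C -> 'cV[R]_(3 + n)) (z : C) :
    'M[R]_(4 + n, 4) :=
  let Y := light_lift rho h in
  (row_mx (row_mx (Y z) (4^-1 *: (dumx (dumx Y) z + dvmx (dvmx Y) z)))
          (row_mx (dumx Y z) (dvmx Y z)) : 'M[R]_(4 + n, (1 + 1) + (1 + 1))).

(* The point X of G/K is the span of the columns of V, oriented by them. *)
Definition oriented_span (X : set 'M[R]_(4 + n)) (V : 'M[R]_(4 + n, 4)) : Prop :=
  exists (g : 'M[R]_(4 + n)) (P : 'M[R]_4),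
    [/\ X g, 0 < \det P & V = lsubmx g *m P].

Definition is_conformal_gauss_map (M : set S) (y : S -> 'cV[R]_(3 + n))
    (FF : S -> set 'M[R]_(4 + n)) : Prop :=
  forall b (rho : C -> R), smoothR (chart b @^-1` M) rho ->
    forall w, M (chart b w) ->
      oriented_span (FF (chart b w)) (gauss_frame rho (y \o chart b) w).

(* y : D -> S^{n+2} is a strong Willmore map, with FF the smooth extension to D
   of its conformal Gauss map *)
Definition strong_Willmore_with_gauss_map (D : set S) (y : S -> 'cV[R]_(3 + n))
    (FF : S -> set 'M[R]_(4 + n)) : Prop :=
  smooth_sphere_map D y /\
  exists M, [/\ open_dense_in D M, conformal_Willmore_immersion M y,
                smooth_GKmap D FF & is_conformal_gauss_map M y FF].

(* the action of A in O(1, n+3) on S^{n+2}, seen as the projectivized light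
   cone: [1 : x] is sent to [A (1, x)] *)
Definition moebius (A : 'M[R]_(4 + n)) (x : 'cV[R]_(3 + n)) : 'cV[R]_(3 + n) :=
  let v : 'cV[R]_(1 + (3 + n)) :=
    A *m (col_mx (1%:M : 'cV[R]_1) x : 'cV[R]_(1 + (3 + n))) in
  (usubmx v 0 0)^-1 *: dsubmx v.

Definition pole : 'cV[R]_(3 + n) :=
  (col_mx (1%:M : 'cV[R]_1) 0 : 'cV[R]_(1 + (2 + n))).

Definition stereographic (x : 'cV[R]_(3 + n)) : 'cV[R]_(2 + n) :=
  let x' : 'cV[R]_(1 + (2 + n)) := x in
  (1 - usubmx x' 0 0)^-1 *: dsubmx x'.

Definition moebius_equivalent_to_minimal (D : set S) (y : S -> 'cV[R]_(3 + n)) :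
    Prop :=
  exists2 A : 'M[R]_(4 + n), O1 A &
    let M := [set q | [/\ D q, immersion_at_point y q & moebius A (y q) <> pole]] in
    open_dense_in D M /\
    forall b w, M (chart b w) ->
      minimal_immersion_at (fun w' => stereographic (moebius A (y (chart b w')))) w.

End Surfaces.

(* Main.v *)
Require Import Defs.
From HB Require Import structures.
From mathcomp Require Import all_boot all_order all_algebra complex.
From mathcomp Require Import all_classical all_reals all_analysis.
From mathcomp Require Import ring lra.
Import Order.TTheory GRing.Theory Num.Theory.
Import numFieldNormedType.Exports.

(* Let v = (1, 1, 0, ..., 0).  The shape of the potential gives eta v = 0, so
   F_- fixes v and v^t I F = v^t I F_+ near the base point.  This row is real on
   the circle |lambda| = 1 and extends holomorphically to the disc, so it does
   not depend on lambda; its last n entries are odd in lambda, so they vanish: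
   v lies in the Lorentzian 4-space at every point near the base point.  Let w1
   and w2 be the first four and the last n entries of F^-1 v for a lift F, and
   s = -B_1^t I_(1,3) w1.  By flatness |dbar (w2, s)| <= K |(w2, s)|, and
   log-convexity of the means over circles yields unique continuation: w2 = 0
   and v lies in the 4-spaces at all points.

   For the conformal Gauss map of y, since v = (1, pole) lies in the span of Y, Y_u,
   Y_v and Y_(z zbar), an equation for the Laplacian of y follows, which says that
   the stereographic projection of y from the pole is harmonic; being conformal,
   it is minimal.

   For the rank, eta F_+(z, 0) = F_+(z, 0) alpha'_p, because the difference
   quotients in z of the holomorphic map lambda |-> F_+(z, lambda) converge
   uniformly on the circle.  The block B_1^t I_(1,3) of alpha'_p kills Y, v and
   Y_zbar, which are independent where y is an immersion avoiding the pole, so it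
   has rank at most 1 there; the 2 x 2 minors of the potential then vanish
   everywhere by the identity theorem. *)

Set Implicit Arguments.
Unset Strict Implicit.
Unset Printing Implicit Defensive.
Local Open Scope classical_set_scope.
Local Open Scope complex_scope.
Local Open Scope ring_scope.

Opaque derive.

(** * Differential calculus on the real plane *)

(** The factorization is available only near the base point and the potential may have poles, so
    what is found there must be carried to the rest of the domain by the harmonic map itself. A lift
    is merely smooth, which is why the continuation rests on an inequality for dbar and not on power
    series. The component w2 alone satisfies no closed inequality, since its dbar derivative
    contains w1; adjoining s closes the system, because harmonicity makes the w1 terms in the
    derivative of s cancel. On the side of loops everything is reduced to the mean value property on
    the unit circle, obtained by Goursat's argument in log-polar coordinates: it gives the Liouville
    theorem behind the uniqueness of Birkhoff factors, and the bounds that carry estimates from the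
    circle to the centre. The rank argument needs the latter: derivatives in z are known only for
    |lambda| = 1, while the identity is to be read off at lambda = 0. *)

Lemma is_derive_epsP (K : numFieldType) (V W : normedModType K) (f : V -> W)
    (a v : V) (df : W) :
  is_derive a v f df <->
  (forall e : K, 0 < e -> exists2 d : K, 0 < d & forall h : K, `|h| < d ->
     `|f (h *: v + a) - f a - h *: df| <= e * `|h|).
Proof.
split=> [[fD fE] e e0|H].
- have : (h^-1 *: ((f \o shift a) (h *: v) - f a)) @[h --> 0^'] --> df.
    by rewrite -fE; exact: fD.
  move=> /cvgrPdist_le /(_ e e0) /nbhs_ballP[d d0 Hd]; exists d => // h hd.
  have [->|h0] := eqVneq h 0.
    by rewrite !scale0r add0r subrr subr0 !normr0 mulr0.
  have := Hd h; rewrite /ball /= sub0r normrN => /(_ hd h0).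
  rewrite distrC => Hh.
  rewrite -[X in `|X|]scale1r -(mulfV h0) -scalerA normrZ mulrC ler_wpM2r//.
  by rewrite scalerBr scalerA mulVf// scale1r.
- have C : (h^-1 *: ((f \o shift a) (h *: v) - f a)) @[h --> 0^'] --> df.
    apply/cvgrPdist_le => e e0; have [d d0 Hd] := H e e0.
    apply/nbhs_ballP; exists d => //= h; rewrite /ball /= sub0r normrN => hd h0.
    have := Hd h hd; rewrite distrC => Hh.
    rewrite -(ler_pM2r (_ : 0 < `|h|)) ?normr_gt0// mulrC -normrZ.
    rewrite scalerBr scalerA mulfV// scale1r distrC.
    by rewrite distrC.
  split; first by apply/cvg_ex; exists df.
  exact: cvg_lim.
Qed.

(** Locked so that rewriting and unification treat the two partial derivatives as atoms. *)
HB.lock Definition D1 (R : realType) (f : R * R -> R) (p : R * R) : R :=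
  'D_((1, 0) : R * R) f p.
HB.lock Definition D2 (R : realType) (f : R * R -> R) (p : R * R) : R :=
  'D_((0, 1) : R * R) f p.

Section PlaneCalculus.
Variable R : realType.
Implicit Types (f g : R * R -> R) (p : R * R) (U : set (R * R)).

Lemma is_derive1_epsP (f : R -> R) (x d : R) :
  is_derive x (1 : R) f d <->
  (forall e : R, 0 < e -> exists2 del : R, 0 < del & forall h : R, `|h| < del ->
     `|f (x + h) - f x - d * h| <= e * `|h|).
Proof.
rewrite is_derive_epsP; split=> H e e0; have [del d0 Hd] := H e e0;
  exists del => // h hd; have := Hd h hd;
  by rewrite -[h *: 1]/(h * 1) mulr1 (addrC h x) -[h *: d]/(h * d) [h * d]mulrC.
Qed.

Lemma cont2_epsP f p :
  {for p, continuous f} <->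
  (forall e : R, 0 < e -> exists2 d : R, 0 < d & forall x y : R,
     `|x - p.1| < d -> `|y - p.2| < d -> `|f (x, y) - f p| < e).
Proof.
split=> [/cvgrPdist_lt H e e0|H].
- have /nbhs_ballP[d d0 Hd] := H e e0; exists d => // x y xd yd.
  rewrite distrC; apply: (Hd (x, y)); split=> /=; rewrite /ball /= distrC //.
- apply/cvgrPdist_lt => e e0; have [d d0 Hd] := H e e0.
  apply: filterS (nbhsx_ballx p d d0) => -[x y] [/= xd yd]; rewrite distrC.
  by apply: Hd; rewrite distrC.
Qed.

Lemma open2_epsP U : open U <-> forall p, U p -> exists2 d : R, 0 < d &
  forall x y : R, `|x - p.1| < d -> `|y - p.2| < d -> U (x, y).
Proof.
split=> [oU p Up|H].
- have : nbhs p U by exact: open_nbhs_nbhs.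
  move=> /nbhs_ballP[d d0 Hd]; exists d => // x y xd yd.
  by apply: (Hd (x, y)); split; rewrite /ball /= distrC.
- rewrite openE => p Up; have [d d0 Hd] := H p Up.
  apply: filterS (nbhsx_ballx p d d0) => -[x y] [/= xd yd].
  by apply: Hd; rewrite distrC.
Qed.

Definition ddf f p := derivable f p ((1, 0) : R * R) /\ derivable f p ((0, 1) : R * R).

Lemma is_derive_sec1 f (x y d : R) :
  is_derive (x, y) ((1, 0) : R * R) f d <-> is_derive x (1 : R) (fun s => f (s, y)) d.
Proof.
rewrite is_derive1_epsP is_derive_epsP; split=> H e e0; have [del d0 Hd] := H e e0;
  exists del => // h hd; have := Hd h hd.
- by rewrite [_ + (x, y)](_ : _ = (x + h, y)) ?[d * h]mulrC//; congr pair => /=;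
    rewrite ?scaler0 ?add0r//= -[h *: _]/(h * 1) mulr1 addrC.
- by rewrite [_ + (x, y)](_ : _ = (x + h, y)) ?[d * h]mulrC//; congr pair => /=;
    rewrite ?scaler0 ?add0r//= -[h *: _]/(h * 1) mulr1 addrC.
Qed.

Lemma is_derive_sec2 f (x y d : R) :
  is_derive (x, y) ((0, 1) : R * R) f d <-> is_derive y (1 : R) (fun s => f (x, s)) d.
Proof.
rewrite is_derive1_epsP is_derive_epsP; split=> H e e0; have [del d0 Hd] := H e e0;
  exists del => // h hd; have := Hd h hd.
- by rewrite [_ + (x, y)](_ : _ = (x, y + h)) ?[d * h]mulrC//; congr pair => /=;
    rewrite ?scaler0 ?add0r//= -[h *: _]/(h * 1) mulr1 addrC.
- by rewrite [_ + (x, y)](_ : _ = (x, y + h)) ?[d * h]mulrC//; congr pair => /=;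
    rewrite ?scaler0 ?add0r//= -[h *: _]/(h * 1) mulr1 addrC.
Qed.

Lemma ddf_D1 f (x y : R) : ddf f (x, y) ->
  is_derive x (1 : R) (fun s => f (s, y)) (D1 f (x, y)).
Proof. by case=> h _; apply/is_derive_sec1; split=> //; rewrite D1.unlock. Qed.

Lemma ddf_D2 f (x y : R) : ddf f (x, y) ->
  is_derive y (1 : R) (fun s => f (x, s)) (D2 f (x, y)).
Proof. by case=> _ h; apply/is_derive_sec2; split=> //; rewrite D2.unlock. Qed.

Lemma ddf_intro f (x y a b : R) :
  is_derive x (1 : R) (fun s => f (s, y)) a ->
  is_derive y (1 : R) (fun s => f (x, s)) b ->
  [/\ ddf f (x, y), D1 f (x, y) = a & D2 f (x, y) = b].
Proof.
by move=> /is_derive_sec1[h1 e1] /is_derive_sec2[h2 e2]; rewrite D1.unlock D2.unlock.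
Qed.

(** Frechet differentiability at [p] with gradient [(a, b)], measured in the sum norm. The chain
    rule needs this rather than the mere existence of partial derivatives, and for a holomorphic
    function it comes directly from the complex derivative, without continuity of the partials. *)
Definition lin_approx f p (a b : R) := forall e : R, 0 < e ->
  exists2 d : R, 0 < d & forall h k : R, `|h| < d -> `|k| < d ->
  `|f (p.1 + h, p.2 + k) - f p - a * h - b * k| <= e * (`|h| + `|k|).

Lemma lin_approx_bound f p a b : lin_approx f p a b -> exists2 d, 0 < d &
  forall h k : R, `|h| < d -> `|k| < d ->
  `|f (p.1 + h, p.2 + k) - f p| <= (`|a| + `|b| + 1) * (`|h| + `|k|).
Proof.
move=> /(_ 1 ltr01)[d d0 Hd]; exists d => // h k hd kd.
have := Hd h k hd kd; set F := f _ - f _ => HF.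
have -> : F = (F - a * h - b * k) + (a * h + b * k) by ring.
apply: le_trans (ler_normD _ _) _.
have := ler_normD (a * h) (b * k); rewrite !normrM => H.
have A : `|a| * `|k| >= 0 by rewrite mulr_ge0.
have B : `|b| * `|h| >= 0 by rewrite mulr_ge0.
by clear -H HF A B; rewrite mul1r in HF; rewrite !mulrDl !mulrDr mul1r; lra.
Qed.

Lemma lin_approx_comp f (p1 p2 : R * R -> R) p (a b a1 b1 a2 b2 : R) :
  lin_approx f (p1 p, p2 p) a b -> lin_approx p1 p a1 b1 -> lin_approx p2 p a2 b2 ->
  lin_approx (fun q => f (p1 q, p2 q)) p (a * a1 + b * a2) (a * b1 + b * b2).
Proof.
move=> Hf H1 H2 e e0.
(* [M1] and [M2] are the local Lipschitz constants of the inner functions given by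
   [lin_approx_bound]; half of [e] pays for the outer remainder and half for the two inner ones. *)
pose M1 := `|a1| + `|b1| + 1. pose M2 := `|a2| + `|b2| + 1.
have M10 : 0 < M1 by rewrite ltr_wpDl// addr_ge0.
have M20 : 0 < M2 by rewrite ltr_wpDl// addr_ge0.
have M0 : 0 < M1 + M2 by rewrite addr_gt0.
have eM : 0 < e / (2 * (M1 + M2)) by rewrite divr_gt0// mulr_gt0.
have [d d0 Hd] := Hf _ eM.
pose N := `|a| + `|b| + 1.
have N0 : 0 < N by rewrite ltr_wpDl// addr_ge0.
have e'0 : 0 < e / (2 * N) by rewrite divr_gt0// mulr_gt0.
have [d1 d10 Hd1] := H1 _ e'0.
have [d2 d20 Hd2] := H2 _ e'0.
have [d3 d30 Hd3] := lin_approx_bound H1.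
have [d4 d40 Hd4] := lin_approx_bound H2.
pose d5 := d / (2 * (M1 + M2)).
have d50 : 0 < d5 by rewrite divr_gt0// mulr_gt0.
exists (Num.min d5 (Num.min (Num.min d1 d2) (Num.min d3 d4))).
  by rewrite !lt_min d10 d20 d30 d40 d50.
move=> h k; rewrite !lt_min.
move=> /andP[h5 /andP[/andP[h1 h2] /andP[h3 h4]]] /andP[k5 /andP[/andP[k1 k2] /andP[k3 k4]]].
have {}Hd1 := Hd1 h k h1 k1; have {}Hd2 := Hd2 h k h2 k2.
have {}Hd3 := Hd3 h k h3 k3; have {}Hd4 := Hd4 h k h4 k4.
set q := (p.1 + h, p.2 + k) in Hd1 Hd2 Hd3 Hd4 *.
have := Hd (p1 q - p1 p) (p2 q - p2 p); rewrite /= ![_ + (_ - _)]addrC !subrK.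
set X := p1 q - p1 p in Hd1 Hd3 *; set Y := p2 q - p2 p in Hd2 Hd4 *.
set F := f _ - f _.
set n := `|h| + `|k| in Hd1 Hd2 Hd3 Hd4 *.
have n0 : 0 <= n by rewrite addr_ge0.
have nd : n < 2 * d5 by clear -h5 k5; rewrite /n; lra.
have nd' : (M1 + M2) * n < d.
  have -> : d = (M1 + M2) * (2 * d5) by rewrite /d5; field; exact: lt0r_neq0.
  by rewrite ltr_pM2l.
have A0 : M1 * n >= 0 by rewrite mulr_ge0// ltW.
have B0 : M2 * n >= 0 by rewrite mulr_ge0// ltW.
have {}Hd3 : `|X| <= M1 * n := Hd3. have {}Hd4 : `|Y| <= M2 * n := Hd4.
have XY : `|X| + `|Y| <= (M1 + M2) * n by rewrite mulrDl; exact: lerD.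
have Xd : `|X| < d by clear -nd' A0 B0 Hd3; rewrite mulrDl in nd'; lra.
have Yd : `|Y| < d by clear -nd' A0 B0 Hd4; rewrite mulrDl in nd'; lra.
move=> /(_ Xd Yd) HF.
have -> : F - (a * a1 + b * a2) * h - (a * b1 + b * b2) * k =
  (F - a * X - b * Y) + (a * (X - a1 * h - b1 * k) + b * (Y - a2 * h - b2 * k)) by ring.
apply: le_trans (ler_normD _ _) _.
have S1 : e / (2 * (M1 + M2)) * (`|X| + `|Y|) <= e / 2 * n.
  have -> : e / 2 * n = e / (2 * (M1 + M2)) * ((M1 + M2) * n).
    by field; rewrite gt_eqF.
  by rewrite ler_pM2l.
have S2 : `|a * (X - a1 * h - b1 * k) + b * (Y - a2 * h - b2 * k)| <= e / 2 * n.
  apply: le_trans (ler_normD _ _) _; rewrite !normrM.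
  set T := e / (2 * N) * n in Hd1 Hd2.
  have -> : e / 2 * n = `|a| * T + `|b| * T + T.
    have -> : `|a| * T + `|b| * T + T = N * T by rewrite /N; ring.
    by rewrite /T; field; rewrite gt_eqF.
  have T0 : 0 <= T by rewrite mulr_ge0// ltW.
  have A1 : `|a| * `|X - a1 * h - b1 * k| <= `|a| * T by rewrite ler_wpM2l.
  have B1 : `|b| * `|Y - a2 * h - b2 * k| <= `|b| * T by rewrite ler_wpM2l.
  by clear -A1 B1 T0; lra.
by clear -S1 S2 HF; lra.
Qed.

Lemma is_derive_lin_approx1 (u : R -> R) p c : is_derive p.1 (1 : R) u c ->
  lin_approx (fun q => u q.1) p c 0.
Proof.
move=> /is_derive1_epsP H e e0; have [d d0 Hd] := H e e0.
exists d => // h k hd _ /=; rewrite mul0r subr0.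
by apply: le_trans (Hd _ hd) _; apply: ler_wpM2l; [exact: ltW|rewrite lerDl].
Qed.

Lemma lin_approx_curve f (p1 p2 : R -> R) (t a b c1 c2 : R) :
  lin_approx f (p1 t, p2 t) a b ->
  is_derive t (1 : R) p1 c1 -> is_derive t (1 : R) p2 c2 ->
  is_derive t (1 : R) (fun s => f (p1 s, p2 s)) (a * c1 + b * c2).
Proof.
move=> Hf H1 H2.
have := @lin_approx_comp f (fun q => p1 q.1) (fun q => p2 q.1) (t, 0) _ _ _ _ _ _ Hf
  (is_derive_lin_approx1 (p := (t, 0)) H1) (is_derive_lin_approx1 (p := (t, 0)) H2).
move=> H; apply/is_derive1_epsP => e e0; have [d d0 Hd] := H e e0.
exists d => // h hd; have := Hd h 0 hd; rewrite normr0 => /(_ d0) /=.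
by rewrite addr0 !mulr0 subr0.
Qed.

(** A form of the mean value theorem that allows an increment of either sign, or zero. *)
Lemma mvt0 (f df : R -> R) (x h : R) :
  (forall s, `|s - x| <= `|h| -> is_derive s (1 : R) f (df s)) ->
  exists2 c, `|c - x| <= `|h| & f (x + h) - f x = df c * h.
Proof.
move=> H.
have cont s : `|s - x| <= `|h| -> {for s, continuous f}.
  by move=> /H[d _]; apply: differentiable_continuous; apply/derivable1_diffP.
have [h0|h0|->] := ltgtP h 0; last first.
- by exists x; rewrite ?subrr ?normr0// addr0 subrr mulr0.
- have [|y|z|c cx E] := @MVT _ f df x (x + h); first by rewrite ltrDl.
  + by rewrite in_itv/= => /andP[a b]; apply: H; rewrite !ger0_norm; lra.
  + apply: continuous_in_subspaceT => y; rewrite inE/= in_itv/= => /andP[a b].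
    by apply: cont; rewrite !ger0_norm; lra.
  + move: cx; rewrite in_itv/= => /andP[a b].
    exists c; first by rewrite !ger0_norm; lra.
    by rewrite E; ring.
- have [|y|z|c cx E] := @MVT _ f df (x + h) x; first by rewrite gtrDl.
  + rewrite in_itv/= => /andP[a b]; apply: H.
    by rewrite (ltr0_norm h0) ler0_norm; lra.
  + apply: continuous_in_subspaceT => y; rewrite inE/= in_itv/= => /andP[a b].
    by apply: cont; rewrite (ltr0_norm h0) ler0_norm; lra.
  + move: cx; rewrite in_itv/= => /andP[a b].
    exists c; first by rewrite (ltr0_norm h0) ler0_norm; lra.
    by rewrite -[LHS]opprB E; ring.
Qed.

(** Only the two coordinate partials enter, which keeps the inductions on [k] short; [smooth_on],
    which speaks of iterated derivatives in all directions, implies it for every [k]. *)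
Fixpoint Ck (k : nat) U f : Prop :=
  (forall p, U p -> {for p, continuous f}) /\
  (if k is k'.+1 then (forall p, U p -> ddf f p) /\ Ck k' U (D1 f) /\ Ck k' U (D2 f)
   else True).

Lemma Ck_cont k U f p : Ck k U f -> U p -> {for p, continuous f}.
Proof. by case: k => [|k] [+ _]; apply. Qed.

Lemma Ck_ddf k U f p : Ck k.+1 U f -> U p -> ddf f p.
Proof. by case=> _ [+ _]; apply. Qed.

Lemma CkD1 k U f : Ck k.+1 U f -> Ck k U (D1 f).
Proof. by case=> _ [_ []]. Qed.

Lemma CkD2 k U f : Ck k.+1 U f -> Ck k U (D2 f).
Proof. by case=> _ [_ []]. Qed.

Lemma CkW k U f : Ck k.+1 U f -> Ck k U f.
Proof.
elim: k f => [|k IH] f; first by case.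
move=> [c [d [e1 e2]]]; split; first exact: c.
by split; [exact: d|split; [exact: (IH _ e1)|exact: (IH _ e2)]].
Qed.

Lemma Ck_sub k U V f : V `<=` U -> Ck k U f -> Ck k V f.
Proof.
move=> VU; elim: k f => [|k IH] f; first by case=> c _; split=> // p /VU; exact: c.
move=> [c [d [e1 e2]]]; split; first by move=> p /VU; exact: c.
by split; [move=> p /VU; exact: d|split; exact: IH].
Qed.

Lemma D_eq_on U f g p : open U -> (forall q, U q -> f q = g q) -> U p ->
  [/\ D1 f p = D1 g p, D2 f p = D2 g p & ddf f p -> ddf g p].
Proof.
move=> oU fg Up.
have near_eq : \forall q \near p, f q = g q.
  by apply: filterS (open_nbhs_nbhs (conj oU Up)).
rewrite D1.unlock D2.unlock; split.
- by apply: near_eq_derive => //; rewrite xpair_eqE negb_and oner_eq0.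
- by apply: near_eq_derive => //; rewrite xpair_eqE negb_and oner_eq0 orbT.
- case=> d1 d2; split; [apply: near_eq_derivable d1|apply: near_eq_derivable d2] => //;
  by rewrite xpair_eqE negb_and oner_eq0 ?orbT.
Qed.

Lemma Ck_eq k U f g : open U -> (forall q, U q -> f q = g q) -> Ck k U f -> Ck k U g.
Proof.
move=> oU; elim: k f g => [|k IH] f g fg.
- case=> c _; split=> // p Up.
  have near_eq : \forall q \near p, f q = g q.
    by apply: filterS (open_nbhs_nbhs (conj oU Up)).
  have h : f x @[x --> p] --> f p := c p Up.
  suff : g x @[x --> p] --> g p by [].
  by rewrite -(fg p Up); apply: cvg_trans h; exact: near_eq_cvg.
- move=> H; have [c [d [e1 e2]]] := H; split.
    by move=> p; exact: (Ck_cont (IH f g fg (CkW H))).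
  split; first by move=> p Up; have [_ _] := D_eq_on oU fg Up; apply; exact: d.
  split; [apply: (IH (D1 f)) e1|apply: (IH (D2 f)) e2] => q Uq.
  + by have [] := D_eq_on oU fg Uq.
  + by have [] := D_eq_on oU fg Uq.
Qed.

Lemma smooth_on_Ck k U f : smooth_on U f -> Ck k U f.
Proof.
elim: k f => [|k IH] f sf; (split; first by move=> p Up; have [] := sf [::] p Up).
  exact: I.
split; first by move=> p Up; have [_ h] := sf [::] p Up; split; exact: h.
split; apply: IH => s p Up.
  by have := sf (rcons s (1, 0)) p Up; rewrite D1.unlock /iter_deriv foldr_rcons.
by have := sf (rcons s (0, 1)) p Up; rewrite D2.unlock /iter_deriv foldr_rcons.
Qed.

Lemma Ck_cst k U (a : R) : Ck k U (fun=> a).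
Proof.
elim: k a => [|k IH] a; (split; first by move=> p _; exact: cvg_cst).
  exact: I.
split; first by move=> p _; split; exact: derivable_cst.
by split; [rewrite (_ : D1 _ = fun=> 0)|rewrite (_ : D2 _ = fun=> 0)] => //;
  apply/funext => p; rewrite ?D1.unlock ?D2.unlock; exact: derive_cst.
Qed.

Lemma ddf_add f g p : ddf f p -> ddf g p ->
  [/\ ddf (fun q => f q + g q) p, D1 (fun q => f q + g q) p = D1 f p + D1 g p &
      D2 (fun q => f q + g q) p = D2 f p + D2 g p].
Proof.
move=> [f1 f2] [g1 g2]; split.
- by split; exact: derivableD.
- by rewrite D1.unlock; exact: deriveD.
- by rewrite D2.unlock; exact: deriveD.
Qed.

Lemma ddf_opp f p : ddf f p ->
  [/\ ddf (fun q => - f q) p, D1 (fun q => - f q) p = - D1 f p &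
      D2 (fun q => - f q) p = - D2 f p].
Proof.
move=> [f1 f2]; split.
- by split; exact: derivableN.
- by rewrite D1.unlock; exact: deriveN.
- by rewrite D2.unlock; exact: deriveN.
Qed.

Lemma ddf_mul f g p : ddf f p -> ddf g p ->
  [/\ ddf (fun q => f q * g q) p,
      D1 (fun q => f q * g q) p = D1 f p * g p + f p * D1 g p &
      D2 (fun q => f q * g q) p = D2 f p * g p + f p * D2 g p].
Proof.
move=> [f1 f2] [g1 g2]; split.
- by split; [exact: (derivableM f1 g1)|exact: (derivableM f2 g2)].
- rewrite D1.unlock [LHS](deriveM f1 g1) addrC; congr (_ + _); exact: mulrC.
- rewrite D2.unlock [LHS](deriveM f2 g2) addrC; congr (_ + _); exact: mulrC.
Qed.

Lemma CkD k U f g : open U -> Ck k U f -> Ck k U g -> Ck k U (fun q => f q + g q).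
Proof.
move=> oU; elim: k f g => [|k IH] f g Hf Hg;
  (split; first by move=> p Up; apply: cvgD; [exact: (Ck_cont Hf)|exact: (Ck_cont Hg)]).
  exact: I.
have H p (Up : U p) := ddf_add (Ck_ddf Hf Up) (Ck_ddf Hg Up).
split; first by move=> p Up; have [] := H p Up.
split.
- apply: (Ck_eq oU _ (IH _ _ (CkD1 Hf) (CkD1 Hg))) => q Uq; by have [_ ->] := H q Uq.
- apply: (Ck_eq oU _ (IH _ _ (CkD2 Hf) (CkD2 Hg))) => q Uq; by have [_ _ ->] := H q Uq.
Qed.

Lemma CkM k U f g : open U -> Ck k U f -> Ck k U g -> Ck k U (fun q => f q * g q).
Proof.
move=> oU; elim: k f g => [|k IH] f g Hf Hg;
  (split; first by move=> p Up; apply: cvgM; [exact: (Ck_cont Hf)|exact: (Ck_cont Hg)]).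
  exact: I.
have H p (Up : U p) := ddf_mul (Ck_ddf Hf Up) (Ck_ddf Hg Up).
split; first by move=> p Up; have [] := H p Up.
split.
- have K : Ck k U (fun q => D1 f q * g q + f q * D1 g q).
    apply: CkD => //; apply: IH; [exact: CkD1|exact: CkW|exact: CkW|exact: CkD1].
  by apply: (Ck_eq oU _ K) => q Uq; have [_ ->] := H q Uq.
- have K : Ck k U (fun q => D2 f q * g q + f q * D2 g q).
    apply: CkD => //; apply: IH; [exact: CkD2|exact: CkW|exact: CkW|exact: CkD2].
  by apply: (Ck_eq oU _ K) => q Uq; have [_ _ ->] := H q Uq.
Qed.

Lemma CkN k U f : open U -> Ck k U f -> Ck k U (fun q => - f q).
Proof.
move=> oU Hf; apply: (Ck_eq oU _ (CkM oU (Ck_cst k U (-1)) Hf)) => q _.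
by rewrite mulN1r.
Qed.

Lemma CkB k U f g : open U -> Ck k U f -> Ck k U g -> Ck k U (fun q => f q - g q).
Proof. by move=> oU Hf Hg; apply: CkD => //; exact: CkN. Qed.

Lemma Ck_sum (I : Type) (r : seq I) (F : I -> R * R -> R) k U : open U ->
  (forall i, Ck k U (F i)) -> Ck k U (fun q => \sum_(i <- r) F i q).
Proof.
move=> oU H; elim: r => [|i r IH].
  by apply: (Ck_eq oU _ (Ck_cst k U 0)) => q _; rewrite big_nil.
by apply: (Ck_eq oU _ (CkD oU (H i) IH)) => q _; rewrite big_cons.
Qed.

Lemma ddf_sum (I : Type) (r : seq I) (F : I -> R * R -> R) p :
  (forall i, ddf (F i) p) ->
  [/\ ddf (fun q => \sum_(i <- r) F i q) p,
      D1 (fun q => \sum_(i <- r) F i q) p = \sum_(i <- r) D1 (F i) p &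
      D2 (fun q => \sum_(i <- r) F i q) p = \sum_(i <- r) D2 (F i) p].
Proof.
move=> H; elim: r => [|i r [IH1 IH2 IH3]].
  rewrite !big_nil (_ : (fun=> _) = cst 0); last by apply/funext => q; rewrite big_nil.
  by split; [split; exact: derivable_cst|rewrite D1.unlock; exact: derive_cst|rewrite D2.unlock; exact: derive_cst].
rewrite !big_cons (_ : (fun=> _) = (fun q => F i q + \sum_(j <- r) F j q)); last first.
  by apply/funext => q; rewrite big_cons.
have [h1 h2 h3] := ddf_add (H i) IH1.
by split=> //; rewrite ?h2 ?h3 ?IH2 ?IH3.
Qed.

(** The increment is split into a horizontal step at height [y + k] and a vertical step at abscissa
    [x]; the mean value theorem turns each into a partial derivative at a nearby point. *)
Lemma Ck1_lin_approx U f p : open U -> Ck 1 U f -> U p -> lin_approx f p (D1 f p) (D2 f p).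
Proof.
move=> oU Hf Up e e0; case: p Up => x y Up.
have [d1 d10 Hd1] := (open2_epsP U).1 oU _ Up.
have [d2 d20 Hd2] := (cont2_epsP _ _).1 (Ck_cont (CkD1 Hf) Up) _ e0.
have [d3 d30 Hd3] := (cont2_epsP _ _).1 (Ck_cont (CkD2 Hf) Up) _ e0.
exists (Num.min d1 (Num.min d2 d3)); first by rewrite !lt_min d10 d20 d30.
move=> h k; rewrite !lt_min => /andP[h1 /andP[h2 h3]] /andP[k1 /andP[k2 k3]] /=.
have near (z w t d : R) : `|z - w| <= `|t| -> `|t| < d -> `|z - w| < d.
  by move=> a b; exact: le_lt_trans b.
have [|c1 c1h E1] := @mvt0 (fun s => f (s, y + k)) (fun s => D1 f (s, y + k)) x h.
  move=> s sh; apply: ddf_D1; apply: (Ck_ddf Hf); apply: Hd1 => /=.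
    exact: near sh h1.
  by rewrite addrC addKr.
have [|c2 c2k E2] := @mvt0 (fun s => f (x, s)) (fun s => D2 f (x, s)) y k.
  move=> s sk; apply: ddf_D2; apply: (Ck_ddf Hf); apply: Hd1 => /=.
    by rewrite subrr normr0.
  exact: near sk k1.
have -> : f (x + h, y + k) - f (x, y) - D1 f (x, y) * h - D2 f (x, y) * k =
  (D1 f (c1, y + k) - D1 f (x, y)) * h + (D2 f (x, c2) - D2 f (x, y)) * k.
  by rewrite !mulrBl -E1 -E2; ring.
apply: le_trans (ler_normD _ _) _; rewrite !normrM mulrDr.
apply: lerD; rewrite ler_wpM2r//; apply: ltW.
- apply: Hd2 => /=; first exact: near c1h h2.
  by rewrite addrC addKr.
- apply: Hd3 => /=; first by rewrite subrr normr0.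
  exact: near c2k k3.
Qed.

(** The second difference [Q] over a small square, evaluated by the mean value theorem in either
    order of the variables, is a value of each mixed derivative near the point; continuity then
    identifies the two. *)
Lemma clairaut U f p : open U -> Ck 2 U f -> U p -> D1 (D2 f) p = D2 (D1 f) p.
Proof.
move=> oU Hf Up; case: p Up => x y Up.
apply/eqP; rewrite -subr_eq0 -normr_le0; apply/ler_addgt0Pl => e e0; rewrite addr0.
have e20 : 0 < e / 2 by rewrite divr_gt0.
have [d1 d10 Hd1] := (open2_epsP U).1 oU _ Up.
have [d2 d20 Hd2] := (cont2_epsP _ _).1 (Ck_cont (CkD1 (CkD2 Hf)) Up) _ e20.
have [d3 d30 Hd3] := (cont2_epsP _ _).1 (Ck_cont (CkD2 (CkD1 Hf)) Up) _ e20.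
pose d := Num.min d1 (Num.min d2 d3).
have d0 : 0 < d by rewrite !lt_min d10 d20 d30.
pose h := d / 2.
have h0 : 0 < h by rewrite divr_gt0.
have hd : h < d by rewrite /h; lra.
have := hd; rewrite !lt_min => /andP[h1 /andP[h2 h3]].
have near (z w d' : R) : `|z - w| <= `|h| -> h < d' -> `|z - w| < d'.
  by rewrite (gtr0_norm h0) => a b; exact: le_lt_trans b.
have inU s t : `|s - x| <= `|h| -> `|t - y| <= `|h| -> U (s, t).
  by move=> a b; apply: Hd1 => /=; apply: near h1.
have xx (z : R) : `|z - z| <= `|h| by rewrite subrr normr0.
have xh (z : R) : `|z + h - z| <= `|h| by rewrite addrC addKr.
pose Q := f (x + h, y + h) - f (x + h, y) - f (x, y + h) + f (x, y).
have [c1 c1h [c2 c2h Q1]] : exists2 c1, `|c1 - x| <= `|h| &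
    exists2 c2, `|c2 - y| <= `|h| & Q = D2 (D1 f) (c1, c2) * h * h.
  have [|c1 c1h E1] := @mvt0 (fun s => f (s, y + h) - f (s, y))
     (fun s => D1 f (s, y + h) - D1 f (s, y)) x h.
    move=> s sh; apply: is_deriveB; apply: ddf_D1; apply: (Ck_ddf Hf); exact: inU.
  have [|c2 c2h E2] := @mvt0 (fun s => D1 f (c1, s)) (fun s => D2 (D1 f) (c1, s)) y h.
    by move=> s sh; apply: ddf_D2; apply: (Ck_ddf (CkD1 Hf)); exact: inU.
  exists c1; first exact: c1h.
  exists c2; first exact: c2h.
  by rewrite -E2 -E1 /Q; ring.
have [c4 c4h [c3 c3h Q2]] : exists2 c4, `|c4 - y| <= `|h| &
    exists2 c3, `|c3 - x| <= `|h| & Q = D1 (D2 f) (c3, c4) * h * h.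
  have [|c4 c4h E1] := @mvt0 (fun s => f (x + h, s) - f (x, s))
     (fun s => D2 f (x + h, s) - D2 f (x, s)) y h.
    move=> s sh; apply: is_deriveB; apply: ddf_D2; apply: (Ck_ddf Hf); exact: inU.
  have [|c3 c3h E2] := @mvt0 (fun s => D2 f (s, c4)) (fun s => D1 (D2 f) (s, c4)) x h.
    by move=> s sh; apply: ddf_D1; apply: (Ck_ddf (CkD2 Hf)); exact: inU.
  exists c4; first exact: c4h.
  exists c3; first exact: c3h.
  by rewrite -E2 -E1 /Q; ring.
have E : D2 (D1 f) (c1, c2) = D1 (D2 f) (c3, c4).
  move: Q1; rewrite Q2; move: (D2 _ _) (D1 _ _) => u v.
  by move=> /(mulIf (lt0r_neq0 h0)) /(mulIf (lt0r_neq0 h0)).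
have A := Hd3 c1 c2 (near c1 x _ c1h h3) (near c2 y _ c2h h3).
have B := Hd2 c3 c4 (near c3 x _ c3h h2) (near c4 y _ c4h h2).
have -> : D1 (D2 f) (x, y) - D2 (D1 f) (x, y) =
  (D2 (D1 f) (c1, c2) - D2 (D1 f) (x, y)) - (D1 (D2 f) (c3, c4) - D1 (D2 f) (x, y)).
  by rewrite E; ring.
by apply: le_trans (ler_normB _ _) _; clear -A B; lra.
Qed.

Lemma ddf_comp (U W : set (R * R)) f (a b : R * R -> R) p :
  open U -> Ck 1 U f -> U (a p, b p) -> ddf a p -> ddf b p ->
  [/\ ddf (fun q => f (a q, b q)) p,
      D1 (fun q => f (a q, b q)) p = D1 f (a p, b p) * D1 a p + D2 f (a p, b p) * D1 b p &
      D2 (fun q => f (a q, b q)) p = D1 f (a p, b p) * D2 a p + D2 f (a p, b p) * D2 b p].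
Proof.
move=> oU Hf Up da db; case: p Up da db => x y Up da db.
have L := Ck1_lin_approx oU Hf Up.
have H1 := @lin_approx_curve f (fun s => a (s, y)) (fun s => b (s, y)) x _ _ _ _ L
  (ddf_D1 da) (ddf_D1 db).
have H2 := @lin_approx_curve f (fun s => a (x, s)) (fun s => b (x, s)) y _ _ _ _ L
  (ddf_D2 da) (ddf_D2 db).
exact: (ddf_intro H1 H2).
Qed.

Lemma cont_comp2 f (T : topologicalType) (a b : T -> R) (p : T) :
  {for (a p, b p), continuous f} -> {for p, continuous a} -> {for p, continuous b} ->
  {for p, continuous (fun q => f (a q, b q))}.
Proof.
move=> Hf Ha Hb.
apply: (@continuous2_cvg _ _ _ _ _ _ a b (fun x y => f (x, y)) _ _ _ Ha Hb).
by rewrite (_ : (fun z => _) = f)//; apply/funext => -[].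
Qed.

Lemma Ck_comp k (U W : set (R * R)) f (a b : R * R -> R) :
  open U -> open W -> (forall p, W p -> U (a p, b p)) ->
  Ck k U f -> Ck k W a -> Ck k W b -> Ck k W (fun q => f (a q, b q)).
Proof.
move=> oU oW WU; elim: k f => [|k IH] f Hf Ha Hb;
  (split; first by move=> p Wp; apply: cont_comp2;
    [exact: (Ck_cont Hf (WU _ Wp))|exact: (Ck_cont Ha)|exact: (Ck_cont Hb)]).
  exact: I.
have Hf1 : Ck 1 U f.
  by split; [exact: (fun p => Ck_cont Hf)|split; [exact: (fun p => Ck_ddf Hf)|split;
   [split=> // p; exact: (Ck_cont (CkD1 Hf))|split=> // p; exact: (Ck_cont (CkD2 Hf))]]].
have H p (Wp : W p) := ddf_comp W oU Hf1 (WU _ Wp) (Ck_ddf Ha Wp) (Ck_ddf Hb Wp).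
split; first by move=> p Wp; have [] := H p Wp.
have I1 := IH _ (CkD1 Hf) (CkW Ha) (CkW Hb).
have I2 := IH _ (CkD2 Hf) (CkW Ha) (CkW Hb).
split.
- apply: (Ck_eq oW _ (CkD oW (CkM oW I1 (CkD1 Ha)) (CkM oW I2 (CkD1 Hb)))) => q Wq.
  by have [_ ->] := H q Wq.
- apply: (Ck_eq oW _ (CkD oW (CkM oW I1 (CkD2 Ha)) (CkM oW I2 (CkD2 Hb)))) => q Wq.
  by have [_ _ ->] := H q Wq.
Qed.

Definition has_D f p (a b : R) := [/\ ddf f p, D1 f p = a & D2 f p = b].

Lemma ddf_has_D f p : ddf f p -> has_D f p (D1 f p) (D2 f p).
Proof. by []. Qed.

Lemma has_D_cst p (a : R) : has_D (fun=> a) p 0 0.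
Proof.
split; first by split; exact: derivable_cst.
  by rewrite D1.unlock; exact: derive_cst.
by rewrite D2.unlock; exact: derive_cst.
Qed.

Lemma has_D_add f g p (a b c d : R) : has_D f p a b -> has_D g p c d ->
  has_D (fun q => f q + g q) p (a + c) (b + d).
Proof. by move=> [f1 <- <-] [g1 <- <-]; exact: ddf_add. Qed.

Lemma has_D_opp f p (a b : R) : has_D f p a b -> has_D (fun q => - f q) p (- a) (- b).
Proof. by move=> [f1 <- <-]; exact: ddf_opp. Qed.

Lemma has_D_sub f g p (a b c d : R) : has_D f p a b -> has_D g p c d ->
  has_D (fun q => f q - g q) p (a - c) (b - d).
Proof. by move=> Hf Hg; apply: has_D_add => //; exact: has_D_opp. Qed.

Lemma has_D_mul f g p (a b c d : R) : has_D f p a b -> has_D g p c d ->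
  has_D (fun q => f q * g q) p (a * g p + f p * c) (b * g p + f p * d).
Proof. by move=> [f1 <- <-] [g1 <- <-]; exact: ddf_mul. Qed.

Lemma has_D_sum (I : Type) (r : seq I) (F : I -> R * R -> R) p (a b : I -> R) :
  (forall i, has_D (F i) p (a i) (b i)) ->
  has_D (fun q => \sum_(i <- r) F i q) p (\sum_(i <- r) a i) (\sum_(i <- r) b i).
Proof.
move=> H; have [h1 h2 h3] : _ := ddf_sum r (fun i => let: And3 h _ _ := H i in h : ddf (F i) p).
by split=> //; rewrite ?h2 ?h3; apply: eq_bigr => i _; have [] := H i.
Qed.

End PlaneCalculus.

(** * Integrals over segments *)

Section Integrals.
Variable R : realType.
Implicit Types (f g F : R -> R) (a b : R).

Definition intg a b f : R := \int[lebesgue_measure]_(t in `[a, b]) f t.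

Lemma is_derive_cont1 f (x d : R) : is_derive x (1 : R) f d -> {for x, continuous f}.
Proof.
by case=> d1 _; apply: differentiable_continuous; apply/derivable1_diffP.
Qed.

Lemma prim_ex f a : continuous f -> exists F, forall x, a < x -> is_derive x (1 : R) F (f x).
Proof.
move=> cf; exists (fun x => \int[lebesgue_measure]_(t in `[a, x]) f t) => x ax.
have [||||d e] := @continuous_FTC1_closed R f a x (x + 1).
- by rewrite ltrDl.
- apply: continuous_compact_integrable; first exact: segment_compact.
  by apply: continuous_subspaceT.
- exact: ax.
- exact: cf.
- by apply: DeriveDef; [exact: d|rewrite -derive1E; exact: e].
Qed.

Lemma intgE f F a b : a < b -> continuous f ->
  (forall x, a <= x <= b -> is_derive x (1 : R) F (f x)) -> intg a b f = F b - F a.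
Proof.
move=> ab cf HF; rewrite /intg /Rintegral (@continuous_FTC2 R f F a b)//.
- by apply: continuous_subspaceT.
- split.
  + move=> x; rewrite in_itv/= => /andP[ax xb].
    by have [] : is_derive x (1 : R) F (f x) by apply: HF; rewrite !ltW.
  + have : F x @[x --> a] --> F a by apply: is_derive_cont1 (HF a _); rewrite lexx ltW.
    exact: cvg_at_right_filter.
  + have : F x @[x --> b] --> F b by apply: is_derive_cont1 (HF b _); rewrite lexx ltW.
    exact: cvg_at_left_filter.
- move=> x; rewrite in_itv/= => /andP[ax xb].
  have [d <-] : is_derive x (1 : R) F (f x) by apply: HF; rewrite !ltW.
  by rewrite derive1E.
Qed.

Lemma intg_ex f a b : a < b -> continuous f -> exists2 F,
  (forall x, a <= x <= b -> is_derive x (1 : R) F (f x)) & intg a b f = F b - F a.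
Proof.
(* Starting the primitive at [a - 1] makes it differentiable on both sides of [a]. *)
move=> ab cf; have [F HF] := prim_ex (a - 1) cf.
have H x : a <= x <= b -> is_derive x (1 : R) F (f x).
  by move=> /andP[ax xb]; apply: HF; clear -ax; lra.
by exists F => //; exact: intgE.
Qed.

Lemma intgD f g a b : a < b -> continuous f -> continuous g ->
  intg a b (fun x => f x + g x) = intg a b f + intg a b g.
Proof.
move=> ab cf cg; have [F HF ->] := intg_ex ab cf; have [G HG ->] := intg_ex ab cg.
rewrite addrACA -opprD; apply: (@intgE _ (fun x => F x + G x)) => //.
- by move=> x; apply: cvgD; [exact: cf|exact: cg].
- by move=> x xab; apply: is_deriveD; [exact: HF|exact: HG].
Qed.

Lemma intgZ f (c : R) a b : a < b -> continuous f ->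
  intg a b (fun x => c * f x) = c * intg a b f.
Proof.
move=> ab cf; have [F HF ->] := intg_ex ab cf.
rewrite mulrBr; apply: (@intgE _ (fun x => c * F x)) => //.
- by move=> x; apply: cvgM; [exact: cvg_cst|exact: cf].
- by move=> x xab; apply: is_deriveZ; exact: HF.
Qed.

Lemma intgN f a b : a < b -> continuous f ->
  intg a b (fun x => - f x) = - intg a b f.
Proof.
move=> ab cf; rewrite -mulN1r -intgZ//; congr intg.
by apply/funext => x; rewrite mulN1r.
Qed.

Lemma intgB f g a b : a < b -> continuous f -> continuous g ->
  intg a b (fun x => f x - g x) = intg a b f - intg a b g.
Proof.
by move=> ab cf cg; rewrite intgD ?intgN// => x; apply: cvgN; exact: cg.
Qed.

Lemma intg_cst (c : R) a b : a < b -> intg a b (fun=> c) = c * (b - a).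
Proof.
move=> ab; rewrite mulrBr; apply: (@intgE _ (fun x => c * x)) => //.
- by move=> x; exact: cst_continuous.
- by move=> x _; rewrite -[X in is_derive _ _ _ X]mulr1; apply: is_deriveZ; exact: is_derive_id.
Qed.

Lemma intg0 a b : a < b -> intg a b (fun=> 0) = 0.
Proof. by move=> ab; rewrite intg_cst// mul0r. Qed.

Lemma nondecr_deriv F f a b : (forall x, a <= x <= b -> is_derive x (1 : R) F (f x)) ->
  (forall x, a <= x <= b -> 0 <= f x) ->
  forall x y, a <= x -> x <= y -> y <= b -> F x <= F y.
Proof.
move=> HF f0 x y ax xy yb.
have [->//|nxy] := eqVneq x y.
have ltxy : x < y by rewrite lt_neqAle nxy.
have [||c cxy E] := @MVT _ F f x y ltxy.
- move=> s; rewrite in_itv/= => /andP[h1 h2]; apply: HF.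
  by rewrite (le_trans ax (ltW h1)) (le_trans (ltW h2) yb).
- apply: continuous_in_subspaceT => s; rewrite inE/= in_itv/= => /andP[h1 h2].
  by apply: (is_derive_cont1 (HF s _)); rewrite (le_trans ax h1) (le_trans h2 yb).
rewrite -subr_ge0 E mulr_ge0 ?subr_ge0//; apply: f0.
move: cxy; rewrite in_itv/= => /andP[h1 h2].
by rewrite (le_trans ax (ltW h1)) (le_trans (ltW h2) yb).
Qed.

Lemma intg_ge0 f a b : a < b -> continuous f -> (forall x, a <= x <= b -> 0 <= f x) ->
  0 <= intg a b f.
Proof.
move=> ab cf f0; have [F HF ->] := intg_ex ab cf; rewrite subr_ge0.
by apply: (nondecr_deriv HF f0) => //; exact: ltW.
Qed.

Lemma le_intg f g a b : a < b -> continuous f -> continuous g ->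
  (forall x, a <= x <= b -> f x <= g x) -> intg a b f <= intg a b g.
Proof.
move=> ab cf cg fg; rewrite -subr_ge0 -intgB//; apply: intg_ge0 => //.
- by move=> x; apply: cvgB; [exact: cg|exact: cf].
- by move=> x /fg; rewrite subr_ge0.
Qed.

Lemma intg_norm_le f (M : R) a b : a < b -> continuous f ->
  (forall x, a <= x <= b -> `|f x| <= M) -> `|intg a b f| <= M * (b - a).
Proof.
move=> ab cf fM; have cM : continuous (fun _ : R => M) by move=> x; exact: cst_continuous.
have cM' : continuous (fun _ : R => - M) by move=> x; exact: cst_continuous.
rewrite ler_norml -mulNr -!intg_cst//; apply/andP; split; apply: le_intg => // x /fM;
  by rewrite ler_norml => /andP[].
Qed.

Lemma eq_intg f g a b : a < b -> (forall x, a <= x <= b -> f x = g x) ->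
  intg a b f = intg a b g.
Proof.
move=> ab fg; apply: eq_Rintegral => x; rewrite inE/= in_itv/=; exact: fg.
Qed.

(** A primitive is monotone with equal end values, hence constant; so its derivative [f] vanishes
    inside the segment, and at the end points by continuity. *)
Lemma intg_eq0 f a b : a < b -> continuous f -> (forall x, a <= x <= b -> 0 <= f x) ->
  intg a b f = 0 -> forall x, a <= x <= b -> f x = 0.
Proof.
move=> ab cf f0; have [F HF ->] := intg_ex ab cf => F0.
have cstF x : a <= x <= b -> F x = F a.
  move=> /andP[ax xb]; apply/eqP; rewrite eq_le; apply/andP; split.
    rewrite (_ : F a = F b); last by apply/esym/eqP; rewrite -subr_eq0 F0.
    by apply: (nondecr_deriv HF f0).
  by apply: (nondecr_deriv HF f0).
have open0 x : a < x < b -> f x = 0.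
  move=> /andP[ax xb].
  have [d1 e1] : is_derive x (1 : R) F (f x) by apply: HF; rewrite !ltW.
  rewrite -e1; have ne : \forall y \near x, F y = cst (F a) y.
    have : x \in `]a, b[ by rewrite in_itv/= ax.
    move=> /near_in_itvoo; apply: filterS => y; rewrite in_itv/= => /andP[h1 h2].
    by rewrite /= cstF// !ltW.
  by rewrite (near_eq_derive (1 : R) ne) derive_cst.
move=> x /andP[ax xb].
apply/eqP; rewrite -normr_le0; apply/ler_addgt0Pl => e e0; rewrite addr0.
have /cvgrPdist_lt /(_ e e0) /nbhs_ballP[d d0 Hd] : f y @[y --> x] --> f x by exact: cf.
have {}d0 : 0 < d := d0.
(* [x] may be an end point; a step of at most a third of the length towards the midpoint stays
   inside. *)
have [y yx yab] : exists2 y, `|x - y| < d & a < y < b.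
  pose h := Num.min (d / 2) ((b - a) / 3).
  have h0 : 0 < h by rewrite lt_min !divr_gt0// subr_gt0.
  have hd : h < d by apply: (@le_lt_trans _ _ (d / 2)); [rewrite ge_min lexx|clear -d0; lra].
  have hb : h <= (b - a) / 3 by rewrite ge_min lexx orbT.
  have [H|H] := leP (x + h) ((a + b) / 2 + h).
    exists (x + h); first by rewrite opprD addNKr normrN gtr0_norm.
    by apply/andP; split; clear -ab ax xb h0 hb H; lra.
  exists (x - h); first by rewrite opprB addrCA subrr addr0 gtr0_norm.
  by apply/andP; split; clear -ab ax xb h0 hb H; lra.
have := Hd y; rewrite /ball /= => /(_ yx); rewrite (open0 y yab) subr0; exact: ltW.
Qed.

Lemma intg_split f a b c : a < b -> b < c -> continuous f ->
  intg a c f = intg a b f + intg b c f.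
Proof.
move=> ab bc cf; have ac := lt_trans ab bc; have [F HF ->] := intg_ex ac cf.
have E1 : intg a b f = F b - F a.
  apply: (@intgE f F a b ab cf) => x /andP[h1 h2].
  by apply: HF; rewrite h1 (le_trans h2 (ltW bc)).
have E2 : intg b c f = F c - F b.
  apply: (@intgE f F b c bc cf) => x /andP[h1 h2].
  by apply: HF; rewrite h2 (le_trans (ltW ab) h1).
rewrite E1 E2.
by rewrite [RHS]addrC addrA subrK.
Qed.

(** Compactness of the segment makes continuity in the first variable uniform in the second; both
    rules for integrals with a parameter rest on this. *)
Lemma tube (h : R * R -> R) (t a b : R) :
  (forall th, a <= th <= b -> {for (t, th), continuous h}) ->
  forall e, 0 < e -> exists2 d, 0 < d & forall s th, `|s - t| < d -> a <= th <= b ->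
    `|h (s, th) - h (t, th)| < e.
Proof.
move=> ch e e0; have e20 : 0 < e / 2 by rewrite divr_gt0.
have := (compact_near_coveringP _).1 (@segment_compact R a b) _ (nbhs t)
  (fun s th => `|h (s, th) - h (t, th)| < e) _.
case.
  move=> th; rewrite /= in_itv/= => thab.
  have [d d0 Hd] := (cont2_epsP _ _).1 (ch th thab) _ e20.
  exists (ball th d, ball t d).
    by split; exact: nbhsx_ballx.
  move=> [th' s] [/= h1 h2].
  have A := Hd s th'; have B := Hd t th'; rewrite /= subrr normr0 in B.
  rewrite (_ : _ - _ = (h (s, th') - h (t, th)) - (h (t, th') - h (t, th))); last first.
    by rewrite opprB addrA subrK.
  have {}A := A ltac:(by rewrite distrC) ltac:(by rewrite distrC).
  have {}B := B d0 ltac:(by rewrite distrC).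
  by apply: le_lt_trans (ler_normB _ _) _; clear -A B; lra.
move=> d /= d0 Hd; exists d => // s th st thab.
by apply: Hd; rewrite /= ?in_itv//= distrC.
Qed.

Lemma intg_param_cont (g : R -> R -> R) (t a b : R) : a < b ->
  (exists2 d, 0 < d & forall s, `|s - t| < d -> continuous (g s)) ->
  (forall th, a <= th <= b -> {for (t, th), continuous (fun p : R * R => g p.1 p.2)}) ->
  {for t, continuous (fun s => intg a b (g s))}.
Proof.
move=> ab [d0 d00 cg] ch; apply/cvgrPdist_lt => e e0.
have ba : 0 < b - a by rewrite subr_gt0.
have e'0 : 0 < e / (2 * (b - a)) by rewrite divr_gt0// mulr_gt0.
have [d d1 Hd] := tube ch e'0.
apply/nbhs_ballP; exists (Num.min d d0); first by rewrite /= lt_min d1.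
move=> s; rewrite /ball /= lt_min => /andP[h1 h2].
rewrite distrC -intgB//; last by apply: cg; rewrite subrr normr0.
  apply: le_lt_trans (intg_norm_le ab _ (fun th H => ltW (Hd s th _ H))) _.
  - move=> x; apply: cvgB; first by apply: cg; rewrite distrC.
    by apply: cg; rewrite subrr normr0.
  - by rewrite distrC.
  rewrite (_ : _ / _ * _ = e / 2); first by clear -e0; lra.
  by field; apply: lt0r_neq0.
by apply: cg; rewrite distrC.
Qed.

Lemma intg_param_deriv (g dg : R -> R -> R) (t a b : R) : a < b ->
  (exists2 d, 0 < d & forall s, `|s - t| < d -> continuous (g s) /\
     forall th, a <= th <= b -> is_derive s (1 : R) (g^~ th) (dg s th)) ->
  continuous (dg t) ->
  (forall th, a <= th <= b -> {for (t, th), continuous (fun p : R * R => dg p.1 p.2)}) ->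
  is_derive t (1 : R) (fun s => intg a b (g s)) (intg a b (dg t)).
Proof.
move=> ab [d0 d00 Hg] cdg ch; apply/is_derive1_epsP => e e0.
have ba : 0 < b - a by rewrite subr_gt0.
have e'0 : 0 < e / (b - a) by rewrite divr_gt0.
have [d d1 Hd] := tube ch e'0.
exists (Num.min d d0); first by rewrite lt_min d1.
move=> h; rewrite lt_min => /andP[h1 h2].
have cg1 : continuous (g (t + h)) by have [] := Hg (t + h); rewrite ?(addrC t) ?addrK.
have cg2 : continuous (g t) by have [] := Hg t; rewrite ?subrr ?normr0.
rewrite mulrC -intgZ// -!intgB//; last 2 first.
- by move=> x; apply: cvgB; [exact: cg1|exact: cg2].
- by move=> x; apply: cvgM; [exact: cvg_cst|exact: cdg].
rewrite (_ : e * `|h| = (e / (b - a) * `|h|) * (b - a)); last first.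
  by field; exact: lt0r_neq0.
apply: intg_norm_le => //.
  move=> x; apply: cvgB; first by apply: cvgB; [exact: cg1|exact: cg2].
  by apply: cvgM; [exact: cvg_cst|exact: cdg].
move=> th thab.
have [|c ch' E] := @mvt0 _ (g^~ th) (dg^~ th) t h.
  by move=> s st; have [_] := Hg s (le_lt_trans st h2); apply.
rewrite E (mulrC h) -mulrBl normrM ler_wpM2r//; apply: ltW; apply: (Hd c) => //.
exact: le_lt_trans h1.
Qed.

End Integrals.

(** * Goursat's lemma *)

Section Goursat.
Variable R : realType.
Implicit Types (P Q : R * R -> R).

(* Two-dimensional Cousin lemma. *)
Lemma bisection (G : R -> R -> R -> Prop) (a0 b0 h k : R) : 0 < h -> 0 < k ->
  (forall a b s, a0 <= a -> a + s * h <= a0 + h -> b0 <= b -> b + s * k <= b0 + k ->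
     0 < s -> (forall i j : bool, G (a + i%:R * (s / 2 * h)) (b + j%:R * (s / 2 * k)) (s / 2)) ->
     G a b s) ->
  (forall x y, a0 <= x <= a0 + h -> b0 <= y <= b0 + k -> exists2 d, 0 < d &
     forall a b s, 0 < s -> s < d -> a <= x <= a + s * h -> b <= y <= b + s * k -> G a b s) ->
  G a0 b0 1.
Proof.
move=> h0 k0 step loc; apply: contrapT => G0.
(* A rectangle is bad when it lies in the given one and [G] fails on it; by [step] one of its
   quarters is bad again. *)
pose inn (q : R * R * R) := [/\ [/\ a0 <= q.1.1, q.1.1 + q.2 * h <= a0 + h & 0 < q.2],
   b0 <= q.1.2 & q.1.2 + q.2 * k <= b0 + k].
pose bad q := inn q /\ ~ G q.1.1 q.1.2 q.2.
have /choice[nx Hnx] : forall q : R * R * R, exists q', bad q ->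
    [/\ bad q', q'.2 = q.2 / 2, q.1.1 <= q'.1.1, q'.1.1 + q'.2 * h <= q.1.1 + q.2 * h &
     q.1.2 <= q'.1.2 /\ q'.1.2 + q'.2 * k <= q.1.2 + q.2 * k].
  move=> [[a b] s]; have [Hb|nb] := pselect (bad (a, b, s)); last by exists (a, b, s).
  have [[[/= i1 i2 i3] i4 i5] nG] := Hb.
  have : exists i j : bool, ~ G (a + i%:R * (s / 2 * h)) (b + j%:R * (s / 2 * k)) (s / 2).
    apply: contrapT => H; apply: nG; apply: step => // i j.
    by apply: contrapT => nG; apply: H; exists i, j.
  move=> [i [j nG']].
  have sh : 0 < s / 2 * h by rewrite mulr_gt0// divr_gt0.
  have sk : 0 < s / 2 * k by rewrite mulr_gt0// divr_gt0.
  have Eh : s * h = s / 2 * h + s / 2 * h by field.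
  have Ek : s * k = s / 2 * k + s / 2 * k by field.
  have ih : 0 <= i%:R * (s / 2 * h) <= s / 2 * h by case: (i); rewrite ?mul1r ?mul0r ?lexx ltW.
  have jk : 0 <= j%:R * (s / 2 * k) <= s / 2 * k by case: (j); rewrite ?mul1r ?mul0r ?lexx ltW.
  exists (a + i%:R * (s / 2 * h), b + j%:R * (s / 2 * k), s / 2) => _ /=.
  move: ih jk => /andP[ih1 ih2] /andP[jk1 jk2].
  split.
  - split=> //; split=> /=; last 2 first.
    + clear -i4 jk1; lra.
    + clear -i5 jk2 Ek; lra.
    split; last by rewrite divr_gt0.
    + clear -i1 ih1; lra.
    + clear -i2 ih2 Eh; lra.
  - by [].
  - clear -ih1; lra.
  - clear -ih2 Eh; lra.
  - by split; [clear -jk1; lra|clear -jk2 Ek; lra].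
pose q n := iter n nx (a0, b0, 1).
have bq n : bad (q n).
  elim: n => [|n IH]; last by have [] := Hnx _ IH.
  by split=> //; split; rewrite /= ?mul1r//; split; rewrite /= ?mul1r.
have qs n : (q n).2 = 2^-1 ^+ n.
  elim: n => [//|n IH]; have [_ E _ _ _] := Hnx _ (bq n).
  by rewrite [LHS]E IH exprS mulrC.
have nest n m : [/\ (q n).1.1 <= (q (n + m)%N).1.1,
   (q (n + m)%N).1.1 + (q (n + m)%N).2 * h <= (q n).1.1 + (q n).2 * h,
   (q n).1.2 <= (q (n + m)%N).1.2 &
   (q (n + m)%N).1.2 + (q (n + m)%N).2 * k <= (q n).1.2 + (q n).2 * k].
  elim: m => [|m [A B C D]]; first by rewrite addn0.
  rewrite addnS; have [_ E1 E2 E3 [E4 E5]] := Hnx _ (bq (n + m)%N).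
  split; [exact: le_trans A E2|exact: le_trans E3 B|exact: le_trans C E4|exact: le_trans E5 D].
have pos n : 0 < (q n).2 by have [[[]]] := bq n.
have cross n m : (q n).1.1 <= (q m).1.1 + (q m).2 * h /\
    (q n).1.2 <= (q m).1.2 + (q m).2 * k.
  have [nm|/ltnW nm] := leqP n m; rewrite -(subnKC nm).
  - have [A _ C _] := nest n (m - n)%N; split.
      by apply: le_trans A _; rewrite lerDl mulr_ge0// ltW.
    by apply: le_trans C _; rewrite lerDl mulr_ge0// ltW.
  - have [_ B _ D] := nest m (n - m)%N; split.
      by apply: le_trans B; rewrite lerDl mulr_ge0// ltW.
    by apply: le_trans D; rewrite lerDl mulr_ge0// ltW.
(* The suprema of the lower left corners give a point common to all the nested bad rectangles; there
   [loc] contradicts badness as soon as the rectangles are small. *)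
pose X := [set (q n).1.1 | n in [set: nat]]; pose Y := [set (q n).1.2 | n in [set: nat]].
have sX : has_sup X.
  by split; [exists (q 0%N).1.1, 0%N|exists ((q 0%N).1.1 + (q 0%N).2 * h) => _ [n _ <-]; have [] := cross n 0%N].
have sY : has_sup Y.
  by split; [exists (q 0%N).1.2, 0%N|exists ((q 0%N).1.2 + (q 0%N).2 * k) => _ [n _ <-]; have [] := cross n 0%N].
have inX n : (q n).1.1 <= sup X <= (q n).1.1 + (q n).2 * h.
  apply/andP; split; first by apply: (ub_le_sup sX.2); exists n.
  by apply: (ge_sup sX.1) => _ [m _ <-]; have [] := cross m n.
have inY n : (q n).1.2 <= sup Y <= (q n).1.2 + (q n).2 * k.
  apply/andP; split; first by apply: (ub_le_sup sY.2); exists n.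
  by apply: (ge_sup sY.1) => _ [m _ <-]; have [] := cross m n.
have [||d d0 Hd] := loc (sup X) (sup Y).
- by have := inX 0%N; rewrite /= mul1r.
- by have := inY 0%N; rewrite /= mul1r.
have [n Hn] : exists n, (2^-1 : R) ^+ n < d.
  have /cvgrPdist_lt /(_ d d0) [n _ Hn] : (2^-1 : R) ^+ n @[n --> \oo] --> 0.
    apply: cvg_expr; rewrite ger0_norm ?invr_ge0// invf_lt1//; lra.
  by exists n; have := Hn n (leqnn n); rewrite /= sub0r normrN ger0_norm ?exprn_ge0 ?invr_ge0.
have [_] := bq n; apply; apply: Hd => //; first by rewrite qs.
Qed.

(** Flux of the field [(P, - Q)] out of the rectangle with corner [(a, b)] and sides [s * h],
    [s * k]; it is to vanish when [D1 P = D2 Q]. *)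
Definition rect_flux P Q (a b s h k : R) : R :=
  intg b (b + s * k) (fun y => P (a + s * h, y) - P (a, y)) -
  intg a (a + s * h) (fun x => Q (x, b + s * k) - Q (x, b)).

Lemma cont_sec1 P (y : R) : continuous P -> continuous (fun x => P (x, y)).
Proof.
move=> cP x; apply: (@cont_comp2 R P R (fun x => x) (fun=> y)); first exact: cP.
  exact: cvg_id.
exact: cst_continuous.
Qed.

Lemma cont_sec2 P (x : R) : continuous P -> continuous (fun y => P (x, y)).
Proof.
move=> cP y; apply: (@cont_comp2 R P R (fun=> x) (fun y => y)); first exact: cP.
  exact: cst_continuous.
exact: cvg_id.
Qed.

Lemma rect_flux_quarters P Q (a b s h k : R) : continuous P -> continuous Q ->
  0 < s -> 0 < h -> 0 < k ->
  rect_flux P Q a b s h k =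
  rect_flux P Q a b (s / 2) h k + rect_flux P Q (a + s / 2 * h) b (s / 2) h k +
  (rect_flux P Q a (b + s / 2 * k) (s / 2) h k +
   rect_flux P Q (a + s / 2 * h) (b + s / 2 * k) (s / 2) h k).
Proof.
move=> cP cQ s0 h0 k0.
have sh : 0 < s / 2 * h by rewrite mulr_gt0// divr_gt0.
have sk : 0 < s / 2 * k by rewrite mulr_gt0// divr_gt0.
have Eh : a + s * h = a + s / 2 * h + s / 2 * h by field.
have Ek : b + s * k = b + s / 2 * k + s / 2 * k by field.
rewrite /rect_flux Eh Ek.
have cP2 x := @cont_sec2 P x cP. have cQ1 y := @cont_sec1 Q y cQ.
have ab1 : a < a + s / 2 * h by rewrite ltrDl.
have ab2 : a + s / 2 * h < a + s / 2 * h + s / 2 * h by rewrite ltrDl.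
have ab3 := lt_trans ab1 ab2.
have bb1 : b < b + s / 2 * k by rewrite ltrDl.
have bb2 : b + s / 2 * k < b + s / 2 * k + s / 2 * k by rewrite ltrDl.
have bb3 := lt_trans bb1 bb2.
have SP x := intg_split bb1 bb2 (cP2 x).
have SQ y := intg_split ab1 ab2 (cQ1 y).
rewrite !intgB// !SP !SQ; ring.
Qed.

(* Goursat's argument: no continuity of the partial derivatives is needed. *)
Lemma div_free_flux P Q (a b h k : R) : continuous P -> continuous Q -> 0 < h -> 0 < k ->
  (forall x y, a <= x <= a + h -> b <= y <= b + k ->
     exists c b1 a2, lin_approx P (x, y) c b1 /\ lin_approx Q (x, y) a2 c) ->
  intg b (b + k) (fun y => P (a + h, y) - P (a, y)) =
  intg a (a + h) (fun x => Q (x, b + k) - Q (x, b)).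
Proof.
move=> cP cQ h0 k0 H; apply/eqP; rewrite -subr_eq0 -normr_le0.
have cP2 x := @cont_sec2 P x cP. have cQ1 y := @cont_sec1 Q y cQ.
apply/ler_addgt0Pl => e e0; rewrite addr0.
suff : `|rect_flux P Q a b 1 h k| <= e * 1 ^+ 2 by rewrite /rect_flux !mul1r expr1n mulr1.
(* The bound [e * s ^+ 2] is additive under quartering, so it has to be proved only for small
   rectangles around a point, where differentiability applies. *)
apply: (@bisection (fun a b s => `|rect_flux P Q a b s h k| <= e * s ^+ 2) a b h k) => //.
  move=> a' b' s _ _ _ _ s0 Hq; rewrite rect_flux_quarters//.
  have := Hq false false; have := Hq false true; have := Hq true false; have := Hq true true.
  rewrite !mul0r !mul1r !addr0.
  set u := rect_flux _ _ _ _ _ _ _; set v := rect_flux _ _ _ _ _ _ _.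
  set w := rect_flux _ _ _ _ _ _ _; set z := rect_flux _ _ _ _ _ _ _.
  have -> : e * (s / 2) ^+ 2 = e * s ^+ 2 / 4 by field.
  move=> h1 h2 h3 h4.
  have A := ler_normD z v; have B := ler_normD w u; have C := ler_normD (z + v) (w + u).
  by clear -A B C h1 h2 h3 h4; lra.
move=> x y xab yab; have [c [b1 [a2 [HP HQ]]]] := H x y xab yab.
(* Each of the two integrals differs from [c] times the area by at most [2 * E * s * (h + k)] times
   a side; this [E] makes the total exactly [e * s ^+ 2]. *)
pose E := e / (2 * (h + k) ^+ 2).
have hk : 0 < h + k by rewrite addr_gt0.
have E0 : 0 < E by rewrite divr_gt0// mulr_gt0// exprn_gt0.
have [d1 d10 Hd1] := HP _ E0; have [d2 d20 Hd2] := HQ _ E0.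
exists (Num.min d1 d2 / (h + k)); first by rewrite divr_gt0// lt_min d10.
move=> a' b' s s0; rewrite ltr_pdivlMr// lt_min => /andP[sd1 sd2] /andP[xa1 xa2] /andP[yb1 yb2].
have sh : 0 < s * h by rewrite mulr_gt0. have sk : 0 < s * k by rewrite mulr_gt0.
have shk : s * (h + k) = s * h + s * k by rewrite mulrDr.
have Rb (F : R * R -> R) (al be d : R) (Hd : forall h k : R, `|h| < d -> `|k| < d ->
   `|F ((x, y).1 + h, (x, y).2 + k) - F (x, y) - al * h - be * k| <= E * (`|h| + `|k|)) :
   s * (h + k) < d -> forall x' y', a' <= x' <= a' + s * h -> b' <= y' <= b' + s * k ->
   `|F (x', y') - F (x, y) - al * (x' - x) - be * (y' - y)| <= E * (s * (h + k)).
  move=> sd x' y' /andP[u1 u2] /andP[v1 v2].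
  have X : `|x' - x| <= s * h by rewrite ler_norml; apply/andP; split; clear -u1 u2 xa1 xa2; lra.
  have Y : `|y' - y| <= s * k by rewrite ler_norml; apply/andP; split; clear -v1 v2 yb1 yb2; lra.
  have := Hd (x' - x) (y' - y); rewrite /= ![_ + (_ - _)]addrC !subrK.
  have -> // : `|x' - x| < d by clear -X sd shk sk; lra.
  have -> // : `|y' - y| < d by clear -Y sd shk sh; lra.
  move=> /(_ isT isT) A; apply: le_trans A _; rewrite ler_pM2l// shk; exact: lerD.
have RP := Rb P c b1 d1 Hd1 sd1. have RQ := Rb Q a2 c d2 Hd2 sd2.
have aa : a' < a' + s * h by rewrite ltrDl.
have bb : b' < b' + s * k by rewrite ltrDl.
pose M := 2 * (E * (s * (h + k))).
have I1 : `|intg b' (b' + s * k) (fun y => P (a' + s * h, y) - P (a', y)) - c * (s * h) * (s * k)| <= M * (s * k).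
  have -> : c * (s * h) * (s * k) = intg b' (b' + s * k) (fun=> c * (s * h)).
    by rewrite intg_cst// (addrC b') addrK.
  have cc : continuous (fun _ : R => c * (s * h)) by move=> ?; exact: cst_continuous.
  have cPP : continuous (fun y => P (a' + s * h, y) - P (a', y)).
    by move=> ?; apply: cvgB; exact: cP2.
  rewrite -intgB//.
  have := @intg_norm_le R (fun y => P (a' + s * h, y) - P (a', y) - c * (s * h)) M b' (b' + s * k) bb.
  rewrite (addrC b' (s * k)) addrK; apply.
    by move=> ?; apply: cvgB; [exact: cPP|exact: cc].
  move=> y'; rewrite addrC => yy.
  have A := RP (a' + s * h) y' _ yy; have B := RP a' y' _ yy.
  have {}A := A ltac:(by rewrite lexx ltW). have {}B := B ltac:(by rewrite lexx ltW).
  set U := (X in `|X| <= _) in A; set V := (X in `|X| <= _) in B.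
  rewrite (_ : _ - _ = U - V); last by rewrite /U /V; ring.
  by apply: le_trans (ler_normB _ _) _; clear -A B; rewrite /M; lra.
have I2 : `|intg a' (a' + s * h) (fun x => Q (x, b' + s * k) - Q (x, b')) - c * (s * h) * (s * k)| <= M * (s * h).
  have -> : c * (s * h) * (s * k) = intg a' (a' + s * h) (fun=> c * (s * k)).
    by rewrite intg_cst// (addrC a') addrK mulrAC.
  have cc : continuous (fun _ : R => c * (s * k)) by move=> ?; exact: cst_continuous.
  have cQQ : continuous (fun x => Q (x, b' + s * k) - Q (x, b')).
    by move=> ?; apply: cvgB; exact: cQ1.
  rewrite -intgB//.
  have := @intg_norm_le R (fun x => Q (x, b' + s * k) - Q (x, b') - c * (s * k)) M a' (a' + s * h) aa.
  rewrite (addrC a' (s * h)) addrK; apply.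
    by move=> ?; apply: cvgB; [exact: cQQ|exact: cc].
  move=> x'; rewrite addrC => xx.
  have A := RQ x' (b' + s * k) xx _; have B := RQ x' b' xx _.
  have {}A := A ltac:(by rewrite lexx ltW). have {}B := B ltac:(by rewrite lexx ltW).
  set U := (X in `|X| <= _) in A; set V := (X in `|X| <= _) in B.
  rewrite (_ : _ - _ = U - V); last by rewrite /U /V; ring.
  by apply: le_trans (ler_normB _ _) _; clear -A B; rewrite /M; lra.
rewrite /rect_flux; set u := intg _ _ _ in I1 *; set v := intg _ _ _ in I2 *.
have -> : u - v = (u - c * (s * h) * (s * k)) - (v - c * (s * h) * (s * k)) by ring.
apply: le_trans (ler_normB _ _) _.
have -> : e * s ^+ 2 = M * (s * k) + M * (s * h).
  by rewrite /M /E; field; exact: lt0r_neq0.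
exact: lerD.
Qed.

End Goursat.

(** * The mean value property *)

Section MeanValue.
Variable R : realType.
Implicit Types (P Q : R * R -> R).

Lemma Ck_fst k (u du : R -> R) : (forall x, is_derive x (1 : R) u (du x)) ->
  Ck k setT (fun p => du p.1) -> Ck k.+1 setT (fun p : R * R => u p.1).
Proof.
move=> H Hk.
have D (p : R * R) : [/\ ddf (fun p => u p.1) p, D1 (fun p => u p.1) p = du p.1 &
    D2 (fun p => u p.1) p = 0].
  by case: p => x y; apply: ddf_intro => /=; exact: is_derive_cst.
split.
  move=> p _; apply: (@continuous_comp _ _ _ fst u); first exact: cvg_fst.
  exact: is_derive_cont1 (H _).
split; first by move=> p _; have [] := D p.
split.
- by apply: (Ck_eq openT _ Hk) => p _; have [_ ->] := D p.
- by apply: (Ck_eq openT _ (Ck_cst k setT 0)) => p _; have [_ _ ->] := D p.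
Qed.

Lemma Ck_snd k (u du : R -> R) : (forall x, is_derive x (1 : R) u (du x)) ->
  Ck k setT (fun p => du p.2) -> Ck k.+1 setT (fun p : R * R => u p.2).
Proof.
move=> H Hk.
have D (p : R * R) : [/\ ddf (fun p => u p.2) p, D1 (fun p => u p.2) p = 0 &
    D2 (fun p => u p.2) p = du p.2].
  by case: p => x y; apply: ddf_intro => /=; exact: is_derive_cst.
split.
  move=> p _; apply: (@continuous_comp _ _ _ snd u); first exact: cvg_snd.
  exact: is_derive_cont1 (H _).
split; first by move=> p _; have [] := D p.
split.
- by apply: (Ck_eq openT _ (Ck_cst k setT 0)) => p _; have [_ ->] := D p.
- by apply: (Ck_eq openT _ Hk) => p _; have [_ _ ->] := D p.
Qed.

Lemma Ck_expR k : Ck k setT (fun p : R * R => expR p.1).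
Proof.
elim: k => [|k IH]; last exact: (@Ck_fst k expR expR).
by apply: CkW; apply: (@Ck_fst 0 expR expR); split=> // p _;
  apply: (@continuous_comp _ _ _ fst expR); [exact: cvg_fst|exact: continuous_expR].
Qed.

Lemma Ck_cos_sin k : Ck k setT (fun p : R * R => cos p.2) /\
  Ck k setT (fun p : R * R => sin p.2).
Proof.
elim: k => [|k [IHc IHs]].
  by split; split=> // p _; [apply: (@continuous_comp _ _ _ snd cos)|
    apply: (@continuous_comp _ _ _ snd sin)]; (try exact: cvg_snd);
  [exact: continuous_cos|exact: continuous_sin].
split; last exact: (@Ck_snd k sin cos).
by apply: (@Ck_snd k cos (fun x => - sin x)); exact: (CkN openT IHs).
Qed.

Lemma is_derive1_mulr (f : R -> R) (x d c : R) : is_derive x (1 : R) f d ->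
  is_derive x (1 : R) (fun s => f s * c) (d * c).
Proof.
move=> H; rewrite (_ : (fun s => _) = c *: f); last first.
  by apply/funext => s; rewrite mulrC.
by rewrite mulrC; apply: is_deriveZ.
Qed.

Definition polar1 (p : R * R) := expR p.1 * cos p.2.
Definition polar2 (p : R * R) := expR p.1 * sin p.2.

Lemma Ck_polar k : Ck k setT polar1 /\ Ck k setT polar2.
Proof.
have [c s] := Ck_cos_sin k.
by split; exact: (CkM openT (Ck_expR k)).
Qed.

Lemma ddf_polar (p : R * R) :
  [/\ ddf polar1 p, D1 polar1 p = polar1 p & D2 polar1 p = - polar2 p] /\
  [/\ ddf polar2 p, D1 polar2 p = polar2 p & D2 polar2 p = polar1 p].
Proof.
case: p => x y; rewrite /polar1 /polar2; split; apply: ddf_intro => /=.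
- by apply: is_derive1_mulr; exact: is_derive_expR.
- by rewrite -mulrN; apply: is_deriveZ; exact: is_derive_cos.
- by apply: is_derive1_mulr; exact: is_derive_expR.
- by apply: is_deriveZ; exact: is_derive_sin.
Qed.

Lemma lin_approx_polar f (p : R * R) (a b : R) : lin_approx f (polar1 p, polar2 p) a b ->
  lin_approx (fun q => f (polar1 q, polar2 q)) p
   (a * polar1 p + b * polar2 p) (- a * polar2 p + b * polar1 p).
Proof.
have [[_ E1 E2] [_ E3 E4]] := ddf_polar p.
have [P1 P2] := Ck_polar 1.
have L1 := Ck1_lin_approx openT P1 (I : setT p).
have L2 := Ck1_lin_approx openT P2 (I : setT p).
rewrite E1 E2 in L1; rewrite E3 E4 in L2.
by move=> H; have := lin_approx_comp H L1 L2; rewrite mulrN mulNr.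
Qed.

Lemma lin_approx_eq f g (p : R * R) (a b d0 : R) : 0 < d0 ->
  (forall h k : R, `|h| < d0 -> `|k| < d0 -> f (p.1 + h, p.2 + k) = g (p.1 + h, p.2 + k)) ->
  lin_approx f p a b -> lin_approx g p a b.
Proof.
move=> d00 fg H e e0; have [d d1 Hd] := H e e0.
exists (Num.min d d0); first by rewrite lt_min d1.
move=> h k; rewrite !lt_min => /andP[h1 h2] /andP[k1 k2].
rewrite -fg//; have := fg 0 0; rewrite normr0 !addr0 -surjective_pairing => <- //.
exact: Hd.
Qed.

Definition in_disc (p : R * R) := p.1 ^+ 2 + p.2 ^+ 2 <= 1.
Definition cont_disc P := forall p, in_disc p -> forall e, 0 < e -> exists2 d, 0 < d &
  forall q, in_disc q -> `|q.1 - p.1| < d -> `|q.2 - p.2| < d -> `|P q - P p| < e.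

(** Clamping the radius to the unit interval makes a function on the closed disc, written in polar
    coordinates, continuous on the whole plane, so that the integral lemmas for everywhere
    continuous functions apply. *)
Definition retract (r : R) := Num.min 1 (Num.max 0 r).

Lemma retract_cont : continuous retract.
Proof.
move=> x; apply: continuous_min; first exact: cst_continuous.
by apply: continuous_max; [exact: cst_continuous|exact: cvg_id].
Qed.

Lemma retract_id r : 0 <= r <= 1 -> retract r = r.
Proof. by move=> /andP[a b]; rewrite /retract max_r// min_r. Qed.

Lemma retract_disc (p : R * R) : in_disc (retract p.1 * cos p.2, retract p.1 * sin p.2).
Proof.
rewrite /in_disc /= !exprMn -mulrDr cos2Dsin2 mulr1 expr_le1//; first by rewrite ge_min lexx.
by rewrite le_min ler01 le_max lexx.
Qed.

Definition disc_ext P (p : R * R) := P (retract p.1 * cos p.2, retract p.1 * sin p.2).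

Lemma disc_ext_cont P : cont_disc P -> continuous (disc_ext P).
Proof.
move=> cP p; apply/cont2_epsP => e e0.
have [d d0 Hd] := cP _ (retract_disc p) e e0.
have cr : {for p, continuous (fun q : R * R => retract q.1)}.
  by apply: (@continuous_comp _ _ _ fst retract); [exact: cvg_fst|exact: retract_cont].
have [Cc Cs] := Ck_cos_sin 0.
have c1 : {for p, continuous (fun q : R * R => retract q.1 * cos q.2)}.
  by apply: cvgM; [exact: cr|exact: (Ck_cont Cc)].
have c2 : {for p, continuous (fun q : R * R => retract q.1 * sin q.2)}.
  by apply: cvgM; [exact: cr|exact: (Ck_cont Cs)].
have [d1 d10 H1] := (cont2_epsP _ _).1 c1 d d0.
have [d2 d20 H2] := (cont2_epsP _ _).1 c2 d d0.
exists (Num.min d1 d2); first by rewrite lt_min d10.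
move=> x y; rewrite !lt_min => /andP[x1 x2] /andP[y1 y2].
by apply: Hd; [exact: (retract_disc (x, y))|exact: H1|exact: H2].
Qed.

(** The complex exponential is holomorphic, so a Cauchy-Riemann pair remains one in the coordinates
    (log radius, angle); only the equality needed by [div_free_flux] is kept. *)
Lemma cauchy_riemann_polar P Q (t th a b : R) : t < 0 ->
  lin_approx P (polar1 (t, th), polar2 (t, th)) a b ->
  lin_approx Q (polar1 (t, th), polar2 (t, th)) (- b) a ->
  exists c b1 a2, lin_approx (fun p => disc_ext P (expR p.1, p.2)) (t, th) c b1 /\
    lin_approx (fun p => disc_ext Q (expR p.1, p.2)) (t, th) a2 c.
Proof.
move=> t0 /lin_approx_polar HP /lin_approx_polar HQ.
have ext (F : R * R -> R) x y : x < 0 ->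
    disc_ext F (expR x, y) = F (polar1 (x, y), polar2 (x, y)).
  move=> x0; rewrite /disc_ext/= retract_id// expR_ge0/= -expR0.
  by rewrite ler_expR ltW.
exists (a * polar1 (t, th) + b * polar2 (t, th)).
eexists; eexists; split.
- apply: (lin_approx_eq (d0 := - t) _ _ HP); first by rewrite oppr_gt0.
  move=> h k ht _ /=; rewrite ext//; move: ht; rewrite ltr_norml opprK => /andP[_ ht].
  by clear -ht; lra.
- rewrite (_ : a * _ + _ = - - b * polar2 (t, th) + a * polar1 (t, th)); last by rewrite opprK addrC.
  apply: (lin_approx_eq (d0 := - t) _ _ HQ); first by rewrite oppr_gt0.
  move=> h k ht _ /=; rewrite ext//; move: ht; rewrite ltr_norml opprK => /andP[_ ht].
  by clear -ht; lra.
Qed.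

(** Over the rectangle between two log radii the contributions of [Q] at the angles [- pi] and [pi]
    cancel by periodicity, so the circular mean is the same for all radii in (0, 1). Continuity
    extends this to radius 1, which is the integral, and to radius 0, which is the value at the
    centre. *)
Lemma mean_value P Q : cont_disc P -> cont_disc Q ->
  (forall p, p.1 ^+ 2 + p.2 ^+ 2 < 1 ->
     exists a b, lin_approx P p a b /\ lin_approx Q p (- b) a) ->
  intg (- pi) pi (fun th => P (cos th, sin th)) = 2 * pi * P (0, 0).
Proof.
move=> cP cQ H.
have pp : - pi < pi :> R by rewrite gtrN// pi_gt0.
have cPe := disc_ext_cont cP. have cQe := disc_ext_cont cQ.
pose M r := intg (- pi) pi (fun th => disc_ext P (r, th)).
have cM : continuous M.
  move=> r; apply: intg_param_cont => //.
    by exists 1 => // s _; exact: cont_sec2.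
  move=> th _; rewrite (_ : (fun p => _) = disc_ext P); first exact: cPe.
  by apply/funext => -[].
have cE (F : R * R -> R) : continuous F -> continuous (fun p : R * R => F (expR p.1, p.2)).
  move=> cF p; apply: cont_comp2; first exact: cF.
    exact: (Ck_cont (Ck_expR 0)).
  exact: cvg_snd.
have Mconst t1 t2 : t1 < t2 -> t2 < 0 -> M (expR t1) = M (expR t2).
  move=> t12 t20.
  have h0 : 0 < t2 - t1 by rewrite subr_gt0.
  have p2 : 0 < (pi + pi : R) by rewrite addr_gt0// pi_gt0.
  have := @div_free_flux R _ _ t1 (- pi) (t2 - t1) (pi + pi) (cE _ cPe) (cE _ cQe) h0 p2.
  rewrite (addrC t1) subrK addKr => /=.
  have -> : (fun x => disc_ext Q (expR x, pi) - disc_ext Q (expR x, - pi)) = fun=> 0.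
    by apply/funext => x; rewrite /disc_ext/= cosN sinN sinpi oppr0 subrr.
  rewrite (intg0 t12) (intgB pp (@cont_sec2 _ _ (expR t2) cPe) (@cont_sec2 _ _ (expR t1) cPe)).
  move=> E; apply/esym/eqP; rewrite -subr_eq0 /M E// => x y /andP[_ xt] _.
  have x0 : x < 0 by exact: le_lt_trans t20.
  have [|a [b [HP HQ]]] := H (polar1 (x, y), polar2 (x, y)).
    rewrite /polar1 /polar2 /= !exprMn -mulrDr cos2Dsin2 mulr1 expr_lt1 ?expR_ge0//.
    by rewrite -expR0 ltr_expR.
  exact: cauchy_riemann_polar HP HQ.
have Mc r : 0 < r -> r < 1 -> M r = M (1/2).
  move=> r0 r1; have h0 : 0 < 1/2 :> R by rewrite divr_gt0.
  have h1 : 1/2 < 1 :> R by lra.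
  have E1 : expR (ln r) = r by rewrite lnK// posrE.
  have E2 : expR (ln (1/2)) = 1/2 :> R by rewrite lnK// posrE.
  suff : M (expR (ln r)) = M (expR (ln (1/2))) by rewrite E1 E2.
  have L s : 0 < s -> s < 1 -> ln s < 0 :> R by move=> s0 s1; rewrite ln_lt0// s0.
  have [e|e|->//] := ltgtP (ln r) (ln (1/2)).
    by apply: Mconst => //; exact: L.
  by apply/esym; apply: Mconst => //; exact: L.
have M01 r0 : 0 <= r0 <= 1 -> M r0 = M (1/2).
  move=> r01; apply/eqP; rewrite -subr_eq0 -normr_le0; apply/ler_addgt0Pl => e e0; rewrite addr0.
  have /cvgrPdist_lt /(_ e e0) /nbhs_ballP[d d0 Hd] : M y @[y --> r0] --> M r0 by exact: cM.
  have {}d0 : 0 < d := d0.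
  pose h := Num.min (d / 2) (1/2).
  have h0 : 0 < h by rewrite lt_min !divr_gt0.
  have hd : h < d.
    by apply: (@le_lt_trans _ _ (d / 2)); [rewrite ge_min lexx|clear -d0; lra].
  have h2 : h <= 1/2 by rewrite ge_min lexx orbT.
  move: r01 => /andP[r00 r01].
  have [r1 rr1 [r10 r11]] : exists2 r1, `|r0 - r1| < d & 0 < r1 /\ r1 < 1.
    have [H0|H0] := leP r0 (1/4).
      exists (r0 + h); first by rewrite opprD addNKr normrN gtr0_norm.
      by clear -H0 h0 h2 r00; split; lra.
    exists (r0 - h / 4); first by rewrite opprB addrCA subrr addr0 gtr0_norm ?divr_gt0//; clear -hd h0; lra.
    by clear -H0 h0 h2 r01; split; lra.
  by rewrite -(Mc r1 r10 r11); apply/ltW; exact: (Hd r1).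
have -> : intg (- pi) pi (fun th => P (cos th, sin th)) = M 1.
  by apply: eq_intg => // th _; rewrite /disc_ext/= retract_id ?ler01 ?lexx// !mul1r.
rewrite M01 ?ler01 ?lexx// -(M01 0) ?ler01 ?lexx//.
have -> : 2 * pi * P (0, 0) = intg (- pi) pi (fun=> P (0, 0)).
  by rewrite intg_cst// opprK mulrC; congr (_ * _); rewrite mulrDl mul1r.
by apply: eq_intg => // th _; rewrite /disc_ext/= retract_id ?ler01 ?lexx// !mul0r.
Qed.

End MeanValue.

(** * Holomorphic functions on the disc *)

Section ComplexPlane.
Variable R : realType.
Local Notation C := (Cplane R).
Implicit Types (z w : C) (f g : C -> C).

Lemma ReD z w : complex.Re (z + w) = complex.Re z + complex.Re w.
Proof. by case: z; case: w. Qed.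
Lemma ImD z w : complex.Im (z + w) = complex.Im z + complex.Im w.
Proof. by case: z; case: w. Qed.
Lemma ReN z : complex.Re (- z) = - complex.Re z.
Proof. by case: z. Qed.
Lemma ImN z : complex.Im (- z) = - complex.Im z.
Proof. by case: z. Qed.
Lemma ReM z w : complex.Re (z * w) = complex.Re z * complex.Re w - complex.Im z * complex.Im w.
Proof. by case: z; case: w. Qed.
Lemma ImM z w : complex.Im (z * w) = complex.Re z * complex.Im w + complex.Im z * complex.Re w.
Proof. by case: z; case: w. Qed.
Lemma Re0 : complex.Re (0 : C) = 0. Proof. by []. Qed.
Lemma Im0 : complex.Im (0 : C) = 0. Proof. by []. Qed.
Lemma Re1 : complex.Re (1 : C) = 1. Proof. by []. Qed.
Lemma Im1 : complex.Im (1 : C) = 0. Proof. by []. Qed.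
Definition ReImE := (ReD, ImD, ReN, ImN, ReM, ImM, Re0, Im0, Re1, Im1).

Lemma eqC z w : complex.Re z = complex.Re w -> complex.Im z = complex.Im w -> z = w.
Proof. by case: z => a b; case: w => c d /= -> ->. Qed.

Lemma eq_of_sum_diff z w (a b : C) : z + a = w + b -> z + (-1) * a = w + (-1) * b -> z = w.
Proof.
move: z w a b => [z z'] [w w'] [a a'] [b b'] [A A'] [].
rewrite !oppr0 !mul0r !mulN1r !subr0 !addr0 => B B'.
by apply: eqC => /=; [clear -A B|clear -A' B']; lra.
Qed.

Lemma posC (d : R[i]) : 0 < d -> exists2 r : R, 0 < r & d = r%:C.
Proof.
by case: d => a b; rewrite ltcE /= => /andP[/eqP -> a0]; exists a.
Qed.

Lemma posC_gt0 (r : R) : (0 < r%:C :> R[i]) = (0 < r).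
Proof. by rewrite ltcE /= eqxx. Qed.

Lemma absRe_le z (r : R) : `|z| <= r%:C -> `|complex.Re z| <= r.
Proof.
rewrite normc_def lecE /= eqxx /= => H; apply: le_trans H.
by rewrite -sqrtr_sqr ler_sqrt ?addr_ge0 ?sqr_ge0// lerDl sqr_ge0.
Qed.

Lemma absIm_le z (r : R) : `|z| <= r%:C -> `|complex.Im z| <= r.
Proof.
rewrite normc_def lecE /= eqxx /= => H; apply: le_trans H.
by rewrite -sqrtr_sqr ler_sqrt ?addr_ge0 ?sqr_ge0// lerDr sqr_ge0.
Qed.

Lemma absRe_lt z (r : R) : `|z| < r%:C -> `|complex.Re z| < r.
Proof.
rewrite normc_def ltcE /= eqxx /= => H; apply: le_lt_trans H.
by rewrite -sqrtr_sqr ler_sqrt ?addr_ge0 ?sqr_ge0// lerDl sqr_ge0.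
Qed.

Lemma absIm_lt z (r : R) : `|z| < r%:C -> `|complex.Im z| < r.
Proof.
rewrite normc_def ltcE /= eqxx /= => H; apply: le_lt_trans H.
by rewrite -sqrtr_sqr ler_sqrt ?addr_ge0 ?sqr_ge0// lerDr sqr_ge0.
Qed.

Lemma normC_le_abs z : `|z| <= (`|complex.Re z| + `|complex.Im z|)%:C.
Proof.
rewrite normc_def lecE /= eqxx /=.
rewrite -[leRHS]ger0_norm ?addr_ge0// -sqrtr_sqr ler_sqrt ?sqr_ge0//.
by rewrite sqrrD !real_normK ?num_real// addrAC lerDl mulrn_wge0// mulr_ge0.
Qed.

Lemma normC_lt_abs z (d : R) : `|complex.Re z| < d -> `|complex.Im z| < d ->
  `|z| < (2 * d)%:C.
Proof.
move=> h1 h2; apply: le_lt_trans (normC_le_abs z) _.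
by rewrite ltcE /= eqxx /=; lra.
Qed.

Lemma normC_lt1 z : (`|z| < 1) = (complex.Re z ^+ 2 + complex.Im z ^+ 2 < 1).
Proof.
rewrite normc_def ltcE /= eqxx /= -[ltRHS]sqrtr1 ltr_sqrt//.
Qed.

Lemma normC_le1 z : (`|z| <= 1) = (complex.Re z ^+ 2 + complex.Im z ^+ 2 <= 1).
Proof.
by rewrite normc_def lecE /= eqxx /= -[leRHS]sqrtr1 ler_sqrt.
Qed.

Lemma normC_eq1 z : `|z| = 1 <-> complex.Re z ^+ 2 + complex.Im z ^+ 2 = 1.
Proof.
rewrite normc_def; split=> [[h]|->]; last by rewrite sqrtr1.
by rewrite -[LHS]sqr_sqrtr ?addr_ge0 ?sqr_ge0// h expr1n.
Qed.

Definition rp f (p : R * R) : R := complex.Re (f (toC p)).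
Definition ip f (p : R * R) : R := complex.Im (f (toC p)).

Lemma toCK z : toC (ofC z) = z. Proof. by case: z. Qed.
Lemma ofCK p : ofC (toC p) = p :> R * R. Proof. by case: p. Qed.

Lemma lin_approx_ddf (f : R * R -> R) p (a b : R) : lin_approx f p a b ->
  [/\ ddf f p, D1 f p = a & D2 f p = b].
Proof.
case: p => x y H; apply: ddf_intro.
- rewrite -[a]mulr1 -[_ * 1]addr0 -(mulr0 b).
  exact: (@lin_approx_curve _ f (fun s => s) (fun=> y)).
- rewrite -[b]mulr1 -[_ * 1]add0r -(mulr0 a).
  exact: (@lin_approx_curve _ f (fun=> x) (fun s => s)).
Qed.

Lemma lin_approxN (f : R * R -> R) p (a b : R) : lin_approx f p a b ->
  lin_approx (fun q => - f q) p (- a) (- b).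
Proof.
move=> H e e0; have [d d0 Hd] := H e e0; exists d => // h k hd kd.
have := Hd h k hd kd; set u := f _; set v := f p.
by rewrite -normrN (_ : - (u - v - a * h - b * k) = - u - - v - - a * h - - b * k)//; ring.
Qed.

Lemma derivable_lin_approx f z : derivable f z 1 -> let d := 'D_1 f z in
  lin_approx (rp f) (ofC z) (complex.Re d) (- complex.Im d) /\
  lin_approx (ip f) (ofC z) (complex.Im d) (complex.Re d).
Proof.
move=> fd d; have /is_derive_epsP H : is_derive z 1 f d by [].
have key (e : R) : 0 < e -> exists2 del : R, 0 < del & forall h k : R, `|h| < del -> `|k| < del ->
    `|f (toC ((ofC z).1 + h, (ofC z).2 + k)) - f z - (h +i* k) * d| <= (e * (`|h| + `|k|))%:C.
  move=> e0; have e0' : 0 < e%:C :> R[i] by rewrite posC_gt0.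
  have [d' /posC[del del0 ->] Hd] := H _ e0'.
  exists (del / 2); first by rewrite divr_gt0.
  move=> h k hd kd; have := Hd (h +i* k); rewrite (_ : toC _ = (h +i* k) *: 1 + z); last first.
    by rewrite -[_ *: 1]/(_ * 1) mulr1; case: (z) => a b /=; rewrite /toC /= addrC (addrC b).
  have hk : `|(h +i* k : C)| < del%:C.
    by have := @normC_lt_abs (h +i* k) _ hd kd; rewrite mulrC divfK.
  move=> /(_ hk) B; apply: le_trans B _.
  rewrite [X in _ <= X]rmorphM/=; apply: ler_wpM2l; first exact: ltW.
  exact: (normC_le_abs (h +i* k)).
split=> e e0; have [del del0 Hd] := key e e0; exists del => // h k hd kd.
- have := absRe_le (Hd h k hd kd); rewrite !ReImE /rp toCK /=.
  by rewrite (_ : _ - _ - (h * _ - _) = complex.Re (f (toC ((ofC z).1 + h, (ofC z).2 + k))) - complex.Re (f z) - complex.Re d * h - - complex.Im d * k)//; ring.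
- have := absIm_le (Hd h k hd kd); rewrite !ReImE /ip toCK /=.
  by rewrite (_ : _ - _ - (h * _ + _) = complex.Im (f (toC ((ofC z).1 + h, (ofC z).2 + k))) - complex.Im (f z) - complex.Im d * h - complex.Re d * k)//; ring.
Qed.

Lemma contC_eps (A : set C) f z : f x @[x --> within A (nbhs z)] --> f z ->
  forall e : R, 0 < e -> exists2 d : R, 0 < d & forall w, A w ->
    `|complex.Re w - complex.Re z| < d -> `|complex.Im w - complex.Im z| < d ->
    `|complex.Re (f w) - complex.Re (f z)| < e /\ `|complex.Im (f w) - complex.Im (f z)| < e.
Proof.
move=> /cvgrPdist_lt H e e0; have e0' : 0 < e%:C :> R[i] by rewrite posC_gt0.
have := H _ e0'; rewrite near_withinE => /nbhs_ballP[d' /posC[del del0 ->] Hd].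
exists (del / 2); first by rewrite divr_gt0.
move=> w Aw h1 h2; have := Hd w; rewrite /ball /= => /(_ _ Aw).
have hk : `|z - w| < del%:C.
  have := @normC_lt_abs (z - w) (del / 2); rewrite !ReImE.
  by rewrite -normrN opprB h1 -normrN opprB h2 mulrC divfK//; apply.
move=> /(_ hk) B; have A1 := absRe_lt B; have A2 := absIm_lt B.
by rewrite !ReImE in A1 A2; rewrite -normrN opprB A1 -normrN opprB A2.
Qed.

Lemma withinC_epsP (A : set C) f z : f x @[x --> within A (nbhs z)] --> f z <->
  (forall e : R[i], 0 < e -> exists2 d : R[i], 0 < d & forall w, A w -> `|z - w| < d ->
    `|f z - f w| < e).
Proof.
split=> [/cvgrPdist_lt H e e0|H].
  have := H _ e0; rewrite near_withinE => /nbhs_ballP[d d0 Hd].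
  by exists d; [exact: d0|move=> w Aw wd; exact: Hd].
apply/cvgrPdist_lt => e e0; have [d d0 Hd] := H e e0.
rewrite near_withinE; apply/nbhs_ballP; exists d; first exact: d0.
by move=> w wd Aw; exact: Hd.
Qed.

Lemma within_cont_disc f : {within [set l : C | `|l| <= 1], continuous f} ->
  cont_disc (rp f) /\ cont_disc (ip f).
Proof.
move=> /subspace_continuousP H; split=> p pd e e0; have A : `|toC p| <= 1 by rewrite normC_le1.
- have [d d0 Hd] := contC_eps (H _ A) e0; exists d => // q qd h1 h2.
  by have [] := Hd (toC q); rewrite /= ?normC_le1.
- have [d d0 Hd] := contC_eps (H _ A) e0; exists d => // q qd h1 h2.
  by have [] := Hd (toC q); rewrite /= ?normC_le1.
Qed.

Definition disc_holo f := holomorphic_on [set l : C | `|l| < 1] f /\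
  {within [set l : C | `|l| <= 1], continuous f}.

Lemma disc_holoD f g : disc_holo f -> disc_holo g -> disc_holo (fun l => f l + g l).
Proof.
move=> [f1 f2] [g1 g2]; split=> [l l1|l].
  by apply: derivableD; [exact: f1|exact: g1].
by apply: cvgD; [exact: f2|exact: g2].
Qed.

Lemma disc_holoM f g : disc_holo f -> disc_holo g -> disc_holo (fun l => f l * g l).
Proof.
move=> [f1 f2] [g1 g2]; split=> [l l1|l].
  by apply: derivableM; [exact: f1|exact: g1].
by apply: cvgM; [exact: f2|exact: g2].
Qed.

Lemma disc_holo_cst (c : C) : disc_holo (fun=> c).
Proof.
by split=> [l l1|l]; [exact: derivable_cst|exact: cst_continuous].
Qed.

Lemma disc_holo_id : disc_holo (fun l => l).
Proof.
split=> [l l1|]; first exact: derivable_id.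
by apply: continuous_subspaceT => l; exact: cvg_id.
Qed.

Lemma disc_holo_sum (I : Type) (r : seq I) (F : I -> C -> C) :
  (forall i, disc_holo (F i)) -> disc_holo (fun l => \sum_(i <- r) F i l).
Proof.
move=> H; elim: r => [|i r IH].
  have -> : (fun l => \sum_(j <- [::]) F j l) = fun=> 0 by apply/funext => l; rewrite big_nil.
  exact: disc_holo_cst.
have -> : (fun l => \sum_(j <- i :: r) F j l) = fun l => F i l + \sum_(j <- r) F j l.
  by apply/funext => l; rewrite big_cons.
exact: (disc_holoD (H i) IH).
Qed.

Lemma disc_holoN f : disc_holo f -> disc_holo (fun l => - f l).
Proof.
move=> H; have -> : (fun l => - f l) = fun l => (-1) * f l by apply/funext => l; rewrite mulN1r.
exact: disc_holoM (disc_holo_cst _) H.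
Qed.

Definition cmean (h : R * R -> R) : R := intg (- pi) pi (fun th => h (cos th, sin th)).

(** The imaginary part of [f] is the real part of [- 'i * f]: [(ip f, - rp f)] is again a
    Cauchy-Riemann pair. *)
Lemma disc_holo_mean f : disc_holo f ->
  cmean (rp f) = 2 * pi * complex.Re (f 0) /\ cmean (ip f) = 2 * pi * complex.Im (f 0).
Proof.
move=> [f1 /within_cont_disc[cr ci]].
have L p : p.1 ^+ 2 + p.2 ^+ 2 < 1 -> exists a b : R,
    [/\ lin_approx (rp f) p a b, lin_approx (ip f) p (- b) a & lin_approx (fun q => - rp f q) p (- a) (- b)].
  move=> p1; have [|A B] := @derivable_lin_approx f (toC p); first by apply: f1; rewrite /= normC_lt1.
  rewrite ofCK in A B; eexists; eexists; split; [exact: A|rewrite opprK; exact: B|].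
  exact: lin_approxN A.
split.
- apply: (@mean_value R (rp f) (ip f) cr ci) => p /L[a [b [A B _]]].
  by exists a, b.
- apply: (@mean_value R (ip f) (fun q => - rp f q) ci) => [p pd e e0|p /L[a [b [A B D]]]].
    have [d d0 Hd] := cr p pd e e0; exists d => // q qd h1 h2.
    by rewrite -opprD normrN; exact: Hd.
  by exists (- b), a; split; rewrite ?opprK.
Qed.

Lemma cont_circle h : cont_disc h -> continuous (fun th : R => h (cos th, sin th)).
Proof.
move=> ch; have := cont_sec2 (x := 1) (disc_ext_cont ch).
rewrite (_ : (fun y => _) = fun th => h (cos th, sin th))//.
by apply/funext => th; rewrite /disc_ext /= retract_id ?ler01 ?lexx// !mul1r.
Qed.

Lemma circle_param z : `|z| = 1 -> exists2 th : R, - pi <= th <= pi &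
  z = toC (cos th, sin th).
Proof.
move=> /normC_eq1; case: z => a b /= ab.
have a1 : -1 <= a <= 1.
  rewrite -ler_norml -(@ler_pXn2r _ 2)// ?nnegrE// expr1n real_normK ?num_real//.
  by rewrite -ab lerDl sqr_ge0.
have sa : sin (acos a) = `|b|.
  rewrite sin_acos// (_ : 1 - a ^+ 2 = b ^+ 2); first by rewrite sqrtr_sqr.
  by rewrite -ab addrC addKr.
have p0 := acos_ge0 a1; have p1 := acos_lepi a1.
have [b0|b0] := leP 0 b.
  exists (acos a); first by rewrite p1 andbT; apply: le_trans p0; rewrite oppr_le0 pi_ge0.
  by rewrite /toC /= acosK ?inE// sa ger0_norm.
exists (- acos a); first by rewrite lerN2 p1 /=; apply: le_trans (pi_ge0 R); rewrite oppr_le0.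
by rewrite /toC /= cosN sinN acosK ?inE// sa ltr0_norm// opprK.
Qed.

Lemma circle_norm (th : R) : `|(toC (cos th, sin th) : C)| = 1.
Proof. by apply/normC_eq1 => /=; rewrite cos2Dsin2. Qed.

(* The mean value property applied to g = f - f(0) and to g^2 >= 0. *)
Lemma disc_holo_real_const f : disc_holo f ->
  (forall l, `|l| = 1 -> complex.Im (f l) = 0) -> forall l, `|l| = 1 -> f l = f 0.
Proof.
move=> Hf Hr.
have pp : - pi < pi :> R by rewrite gtrN// pi_gt0.
have ImE th : ip f (cos th, sin th) = 0 by apply: Hr; exact: circle_norm.
have f0 : complex.Im (f 0) = 0.
  have [_] := disc_holo_mean Hf; rewrite /cmean (eq_intg (g := fun=> 0)) ?intg0//.
  move=> /esym/eqP; rewrite mulf_eq0 => /orP[|/eqP//].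
  by rewrite mulf_eq0 pnatr_eq0/= gt_eqF// pi_gt0.
pose g l := f l - f 0.
have Hg : disc_holo g by apply: disc_holoD Hf (disc_holo_cst _).
have Hg2 := disc_holoM Hg Hg.
have [] := disc_holo_mean Hg2; rewrite /g subrr mul0r mulr0 => M0 _.
have [_ /within_cont_disc[cr _]] := Hg2.
have Z := intg_eq0 pp (cont_circle cr) _ M0.
have E th : rp (fun l => (f l - f 0) * (f l - f 0)) (cos th, sin th) =
    (rp f (cos th, sin th) - complex.Re (f 0)) ^+ 2.
  rewrite /rp !ReImE f0; have := ImE th; rewrite /ip => ->.
  by rewrite subr0 mulr0 subr0 expr2.
move=> l /circle_param[th thp ->].
have := Z _ th thp; rewrite E => /(_ _)/eqP; rewrite sqrf_eq0 subr_eq0 => H.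
apply: eqC; first by apply/eqP/H => x _; rewrite E sqr_ge0.
by rewrite f0; exact: ImE.
Qed.

Lemma normcJ z : `|(conjc z : C)| = `|z|.
Proof. by rewrite !normc_def; case: z => a b /=; rewrite sqrrN. Qed.

Lemma conjcM z w : conjc (z * w) = conjc z * conjc w :> C.
Proof. by apply: eqC; case: z => a b; case: w => c d /=; ring. Qed.

Lemma conjcB z w : conjc (z - w) = conjc z - conjc w :> C.
Proof. by apply: eqC; case: z => a b; case: w => c d /=; ring. Qed.

Lemma conjcKK z : conjc (conjc z) = z.
Proof. by case: z => a b /=; rewrite opprK. Qed.

(** Since [l^-1 = conjc l] on the circle, a loop [l |-> f l^-1], which is holomorphic outside the
    disc, is there the conjugate of this function, which is holomorphic inside. *)
Lemma disc_holo_conj f : disc_holo f -> disc_holo (fun l => conjc (f (conjc l))).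
Proof.
move=> [f1 /subspace_continuousP f2]; split.
  move=> l l1; have fd : derivable f (conjc l) 1 by apply: f1; rewrite /= normcJ.
  have /is_derive_epsP H : is_derive (conjc l : C) 1 f ('D_1 f (conjc l)) by [].
  suff [] : is_derive l 1 (fun l => conjc (f (conjc l)) : C) (conjc ('D_1 f (conjc l))) by [].
  apply/is_derive_epsP => e e0; have [d d0 Hd] := H e e0; exists d => // h hd.
  have := Hd (conjc h); rewrite normcJ => /(_ hd).
  rewrite -[X in X <= _]normcJ 2!conjcB -[conjc h *: 1]/(conjc h * 1) -[conjc h *: 'D_1 f _]/(conjc h * _).
  rewrite conjcM conjcKK mulr1 -[h *: 1]/(h * 1) mulr1 -[h *: conjc _]/(h * _).
  by rewrite (_ : conjc (h + l) = conjc h + conjc l)//; case: (h) => a b; case: (l) => c d' /=; rewrite opprD.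
apply/subspace_continuousP => l l1; apply/withinC_epsP => e e0.
have lA : [set l : C | `|l| <= 1] (conjc l) by rewrite /= normcJ.
have [d d0 Hd] := (withinC_epsP _ _ _).1 (f2 _ lA) e e0; exists d; first exact: d0.
move=> w w1 wd; rewrite -conjcB normcJ; apply: Hd; first by rewrite /= normcJ.
by rewrite -conjcB normcJ.
Qed.

Lemma conjc_circle z : `|z| = 1 -> z^-1 = conjc z.
Proof.
move=> z1; have z0 : z != 0 by rewrite -normr_eq0 z1 oner_eq0.
apply: (mulfI z0); rewrite divff//; apply: eqC.
  by rewrite !ReImE; case: z z1 {z0} => a b /normC_eq1 /= <-; ring.
by rewrite !ReImE; case: z {z1 z0} => a b /=; ring.
Qed.

(* g + conj(e(conj l)) and i (g - conj(e(conj l))) are real on the circle. *)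
Lemma disc_holo_both_const (g e : C -> C) : disc_holo g -> disc_holo e ->
  (forall l, `|l| = 1 -> g l = e l^-1) -> forall l, `|l| = 1 -> e l = e 0.
Proof.
move=> Hg He ge.
have He' := disc_holo_conj He.
have E l : `|l| = 1 -> conjc (e (conjc l)) = conjc (g l).
  by move=> l1; rewrite ge// conjc_circle.
have H1 : disc_holo (fun l => g l + conjc (e (conjc l))) by exact: disc_holoD.
have H2 : disc_holo (fun l => 'i * (g l + (-1) * conjc (e (conjc l)))).
  by apply: disc_holoM (disc_holo_cst _) _; apply: disc_holoD Hg _; apply: disc_holoM (disc_holo_cst _) _.
have R1 := disc_holo_real_const H1 _.
have R2 := disc_holo_real_const H2 _.
have {}R1 l : `|l| = 1 -> g l + conjc (e (conjc l)) = g 0 + conjc (e (conjc 0)).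
  by apply: R1 => l' l1'; rewrite E// !ReImE; case: (g l') => a b /=; rewrite subrr.
have {}R2 l : `|l| = 1 -> 'i * (g l + (-1) * conjc (e (conjc l))) = 'i * (g 0 + (-1) * conjc (e (conjc 0))).
  apply: R2 => l' l1'; rewrite E// mulN1r !ReImE; case: (g l') => a b /=.
  by rewrite mul0r mul1r subrr addr0.
have gc l : `|l| = 1 -> g l = g 0.
  move=> l1; have A := R1 l l1; have B := R2 l l1.
  have {}B : g l + (-1) * conjc (e (conjc l)) = g 0 + (-1) * conjc (e (conjc 0)).
    apply: (mulfI (x := 'i)) B; apply/eqP => /(congr1 (@complex.Im R)) /= /eqP.
    by rewrite oner_eq0.
  exact: eq_of_sum_diff A B.
have ec l : `|l| = 1 -> e l = g 0.
  move=> l1; have li : `|l^-1| = 1 by rewrite normfV l1 invr1.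
  by have := ge _ li; rewrite invrK gc.
have pp : - pi < pi :> R by rewrite gtrN// pi_gt0.
have p2 : 2 * pi != 0 :> R by rewrite mulf_neq0 ?pnatr_eq0// gt_eqF// pi_gt0.
have cst (c : R) : intg (- pi) pi (fun=> c) = 2 * pi * c.
  by rewrite intg_cst// opprK mulrC; congr (_ * _); rewrite mulrDl mul1r.
move=> l /ec ->; have [Mr Mi] := disc_holo_mean He.
apply: eqC; apply: (mulfI p2).
- rewrite -Mr -cst; apply: eq_intg => // th _; rewrite /rp ec//; exact: circle_norm.
- rewrite -Mi -cst; apply: eq_intg => // th _; rewrite /ip ec//; exact: circle_norm.
Qed.

(** A substitute for the maximum principle at the centre. Bounding the real and imaginary parts
    separately costs a factor in the modulus, which is harmless in limits. *)
Lemma disc_holo_mean_le f (M : R) : disc_holo f ->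
  (forall l, `|l| = 1 -> `|f l| <= M%:C) ->
  `|complex.Re (f 0)| <= M /\ `|complex.Im (f 0)| <= M.
Proof.
move=> Hf HM; have [Mr Mi] := disc_holo_mean Hf.
have pp : - pi < pi :> R by rewrite gtrN// pi_gt0.
have p2 : 0 < 2 * pi :> R by rewrite mulr_gt0// pi_gt0.
have [_ /within_cont_disc[cr ci]] := Hf.
have E : pi - - pi = 2 * pi :> R by rewrite opprK mulrDl mul1r.
split.
- rewrite -(ler_pM2l p2) -[X in X * `|_|]gtr0_norm// -normrM -Mr mulrC -E.
  apply: intg_norm_le => //; first exact: cont_circle.
  by move=> th _; apply: absRe_le; apply: HM; exact: circle_norm.
- rewrite -(ler_pM2l p2) -[X in X * `|_|]gtr0_norm// -normrM -Mi mulrC -E.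
  apply: intg_norm_le => //; first exact: cont_circle.
  by move=> th _; apply: absIm_le; apply: HM; exact: circle_norm.
Qed.

Lemma derivable_disc_holo f : (forall l, `|l| <= 1 -> derivable f l 1) -> disc_holo f.
Proof.
move=> H; split; first by move=> l /= l1; apply: H; exact: ltW.
apply/subspace_continuousP => l /= l1; apply: cvg_within_filter.
by apply: differentiable_continuous; apply/derivable1_diffP; exact: H.
Qed.

Lemma derivable_compC f g z : derivable g z 1 -> derivable f (g z) 1 ->
  derivable (fun w => f (g w)) z 1.
Proof.
move=> /derivable1_diffP Hg /derivable1_diffP Hf; apply/derivable1_diffP.
by have := @differentiable_comp _ _ _ _ g f z Hg Hf; rewrite /comp.
Qed.

Lemma disc_holo_bounded f : disc_holo f -> exists2 M : R, 0 <= M &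
  forall l, `|l| = 1 -> `|f l| <= M%:C.
Proof.
move=> [_ /within_cont_disc[cr ci]].
have pp : - pi <= pi :> R by rewrite ltW// gtrN// pi_gt0.
have B h : cont_disc h -> exists M : R, forall th : R, - pi <= th <= pi -> `|h (cos th, sin th)| <= M.
  move=> ch; have [|c _ Hc] := @EVT_max R (fun th => `|h (cos th, sin th)|) _ _ pp.
    apply: continuous_subspaceT => x; apply: (@continuous_comp _ _ _ (fun th => h (cos th, sin th)) Num.norm).
      exact: cont_circle.
    exact: norm_continuous.
  exists `|h (cos c, sin c)| => th thp; apply: Hc; exact: thp.
have [M1 H1] := B _ cr; have [M2 H2] := B _ ci.
exists (`|M1| + `|M2|); first by rewrite addr_ge0.
move=> l /circle_param[th thp ->]; apply: le_trans (normC_le_abs _) _.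
rewrite lecE /= eqxx /=; apply: lerD.
- by apply: le_trans (H1 th thp) _; exact: ler_norm.
- by apply: le_trans (H2 th thp) _; exact: ler_norm.
Qed.

End ComplexPlane.

(** * The identity theorem *)

Section IdentityTheorem.
Variable R : realType.
Local Notation C := (Cplane R).
Implicit Types (z w : C) (f g : C -> C).

(** The automorphism of the unit disc that carries 0 to [a], for [a] in the open disc. *)
Definition disc_aut (a u : C) : C := (u + a) / (1 + conjc a * u).

Lemma disc_aut_den (a u : C) : `|a| < 1 -> `|u| <= 1 -> 1 + conjc a * u != 0.
Proof.
move=> a1 u1; apply/eqP => /eqP; rewrite addrC addr_eq0 => /eqP E.
have : `|conjc a * u| < 1.
  rewrite normrM normcJ; apply: le_lt_trans a1.
  by rewrite ler_piMr.
by rewrite E normrN normr1 ltxx.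
Qed.

Lemma sqr_normC z : `|z| ^+ 2 = (complex.Re z ^+ 2 + complex.Im z ^+ 2)%:C.
Proof. by rewrite add_Re2_Im2. Qed.

(* |1 + conj(a) u|^2 - |u + a|^2 = (1 - |a|^2) (1 - |u|^2) *)
Lemma disc_aut_norm (a u : C) : `|a| < 1 ->
  (`|u| <= 1 -> `|disc_aut a u| <= 1) /\ (`|u| = 1 -> `|disc_aut a u| = 1).
Proof.
move=> a1.
have K : complex.Re (1 + conjc a * u) ^+ 2 + complex.Im (1 + conjc a * u) ^+ 2 -
   (complex.Re (u + a) ^+ 2 + complex.Im (u + a) ^+ 2) =
   (1 - (complex.Re a ^+ 2 + complex.Im a ^+ 2)) * (1 - (complex.Re u ^+ 2 + complex.Im u ^+ 2)).
  by rewrite !ReImE; case: (a) => x y; case: (u) => s t /=; ring.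
have a1' := a1; rewrite normC_lt1 in a1'.
split=> u1; have D := disc_aut_den a1 (_ : `|u| <= 1).
- have {}D : 0 < `|1 + conjc a * u| by rewrite normr_gt0 D.
  rewrite /disc_aut normrM normfV ler_pdivrMr// mul1r -(@ler_pXn2r _ 2)// ?nnegrE//.
  rewrite !sqr_normC lecE /= eqxx /= -subr_ge0 K mulr_ge0// subr_ge0; first exact: ltW.
  by rewrite -normC_le1.
- have u1' : `|u| <= 1 by rewrite u1.
  have {}D : 0 < `|1 + conjc a * u| by rewrite normr_gt0 D.
  rewrite /disc_aut normrM normfV; suff -> : `|u + a| = `|1 + conjc a * u| by rewrite divff// gt_eqF.
  apply/eqP; rewrite -(@eqrXn2 _ 2)//; apply/eqP; rewrite !sqr_normC; congr (_%:C).
  apply/esym/eqP; rewrite -subr_eq0 K; have -> := (normC_eq1 u).1 u1.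
  by rewrite subrr mulr0.
Qed.

Lemma derivable_disc_aut (a u : C) : `|a| < 1 -> `|u| <= 1 -> derivable (disc_aut a) u 1.
Proof.
move=> a1 u1; apply: derivableM.
  by apply: derivableD; [exact: derivable_id|exact: derivable_cst].
apply: derivableV; first exact: disc_aut_den.
apply: derivableD; first exact: derivable_cst.
by apply: derivableM; [exact: derivable_cst|exact: derivable_id].
Qed.

Lemma near_eq_derivableC f g z : (\forall w \near z, f w = g w) ->
  derivable f z 1 -> derivable g z 1.
Proof. by move=> ne; exact: near_eq_derivable ne. Qed.

Lemma derivable_contC f z : derivable f z 1 -> f w @[w --> z] --> f z.
Proof. by move=> /derivable1_diffP; exact: differentiable_continuous. Qed.

Lemma derivable_expC f z k : derivable f z 1 -> derivable (fun w => f w ^+ k) z 1.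
Proof.
move=> fd; elim: k => [|k IH]; first exact: derivable_cst.
have -> : (fun w => f w ^+ k.+1) = (fun w => f w * f w ^+ k).
  by apply/funext => w; rewrite exprS.
exact: derivableM fd IH.
Qed.

Lemma exp_small (t : R) (A B : R) : 0 <= t < 1 -> 0 <= B -> (forall k, A <= B * t ^+ k) -> A <= 0.
Proof.
move=> /andP[t0 t1] B0 H; apply/ler_addgt0Pl => e e0; rewrite addr0.
have B1 : 0 < B + 1 by rewrite ltr_wpDl.
have eB : 0 < e / (B + 1) by rewrite divr_gt0.
have /cvgrPdist_lt /(_ _ eB) [n _ Hn] : t ^+ n @[n --> \oo] --> 0.
  by apply: cvg_expr; rewrite ger0_norm.
have := Hn n (leqnn n); rewrite /= sub0r normrN ger0_norm ?exprn_ge0// => Hn'.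
apply: le_trans (H n) _; apply: (@le_trans _ _ (B * (e / (B + 1)))).
  by apply: ler_wpM2l => //; exact: ltW.
rewrite mulrCA ler_piMr ?ltW// ltr_pdivrMr// mul1r; lra.
Qed.

(* Maximum principle for f(w) / (w - c)^k, k arbitrary, on a circle around c. *)
Lemma identity_ball f c (r : R) :
  (forall w, `|w - c| < r%:C -> derivable f w 1) -> (\forall w \near c, f w = 0) ->
  forall w, `|w - c| < r%:C -> f w = 0.
Proof.
move=> Hf f0 w wr.
have [->|wc] := eqVneq w c; first exact: nbhs_singleton f0.
have [t t0 Et] : exists2 t : R, 0 < t & `|w - c| = t%:C.
  by apply: posC; rewrite normr_gt0 subr_eq0.
have tr : t < r by move: wr; rewrite Et ltcE /= eqxx.
pose s := (t + r) / 2.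
have ts : t < s by rewrite /s; clear -tr; lra.
have sr : s < r by rewrite /s; clear -tr; lra.
have s0 : 0 < s by exact: lt_trans ts.
have sC0 : s%:C != 0 :> R[i] by rewrite gt_eqF// posC_gt0.
(* In the coordinate that makes the circle of radius [s] the unit circle, [w] becomes [a]; composing
   with [disc_aut a] moves it to the centre, the point at which the mean value property gives a
   bound. *)
pose a : C := (w - c) / s%:C.
have sCge : 0 <= s%:C :> R[i] by rewrite lecE /= eqxx ltW.
have Ns : `|s%:C : C| = s%:C by rewrite ger0_norm.
have Na : `|a| = (t / s)%:C.
  rewrite /a normrM normfV Et Ns.
  by rewrite -(fmorphV (real_complex R)) -(rmorphM (real_complex R)).
have a1 : `|a| < 1 by rewrite Na ltcE /= eqxx /= ltr_pdivrMr// mul1r.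
have a0 : a != 0 by rewrite -normr_gt0 Na posC_gt0 divr_gt0.
pose h u := f (c + s%:C * disc_aut a u).
have inr u : `|u| <= 1 -> `|c + s%:C * disc_aut a u - c| < r%:C.
  move=> u1; rewrite addrC addKr normrM Ns; apply: (@le_lt_trans _ _ s%:C).
    by apply: ler_piMr => //; have [H _] := disc_aut_norm u a1; exact: H.
  by rewrite ltcE /= eqxx.
have dphi u : `|u| <= 1 -> derivable (fun u => c + s%:C * disc_aut a u) u 1.
  move=> u1; apply: derivableD; first exact: derivable_cst.
  by apply: derivableM; [exact: derivable_cst|exact: derivable_disc_aut].
have dh u : `|u| <= 1 -> derivable h u 1.
  by move=> u1; apply: (derivable_compC (dphi u u1)); apply: Hf; exact: inr.
(* [disc_aut a] has modulus 1 on the unit circle, so the bound on [G k] there does not depend on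
   [k], while at the centre [G k] is [f w / a ^+ k]. Around a zero of the denominator [f] vanishes
   and division by zero also returns 0, so [G k] is constant there. *)
pose G k u := h u / disc_aut a u ^+ k.
have dG k : disc_holo (G k).
  apply: derivable_disc_holo => u u1.
  have [p0|p0] := eqVneq (disc_aut a u) 0; last first.
    apply: derivableM; first exact: dh.
    apply: derivableV; first by rewrite expf_neq0.
    by apply: derivable_expC; exact: derivable_disc_aut.
  have ne : {near u, G k =1 cst 0}.
    have : \forall v \near u, f (c + s%:C * disc_aut a v) = 0.
      have ct := derivable_contC (dphi u u1); rewrite p0 mulr0 addr0 in ct.
      exact: ct _ f0.
    by apply: filterS => v; rewrite /G /h => ->; rewrite mul0r.
  have := @derivable_cst R[i] C C 0 u 1.
  by apply: near_eq_derivableC; apply: filterS ne => v ->.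
have [M M0 HM] : exists2 M : R, 0 <= M & forall u, `|u| = 1 -> `|f (c + s%:C * u)| <= M%:C.
  apply: (@disc_holo_bounded R (fun u => f (c + s%:C * u))).
  apply: derivable_disc_holo => u u1; apply: derivable_compC.
    apply: derivableD; first exact: derivable_cst.
    by apply: derivableM; [exact: derivable_cst|exact: derivable_id].
  apply: Hf; rewrite addrC addKr normrM Ns; apply: (@le_lt_trans _ _ s%:C).
    exact: ler_piMr.
  by rewrite ltcE /= eqxx.
have GM k u : `|u| = 1 -> `|G k u| <= M%:C.
  move=> u1; have [_ /(_ u1) p1] := disc_aut_norm u a1.
  by rewrite /G normrM normfV normrX p1 expr1n invr1 mulr1; exact: HM.
have G0 k : G k 0 = f w / a ^+ k.
  rewrite /G /h /disc_aut mulr0 addr0 add0r divr1 /a mulrCA divff// mulr1.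
  by rewrite addrCA subrr addr0.
have bnd k : `|f w| <= (2 * M)%:C * `|a| ^+ k.
  have [A B] := disc_holo_mean_le (dG k) (GM k).
  have -> : f w = G k 0 * a ^+ k by rewrite G0 divfK// expf_neq0.
  rewrite normrM normrX ler_wpM2r ?exprn_ge0//; apply: le_trans (normC_le_abs _) _.
  by rewrite lecE /= eqxx /=; clear -A B; lra.
have [q [Eq q0]] : exists q : R, `|f w| = q%:C /\ 0 <= q.
  by rewrite normc_def; eexists; split; [reflexivity|exact: sqrtr_ge0].
apply/eqP; rewrite -normr_eq0 Eq; apply/eqP; congr (_%:C); apply/eqP.
rewrite eq_le q0 andbT; apply: (@exp_small (t / s) q (2 * M)).
- by rewrite divr_ge0 ?ltW// ltr_pdivrMr// mul1r.
- by rewrite mulr_ge0.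
- by move=> k; have := bnd k; rewrite Eq Na -rmorphXn -rmorphM lecE /= eqxx.
Qed.

(** Around a centre [z] in the inner third, the ball of radius [2 * r / 3] stays where [f] is
    holomorphic and already covers the inner third. *)
Lemma identity_ball_open f c (r : R) z : (forall w, `|w - c| < r%:C -> derivable f w 1) ->
  `|z - c| < (r / 3)%:C -> (\forall w \near z, f w = 0) ->
  forall w, `|w - c| < (r / 3)%:C -> f w = 0.
Proof.
move=> Hf zc f0 w wc; apply: (@identity_ball f z (r * 2 / 3)) f0 _ _ => [v vz|].
  apply: Hf; rewrite -(subrKA z) [X in `|X|](_ : _ = (v - z) + (z - c)); last by rewrite subrKA.
  apply: le_lt_trans (ler_normD _ _) _; apply: lt_le_trans (ltrD vz zc) _.
  by rewrite -rmorphD lecE /= eqxx /=; lra.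
rewrite [X in `|X|](_ : _ = (w - c) - (z - c)); last by rewrite opprB addrA subrK.
apply: le_lt_trans (ler_normB _ _) _; apply: lt_le_trans (ltrD wc zc) _.
by rewrite -rmorphD lecE /= eqxx /=; lra.
Qed.

End IdentityTheorem.

(** * Unique continuation *)

Section UniqueContinuation.
Variable R : realType.

(* Agmon-Nirenberg: q'/q is controlled by the frequency N = D/q, whose growth is
   bounded below, so log q cannot reach -oo in finite time. *)
Lemma frequency_vanish (q D dq dD : R -> R) (T K t1 : R) : 0 <= K -> t1 < T ->
  (forall t, t < T -> is_derive t (1 : R) q (dq t)) ->
  (forall t, t < T -> is_derive t (1 : R) D (dD t)) ->
  (forall t, t < T -> 0 <= q t) ->
  (forall t, t < T -> 0 < q t -> - (K / 2) * q t ^+ 2 <= dD t * q t - D t * dq t) ->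
  (forall t, t < T -> dq t <= 2 * D t + (1 + K) * q t) ->
  (forall t, t <= t1 -> q t = 0) ->
  forall t, t < T -> q t = 0.
Proof.
move=> K0 t1T Hq HD q0 HN Hdq qt1 t0 t0T.
apply/eqP; rewrite eq_le (q0 _ t0T) andbT leNgt; apply/negP => qt0.
have t10 : t1 < t0.
  by rewrite ltNge; apply/negP => /qt1 E; rewrite E ltxx in qt0.
have cq t : t < T -> {for t, continuous q} by move=> /Hq; exact: is_derive_cont1.
(* Its supremum [s] is the last zero of [q] before [t0]; between [s] and [t0] the quotient
   [N = D / q] makes sense. *)
pose S := [set t | t <= t0 /\ q t = 0].
have St1 : S t1 by split; [exact: ltW|exact: qt1].
have hS : has_sup S by split; [exists t1|exists t0 => t []].
pose s := sup S.
have st0 : s <= t0 by apply: (ge_sup hS.1) => t [].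
have sT : s < T by exact: le_lt_trans t0T.
have qs : q s = 0.
  apply/eqP; rewrite -normr_le0; apply/ler_addgt0Pl => e e0; rewrite addr0.
  have /cvgrPdist_lt /(_ e e0) /nbhs_ballP[d d0 Hd] : q y @[y --> s] --> q s by exact: cq.
  have [t [tt0 qt] ts] := sup_adherent d0 hS.
  have ts' : t <= s by apply: (ub_le_sup hS.2).
  have := Hd t; rewrite /ball /= qt subr0 => H; apply/ltW/H.
  by rewrite ger0_norm ?subr_ge0//; clear -ts; rewrite /s; lra.
have lst0 : s < t0.
  by rewrite lt_neqAle st0 andbT; apply/eqP => E; rewrite E in qs; rewrite qs ltxx in qt0.
have qpos t : s < t -> t <= t0 -> 0 < q t.
  move=> st tt0; rewrite lt_neqAle q0 ?(le_lt_trans tt0)// andbT eq_sym; apply/eqP => qt.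
  have : t <= s by apply: (ub_le_sup hS.2).
  by rewrite leNgt st.
pose N t := D t / q t.
pose dN t := (dD t * q t - D t * dq t) / q t ^+ 2.
have HdN t : s < t -> t <= t0 -> is_derive t (1 : R) N (dN t).
  move=> st tt0; have tT := le_lt_trans tt0 t0T; have qt := qpos t st tt0.
  have [h1 h2] := HD t tT; have [h3 h4] := Hq t tT.
  have qn : q t != 0 by rewrite gt_eqF.
  apply: DeriveDef; first by apply: derivableM => //; exact: derivableV.
  rewrite [LHS](deriveM h1 (derivableV qn h3)) deriveV// h2 h4 /dN.
  rewrite -[D t *: _]/(D t * _) -[_ *: dq t]/(_ * dq t) -[_ *: dD t]/(_ * dD t).
  by field.
(* [N + K / 2 * t] is nondecreasing, so on the way back from [t0] to [s] the frequency rises by at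
   most [K / 2 * (t0 - s)]. *)
pose Kb := N t0 + K / 2 * (t0 - s).
have NKb t : s < t -> t <= t0 -> N t <= Kb.
  move=> st tt0.
  have := @nondecr_deriv R (fun u => N u + K / 2 * u) (fun u => dN u + K / 2) t t0.
  move=> /(_ _ _ t t0 (lexx _) tt0 (lexx _)) H.
  have {}H : N t + K / 2 * t <= N t0 + K / 2 * t0.
    apply: H => u /andP[tu ut0].
    - apply: is_deriveD; first by apply: HdN => //; exact: lt_le_trans tu.
      rewrite -[X in is_derive _ _ _ X]mulr1; apply: is_deriveZ; exact: is_derive_id.
    - have su := lt_le_trans st tu; have qu := qpos u su ut0.
      rewrite -lerBlDr sub0r /dN ler_pdivlMr ?exprn_gt0//.
      by apply: HN => //; exact: le_lt_trans t0T.
  have : 0 <= K / 2 * (t - s) by rewrite mulr_ge0 ?divr_ge0// subr_ge0 ltW.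
  by clear -H; rewrite /Kb; lra.
(* With [N <= Kb] the derivative of [q] is at most [L * q], so [g] does not increase and cannot rise
   from its value 0 at [s]. *)
pose L := 2 * Kb + 1 + K.
pose g t := q t * expR (- L * t).
have cE : continuous (fun t : R => expR (- L * t)).
  move=> t; apply: (@continuous_comp _ _ _ (fun t => - L * t) expR); last exact: continuous_expR.
  by apply: cvgM; [exact: cst_continuous|exact: cvg_id].
have cg : {for s, continuous g} by apply: cvgM; [exact: cq|exact: cE].
have gs : g s = 0 by rewrite /g qs mul0r.
have g0 : 0 < g t0 by rewrite /g mulr_gt0// expR_gt0.
have gdec t : s < t -> t <= t0 -> g t0 <= g t.
  move=> st tt0.
  have := @nondecr_deriv R (fun u => - g u) (fun u => (L * q u - dq u) * expR (- L * u)) t t0.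
  move=> /(_ _ _ t t0 (lexx _) tt0 (lexx _)) H; rewrite -lerN2; apply: H => u /andP[tu ut0].
  - have uT := le_lt_trans ut0 t0T; have [h1 h2] := Hq u uT.
    have [h3 h4] : is_derive u (1 : R) (fun t => expR (- L * t)) (expR (- L * u) * - L).
      apply: (@is_derive1_comp R expR (fun t => - L * t)).
      rewrite -[X in is_derive _ _ _ X]mulr1; apply: is_deriveZ; exact: is_derive_id.
    apply: DeriveDef; first by apply: derivableN; exact: derivableM.
    rewrite [LHS]deriveN; last exact: derivableM.
    rewrite [X in - X](deriveM h1 h3) h2 h4 -[q u *: _]/(q u * _) -[_ *: dq u]/(_ * dq u).
    by ring.
  - rewrite mulr_ge0 ?expR_ge0// subr_ge0.
    have su := lt_le_trans st tu; have qu := qpos u su ut0.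
    apply: le_trans (Hdq u (le_lt_trans ut0 t0T)) _.
    have : D u = N u * q u by rewrite /N divfK// gt_eqF.
    have : N u * q u <= Kb * q u by rewrite ler_pM2r// NKb.
    by clear; move=> h ->; rewrite /L !mulrDl !mul1r; lra.
have /cvgrPdist_lt /(_ _ g0) /nbhs_ballP[d d0 Hd] : g y @[y --> s] --> g s by exact: cg.
have {}d0 : 0 < d := d0.
pose h := Num.min (d / 2) (t0 - s).
have h0 : 0 < h by rewrite lt_min divr_gt0//= subr_gt0.
have hd : h < d by apply: (@le_lt_trans _ _ (d / 2)); [rewrite ge_min lexx|clear -d0; lra].
have ht : h <= t0 - s by rewrite ge_min lexx orbT.
have := Hd (s + h); rewrite /ball /= opprD addNKr normrN gtr0_norm// gs sub0r normrN.
have A : g t0 <= g (s + h) by apply: gdec; [rewrite ltrDl|clear -ht; lra].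
by rewrite gtr0_norm ?(lt_le_trans g0)// => /(_ hd); rewrite ltNge A.
Qed.

(** * The frequency function in log-polar coordinates *)

Section Polar.
Variables (I : finType) (X Y : I -> R * R -> R) (T K : R).
Let W := [set p : R * R | p.1 < T].
Hypothesis K0 : 0 <= K.
Hypothesis CX : forall i, Ck 2 W (X i).
Hypothesis CY : forall i, Ck 2 W (Y i).
Hypothesis perX : forall i t, t < T -> X i (t, pi) = X i (t, - pi).
Hypothesis perY : forall i t, t < T -> Y i (t, pi) = Y i (t, - pi).
(** [a + 'i b] is twice the dbar derivative of [X + 'i Y] in the coordinates (log radius, angle). *)
Let a i p := D1 (X i) p - D2 (Y i) p.
Let b i p := D1 (Y i) p + D2 (X i) p.
Hypothesis bound : forall p, W p ->
  \sum_i (a i p ^+ 2 + b i p ^+ 2) <= K * \sum_i (X i p ^+ 2 + Y i p ^+ 2).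

Lemma open_halfplane : open W.
Proof.
apply/open2_epsP => p pT; exists (T - p.1); first by rewrite subr_gt0.
by move=> x y /=; rewrite ltr_norml => /andP[_ h] _; rewrite /W /=; lra.
Qed.

Lemma sec2_cont k h t : Ck k W h -> t < T -> continuous (fun th => h (t, th)).
Proof.
move=> Hh tT th; apply: (@cont_comp2 R h R (fun=> t) (fun y => y)).
- exact: (Ck_cont Hh).
- exact: cst_continuous.
- exact: cvg_id.
Qed.

Lemma halfplane_intg_deriv h t : Ck 1 W h -> t < T ->
  is_derive t (1 : R) (fun s => intg (- pi) pi (fun th => h (s, th)))
    (intg (- pi) pi (fun th => D1 h (t, th))).
Proof.
move=> Hh tT.
apply: (@intg_param_deriv R (fun s th => h (s, th)) (fun s th => D1 h (s, th))).
- by rewrite gtrN// pi_gt0.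
- exists (T - t); first by rewrite subr_gt0.
  move=> s; rewrite ltr_norml => /andP[_ h1].
  have sT : s < T by lra.
  by split; [exact: sec2_cont Hh sT|move=> th _; apply: ddf_D1; exact: (Ck_ddf Hh (sT : W (s, th)))].
- exact: sec2_cont (CkD1 Hh) tT.
- move=> th _; rewrite (_ : (fun p => _) = D1 h); first exact: (Ck_cont (CkD1 Hh)).
  by apply/funext => -[].
Qed.

Let S p := \sum_i (X i p * X i p + Y i p * Y i p).
(** For [u = X + 'i Y] the definitions of [a] and [b] read [u_t = - 'i u_theta + (a + 'i b)]. [V] is
    the quadratic form of the symmetric operator [- 'i d/dtheta] at [u]; its mean over the circle is
    the numerator of the frequency. *)
Let V p := \sum_i (X i p * D2 (Y i) p - Y i p * D2 (X i) p).
Let Z p := \sum_i (X i p * D1 (Y i) p - Y i p * D1 (X i) p).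
Let H p := \sum_i (D2 (X i) p ^+ 2 + D2 (Y i) p ^+ 2).
Let e1 p := \sum_i (X i p * a i p + Y i p * b i p).
Let e2 p := \sum_i (a i p * D2 (Y i) p - b i p * D2 (X i) p).
Let A2 p := \sum_i (a i p ^+ 2 + b i p ^+ 2).

Let oW := open_halfplane.

Let CS : Ck 1 W S.
Proof. by apply: Ck_sum => // i; exact: (CkD oW (CkM oW (CkW (CX i)) (CkW (CX i))) (CkM oW (CkW (CY i)) (CkW (CY i)))). Qed.

Let CV : Ck 1 W V.
Proof. by apply: Ck_sum => // i; exact: (CkB oW (CkM oW (CkW (CX i)) (CkD2 (CY i))) (CkM oW (CkW (CY i)) (CkD2 (CX i)))). Qed.

Let CZ : Ck 1 W Z.
Proof. by apply: Ck_sum => // i; exact: (CkB oW (CkM oW (CkW (CX i)) (CkD1 (CY i))) (CkM oW (CkW (CY i)) (CkD1 (CX i)))). Qed.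

Let D1S p : W p -> D1 S p = 2 * (V p + e1 p).
Proof.
move=> Wp.
have dX i := ddf_has_D (Ck_ddf (CX i) Wp); have dY i := ddf_has_D (Ck_ddf (CY i) Wp).
have [_ -> _] := has_D_sum (index_enum I) (fun i => has_D_add (has_D_mul (dX i) (dX i)) (has_D_mul (dY i) (dY i))).
rewrite -big_split/= mulr_sumr; apply: eq_bigr => i _.
by rewrite /a /b; ring.
Qed.

(** The operator is symmetric up to the angular derivative of [Z], which integrates to zero by
    periodicity; hence both arguments of the quadratic form contribute equally. *)
Let D1V p : W p -> D1 V p = D2 Z p + 2 * (H p + e2 p).
Proof.
move=> Wp.
have dX i := ddf_has_D (Ck_ddf (CX i) Wp); have dY i := ddf_has_D (Ck_ddf (CY i) Wp).
have dX1 i := ddf_has_D (Ck_ddf (CkD1 (CX i)) Wp).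
have dY1 i := ddf_has_D (Ck_ddf (CkD1 (CY i)) Wp).
have dX2 i := ddf_has_D (Ck_ddf (CkD2 (CX i)) Wp).
have dY2 i := ddf_has_D (Ck_ddf (CkD2 (CY i)) Wp).
have [_ -> _] := has_D_sum (index_enum I) (fun i => has_D_sub (has_D_mul (dX i) (dY2 i)) (has_D_mul (dY i) (dX2 i))).
have [_ _ ->] := has_D_sum (index_enum I) (fun i => has_D_sub (has_D_mul (dX i) (dY1 i)) (has_D_mul (dY i) (dX1 i))).
rewrite -big_split/= mulr_sumr -big_split; apply: eq_bigr => i _ /=.
rewrite (clairaut oW (CX i) Wp) (clairaut oW (CY i) Wp) /a /b.
by ring.
Qed.

(** The squared norm of [- 'i u_theta - N u + (a + 'i b) / 2], expanded. When the mean of [V] is [N]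
    times that of [S], its mean is, up to a positive factor, the numerator of the derivative of the
    frequency, plus a quarter of the mean of [A2]; this is where the constant [- (K / 2)] comes
    from. *)
Let sq_ge0 p (N : R) : 0 <= H p + e2 p - 2 * N * V p + N ^+ 2 * S p - N * e1 p + A2 p / 4.
Proof.
suff -> : H p + e2 p - 2 * N * V p + N ^+ 2 * S p - N * e1 p + A2 p / 4 =
  \sum_i ((D2 (Y i) p - N * X i p + a i p / 2) ^+ 2 + (- D2 (X i) p - N * Y i p + b i p / 2) ^+ 2).
  by apply: sumr_ge0 => i _; rewrite addr_ge0// sqr_ge0.
rewrite /H /e2 /V /S /e1 /A2 !mulr_sumr mulr_suml -!sumrN -!big_split /=.
by apply: eq_bigr => i _; field.
Qed.

Let e1_le p : W p -> e1 p <= (1 + K) / 2 * S p.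
Proof.
move=> Wp; have B := bound Wp.
have : \sum_i (X i p * a i p + Y i p * b i p) <= (S p + A2 p) / 2.
  rewrite -big_split/= mulr_suml; apply: ler_sum => i _.
  have key (u v : R) : u * v <= (u * u + v ^+ 2) / 2.
    by have := sqr_ge0 (u - v); rewrite expr2 => h; lra.
  have k1 := key (X i p) (a i p); have k2 := key (Y i p) (b i p).
  by move: (X i p) (Y i p) (a i p) (b i p) k1 k2 => u v w z; lra.
have ES : S p = \sum_i (X i p ^+ 2 + Y i p ^+ 2) by [].
by rewrite -/(e1 p); rewrite -ES -/(A2 p) in B; move: (S p) (A2 p) (e1 p) B => u v w; lra.
Qed.

Let Ca i : Ck 1 W (a i).
Proof. by apply: CkB => //; [exact: (CkD1 (CX i))|exact: (CkD2 (CY i))]. Qed.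
Let Cb i : Ck 1 W (b i).
Proof. by apply: CkD => //; [exact: (CkD1 (CY i))|exact: (CkD2 (CX i))]. Qed.
Let CH : Ck 1 W H.
Proof. by apply: Ck_sum => // i; exact: (CkD oW (CkM oW (CkD2 (CX i)) (CkD2 (CX i))) (CkM oW (CkD2 (CY i)) (CkD2 (CY i)))). Qed.
Let Ce1 : Ck 1 W e1.
Proof. by apply: Ck_sum => // i; exact: (CkD oW (CkM oW (CkW (CX i)) (Ca i)) (CkM oW (CkW (CY i)) (Cb i))). Qed.
Let Ce2 : Ck 1 W e2.
Proof. by apply: Ck_sum => // i; exact: (CkB oW (CkM oW (Ca i) (CkD2 (CY i))) (CkM oW (Cb i) (CkD2 (CX i)))). Qed.
Let CA2 : Ck 1 W A2.
Proof. by apply: Ck_sum => // i; exact: (CkD oW (CkM oW (Ca i) (Ca i)) (CkM oW (Cb i) (Cb i))). Qed.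

Let per1 (F : I -> R * R -> R) : (forall i, Ck 2 W (F i)) ->
  (forall i t, t < T -> F i (t, pi) = F i (t, - pi)) ->
  forall i t, t < T -> D1 (F i) (t, pi) = D1 (F i) (t, - pi).
Proof.
move=> CF perF i t tT.
have [_ <-] := ddf_D1 (Ck_ddf (CF i) (tT : W (t, pi))).
have [_ <-] := ddf_D1 (Ck_ddf (CF i) (tT : W (t, - pi))).
apply: near_eq_derive.
have := @near_in_itvNyo R T t; rewrite in_itv/= => /(_ tT).
by apply: filterS => s; rewrite in_itv/= => sT; exact: perF.
Qed.

Let pp : - pi < pi :> R. Proof. by rewrite gtrN// pi_gt0. Qed.

Let intZ t : t < T -> intg (- pi) pi (fun th => D2 Z (t, th)) = 0.
Proof.
move=> tT; transitivity (Z (t, pi) - Z (t, - pi)).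
  apply: (@intgE R _ (fun th => Z (t, th)) _ _ pp (sec2_cont (CkD2 CZ) tT)) => th _.
  by apply: ddf_D2; exact: (Ck_ddf CZ (tT : W (t, th))).
apply/eqP; rewrite subr_eq0; apply/eqP; apply: eq_bigr => i _.
by rewrite !perX// !perY// !(per1 CX)// !(per1 CY).
Qed.

Lemma polar_unique t1 : t1 < T ->
  (forall i t th, t <= t1 -> X i (t, th) = 0 /\ Y i (t, th) = 0) ->
  forall i t th, t < T -> - pi <= th <= pi -> X i (t, th) = 0 /\ Y i (t, th) = 0.
Proof.
move=> t1T Z0.
pose J (h : R * R -> R) t := intg (- pi) pi (fun th => h (t, th)).
have cc k h t (Hh : Ck k W h) (tT : t < T) := sec2_cont Hh tT.
have qz : forall t, t < T -> J S t = 0.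
  apply: (@frequency_vanish (J S) (J V) (J (D1 S)) (J (D1 V)) T K t1) => //.
  - by move=> t tT; exact: halfplane_intg_deriv.
  - by move=> t tT; exact: halfplane_intg_deriv.
  - move=> t tT; apply: intg_ge0 => //; first exact: cc CS tT.
    by move=> th _; apply: sumr_ge0 => i _; rewrite addr_ge0// -expr2 sqr_ge0.
  - move=> t tT qt.
    have JS : J (D1 S) t = 2 * (J V t + J e1 t).
      rewrite /J -intgD//; [|exact: cc CV tT|exact: cc Ce1 tT].
      rewrite -intgZ//; last by move=> x; apply: cvgD; [exact: cc CV tT _|exact: cc Ce1 tT _].
      by apply: eq_intg => // th _; exact: D1S.
    have JV : J (D1 V) t = 2 * (J H t + J e2 t).
      rewrite -[LHS]subr0 -(intZ tT) /J -intgB//; [|exact: cc (CkD1 CV) tT|exact: cc (CkD2 CZ) tT].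
      rewrite -intgD//; [|exact: cc CH tT|exact: cc Ce2 tT].
      rewrite -intgZ//; last by move=> x; apply: cvgD; [exact: cc CH tT _|exact: cc Ce2 tT _].
      by apply: eq_intg => // th _; rewrite D1V// addrC addrA addNr add0r.
    have JA : J A2 t <= K * J S t.
      rewrite /J -intgZ//; last exact: cc CS tT.
      apply: le_intg => //; first exact: cc CA2 tT.
        by move=> x; apply: cvgM; [exact: cst_continuous|exact: cc CS tT _].
      by move=> th _; exact: bound.
    pose N := J V t / J S t.
    have sq : 0 <= J H t + J e2 t - 2 * N * J V t + N ^+ 2 * J S t - N * J e1 t + 4^-1 * J A2 t.
      have c1 : continuous (fun th => H (t, th)) by exact: cc CH tT.
      have c2 : continuous (fun th => e2 (t, th)) by exact: cc Ce2 tT.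
      have c3 : continuous (fun th => 2 * N * V (t, th)).
        by move=> x; apply: cvgM; [exact: cst_continuous|exact: cc CV tT _].
      have c4 : continuous (fun th => N ^+ 2 * S (t, th)).
        by move=> x; apply: cvgM; [exact: cst_continuous|exact: cc CS tT _].
      have c5 : continuous (fun th => N * e1 (t, th)).
        by move=> x; apply: cvgM; [exact: cst_continuous|exact: cc Ce1 tT _].
      have c6 : continuous (fun th => 4^-1 * A2 (t, th)).
        by move=> x; apply: cvgM; [exact: cst_continuous|exact: cc CA2 tT _].
      have c12 : continuous (fun th => H (t, th) + e2 (t, th)).
        by move=> x; apply: cvgD; [exact: c1|exact: c2].
      have c123 : continuous (fun th => H (t, th) + e2 (t, th) - 2 * N * V (t, th)).
        by move=> x; apply: cvgB; [exact: c12|exact: c3].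
      have c1234 : continuous (fun th => H (t, th) + e2 (t, th) - 2 * N * V (t, th) + N ^+ 2 * S (t, th)).
        by move=> x; apply: cvgD; [exact: c123|exact: c4].
      have c15 : continuous (fun th => H (t, th) + e2 (t, th) - 2 * N * V (t, th) + N ^+ 2 * S (t, th) - N * e1 (t, th)).
        by move=> x; apply: cvgB; [exact: c1234|exact: c5].
      rewrite /J -(intgZ (2 * N) pp (cc _ _ _ CV tT)) -(intgZ (N ^+ 2) pp (cc _ _ _ CS tT)).
      rewrite -(intgZ N pp (cc _ _ _ Ce1 tT)) -(intgZ (4^-1) pp (cc _ _ _ CA2 tT)).
      rewrite -(intgD pp c1 c2) -(intgB pp c12 c3) -(intgD pp c123 c4) -(intgB pp c1234 c5).
      rewrite -(intgD pp c15 c6); apply: intg_ge0 => //.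
        by move=> x; apply: cvgD; [exact: c15|exact: c6].
      by move=> th _; rewrite (mulrC 4^-1); exact: sq_ge0.
    rewrite JS JV; have EN : J V t = N * J S t by rewrite /N divfK// gt_eqF.
    rewrite EN in sq *.
    have sq2 := mulr_ge0 (ltW qt) sq.
    have JA2 := ler_wpM2l (ltW qt) JA.
    clear EN sq; move: (J S t) (J H t) (J e2 t) (J e1 t) (J A2 t) N sq2 JA2 => q h f e A N' sq2 JA2.
    by move: sq2 JA2; rewrite !expr2 !mulrDr !mulrN; lra.
  - move=> t tT.
    have -> : J (D1 S) t = 2 * (J V t + J e1 t).
      rewrite /J -intgD//; [|exact: cc CV tT|exact: cc Ce1 tT].
      rewrite -intgZ//; last by move=> x; apply: cvgD; [exact: cc CV tT _|exact: cc Ce1 tT _].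
      by apply: eq_intg => // th _; exact: D1S.
    have : J e1 t <= (1 + K) / 2 * J S t.
      rewrite /J -intgZ//; last exact: cc CS tT.
      apply: le_intg => //; first exact: cc Ce1 tT.
        by move=> x; apply: cvgM; [exact: cst_continuous|exact: cc CS tT _].
      by move=> th _; exact: e1_le.
    by move: (J e1 t) (J S t) (J V t) => u v w; lra.
  - move=> t tt1; rewrite /J (eq_intg (g := fun=> 0))// ?intg0// => th _.
    by apply: big1 => i _; have [-> ->] := Z0 i t th tt1; rewrite mul0r addr0.
move=> i t th tT thp.
have S0 : S (t, th) = 0.
  apply: (intg_eq0 pp (cc _ _ _ CS tT) _ (qz t tT)) => // th' _.
  by apply: sumr_ge0 => j _; rewrite addr_ge0// -expr2 sqr_ge0.
have : X i (t, th) ^+ 2 + Y i (t, th) ^+ 2 = 0.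
  move/eqP: S0; rewrite /S psumr_eq0 => [/allP/(_ i)|j _]; last first.
    by rewrite addr_ge0// -expr2 sqr_ge0.
  by rewrite mem_index_enum => /(_ isT)/= /eqP.
move/eqP; rewrite paddr_eq0 ?sqr_ge0// !sqrf_eq0 => /andP[/eqP -> /eqP ->].
by [].
Qed.

End Polar.
(** The complex exponential maps a half-plane onto the punctured disc and multiplies the dbar
    derivative by a factor of modulus less than [r], so [K] becomes [r ^+ 2 * K]. Vanishing near the
    centre becomes vanishing for all sufficiently negative log radii. *)
Lemma unique_continuation (I : finType) (x y : I -> R * R -> R) (c : R * R) (r K : R) :
  let B := [set p : R * R | (p.1 - c.1) ^+ 2 + (p.2 - c.2) ^+ 2 < r ^+ 2] in
  0 < r -> 0 <= K -> (forall i, Ck 2 B (x i)) -> (forall i, Ck 2 B (y i)) ->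
  (forall p, B p -> \sum_i ((D1 (x i) p - D2 (y i) p) ^+ 2 + (D2 (x i) p + D1 (y i) p) ^+ 2) <=
     K * \sum_i (x i p ^+ 2 + y i p ^+ 2)) ->
  (exists2 d, 0 < d & forall i p, `|p.1 - c.1| < d -> `|p.2 - c.2| < d -> x i p = 0 /\ y i p = 0) ->
  forall i p, B p -> x i p = 0 /\ y i p = 0.
Proof.
move=> B r0 K0 Cx Cy bound [d d0 Hd].
pose T := ln r; pose W := [set p : R * R | p.1 < T].
have oW : open W := @open_halfplane T.
have oB : open B.
  apply/open2_epsP => p Bp.
  pose h (q : R * R) := (q.1 - c.1) ^+ 2 + (q.2 - c.2) ^+ 2.
  have ch : {for p, continuous h}.
    by apply: cvgD; apply: cvgM; apply: cvgB; (try exact: cst_continuous);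
      (try exact: cvg_fst); exact: cvg_snd.
  have e0 : 0 < r ^+ 2 - h p by rewrite subr_gt0.
  have [e e1 He] := (cont2_epsP _ _).1 ch _ e0; exists e => // u v u1 v1.
  have := He u v u1 v1; rewrite ltr_norml => /andP[_]; rewrite /B /= /h /=; lra.
pose a (p : R * R) := c.1 + polar1 p; pose b (p : R * R) := c.2 + polar2 p.
have [P1 P2] := Ck_polar R 2.
have Ca : Ck 2 W a := CkD oW (Ck_cst 2 W c.1) (Ck_sub (@subsetT _ W) P1).
have Cb : Ck 2 W b := CkD oW (Ck_cst 2 W c.2) (Ck_sub (@subsetT _ W) P2).
have norm_polar (p : R * R) : polar1 p ^+ 2 + polar2 p ^+ 2 = expR p.1 ^+ 2.
  by rewrite /polar1 /polar2 !exprMn -mulrDr cos2Dsin2 mulr1.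
have lt_r t : t < T -> expR t ^+ 2 < r ^+ 2.
  move=> tT; rewrite ltr_pXn2r// ?nnegrE ?expR_ge0//; last exact: ltW.
  by rewrite -[ltRHS](lnK (x := r)) ?posrE// ltr_expR.
have WB p : W p -> B (a p, b p).
  move=> Wp; have E (u v : R) : u + v - u = v by rewrite addrC addKr.
  by rewrite /B /= /a /b !E norm_polar; exact: lt_r.
have ha (p : R * R) : has_D a p (polar1 p) (- polar2 p).
  have [[h1 h2 h3] _] := ddf_polar p.
  by have := has_D_add (has_D_cst p c.1) (And3 h1 h2 h3); rewrite !add0r.
have hb (p : R * R) : has_D b p (polar2 p) (polar1 p).
  have [_ [h1 h2 h3]] := ddf_polar p.
  by have := has_D_add (has_D_cst p c.2) (And3 h1 h2 h3); rewrite !add0r.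
have CC (f : R * R -> R) : Ck 2 B f -> Ck 2 W (fun p => f (a p, b p)).
  by move=> Cf; exact: (Ck_comp oB oW WB Cf Ca Cb).
have DD f p : Ck 2 B f -> W p -> has_D (fun p => f (a p, b p)) p
    (D1 f (a p, b p) * polar1 p + D2 f (a p, b p) * polar2 p)
    (D1 f (a p, b p) * - polar2 p + D2 f (a p, b p) * polar1 p).
  move=> Cf Wp; have [a1 a2 a3] := ha p; have [b1 b2 b3] := hb p.
  have := ddf_comp setT oB (_ : Ck 1 B f) (WB p Wp) a1 b1.
  rewrite a2 a3 b2 b3; apply; exact: CkW.
pose X i p := x i (a p, b p); pose Y i p := y i (a p, b p).
have per (f : R * R -> R) t : f (a (t, pi), b (t, pi)) = f (a (t, - pi), b (t, - pi)).
  by rewrite /a /b /polar1 /polar2 /= cosN sinN sinpi oppr0.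
have bnd p : W p -> \sum_i ((D1 (X i) p - D2 (Y i) p) ^+ 2 + (D1 (Y i) p + D2 (X i) p) ^+ 2) <=
    (r ^+ 2 * K) * \sum_i (X i p ^+ 2 + Y i p ^+ 2).
  move=> Wp; have := bound _ (WB p Wp).
  set s1 := \sum_i _; set s2 := \sum_i _ => H.
  have s10 : 0 <= s1 by apply: sumr_ge0 => i _; rewrite addr_ge0// sqr_ge0.
  apply: (@le_trans _ _ (expR p.1 ^+ 2 * s1)); last first.
    rewrite -mulrA; apply: (@le_trans _ _ (r ^+ 2 * s1)).
      by rewrite ler_wpM2r// ltW// lt_r.
    by rewrite ler_pM2l// exprn_gt0.
  rewrite /s1 mulr_sumr -norm_polar; apply: ler_sum => i _.
  have [_ -> ->] := DD _ p (Cx i) Wp; have [_ -> ->] := DD _ p (Cy i) Wp.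
  rewrite le_eqVlt; apply/orP; left; apply/eqP.
  by move: (D1 (x i) _) (D2 (x i) _) (D1 (y i) _) (D2 (y i) _) => u v w z; ring.
pose t1 := Num.min (ln (d / 2)) (T - 1).
have t1T : t1 < T by rewrite gt_min; apply/orP; right; lra.
have zero : forall i t th, t <= t1 -> X i (t, th) = 0 /\ Y i (t, th) = 0.
  move=> i t th tt1; have ed : expR t < d.
    apply: (@le_lt_trans _ _ (expR (ln (d / 2)))).
      by rewrite ler_expR (le_trans tt1)// ge_min lexx.
    by rewrite lnK ?posrE ?divr_gt0//; lra.
  have ea (u : R) : -1 <= u <= 1 -> `|expR t * u| < d.
    move=> u1; rewrite normrM ger0_norm ?expR_ge0//; apply: le_lt_trans ed.
    by rewrite ler_piMr ?expR_ge0// ler_norml.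
  apply: Hd; rewrite /a /b /= addrC addKr; apply: ea.
    by rewrite cos_geN1 cos_le1.
  by rewrite sin_geN1 sin_le1.
have rK : 0 <= r ^+ 2 * K by rewrite mulr_ge0// sqr_ge0.
have main := polar_unique rK (fun i => CC _ (Cx i)) (fun i => CC _ (Cy i))
  (fun i t _ => per (x i) t) (fun i t _ => per (y i) t) bnd t1T zero.
move=> i p Bp; set u := p.1 - c.1 in Bp *; set v := p.2 - c.2 in Bp *.
have [uv0|uv0] := eqVneq (u ^+ 2 + v ^+ 2) 0.
  move/eqP: uv0; rewrite paddr_eq0 ?sqr_ge0// !sqrf_eq0 => /andP[/eqP u0 /eqP v0].
  by apply: Hd; rewrite -/u -/v ?u0 ?v0 normr0.
have uv1 : 0 < u ^+ 2 + v ^+ 2 by rewrite lt_neqAle eq_sym uv0 addr_ge0 ?sqr_ge0.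
pose rho := Num.sqrt (u ^+ 2 + v ^+ 2).
have rho0 : 0 < rho by rewrite sqrtr_gt0.
have rho2 : rho ^+ 2 = u ^+ 2 + v ^+ 2 by rewrite sqr_sqrtr ?addr_ge0 ?sqr_ge0.
have rhor : rho < r.
  by rewrite -(@ltr_pXn2r _ 2)// ?nnegrE ?ltW// rho2.
have [|th thp [Eu Ev]] := @circle_param R (toC (u / rho, v / rho)).
  apply/normC_eq1 => /=; rewrite !expr_div_n -mulrDl rho2 divff//.
have lnT : ln rho < T by rewrite /T ltr_ln ?posrE.
have -> : p = (a (ln rho, th), b (ln rho, th)).
  rewrite /a /b /polar1 /polar2 /= lnK ?posrE// -Eu -Ev !(mulrC rho) !divfK ?gt_eqF//.
  by rewrite /u /v !(addrC c.1) !(addrC c.2) !subrK -surjective_pairing.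
exact: main lnT thp.
Qed.

End UniqueContinuation.

(** * Wirtinger derivatives *)

Section Wirtinger.
Variable R : realType.
Local Notation C := (Cplane R).
Implicit Types (f g : R * R -> R) (p : R * R).

Lemma lin_approx_cst p (c : R) : lin_approx (fun=> c) p 0 0.
Proof.
move=> e e0; exists 1 => // h k _ _.
by rewrite !mul0r !subr0 subrr normr0 mulr_ge0// ?addr_ge0// ltW.
Qed.

Lemma lin_approx_add f g p (a b c d : R) : lin_approx f p a b -> lin_approx g p c d ->
  lin_approx (fun q => f q + g q) p (a + c) (b + d).
Proof.
move=> Hf Hg e e0; have e20 : 0 < e / 2 by rewrite divr_gt0.
have [d1 d10 H1] := Hf _ e20; have [d2 d20 H2] := Hg _ e20.
exists (Num.min d1 d2); first by rewrite lt_min d10.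
move=> h k; rewrite !lt_min => /andP[h1 h2] /andP[k1 k2].
have A := H1 h k h1 k1; have B := H2 h k h2 k2.
set u := f _ in A *; set v := f _ in A *; set w := g _ in B *; set z := g _ in B *.
have -> : u + w - (v + z) - (a + c) * h - (b + d) * k =
  (u - v - a * h - b * k) + (w - z - c * h - d * k) by ring.
by apply: le_trans (ler_normD _ _) _; clear -A B; lra.
Qed.

Lemma lin_approx_mul f g p (a b c d : R) : lin_approx f p a b -> lin_approx g p c d ->
  lin_approx (fun q => f q * g q) p (a * g p + f p * c) (b * g p + f p * d).
Proof.
move=> Hf Hg; have L : lin_approx (fun q => q.1 * q.2) (f p, g p) (g p) (f p).
  move=> e e0; exists e => // h k he ke /=.
  have -> : (f p + h) * (g p + k) - f p * g p - g p * h - f p * k = h * k by ring.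
  rewrite normrM mulrDr; have := normr_ge0 h; have := normr_ge0 k => k0 h0.
  have := ler_pM h0 k0 (ltW he) (lexx `|k|); have := mulr_ge0 (ltW e0) h0.
  by clear; lra.
have := lin_approx_comp L Hf Hg.
by rewrite (mulrC (g p) a) (mulrC (g p) b).
Qed.

(* The differential of f at z is p dz + q dzbar. *)
Definition has_W (f : C -> C) (z p q : C) : Prop :=
  lin_approx (rp f) (ofC z) (complex.Re (p + q)) (- complex.Im (p - q)) /\
  lin_approx (ip f) (ofC z) (complex.Im (p + q)) (complex.Re (p - q)).

Lemma has_W_cst (c z : C) : has_W (fun=> c) z 0 0.
Proof.
by split; rewrite ?addr0 ?subr0 ?Re0 ?Im0 ?oppr0; exact: lin_approx_cst.
Qed.

Lemma eq_lin_approx f p (a b c d : R) : a = c -> b = d -> lin_approx f p a b -> lin_approx f p c d.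
Proof. by move=> -> ->. Qed.

Lemma has_W_add (f g : C -> C) (z p q r s : C) : has_W f z p q -> has_W g z r s ->
  has_W (fun w => f w + g w) z (p + r) (q + s).
Proof.
move=> [f1 f2] [g1 g2]; split.
- have -> : rp (fun w => f w + g w) = (fun x => rp f x + rp g x).
    by apply/funext => x; rewrite /rp ReD.
  by apply: eq_lin_approx (lin_approx_add f1 g1); rewrite !ReImE; ring.
- have -> : ip (fun w => f w + g w) = (fun x => ip f x + ip g x).
    by apply/funext => x; rewrite /ip ImD.
  by apply: eq_lin_approx (lin_approx_add f2 g2); rewrite !ReImE; ring.
Qed.

Lemma has_W_mul (f g : C -> C) (z p q r s : C) : has_W f z p q -> has_W g z r s ->
  has_W (fun w => f w * g w) z (p * g z + f z * r) (q * g z + f z * s).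
Proof.
move=> [f1 f2] [g1 g2]; split.
- have -> : rp (fun w => f w * g w) = (fun x => rp f x * rp g x + - (ip f x * ip g x)).
    by apply/funext => x; rewrite /rp ReM.
  apply: eq_lin_approx (lin_approx_add (lin_approx_mul f1 g1) (lin_approxN (lin_approx_mul f2 g2)));
  by rewrite /rp /ip !toCK !ReImE; ring.
- have -> : ip (fun w => f w * g w) = (fun x => rp f x * ip g x + ip f x * rp g x).
    by apply/funext => x; rewrite /ip ImM.
  apply: eq_lin_approx (lin_approx_add (lin_approx_mul f1 g2) (lin_approx_mul f2 g1));
  by rewrite /rp /ip !toCK !ReImE; ring.
Qed.

Lemma ReJ (z : C) : complex.Re (conjc z) = complex.Re z.
Proof. by case: z. Qed.

Lemma ImJ (z : C) : complex.Im (conjc z) = - complex.Im z.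
Proof. by case: z. Qed.

(** Conjugation swaps the two Wirtinger coefficients; for a real function they are therefore
    conjugate to each other. *)
Lemma has_W_conj (f : C -> C) (z p q : C) : has_W f z p q ->
  has_W (fun w => conjc (f w)) z (conjc q) (conjc p).
Proof.
move=> [f1 f2]; split.
- have -> : rp (fun w => conjc (f w)) = rp f.
    by apply/funext => x; rewrite /rp; case: (f _).
  by apply: eq_lin_approx f1; rewrite !ReImE ?ReJ ?ImJ; ring.
- have -> : ip (fun w => conjc (f w)) = (fun x => - ip f x).
    by apply/funext => x; rewrite /ip; case: (f _).
  by apply: eq_lin_approx (lin_approxN f2); rewrite !ReImE ?ReJ ?ImJ; ring.
Qed.

Lemma has_W_sum (I : Type) (r : seq I) (F : I -> C -> C) (z : C) (P Q : I -> C) :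
  (forall i, has_W (F i) z (P i) (Q i)) ->
  has_W (fun w => \sum_(i <- r) F i w) z (\sum_(i <- r) P i) (\sum_(i <- r) Q i).
Proof.
move=> H; elim: r => [|i r IH].
  rewrite !big_nil; have -> : (fun w => \sum_(i <- [::]) F i w) = fun=> 0.
    by apply/funext => w; rewrite big_nil.
  exact: has_W_cst.
rewrite !big_cons; have -> : (fun w => \sum_(j <- i :: r) F j w) = fun w => F i w + \sum_(j <- r) F j w.
  by apply/funext => w; rewrite big_cons.
exact: (has_W_add (H i) IH).
Qed.

Lemma has_W_holo (f : C -> C) (z d : C) : is_derive z 1 f d -> has_W f z d 0.
Proof.
case=> fd <-; have [h1 h2] := derivable_lin_approx fd.
by split; rewrite addr0 subr0.
Qed.

Lemma duE (h : C -> R) (z : C) : du h z = D1 (fun p => h (toC p)) (ofC z).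
Proof. by rewrite /du D1.unlock. Qed.

Lemma dvE (h : C -> R) (z : C) : dv h z = D2 (fun p => h (toC p)) (ofC z).
Proof. by rewrite /dv D2.unlock. Qed.

Lemma has_W_duC (f : C -> C) (z p q : C) : has_W f z p q ->
  duC f z = p + q /\ dvC f z = 'i * (p - q).
Proof.
move=> [/lin_approx_ddf[_ h1 h2] /lin_approx_ddf[_ h3 h4]].
split; rewrite /duC /dvC ?duE ?dvE; apply: eqC => /=.
- exact: h1.
- exact: h3.
- by rewrite [LHS]h2 !ReImE /=; ring.
- by rewrite [LHS]h4 !ReImE /=; ring.
Qed.

Lemma i_sqr : 'i * 'i = -1 :> C.
Proof. by apply: eqC; rewrite !ReImE /=; ring. Qed.

Lemma wirtinger_solve (p q : C) :
  2^-1 * (p + q - 'i * ('i * (p - q))) = p /\ 2^-1 * (p + q + 'i * ('i * (p - q))) = q.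
Proof.
have two : (2 : C) != 0 by rewrite pnatr_eq0.
by rewrite !mulrA i_sqr; split; field.
Qed.

Lemma wirtinger_solve' (u v : C) :
  2^-1 * (u - 'i * v) + 2^-1 * (u + 'i * v) = u /\
  'i * (2^-1 * (u - 'i * v) - 2^-1 * (u + 'i * v)) = v.
Proof.
have two : (2 : C) != 0 by rewrite pnatr_eq0.
split; first by field.
have -> : 2^-1 * (u - 'i * v) - 2^-1 * (u + 'i * v) = - 'i * v by field.
by rewrite mulNr mulrN mulrA i_sqr mulN1r opprK.
Qed.

Lemma has_W_C1 (V : set (R * R)) (f : C -> C) (z : C) : open V -> V (ofC z) ->
  Ck 1 V (rp f) -> Ck 1 V (ip f) ->
  has_W f z (2^-1 * (duC f z - 'i * dvC f z)) (2^-1 * (duC f z + 'i * dvC f z)).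
Proof.
move=> oV Vz /(Ck1_lin_approx oV)/(_ Vz) h1 /(Ck1_lin_approx oV)/(_ Vz) h2.
have [e1 e2] := wirtinger_solve' (duC f z) (dvC f z).
have e3 : forall w : C, complex.Re w = complex.Im ('i * w) /\ - complex.Im w = complex.Re ('i * w).
  by move=> w; rewrite !ReImE /=; split; ring.
split; rewrite e1.
- by rewrite (e3 _).2 e2 /duC /dvC /= duE dvE.
- by rewrite (e3 _).1 e2 /duC /dvC /= duE dvE.
Qed.

(** * Wirtinger derivatives of matrix functions *)

Section Matrices.

Definition has_WM m n (A : C -> 'M[C]_(m, n)) (z : C) (P Q : 'M[C]_(m, n)) : Prop :=
  forall i j, has_W (fun w => A w i j) z (P i j) (Q i j).

Lemma has_WM_cst m n (A : 'M[C]_(m, n)) z : has_WM (fun=> A) z 0 0.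
Proof. by move=> i j; rewrite mxE; exact: has_W_cst. Qed.

Lemma has_WM_add m n (A B : C -> 'M[C]_(m, n)) z P Q S T :
  has_WM A z P Q -> has_WM B z S T -> has_WM (fun w => A w + B w) z (P + S) (Q + T).
Proof.
move=> HA HB i j; rewrite 2!mxE.
have -> : (fun w => (A w + B w) i j) = (fun w => A w i j + B w i j).
  by apply/funext => w; rewrite mxE.
exact: (has_W_add (HA i j) (HB i j)).
Qed.

Lemma has_WM_mul m n k (A : C -> 'M[C]_(m, n)) (B : C -> 'M[C]_(n, k)) z P Q S T :
  has_WM A z P Q -> has_WM B z S T ->
  has_WM (fun w => A w *m B w) z (P *m B z + A z *m S) (Q *m B z + A z *m T).
Proof.
move=> HA HB i j; rewrite !mxE -!big_split /=.
have -> : (fun w => (A w *m B w) i j) = (fun w => \sum_l A w i l * B w l j).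
  by apply/funext => w; rewrite mxE.
by apply: has_W_sum => l; exact: (has_W_mul (HA i l) (HB l j)).
Qed.

Lemma has_WM_tr m n (A : C -> 'M[C]_(m, n)) z P Q :
  has_WM A z P Q -> has_WM (fun w => (A w)^T) z P^T Q^T.
Proof.
move=> HA i j; rewrite !mxE.
have -> : (fun w => (A w)^T i j) = (fun w => A w j i) by apply/funext => w; rewrite mxE.
exact: HA.
Qed.

Lemma has_WM_mull m n k (A : 'M[C]_(m, n)) (B : C -> 'M[C]_(n, k)) z S T :
  has_WM B z S T -> has_WM (fun w => A *m B w) z (A *m S) (A *m T).
Proof.
move=> HB; have := has_WM_mul (has_WM_cst A z) HB.
by rewrite !mul0mx !add0r.
Qed.

Lemma has_WM_mulr m n k (A : C -> 'M[C]_(m, n)) (B : 'M[C]_(n, k)) z S T :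
  has_WM A z S T -> has_WM (fun w => A w *m B) z (S *m B) (T *m B).
Proof.
move=> HA; have := has_WM_mul HA (has_WM_cst B z).
by rewrite !mulmx0 !addr0.
Qed.

Lemma has_WM_scale m n (c : C) (A : C -> 'M[C]_(m, n)) z P Q :
  has_WM A z P Q -> has_WM (fun w => c *: A w) z (c *: P) (c *: Q).
Proof.
move=> HA i j; rewrite !mxE; have := has_W_mul (has_W_cst c z) (HA i j).
have -> : (fun w => (c *: A w) i j) = (fun w => c * A w i j) by apply/funext => w; rewrite mxE.
by rewrite !mul0r !add0r.
Qed.

Lemma has_WM_conj m n (A : C -> 'M[C]_(m, n)) z P Q :
  has_WM A z P Q ->
  has_WM (fun w => map_mx conjc (A w)) z (map_mx conjc Q) (map_mx conjc P).
Proof.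
move=> HA i j; rewrite !mxE; have := has_W_conj (HA i j).
by have -> : (fun w => map_mx conjc (A w) i j) = (fun w => conjc (A w i j))
  by apply/funext => w; rewrite mxE.
Qed.

Lemma has_WM_dz m n (A : C -> 'M[C]_(m, n)) z P Q : has_WM A z P Q ->
  dz A z = P /\ dzbar A z = Q.
Proof.
move=> HA; split; apply/matrixP => i j; rewrite mxE; have [-> ->] := has_W_duC (HA i j);
by have [h1 h2] := wirtinger_solve (P i j) (Q i j).
Qed.

Lemma has_WM_C1 m n (V : set (R * R)) (A : C -> 'M[C]_(m, n)) z : open V -> V (ofC z) ->
  (forall i j, Ck 1 V (rp (fun w => A w i j)) /\ Ck 1 V (ip (fun w => A w i j))) ->
  has_WM A z (dz A z) (dzbar A z).
Proof.
move=> oV Vz HA i j; rewrite !mxE; have [h1 h2] := HA i j.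
exact: (has_W_C1 oV Vz h1 h2).
Qed.

Lemma eq_has_WM m n (A : C -> 'M[C]_(m, n)) z P Q P' Q' : P = P' -> Q = Q' ->
  has_WM A z P Q -> has_WM A z P' Q'.
Proof. by move=> -> ->. Qed.

(** A ball around 0 is star-shaped: along the ray [s |-> s * z] the real derivative vanishes. *)
Lemma has_WM_const m n (A : C -> 'M[C]_(m, n)) (r : R[i]) :
  (forall z, `|z| < r -> has_WM A z 0 0) -> forall z, `|z| < r -> A z = A 0.
Proof.
move=> H z zr; apply/matrixP => i j.
have D (s : R) : `|s| <= 1 -> has_W (fun w => A w i j) (toC (s * complex.Re z, s * complex.Im z)) 0 0.
  move=> s1; have := H (toC (s * complex.Re z, s * complex.Im z)).
  have E : toC (s * complex.Re z, s * complex.Im z) = s%:C * z.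
    by apply: eqC; rewrite !ReImE /=; ring.
  have ns : `|(s%:C : C)| <= 1.
    rewrite normc_def /= expr0n /= addr0 sqrtr_sqr lecE /= eqxx //.
  move=> /(_ _ i j); rewrite !mxE; apply; rewrite E normrM.
  by apply: le_lt_trans zr; rewrite ler_piMl.
have K (f : R * R -> R) : (forall s : R, `|s| <= 1 -> lin_approx f (s * complex.Re z, s * complex.Im z) 0 0) ->
    f (complex.Re z, complex.Im z) = f (0, 0).
  move=> Hf; have [|c _] := @mvt0 _ (fun s => f (s * complex.Re z, s * complex.Im z)) (fun=> 0) 0 1.
    move=> s; rewrite subr0 normr1 => s1.
    have m1 (a : R) : is_derive s (1 : R) (fun s => s * a) a.
      by rewrite -[X in is_derive _ _ _ X]mul1r; apply: is_derive1_mulr; exact: is_derive_id.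
    have := @lin_approx_curve R f (fun s => s * complex.Re z) (fun s => s * complex.Im z) s 0 0 _ _ (Hf s s1) (m1 _) (m1 _).
    by rewrite !mul0r addr0.
  by rewrite add0r !mul1r !mul0r => /eqP; rewrite subr_eq0 => /eqP.
have Z1 : rp (fun w => A w i j) (complex.Re z, complex.Im z) = rp (fun w => A w i j) (0, 0).
  by apply: K => s /D[]; rewrite ofCK addr0 subr0 oppr0.
have Z2 : ip (fun w => A w i j) (complex.Re z, complex.Im z) = ip (fun w => A w i j) (0, 0).
  by apply: K => s /D[_]; rewrite ofCK addr0 subr0.
by move: Z1 Z2; rewrite /rp /ip -[toC (complex.Re z, _)]/(toC (ofC z)) toCK; exact: eqC.
Qed.

End Matrices.
End Wirtinger.

(** * The lightlike vector near the base point *)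

Section Lorentz.
Variable T : comNzRingType.

Lemma I1_tr N : (I1 T N)^T = I1 T N.
Proof. exact: tr_diag_mx. Qed.

Lemma I1_sq N : I1 T N *m I1 T N = 1%:M.
Proof.
rewrite /I1 mulmx_diag -diag_const_mx; congr diag_mx; apply/rowP => i.
by rewrite !mxE; case: ifP => _; rewrite ?mulr1 ?mulrNN ?mulr1.
Qed.

Lemma I1_block n : I1 T (4 + n) = block_mx (I1 T 4) 0 0 1%:M.
Proof.
rewrite -diag_const_mx /I1 -diag_mx_row; congr diag_mx; apply/rowP => i; rewrite !mxE.
by case: splitP => k ik; rewrite !mxE -[val i]/(nat_of_ord i) ik.
Qed.

(** The top block of the lightlike vector: its first coordinate has square -1 and its second has
    square 1. *)
Definition v4 : 'cV[T]_4 := \col_i (if (i < 2)%N then 1 else 0).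
Definition v0 n : 'cV[T]_(4 + n) := col_mx v4 0.

Lemma v4_I1 n (A : 'M[T]_(4, n)) j : (v4^T *m I1 T 4 *m A) 0 j = A 1 j - A 0 j.
Proof.
rewrite mxE !big_ord_recl big_ord0 /I1 mul_mx_diag !mxE /=.
rewrite !mul0r !addr0 mul1r mulN1r mulr1 mul1r addrC.
congr (A _ _ - A _ _); exact: val_inj.
Qed.

Lemma v0_I1 n (A : 'M[T]_(4 + n)) : (v0 n)^T *m I1 T (4 + n) *m A =
  v4^T *m I1 T 4 *m usubmx A.
Proof.
rewrite /v0 I1_block tr_col_mx trmx0 mul_row_block !mul0mx !mulmx0 !addr0.
by rewrite -[in LHS](vsubmxK A) mul_row_col mul0mx addr0.
Qed.

Lemma O1_inv N (A : 'M[T]_N) : A^T *m I1 T N *m A = I1 T N ->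
  (I1 T N *m A^T *m I1 T N) *m A = 1%:M /\ A *m (I1 T N *m A^T *m I1 T N) = 1%:M.
Proof.
move=> H; have E : I1 T N *m A^T *m I1 T N *m A = 1%:M by rewrite -!mulmxA (mulmxA A^T) H I1_sq.
by split=> //; apply: mulmx1C.
Qed.

(** The invariance of [v] restated for its covector, the form in which it passes through the left
    factor of a Birkhoff product. *)
Lemma O1_fix N (A : 'M[T]_N) (v : 'cV[T]_N) : A^T *m I1 T N *m A = I1 T N ->
  A *m v = v -> v^T *m I1 T N *m A = v^T *m I1 T N.
Proof. by move=> H Av; rewrite -{1}Av trmx_mul -!mulmxA (mulmxA A^T) H. Qed.

(** The derivative of [F^T *m J *m F = J], read in the frame [F]: logarithmic derivatives lie in the
    Lie algebra. *)
Lemma so_of_deriv N (J F X P : 'M[T]_N) : F^T *m J *m F = J -> X = F *m P ->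
  X^T *m J *m F + F^T *m J *m X = 0 -> J *m P + P^T *m J = 0.
Proof.
move=> H ->; rewrite trmx_mul (_ : P^T *m F^T *m J *m F = P^T *m (F^T *m J *m F)).
  by rewrite (mulmxA (F^T *m J)) H addrC.
by rewrite !mulmxA.
Qed.

Lemma so_lin N (J P K : 'M[T]_N) (c : T) : J *m P + P^T *m J = 0 -> J *m K + K^T *m J = 0 ->
  J *m (c *: P + K) + (c *: P + K)^T *m J = 0.
Proof.
move=> h1 h2; have -> : (c *: P + K)^T = c *: P^T + K^T by rewrite linearD linearZ.
rewrite mulmxDr mulmxDl -scalemxAl -scalemxAr addrACA.
by rewrite -scalerDr h1 h2 scaler0 addr0.
Qed.

End Lorentz.

(** * Frames, loops and Birkhoff factors near the base point *)

Section BasePoint.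
Variable R : realType.
Local Notation C := (Cplane R).

Lemma O1_invmx N (A : 'M[C]_N) : A^T *m I1 C N *m A = I1 C N ->
  invmx A = I1 C N *m A^T *m I1 C N /\ A \in unitmx.
Proof.
move=> /O1_inv[h1 h2]; have u := (mulmx1_unit h2).1.
by split=> //; rewrite -[LHS]mulmx1 -h2 mulKmx.
Qed.

Lemma cmx_I1 N : cmx (I1 R N) = I1 C N.
Proof.
rewrite /cmx /I1 map_diag_mx; congr diag_mx; apply/rowP => i; rewrite !mxE.
by case: ifP => _; rewrite ?rmorphN ?rmorph1.
Qed.

Lemma cmx_O1 N (A : 'M[R]_N) : O1 A -> (cmx A)^T *m I1 C N *m cmx A = I1 C N.
Proof.
by rewrite -cmx_I1 /cmx matrix.map_trmx -!map_mxM => ->.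
Qed.

Lemma SO1plus_O1 N (A : 'M[R]_N) : SO1plus A -> O1 A.
Proof. by move=> /connected_component_sub[]. Qed.

Variable n : nat.
Implicit Types (A B : 'M[C]_(4 + n)).

Let Dm : 'M[C]_(4 + n) := block_mx (- 1%:M) 0 0 1%:M.

Lemma sigma_block_sq : Dm *m Dm = 1%:M.
Proof.
rewrite /Dm mulmx_block !mulmx0 !mul0mx !addr0 !add0r mulNmx mulmxN opprK !mulmx1.
by rewrite -scalar_mx_block.
Qed.

Lemma sigmaE A : sigma A = block_mx (ulsubmx A) (- ursubmx A) (- dlsubmx A) (drsubmx A).
Proof.
have [u iv] : Dm \in unitmx /\ invmx Dm = Dm.
  have u := (mulmx1_unit sigma_block_sq).1; split=> //.
  by rewrite -[RHS]mul1mx -(mulVmx u) -mulmxA sigma_block_sq mulmx1.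
rewrite /sigma -/Dm iv /Dm -{1}(submxK A) !mulmx_block !mulmx0 !mul0mx !addr0 !add0r.
by rewrite !mulNmx !mulmxN !mulmx1 !mul1mx opprK.
Qed.

Lemma kppart_block A : ppart A = block_mx 0 (ursubmx A) (dlsubmx A) 0 /\
  kpart A = block_mx (ulsubmx A) 0 0 (drsubmx A).
Proof.
have half p q (M : 'M[C]_(p, q)) : 2^-1 *: (M + M) = M.
  have two : (2 : C) != 0 by rewrite pnatr_eq0.
  by apply/matrixP => i j; rewrite !mxE; move: (M i j) => x; field.
rewrite /ppart /kpart sigmaE; split.
- rewrite -[X in X - _](submxK A) opp_block_mx add_block_mx scale_block_mx.
  by rewrite !subrr !opprK !half !scaler0.
- rewrite -[X in X + block_mx _ _ _ _](submxK A) add_block_mx scale_block_mx.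
  by rewrite !subrr !half !scaler0.
Qed.

Lemma kppart_sum A : ppart A + kpart A = A.
Proof.
have [-> ->] := kppart_block A.
by rewrite add_block_mx !add0r !addr0 submxK.
Qed.

Lemma so_parts A : I1 C (4 + n) *m A + A^T *m I1 C (4 + n) = 0 ->
  (I1 C (4 + n) *m ppart A + (ppart A)^T *m I1 C (4 + n) = 0) /\
  (I1 C (4 + n) *m kpart A + (kpart A)^T *m I1 C (4 + n) = 0).
Proof.
rewrite -[in X in X -> _](submxK A) I1_block tr_block_mx !mulmx_block !mulmx0 !mul0mx !addr0 !add0r.
rewrite !mul1mx !mulmx1 add_block_mx => E.
have /eq_block_mx[h1 h2 h3 h4] := etrans E (esym (block_mx0 _ 4 n 4 n)).
have [-> ->] := kppart_block A.
rewrite !tr_block_mx !trmx0 !mulmx_block !mulmx0 !mul0mx !addr0 !add0r.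
by rewrite !mul1mx !mulmx1 !add_block_mx h1 h2 h3 h4 !addr0 !block_mx0.
Qed.

Section Lift.
Variables (U : set C) (F0 : C -> 'M[R]_(4 + n)).
Hypothesis oU : open U.
Hypothesis sF0 : smoothRmx U F0.
Hypothesis F0O : forall z, U z -> O1 (F0 z).

Lemma open_toC (V : set C) : open V -> open ((@toC R) @^-1` V).
Proof.
move=> oV; apply/open2_epsP => p Vp.
have /nbhs_ballP[d' /posC[d d0 ->] Hd] : nbhs (toC p) V by exact: open_nbhs_nbhs.
exists (d / 2); first by rewrite divr_gt0.
move=> x y hx hy; apply: Hd; rewrite /ball /=.
have := @normC_lt_abs R (toC p - toC (x, y)) (d / 2).
have -> : complex.Re (toC p - toC (x, y)) = p.1 - x by rewrite ReD ReN.
have -> : complex.Im (toC p - toC (x, y)) = p.2 - y by rewrite ImD ImN.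
by rewrite distrC hx distrC hy mulrC divfK//; exact.
Qed.

Lemma lift_Ck k i j : Ck k ((@toC R) @^-1` U) (fun p => F0 (toC p) i j).
Proof. by have := smooth_on_Ck k (sF0 i j). Qed.

Lemma lift_has_WM z : U z ->
  has_WM (fun w => cmx (F0 w)) z (dz (fun w => cmx (F0 w)) z) (dzbar (fun w => cmx (F0 w)) z).
Proof.
move=> Uz; apply: (has_WM_C1 (open_toC oU)); first by rewrite /= toCK.
move=> i j; split.
- have -> : rp (fun w => cmx (F0 w) i j) = (fun p => F0 (toC p) i j).
    by apply/funext => p; rewrite /rp mxE.
  exact: lift_Ck.
- have -> : ip (fun w => cmx (F0 w) i j) = fun=> 0.
    by apply/funext => p; rewrite /ip mxE.
  exact: Ck_cst.
Qed.

Lemma conj_cmx N k (A : 'M[R]_(N, k)) : map_mx conjc (cmx A) = cmx A.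
Proof. by apply/matrixP => i j; rewrite !mxE conjc_real. Qed.

Lemma conj_conj a b (A : 'M[C]_(a, b)) : map_mx conjc (map_mx conjc A) = A.
Proof. by apply/matrixP => i j; rewrite !mxE conjcKK. Qed.

Lemma conj_mulmx a b c (A : 'M[C]_(a, b)) (B : 'M[C]_(b, c)) :
  map_mx conjc (A *m B) = map_mx conjc A *m map_mx conjc B.
Proof. exact: (map_mxM (@conjc R)). Qed.

Lemma lift_dz_conj z : U z -> map_mx conjc (dz (fun w => cmx (F0 w)) z) = dzbar (fun w => cmx (F0 w)) z.
Proof.
move=> Uz; have H := lift_has_WM Uz; have := has_WM_conj H.
have -> : (fun w => map_mx conjc (cmx (F0 w))) = (fun w => cmx (F0 w)).
  by apply/funext => w; exact: conj_cmx.
by move=> /has_WM_dz[_ <-].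
Qed.

Lemma mc_conj z : U z -> map_mx conjc (mc_z F0 z) = mc_zbar F0 z.
Proof.
move=> Uz; have [E _] := O1_invmx (cmx_O1 (F0O Uz)).
rewrite /mc_z /mc_zbar -(lift_dz_conj Uz) conj_mulmx; congr (_ *m _).
by rewrite E !conj_mulmx -matrix.map_trmx conj_cmx -cmx_I1 conj_cmx.
Qed.

Lemma mc_lift z : U z -> dz (fun w => cmx (F0 w)) z = cmx (F0 z) *m mc_z F0 z /\
  dzbar (fun w => cmx (F0 w)) z = cmx (F0 z) *m mc_zbar F0 z.
Proof.
move=> Uz; have [_ u] := O1_invmx (cmx_O1 (F0O Uz)).
rewrite /mc_z /mc_zbar; move: (dz _ z) (dzbar _ z) => X Y.
by split; rewrite mulKVmx.
Qed.

Lemma mc_so z : U z -> I1 C (4 + n) *m mc_z F0 z + (mc_z F0 z)^T *m I1 C (4 + n) = 0.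
Proof.
move=> Uz; have H := lift_has_WM Uz; have [E1 E2] := mc_lift Uz.
set J := I1 C (4 + n); set F := cmx (F0 z); set P := mc_z F0 z.
have oV : open U := oU.
have H1 := has_WM_mul (has_WM_mulr J (has_WM_tr H)) H.
have [D1e _] := has_WM_dz H1.
have Z : dz (fun w => (cmx (F0 w))^T *m J *m cmx (F0 w)) z = 0.
  have W : has_WM (fun w => (cmx (F0 w))^T *m J *m cmx (F0 w)) z 0 0.
    have HJ := has_WM_cst J z.
    move=> i j; have := HJ i j; rewrite /has_W => -[h1 h2].
    have /open2_epsP/(_ (ofC z)) := open_toC oU; rewrite /= toCK => /(_ Uz)[d d0 Hd].
    split; [apply: (lin_approx_eq d0 _ h1)|apply: (lin_approx_eq d0 _ h2)] => h k hd kd;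
    by rewrite /rp /ip (cmx_O1 (F0O _))//; apply: Hd => /=; rewrite addrC addKr.
  by have [] := has_WM_dz W.
exact: (so_of_deriv (cmx_O1 (F0O Uz)) E1 (etrans (esym D1e) Z)).
Qed.

(** On the circle [l^-1] and [l] are conjugate, so conjugation exchanges the [dz] and [dzbar]
    coefficients: the form [alpha_lambda] is real there. *)
Lemma alpha_conj (l z : C) : `|l| = 1 -> U z ->
  map_mx conjc (alpha_z F0 l z) = alpha_zbar F0 l z.
Proof.
move=> l1 Uz; rewrite /alpha_z /alpha_zbar -(mc_conj Uz).
have [-> ->] := kppart_block (mc_z F0 z); have [-> ->] := kppart_block (map_mx conjc (mc_z F0 z)).
rewrite (map_mxD (@conjc R)) (map_mxZ (@conjc R)) !(map_block_mx (@conjc R)) !(map_mx0 (@conjc R)).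
by rewrite /= (conjc_circle l1) conjcKK map_ursubmx map_dlsubmx map_ulsubmx map_drsubmx.
Qed.

Lemma alpha_so (l z : C) : U z ->
  alpha_z F0 l z *m I1 C (4 + n) + I1 C (4 + n) *m (alpha_z F0 l z)^T = 0.
Proof.
move=> Uz; have [h1 h2] := so_parts (mc_so Uz).
set J := I1 C (4 + n) in h1 h2 *.
have E : J *m alpha_z F0 l z + (alpha_z F0 l z)^T *m J = 0.
  exact: (so_lin _ h1 h2).
have := congr1 (fun M => J *m M *m J) E.
rewrite mulmxDr mulmxDl mulmx0 mul0mx !mulmxA I1_sq mul1mx -!mulmxA I1_sq mulmx1.
by [].
Qed.

Lemma alpha_bar_so (l z : C) : `|l| = 1 -> U z ->
  alpha_zbar F0 l z *m I1 C (4 + n) + I1 C (4 + n) *m (alpha_zbar F0 l z)^T = 0.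
Proof.
move=> l1 Uz; have := congr1 (map_mx (@conjc R)) (alpha_so l Uz).
rewrite (map_mxD (@conjc R)) !conj_mulmx -matrix.map_trmx (alpha_conj l1 Uz) -cmx_I1 conj_cmx.
by rewrite (map_mx0 (@conjc R)).
Qed.

(* A I B^t is constant. *)
Lemma frame_unique (r : R[i]) (A B P Q : C -> 'M[C]_(4 + n)) :
  (forall z, `|z| < r -> has_WM A z (A z *m P z) (A z *m Q z)) ->
  (forall z, `|z| < r -> has_WM B z (B z *m P z) (B z *m Q z)) ->
  (forall z, `|z| < r -> P z *m I1 C (4 + n) + I1 C (4 + n) *m (P z)^T = 0) ->
  (forall z, `|z| < r -> Q z *m I1 C (4 + n) + I1 C (4 + n) *m (Q z)^T = 0) ->
  A 0 = 1%:M -> B 0 = 1%:M ->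
  (forall z, `|z| < r -> (B z)^T *m I1 C (4 + n) *m B z = I1 C (4 + n)) ->
  forall z, `|z| < r -> A z = B z.
Proof.
move=> HA HB HP HQ A0 B0 BO z zr; set J := I1 C (4 + n) in HP HQ BO *.
have Z w : `|w| < r -> has_WM (fun w => A w *m J *m (B w)^T) w 0 0.
  move=> wr; apply: eq_has_WM (has_WM_mul (has_WM_mulr J (HA w wr)) (has_WM_tr (HB w wr))).
  - by rewrite trmx_mul -!mulmxA -mulmxDr !mulmxA -mulmxDl HP// mul0mx mulmx0.
  - by rewrite trmx_mul -!mulmxA -mulmxDr !mulmxA -mulmxDl HQ// mul0mx mulmx0.
have := has_WM_const Z zr; rewrite A0 B0 trmx1 mulmx1 mul1mx => E.
have := BO z zr => /O1_inv[_ E2].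
rewrite -[A z]mulmx1 -(@I1_sq C (4 + n)) -/J.
have BJ := BO z zr.
have : A z *m J *m (B z)^T *m (J *m B z) = J *m (J *m B z) by rewrite E.
by rewrite -!mulmxA (mulmxA (B z)^T) BJ (mulmxA J) I1_sq mul1mx.
Qed.

End Lift.

(** Uniqueness of the Birkhoff factors of the identity. On the circle [d l^-1] is the inverse of
    [g], namely [I1 *m g^T *m I1], which is holomorphic inside the disc, while [d l^-1] is
    holomorphic outside; so both are constant. *)
Lemma plus_loop_const (g d : C -> 'M[C]_(4 + n)) : plus_loop g -> plus_loop d ->
  d 0 = 1%:M -> (forall l : C, `|l| = 1 -> d l^-1 *m g l = 1%:M) ->
  forall l : C, `|l| = 1 -> d l = 1%:M.
Proof.
move=> [g1 _ g3 g4] [d1 _ d3 d4] d0 dg l l1; apply/matrixP => i j.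
have Hd : disc_holo (fun l => d l i j) by split; [exact: d3|exact: d4].
have Hg : disc_holo (fun l => (I1 C (4 + n) *m (g l)^T *m I1 C (4 + n)) i j).
  have -> : (fun l => (I1 C (4 + n) *m (g l)^T *m I1 C (4 + n)) i j) =
    (fun l => (if val i == 0%N then -1 else 1) * ((if val j == 0%N then -1 else 1) * g l j i)).
    apply/funext => l'; rewrite /I1 mul_mx_diag mul_diag_mx !mxE -mulrA.
    by congr (_ * _); exact: mulrC.
  apply: disc_holoM (disc_holo_cst _) (disc_holoM (disc_holo_cst _) _).
  by split; [exact: g3|exact: g4].
rewrite (disc_holo_both_const Hg Hd) ?d0// => l' l'1.
have li : `|l'^-1| = 1 by rewrite normfV l'1 invr1.
have l'le : `|l'| <= 1 by rewrite l'1.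
have [gO _] := g1 l' l'le.
have [h1 h2] := O1_inv gO.
by rewrite -[d _]mulmx1 -h2 mulmxA dg// mul1mx.
Qed.

Lemma minus_loop_O1 (g : C -> 'M[C]_(4 + n)) (l : C) : minus_loop_based g -> `|l| = 1 ->
  (g l)^T *m I1 C (4 + n) *m g l = I1 C (4 + n).
Proof.
move=> [d [[dO _ _ _] _ gd]] l1; rewrite gd ?l1//.
by have [] := dO l^-1 _; rewrite ?normfV ?l1 ?invr1.
Qed.

Lemma plus_loop_O1 (g : C -> 'M[C]_(4 + n)) (l : C) : plus_loop g -> `|l| <= 1 ->
  (g l)^T *m I1 C (4 + n) *m g l = I1 C (4 + n).
Proof. by move=> [gO _ _ _] l1; have [] := gO l l1. Qed.

Lemma O1_mul N (A B : 'M[C]_N) : A^T *m I1 C N *m A = I1 C N -> B^T *m I1 C N *m B = I1 C N ->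
  (A *m B)^T *m I1 C N *m (A *m B) = I1 C N.
Proof.
move=> HA HB; rewrite trmx_mul (_ : B^T *m A^T *m I1 C N *m (A *m B) = B^T *m (A^T *m I1 C N *m A) *m B).
  by rewrite HA.
by rewrite !mulmxA.
Qed.

Lemma alpha1 (G : C -> 'M[R]_(4 + n)) (l z : C) : l = 1 ->
  alpha_z G l z = mc_z G z /\ alpha_zbar G l z = mc_zbar G z.
Proof.
move=> l1; have li : l^-1 = 1 by rewrite l1 invr1.
rewrite /alpha_z /alpha_zbar; move: (mc_z _ _) (mc_zbar _ _) => P Q.
rewrite li l1; split.
- by rewrite scale1r; exact: kppart_sum.
- by rewrite scale1r; exact: kppart_sum.
Qed.

Section Factorization.
Variables (U : set C) (F0 : C -> 'M[R]_(4 + n)) (F Fm Fp : C -> C -> 'M[C]_(4 + n)).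
Variable eta : C -> 'M[C]_(4 + n).
Hypothesis oU : open U.
Hypothesis U0 : U 0.
Hypothesis sF0 : smoothRmx U F0.
Hypothesis F0O : forall z, U z -> O1 (F0 z).
Hypothesis F00 : F0 0 = 1%:M.
Hypothesis HF : is_extended_frame U F0 F.
Hypothesis HFmp : forall z, U z -> [/\ minus_loop_based (Fm z), plus_loop (Fp z) &
  forall l : C, `|l| = 1 -> F z l = Fm z l *m Fp z l].
Hypothesis HFm : forall z, U z -> forall l : C, `|l| = 1 -> forall i j,
  is_derive z 1 (fun w => Fm w l i j : C) ((Fm z l *m (l^-1 *: eta z)) i j).

Lemma frame_O1 z l : U z -> `|l| = 1 -> (F z l)^T *m I1 C (4 + n) *m F z l = I1 C (4 + n).
Proof.
move=> Uz l1; have [h1 h2 ->//] := HFmp Uz.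
by apply: O1_mul; [exact: minus_loop_O1|apply: plus_loop_O1; rewrite ?l1].
Qed.

Lemma frame_has_WM z l : U z -> `|l| = 1 ->
  has_WM (F^~ l) z (F z l *m alpha_z F0 l z) (F z l *m alpha_zbar F0 l z).
Proof.
move=> Uz l1; have [sF _ HD] := HF l1; have [E1 E2] := HD z Uz.
apply: (eq_has_WM E1 E2); apply: (has_WM_C1 (open_toC oU)); first by rewrite /= toCK.
by move=> i j; have [h1 h2] := sF i j; split; exact: smooth_on_Ck.
Qed.

(** The base point normalizes [F], not [F_-]; that [F_-] also starts at the identity follows from
    the uniqueness of the factors. *)
Lemma minus_base l : `|l| = 1 -> Fm 0 l = 1%:M.
Proof.
move=> l1; have [[d [dp d0 dm]] gp FF] := HFmp U0.
rewrite dm ?l1//.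
have H : forall l : C, `|l| = 1 -> d l = 1%:M.
  apply: (plus_loop_const gp dp d0) => l' l'1.
  by have [_ + _] := HF l'1; rewrite FF// dm ?l'1.
by rewrite H// normfV l1 invr1.
Qed.

Lemma minus_has_WM z l : U z -> `|l| = 1 -> has_WM (Fm^~ l) z (Fm z l *m (l^-1 *: eta z)) 0.
Proof. by move=> Uz l1 i j; rewrite [X in has_W _ _ _ X]mxE; apply: has_W_holo; exact: HFm. Qed.

Lemma ball_in_open (V : set C) (c : C) : open V -> V c ->
  exists2 r : R, 0 < r & forall z : C, `|z - c| < r%:C -> V z.
Proof.
move=> oV Vc; have /nbhs_ballP[d /posC[r r0 ->] Hd] : nbhs c V by exact: open_nbhs_nbhs.
by exists r => // z zr; apply: Hd; rewrite /ball /= distrC.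
Qed.

(** Both facts are uniqueness for a linear system with the identity as initial value: on the circle
    the conjugate of [F] solves the same system, because [alpha_lambda] is real, and at [l = 1] the
    lift itself solves it. *)
Lemma frame_real_lift : exists2 r : R, 0 < r & forall z : C, `|z| < r%:C ->
  [/\ U z, forall l : C, `|l| = 1 -> map_mx conjc (F z l) = F z l & F z 1 = cmx (F0 z)].
Proof.
have [r r0 Hr] := ball_in_open oU U0.
have {}Hr z : `|z| < r%:C -> U z by move=> zr; apply: Hr; rewrite subr0.
exists r => // z zr; split; first exact: Hr.
- move=> l l1.
  apply: (@frame_unique (r%:C) (fun z => map_mx conjc (F z l)) (F^~ l) (alpha_z F0 l) (alpha_zbar F0 l)) zr => [w wr|w wr|w wr|w wr|||w wr].
  + have := has_WM_conj (frame_has_WM (Hr w wr) l1).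
    apply: eq_has_WM; rewrite conj_mulmx.
    * congr (_ *m _); rewrite -(alpha_conj oU sF0 F0O l1 (Hr w wr)).
      by rewrite conj_conj.
    * by rewrite (alpha_conj oU sF0 F0O l1 (Hr w wr)).
  + exact: frame_has_WM (Hr w wr) l1.
  + exact: (alpha_so oU sF0 F0O _ (Hr w wr)).
  + exact: (alpha_bar_so oU sF0 F0O l1 (Hr w wr)).
  + by have [_ -> _] := HF l1; rewrite (map_mx1 (@conjc R)).
  + by have [_ -> _] := HF l1.
  + exact: frame_O1 (Hr w wr) l1.
- have [l lE] : exists l : C, l = 1 by exists 1.
  rewrite -lE; have l1 : `|l| = 1 by rewrite lE normr1.
  apply: (@frame_unique (r%:C) (F^~ l) (fun z => cmx (F0 z)) (alpha_z F0 l) (alpha_zbar F0 l)) zr => [w wr|w wr|w wr|w wr|||w wr].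
  + exact: frame_has_WM (Hr w wr) l1.
  + have Uw := Hr w wr; have [E1 E2] := mc_lift F0O Uw.
    apply: eq_has_WM (lift_has_WM oU sF0 Uw); rewrite ?E1 ?E2.
    * by have [e1 _] := alpha1 F0 w lE; congr (_ *m _); symmetry; exact e1.
    * by have [_ e2] := alpha1 F0 w lE; congr (_ *m _); symmetry; exact e2.
  + exact: (alpha_so oU sF0 F0O _ (Hr w wr)).
  + exact: (alpha_bar_so oU sF0 F0O l1 (Hr w wr)).
  + by have [_ -> _] := HF l1.
  + by rewrite F00 /cmx map_mx1.
  + exact: cmx_O1 (F0O (Hr w wr)).
Qed.

Hypothesis eta_v0 : forall z, eta z *m v0 C n = 0.

(* v0^t I F(z, .) = v0^t I F_+(z, .) is holomorphic in the disc and real on the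
   circle, hence constant in lambda; its last n entries are odd in lambda. *)
Lemma lightlike_near_base : exists2 r : R, 0 < r & forall z : C, `|z| < r%:C ->
  U z /\ (v4 R)^T *m I1 R 4 *m ursubmx (F0 z) = 0.
Proof.
have [r r0 Hr] := frame_real_lift; exists r => // z zr.
have [Uz Freal F1] := Hr z zr; split=> //.
have Fmv l : `|l| = 1 -> Fm z l *m v0 C n = v0 C n.
  move=> l1; have Z w : `|w| < r%:C -> has_WM (fun w => Fm w l *m v0 C n) w 0 0.
    move=> wr; have [Uw _ _] := Hr w wr.
    apply: eq_has_WM (has_WM_mulr (v0 C n) (minus_has_WM Uw l1)); last by rewrite mul0mx.
    by rewrite -mulmxA -scalemxAl eta_v0 scaler0 mulmx0.
  by rewrite (has_WM_const Z zr) minus_base// mul1mx.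
have [mz pz FF] := HFmp Uz.
pose h l := (v0 C n)^T *m I1 C (4 + n) *m Fp z l.
have hF l : `|l| = 1 -> h l = (v0 C n)^T *m I1 C (4 + n) *m F z l.
  move=> l1; rewrite /h FF// mulmxA; congr (_ *m _).
  by rewrite (O1_fix (minus_loop_O1 mz l1) (Fmv l l1)).
have hE l j : h l 0 j = Fp z l (lshift n 1) j - Fp z l (lshift n 0) j.
  by rewrite /h v0_I1 v4_I1 !mxE.
have [_ ptw ph pc] := pz.
clearbody h.
have hc j l : `|l| = 1 -> h l 0 j = h 0 0 j.
  apply: (@disc_holo_real_const R (fun l => h l 0 j)).
    have -> : (fun l => h l 0 j) = (fun l => Fp z l (lshift n 1) j + - Fp z l (lshift n 0) j).
      by apply/funext => l'; rewrite hE.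
    apply: disc_holoD; last apply: disc_holoN.
    - by split; [exact: ph|exact: pc].
    - by split; [exact: ph|exact: pc].
  move=> l' l'1; rewrite hF// v0_I1 v4_I1 !mxE.
  have Fr i : complex.Im (F z l' i j) = 0.
    have := congr1 (fun M : 'M[C]_(4 + n) => M i j) (Freal l' l'1); rewrite mxE.
    by case: (F z l' i j) => a b /= [/eqP]; rewrite eqNr => /eqP.
  by rewrite ImD ImN !Fr subrr.
have odd_h (k : 'I_n) l : `|l| = 1 -> h (- l) 0 (rshift 4 k) = - h l 0 (rshift 4 k).
  move=> l1; rewrite !hE ptw// sigmaE.
  by rewrite !block_mxEur !mxE -opprD.
have n1 : `|(1 : C)| = 1 by rewrite normr1.
have nN1 : `|(-1 : C)| = 1 by rewrite normrN normr1.
have h0 k : h 1 0 (rshift 4 k) = 0.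
  have E : h (- 1) 0 (rshift 4 k) = h 1 0 (rshift 4 k).
    have e1 := hc (rshift 4 k) (-1 : C) nN1; have e2 := hc (rshift 4 k) (1 : C) n1.
    exact: etrans e1 (esym e2).
  have key (x : C) : x = - x -> x = 0.
    by move/eqP; rewrite -addr_eq0 -mulr2n mulrn_eq0 /= => /eqP.
  by apply: key; rewrite -{1}E; exact: odd_h.
apply/rowP => k; rewrite [RHS]mxE v4_I1 !mxE.
have := h0 k; rewrite hF// F1 v0_I1 v4_I1 !mxE => /(congr1 (@complex.Re R)).
by rewrite ReD ReN.
Qed.

End Factorization.
End BasePoint.

(** * Propagation of the lightlike vector *)

Section Propagation.
Variable R : realType.
Local Notation C := (Cplane R).

Definition CkC k (V : set (R * R)) (f : C -> C) := Ck k V (rp f) /\ Ck k V (ip f).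

Lemma CkC_eq k V (f g : C -> C) : open V -> (forall p, V p -> f (toC p) = g (toC p)) ->
  CkC k V f -> CkC k V g.
Proof.
move=> oV fg [h1 h2]; split.
- by apply: (Ck_eq oV _ h1) => p Vp; rewrite /rp fg.
- by apply: (Ck_eq oV _ h2) => p Vp; rewrite /ip fg.
Qed.

Lemma CkC_add k V (f g : C -> C) : open V -> CkC k V f -> CkC k V g -> CkC k V (fun z => f z + g z).
Proof.
move=> oV [f1 f2] [g1 g2]; split.
- have -> : rp (fun w => f w + g w) = (fun x => rp f x + rp g x).
    by apply/funext => x; rewrite /rp ReD.
  exact: CkD.
- have -> : ip (fun w => f w + g w) = (fun x => ip f x + ip g x).
    by apply/funext => x; rewrite /ip ImD.
  exact: CkD.
Qed.

Lemma CkC_mul k V (f g : C -> C) : open V -> CkC k V f -> CkC k V g -> CkC k V (fun z => f z * g z).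
Proof.
move=> oV [f1 f2] [g1 g2]; split.
- have -> : rp (fun w => f w * g w) = (fun x => rp f x * rp g x - ip f x * ip g x).
    by apply/funext => x; rewrite /rp ReM.
  exact: (CkB oV (CkM oV f1 g1) (CkM oV f2 g2)).
- have -> : ip (fun w => f w * g w) = (fun x => rp f x * ip g x + ip f x * rp g x).
    by apply/funext => x; rewrite /ip ImM.
  exact: (CkD oV (CkM oV f1 g2) (CkM oV f2 g1)).
Qed.

Lemma CkC_cst k V (c : C) : CkC k V (fun=> c).
Proof. by split; exact: Ck_cst. Qed.

Lemma CkC_conj k V (f : C -> C) : open V -> CkC k V f -> CkC k V (fun z => conjc (f z)).
Proof.
move=> oV [f1 f2]; split.
- have -> : rp (fun w => conjc (f w)) = rp f by apply/funext => x; rewrite /rp ReJ.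
  exact: f1.
- have -> : ip (fun w => conjc (f w)) = (fun x => - ip f x) by apply/funext => x; rewrite /ip ImJ.
  exact: CkN.
Qed.

Lemma CkC_sum k V (I : Type) (r : seq I) (F : I -> C -> C) : open V ->
  (forall i, CkC k V (F i)) -> CkC k V (fun z => \sum_(i <- r) F i z).
Proof.
move=> oV H; elim: r => [|i r IH].
  have -> : (fun w => \sum_(i <- [::]) F i w) = fun=> 0.
    by apply/funext => w; rewrite big_nil.
  exact: CkC_cst.
have -> : (fun w => \sum_(j <- i :: r) F j w) = fun w => F i w + \sum_(j <- r) F j w.
  by apply/funext => w; rewrite big_cons.
exact: (CkC_add oV (H i) IH).
Qed.

Definition CkMx k (V : set (R * R)) m n (A : C -> 'M[C]_(m, n)) :=
  forall i j, CkC k V (fun z => A z i j).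

Lemma CkMx_mul k V m n q (A : C -> 'M[C]_(m, n)) (B : C -> 'M[C]_(n, q)) : open V ->
  CkMx k V A -> CkMx k V B -> CkMx k V (fun z => A z *m B z).
Proof.
move=> oV HA HB i j.
have -> : (fun w => (A w *m B w) i j) = (fun w => \sum_l A w i l * B w l j).
  by apply/funext => w; rewrite mxE.
by apply: (CkC_sum _ oV) => l; exact: (CkC_mul oV (HA i l) (HB l j)).
Qed.

Lemma CkMx_cst k V m n (A : 'M[C]_(m, n)) : CkMx k V (fun=> A).
Proof. by move=> i j; exact: CkC_cst. Qed.

Lemma CkMx_tr k V m n (A : C -> 'M[C]_(m, n)) : CkMx k V A -> CkMx k V (fun z => (A z)^T).
Proof.
move=> HA i j; have -> : (fun w => (A w)^T i j) = (fun w => A w j i) by apply/funext => w; rewrite mxE.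
exact: HA.
Qed.

Lemma CkMx_conj k V m n (A : C -> 'M[C]_(m, n)) : open V -> CkMx k V A ->
  CkMx k V (fun z => map_mx conjc (A z)).
Proof.
move=> oV HA i j; have -> : (fun w => map_mx conjc (A w) i j) = (fun w => conjc (A w i j)).
  by apply/funext => w; rewrite mxE.
exact: (CkC_conj oV (HA i j)).
Qed.

Lemma CkMx_eq k V m n (A B : C -> 'M[C]_(m, n)) : open V ->
  (forall p, V p -> A (toC p) = B (toC p)) -> CkMx k V A -> CkMx k V B.
Proof. by move=> oV AB HA i j; apply: (CkC_eq oV _ (HA i j)) => p Vp; rewrite AB. Qed.

Lemma CkMx_has_WM V m n (A : C -> 'M[C]_(m, n)) z : open V -> V (ofC z) -> CkMx 1 V A ->
  has_WM A z (dz A z) (dzbar A z).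
Proof. by move=> oV Vz HA; apply: (has_WM_C1 oV Vz) => i j; exact: HA. Qed.

Lemma CkMx_dz k V m n (A : C -> 'M[C]_(m, n)) : open V -> CkMx k.+1 V A -> CkMx k V (dz A).
Proof.
move=> oV HA i j; have [h1 h2] := HA i j.
have -> : (fun z => dz A z i j) = (fun z => 2^-1 * (duC (fun w => A w i j) z +
    (- 'i) * dvC (fun w => A w i j) z)).
  by apply/funext => z; rewrite mxE mulNr.
apply: (CkC_mul oV (CkC_cst _ _ _)); apply: (CkC_add oV); last apply: (CkC_mul oV (CkC_cst _ _ _)).
- split.
  + have -> : rp (duC (fun w => A w i j)) = D1 (rp (fun w => A w i j)).
      by apply/funext => p; rewrite /rp /duC /= duE ofCK.
    exact: CkD1.
  + have -> : ip (duC (fun w => A w i j)) = D1 (ip (fun w => A w i j)).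
      by apply/funext => p; rewrite /ip /duC /= duE ofCK.
    exact: CkD1.
- split.
  + have -> : rp (dvC (fun w => A w i j)) = D2 (rp (fun w => A w i j)).
      by apply/funext => p; rewrite /rp /dvC /= dvE ofCK.
    exact: CkD2.
  + have -> : ip (dvC (fun w => A w i j)) = D2 (ip (fun w => A w i j)).
      by apply/funext => p; rewrite /ip /dvC /= dvE ofCK.
    exact: CkD2.
Qed.

(** A norm with values in the reals, equivalent to the modulus, which lives in the complex numbers;
    estimates of sums of entries then become linear arithmetic. *)
Definition N1 (z : C) : R := `|complex.Re z| + `|complex.Im z|.

Lemma N1_ge0 z : 0 <= N1 z. Proof. by rewrite addr_ge0. Qed.

Lemma N1D z w : N1 (z + w) <= N1 z + N1 w.
Proof. by rewrite /N1 !ReImE addrACA lerD// ler_normD. Qed.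

Lemma N1N z : N1 (- z) = N1 z.
Proof. by rewrite /N1 !ReImE !normrN. Qed.

Lemma N1J z : N1 (conjc z) = N1 z.
Proof. by rewrite /N1 ReJ ImJ normrN. Qed.

Lemma N1M z w : N1 (z * w) <= N1 z * N1 w.
Proof.
rewrite /N1 !ReImE mulrDl !mulrDr.
have A := ler_normB (complex.Re z * complex.Re w) (complex.Im z * complex.Im w).
have B := ler_normD (complex.Re z * complex.Im w) (complex.Im z * complex.Re w).
by rewrite !normrM in A B; clear -A B; lra.
Qed.

Lemma N1_sum (I : Type) (r : seq I) (F : I -> C) : N1 (\sum_(i <- r) F i) <= \sum_(i <- r) N1 (F i).
Proof.
elim: r => [|i r IH]; first by rewrite !big_nil /N1 /= normr0 addr0.
by rewrite !big_cons; apply: le_trans (N1D _ _) _; rewrite lerD2l.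
Qed.

Lemma N1_sqr_bounds z : complex.Re z ^+ 2 + complex.Im z ^+ 2 <= N1 z ^+ 2 /\
  N1 z ^+ 2 <= 2 * (complex.Re z ^+ 2 + complex.Im z ^+ 2).
Proof.
have : N1 z ^+ 2 = complex.Re z ^+ 2 + complex.Im z ^+ 2 + 2 * (`|complex.Re z| * `|complex.Im z|).
  by rewrite /N1 sqrrD !real_normK ?num_real//; ring.
have h1 : 0 <= `|complex.Re z| * `|complex.Im z| by rewrite mulr_ge0.
have h2 := sqr_ge0 (`|complex.Re z| - `|complex.Im z|).
rewrite sqrrB !real_normK ?num_real// in h2.
by clear -h1 h2; move=> ->; split; lra.
Qed.

Lemma sum_sqr_le (I : finType) (a : I -> R) : (\sum_i a i) ^+ 2 <= #|I|%:R * \sum_i a i ^+ 2.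
Proof.
rewrite expr2 mulr_suml.
have -> : #|I|%:R * (\sum_i a i ^+ 2) = \sum_i \sum_j ((a i ^+ 2 + a j ^+ 2) / 2).
  have -> : \sum_i \sum_j ((a i ^+ 2 + a j ^+ 2) / 2) =
    \sum_i (#|I|%:R * a i ^+ 2 / 2 + (\sum_j a j ^+ 2) / 2).
    apply: eq_bigr => i _; rewrite -mulr_suml big_split /= mulrDl; congr (_ / 2 + _).
    by rewrite sumr_const mulr_natl.
  rewrite big_split /= sumr_const -mulr_suml -mulr_sumr -[X in _ + X]mulr_natl.
  by move: (\sum_i _) => s; lra.
apply: ler_sum => i _; rewrite mulr_sumr; apply: ler_sum => j _.
have := sqr_ge0 (a i - a j); rewrite sqrrB => h.
by clear -h; lra.
Qed.

Lemma normC_ltr (z : C) (r : R) : 0 < r ->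
  (`|z| < r%:C) = (complex.Re z ^+ 2 + complex.Im z ^+ 2 < r ^+ 2).
Proof.
move=> r0; rewrite normc_def ltcE /= eqxx /= -[X in _ < X](@gtr0_norm _ r)// -sqrtr_sqr.
by rewrite ltr_sqrt// exprn_gt0.
Qed.

Lemma near_box (z0 : C) (P : C -> Prop) : (\forall z \near z0, P z) <->
  exists2 d : R, 0 < d & forall z : C, `|complex.Re z - complex.Re z0| < d ->
    `|complex.Im z - complex.Im z0| < d -> P z.
Proof.
split=> [/nbhs_ballP[d /posC[r r0 ->] Hd]|[d d0 Hd]].
- exists (r / 2); first by rewrite divr_gt0.
  move=> z h1 h2; apply: Hd; rewrite /ball /=.
  have -> : r = 2 * (r / 2) by field.
  by apply: normC_lt_abs; rewrite !ReImE distrC.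
- apply/nbhs_ballP; exists d%:C; first by rewrite /= posC_gt0.
  move=> z; rewrite /ball /= => zd; apply: Hd.
    by have := absRe_lt zd; rewrite !ReImE distrC.
  by have := absIm_lt zd; rewrite !ReImE distrC.
Qed.

Lemma unique_continuation_dbar (I : finType) (u q : I -> C -> C) (z0 : C) (r K : R) :
  0 < r -> 0 <= K ->
  (forall i, CkC 2 [set p | `|toC p - z0| < r%:C] (u i)) ->
  (forall z, `|z - z0| < r%:C -> forall i, exists p, has_W (u i) z p (q i z)) ->
  (forall z, `|z - z0| < r%:C -> forall i, N1 (q i z) <= K * \sum_j N1 (u j z)) ->
  (\forall z \near z0, forall i, u i z = 0) ->
  forall z, `|z - z0| < r%:C -> forall i, u i z = 0.
Proof.
move=> r0 K0 Cu Hq bq /near_box[d d0 Hd] z zr i.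
have EB : [set p | `|toC p - z0| < r%:C] =
   [set p : R * R | (p.1 - (ofC z0).1) ^+ 2 + (p.2 - (ofC z0).2) ^+ 2 < r ^+ 2].
  by apply/seteqP; split=> p; rewrite /= normC_ltr// !ReImE.
have cI0 : (0 : R) <= #|I|%:R by rewrite ler0n.
(* A factor 4 comes from the squares of twice the dbar derivative, a factor 2 from comparing [N1]
   with the modulus, and the two factors [#|I|] from Cauchy-Schwarz and from the sum over the
   index. *)
pose K' := 8 * (#|I|%:R ^+ 2 * K ^+ 2).
have K'0 : 0 <= K' by rewrite mulr_ge0// mulr_ge0// exprn_ge0.
have := @unique_continuation R I (fun i => rp (u i)) (fun i => ip (u i)) (ofC z0) r K' r0 K'0.
rewrite -EB => /(_ (fun i => (Cu i).1) (fun i => (Cu i).2)) H.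
have bnd p : [set p | `|toC p - z0| < r%:C] p ->
    \sum_j ((D1 (rp (u j)) p - D2 (ip (u j)) p) ^+ 2 + (D2 (rp (u j)) p + D1 (ip (u j)) p) ^+ 2) <=
    K' * \sum_j (rp (u j) p ^+ 2 + ip (u j) p ^+ 2).
  rewrite /= => pr.
  have qb := bq _ pr; have Hp := Hq _ pr.
  pose L := \sum_j N1 (u j (toC p)).
  have L0 : 0 <= L by apply: sumr_ge0 => j _; exact: N1_ge0.
  have L2 : L ^+ 2 <= #|I|%:R * (2 * \sum_j (rp (u j) p ^+ 2 + ip (u j) p ^+ 2)).
    apply: le_trans (sum_sqr_le _) _; apply: ler_wpM2l => //; rewrite mulr_sumr.
    by apply: ler_sum => j _; have [_] := N1_sqr_bounds (u j (toC p)).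
  have T j : (D1 (rp (u j)) p - D2 (ip (u j)) p) ^+ 2 + (D2 (rp (u j)) p + D1 (ip (u j)) p) ^+ 2 <=
      4 * (K * L) ^+ 2.
    have [p' [/lin_approx_ddf + /lin_approx_ddf]] := Hp j.
    rewrite ofCK => -[_ -> ->] [_ -> ->]; rewrite !ReImE.
    have [+ _] := N1_sqr_bounds (q j (toC p)).
    have : N1 (q j (toC p)) ^+ 2 <= (K * L) ^+ 2.
      by rewrite ler_pXn2r ?nnegrE ?N1_ge0 ?mulr_ge0//; exact: qb.
    move: (N1 _) (complex.Re (q j _)) (complex.Im (q j _)) (K * L) => w x y k; clear.
    move=> A B.
    have -> : complex.Re p' + x - (complex.Re p' + - x) = 2 * x by ring.
    have -> : - (complex.Im p' + - y) + (complex.Im p' + y) = 2 * y by ring.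
    by rewrite !exprMn; lra.
  apply: le_trans (ler_sum _ (fun j _ => T j)) _; rewrite sumr_const -[X in X <= _]mulr_natl /K'.
  have A : (K * L) ^+ 2 <= K ^+ 2 * (#|I|%:R * (2 * \sum_j (rp (u j) p ^+ 2 + ip (u j) p ^+ 2))).
    by rewrite exprMn; apply: ler_wpM2l => //; exact: exprn_ge0.
  have := ler_wpM2l cI0 A.
  move: ((K * L) ^+ 2) (\sum_j _) (K ^+ 2) (#|I|%:R : R) => x y k m; clear; move=> h.
  have -> : 8 * (m ^+ 2 * k) * y = 4 * (m * (k * (m * (2 * y)))) by ring.
  have -> : m * (4 * x) = 4 * (m * x) by ring.
  by rewrite ler_pM2l.
have zz : exists2 d, 0 < d & forall j p, `|p.1 - (ofC z0).1| < d -> `|p.2 - (ofC z0).2| < d ->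
    rp (u j) p = 0 /\ ip (u j) p = 0.
  exists d => // j p h1 h2.
  by have E := Hd (toC p) h1 h2 j; rewrite /rp /ip E.
have [|h1 h2] := H bnd zz i (ofC z); first by rewrite /= toCK.
by apply: eqC; [move: h1|move: h2]; rewrite /rp /ip toCK.
Qed.

Lemma dl_mul_parts n (P Q : 'M[C]_(4 + n)) (a b : C) :
  dlsubmx ((a *: ppart P + kpart P) *m (b *: ppart Q + kpart Q)) =
  a *: (dlsubmx P *m ulsubmx Q) + b *: (drsubmx P *m dlsubmx Q).
Proof.
have [-> ->] := kppart_block P; have [-> ->] := kppart_block Q.
move: (ursubmx P) (dlsubmx P) (ulsubmx P) (drsubmx P) => p1 p2 p3 p4.
move: (ursubmx Q) (dlsubmx Q) (ulsubmx Q) (drsubmx Q) => q1 q2 q3 q4.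
rewrite !scale_block_mx !add_block_mx mulmx_block block_mxKdl !scaler0 !addr0 !add0r.
by rewrite -scalemxAl -scalemxAr.
Qed.

Lemma dl_flat n (A B M N : 'M[C]_(4 + n)) a b c d : dlsubmx A = a -> dlsubmx B = b ->
  dlsubmx M = c -> dlsubmx N = d -> A - B + (M - N) = 0 -> a - b + (c - d) = 0.
Proof.
move=> <- <- <- <- h; apply/matrixP => i j.
have := congr1 (fun X : 'M[C]_(4 + n) => X (rshift 4 i) (lshift n j)) h.
by rewrite !mxE.
Qed.

Lemma flat_split m n (l li : C) (X Y a b c d : 'M[C]_(m, n)) :
  l *: X - li *: Y + (li *: a + l *: b - (l *: c + li *: d)) = 0 ->
  l *: (X + (b - c)) = li *: (Y - (a - d)).
Proof.
move=> h; apply/eqP; rewrite -subr_eq0 -[X in _ == X]h; apply/eqP.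
by apply/matrixP => i j; rewrite !mxE; ring.
Qed.

(** Two parameters are enough: [l^-1] is [l] at 1 and [- l] at ['i]. *)
Lemma circle_split m n (S T : 'M[C]_(m, n)) :
  (forall l : C, `|l| = 1 -> l *: S = l^-1 *: T) -> T = 0.
Proof.
move=> E.
have n1 : `|(1 : C)| = 1 by rewrite normr1.
have ni : `|('i : C)| = 1 by apply/normC_eq1 => /=; rewrite expr0n expr1n add0r.
have A := E _ n1; have B := E _ ni.
have iV : ('i : C)^-1 = - 'i by rewrite conjc_circle//; apply: eqC; rewrite /= ?oppr0.
rewrite iV invr1 !scale1r in A B; rewrite A in B.
apply/matrixP => i j; have := congr1 (fun M : 'M[C]_(m, n) => M i j) B.
rewrite !mxE; case: (T i j) => a b; rewrite mulNr => -[].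
by rewrite !mul0r !mul1r => h1 h2; apply: eqC => /=; clear -h1 h2; lra.
Qed.

Section HarmonicLift.
Variables (n : nat) (U : set C) (F : C -> 'M[R]_(4 + n)).
Hypothesis oU : open U.
Hypothesis sF : smoothRmx U F.
Hypothesis FO : forall z, U z -> O1 (F z).
Hypothesis flat : forall l : C, `|l| = 1 -> flat_on U (alpha_z F l) (alpha_zbar F l).

Let V := (@toC R) @^-1` U.
Let oV : open V := open_toC oU.

Lemma lift_CkMx k : CkMx k V (fun w => cmx (F w)).
Proof.
move=> i j; split.
- have -> : rp (fun w => cmx (F w) i j) = (fun p => F (toC p) i j).
    by apply/funext => p; rewrite /rp mxE.
  exact: (lift_Ck sF).
- have -> : ip (fun w => cmx (F w) i j) = fun=> 0.
    by apply/funext => p; rewrite /ip mxE.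
  exact: Ck_cst.
Qed.

Lemma mc_CkMx k : CkMx k V (mc_z F).
Proof.
have H : CkMx k V (fun w => I1 C (4 + n) *m (cmx (F w))^T *m I1 C (4 + n) *m dz (fun w => cmx (F w)) w).
  apply: (CkMx_mul oV); last exact: (CkMx_dz oV (lift_CkMx k.+1)).
  apply: (CkMx_mul oV); last exact: CkMx_cst.
  by apply: (CkMx_mul oV (CkMx_cst _ _ _)); apply: CkMx_tr; exact: lift_CkMx.
apply: (CkMx_eq oV _ H) => p Vp.
by rewrite /mc_z (O1_invmx (cmx_O1 (FO Vp))).1.
Qed.

Lemma mcbar_CkMx k : CkMx k V (mc_zbar F).
Proof.
apply: (CkMx_eq oV _ (CkMx_conj oV (mc_CkMx k))) => p Vp.
exact: (mc_conj oU sF FO Vp).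
Qed.

Lemma dz_dlsubmx (A : C -> 'M[C]_(4 + n)) z :
  dlsubmx (dz A z) = dz (fun w => dlsubmx (A w)) z /\
  dlsubmx (dzbar A z) = dzbar (fun w => dlsubmx (A w)) z.
Proof.
by split; apply/matrixP => i j; rewrite !mxE; congr (_ * (_ + _));
  do ?congr (- _); do ?congr (_ * _); congr (_ _ z); apply/funext => w; rewrite !mxE.
Qed.

(* The lambda and 1/lambda terms of the flatness equation, separated by taking
   lambda = 1 and lambda = i. *)
Lemma harmonic_dl z : U z ->
  dzbar (fun w => dlsubmx (mc_z F w)) z =
  dlsubmx (mc_z F z) *m ulsubmx (mc_zbar F z) - drsubmx (mc_zbar F z) *m dlsubmx (mc_z F z).
Proof.
move=> Uz; have Vz : V (ofC z) by rewrite /V /= toCK.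
set P := mc_z F; set Q := mc_zbar F.
have dlC (A : C -> 'M[C]_(4 + n)) : CkMx 1 V A -> CkMx 1 V (fun w => dlsubmx (A w)).
  move=> HA i j; have -> : (fun w => dlsubmx (A w) i j) = (fun w => A w (rshift 4 i) (lshift n j)).
    by apply/funext => w; rewrite !mxE.
  exact: HA.
have HP := CkMx_has_WM oV Vz (dlC _ (mc_CkMx 1)).
have HQ := CkMx_has_WM oV Vz (dlC _ (mcbar_CkMx 1)).
set X := dz (fun w => dlsubmx (mc_zbar F w)) z in HQ.
set Y := dzbar (fun w => dlsubmx (mc_z F w)) z in HP.
set G := dlsubmx (P z) *m ulsubmx (Q z) - drsubmx (Q z) *m dlsubmx (P z).
set G' := drsubmx (P z) *m dlsubmx (Q z) - dlsubmx (Q z) *m ulsubmx (P z).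
have dlz l w : dlsubmx (alpha_z F l w) = l^-1 *: dlsubmx (P w).
  rewrite /alpha_z; have [-> ->] := kppart_block (mc_z F w).
  by rewrite scale_block_mx add_block_mx block_mxKdl addr0.
have dlzb l w : dlsubmx (alpha_zbar F l w) = l *: dlsubmx (Q w).
  rewrite /alpha_zbar; have [-> ->] := kppart_block (mc_zbar F w).
  by rewrite scale_block_mx add_block_mx block_mxKdl addr0.
have E l : `|l| = 1 -> l *: (X + G') = l^-1 *: (Y - G).
  move=> l1.
  have [D1e _] := dz_dlsubmx (alpha_zbar F l) z; have [_ D2e] := dz_dlsubmx (alpha_z F l) z.
  have e1 : dlsubmx (dz (alpha_zbar F l) z) = l *: X.
    rewrite D1e; have -> : (fun w => dlsubmx (alpha_zbar F l w)) = (fun w => l *: dlsubmx (Q w)).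
      by apply/funext => w; exact: dlzb.
    by have [] := has_WM_dz (has_WM_scale l HQ).
  have e2 : dlsubmx (dzbar (alpha_z F l) z) = l^-1 *: Y.
    rewrite D2e; have -> : (fun w => dlsubmx (alpha_z F l w)) = (fun w => l^-1 *: dlsubmx (P w)).
      by apply/funext => w; exact: dlz.
    by have [] := has_WM_dz (has_WM_scale l^-1 HP).
  have e3 : dlsubmx (alpha_z F l z *m alpha_zbar F l z) =
      l^-1 *: (dlsubmx (P z) *m ulsubmx (Q z)) + l *: (drsubmx (P z) *m dlsubmx (Q z)).
    exact: dl_mul_parts.
  have e4 : dlsubmx (alpha_zbar F l z *m alpha_z F l z) =
      l *: (dlsubmx (Q z) *m ulsubmx (P z)) + l^-1 *: (drsubmx (Q z) *m dlsubmx (P z)).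
    exact: dl_mul_parts.
  have h := dl_flat e1 e2 e3 e4 (flat l1 Uz).
  exact: flat_split h.
by have := circle_split E => /eqP; rewrite subr_eq0 => /eqP.
Qed.

End HarmonicLift.
End Propagation.

(** * Local continuation of the lightlike vector *)

Section LightlikeContinuation.
Variable R : realType.
Local Notation C := (Cplane R).

Lemma near_bounded V (f : C -> C) z0 : open V -> V (ofC z0) -> CkC 0 V f ->
  \forall z \near z0, N1 (f z) <= N1 (f z0) + 2.
Proof.
move=> oV Vz [h1 h2].
have [d1 d10 H1] := (cont2_epsP _ _).1 (Ck_cont h1 Vz) _ ltr01.
have [d2 d20 H2] := (cont2_epsP _ _).1 (Ck_cont h2 Vz) _ ltr01.
apply/near_box; exists (Num.min d1 d2); first by rewrite lt_min d10.
move=> z; rewrite !lt_min => /andP[a1 a2] /andP[b1 b2].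
have A := H1 _ _ a1 b1; have B := H2 _ _ a2 b2.
have Ez : toC (complex.Re z, complex.Im z) = z by case: (z).
rewrite /rp /ip Ez toCK in A B.
have A' := ler_normD (complex.Re (f z) - complex.Re (f z0)) (complex.Re (f z0)).
have B' := ler_normD (complex.Im (f z) - complex.Im (f z0)) (complex.Im (f z0)).
rewrite !subrK in A' B'.
by clear -A B A' B'; rewrite /N1; lra.
Qed.

Lemma near_bounded_mx V m n (A : C -> 'M[C]_(m, n)) z0 : open V -> V (ofC z0) -> CkMx 0 V A ->
  exists2 M : R, 0 <= M & \forall z \near z0, forall i j, N1 (A z i j) <= M.
Proof.
move=> oV Vz HA; pose b i j := N1 (A z0 i j) + 2.
have b0 i j : 0 <= b i j by rewrite addr_ge0// N1_ge0.
exists (\sum_i \sum_j b i j).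
  by apply: sumr_ge0 => i _; apply: sumr_ge0 => j _.
have F i j := near_bounded oV Vz (HA i j).
apply: (filterS _ (filter_forall _ (fun i => filter_forall _ (F i)))) => z h i j; apply: le_trans (h i j) _.
rewrite -/(b i j) (bigD1 i)//= (bigD1 j)//= -addrA lerDl addr_ge0//.
  by apply: sumr_ge0 => k _.
by apply: sumr_ge0 => k _; apply: sumr_ge0 => l _.
Qed.

Lemma N1_mulmx m n (A : 'M[C]_(m, n)) (x : 'cV[C]_n) (M : R) i :
  (forall i j, N1 (A i j) <= M) -> N1 ((A *m x) i 0) <= M * \sum_k N1 (x k 0).
Proof.
move=> HA; rewrite mxE; apply: le_trans (N1_sum _ _) _; rewrite mulr_sumr.
apply: ler_sum => k _; apply: le_trans (N1M _ _) _.
by apply: ler_wpM2r; [exact: N1_ge0|exact: HA].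
Qed.

Lemma has_W_near0 (f : C -> C) z p q : has_W f z p q -> (\forall w \near z, f w = 0) ->
  p = 0 /\ q = 0.
Proof.
move=> [/lin_approx_ddf[_ h1 h2] /lin_approx_ddf[_ h3 h4]] /near_box[d d0 Hd].
have Z (g : C -> R) : (g 0 = 0) -> forall a, lin_approx (fun p => g (f (toC p))) (ofC z) 0 0 /\ a = a :> R.
  move=> g0 a; split=> //; apply: (lin_approx_eq d0 _ (lin_approx_cst (ofC z) 0)) => h k hd kd.
  by rewrite Hd ?g0//= addrC addKr.
have [/lin_approx_ddf[_ k1 k2] _] := Z (@complex.Re R) erefl 0.
have [/lin_approx_ddf[_ k3 k4] _] := Z (@complex.Im R) erefl 0.
rewrite [D1 _ _]k1 in h1; rewrite [D2 _ _]k2 in h2; rewrite [D1 _ _]k3 in h3; rewrite [D2 _ _]k4 in h4.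
rewrite !ReImE in h1 h2 h3 h4.
by split; apply: eqC; rewrite /=; clear -h1 h2 h3 h4; lra.
Qed.

Lemma has_WM_usub m1 m2 n (f : C -> 'M[C]_(m1 + m2, n)) z A B : has_WM f z A B ->
  has_WM (fun w => usubmx (f w)) z (usubmx A) (usubmx B).
Proof.
move=> h i j; have -> : (fun w => usubmx (f w) i j) = (fun w => f w (lshift m2 i) j).
  by apply/funext => w; rewrite mxE.
by rewrite [usubmx A i j]mxE [usubmx B i j]mxE.
Qed.

Lemma has_WM_dsub m1 m2 n (f : C -> 'M[C]_(m1 + m2, n)) z A B : has_WM f z A B ->
  has_WM (fun w => dsubmx (f w)) z (dsubmx A) (dsubmx B).
Proof.
move=> h i j; have -> : (fun w => dsubmx (f w) i j) = (fun w => f w (rshift m1 i) j).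
  by apply/funext => w; rewrite mxE.
by rewrite [dsubmx A i j]mxE [dsubmx B i j]mxE.
Qed.

Lemma neg_col_mx m1 m2 n (A : 'M[C]_(m1, n)) (B : 'M[C]_(m2, n)) :
  usubmx (- col_mx A B) = - A /\ dsubmx (- col_mx A B) = - B.
Proof. by rewrite opp_col_mx col_mxKu col_mxKd. Qed.

Section Lift.
Variables (n : nat) (U : set C) (F : C -> 'M[R]_(4 + n)).
Hypothesis oU : open U.
Hypothesis sF : smoothRmx U F.
Hypothesis FO : forall z, U z -> O1 (F z).
Hypothesis flat : forall l : C, `|l| = 1 -> flat_on U (alpha_z F l) (alpha_zbar F l).

Let V := (@toC R) @^-1` U.
Let oV : open V := open_toC oU.

Let P := mc_z F.
Let Q := mc_zbar F.
Let J := I1 C (4 + n).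

(* F^{-1} v0 *)
Definition pulled z : 'cV[C]_(4 + n) := J *m (cmx (F z))^T *m J *m v0 C n.
Let w1 z : 'cV[C]_4 := usubmx (pulled z).
Let w2 z : 'cV[C]_n := dsubmx (pulled z).
Let s z : 'cV[C]_n := dlsubmx (P z) *m w1 z.

Lemma mcbar_so z : U z -> J *m Q z + (Q z)^T *m J = 0.
Proof.
move=> Uz; have := congr1 (map_mx (@conjc R)) (mc_so oU sF FO Uz).
rewrite (map_mxD (@conjc R)) (conj_mulmx _ (mc_z F z)) (conj_mulmx (mc_z F z)^T) -matrix.map_trmx (mc_conj oU sF FO Uz).
by rewrite /J -(cmx_I1 R (4 + n)) conj_cmx (map_mx0 (@conjc R)).
Qed.

(** With [A] the metric and [B] a frame, [A *m B^T *m A] is the inverse frame, and this is the rule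
    [d (B^-1) = - X B^-1] for [dB = B X]. *)
Lemma so_flip N (A B X : 'M[C]_N) : A *m A = 1%:M -> A *m X + X^T *m A = 0 ->
  A *m (B *m X)^T *m A = - (X *m (A *m B^T *m A)).
Proof.
move=> AA h; have E : X^T *m A = - (A *m X) by apply/eqP; rewrite -addr_eq0 addrC h.
have E2 : A *m X^T = - (X *m A).
  have := congr1 (fun M => A *m M *m A) E.
  rewrite mulmxN mulNmx !mulmxA AA mul1mx -!mulmxA AA mulmx1 => <-.
  by [].
by rewrite trmx_mul !mulmxA E2 !mulNmx.
Qed.

Lemma pulled_has_WM z : U z -> has_WM pulled z (- (P z *m pulled z)) (- (Q z *m pulled z)).
Proof.
move=> Uz; have [E1 E2] := mc_lift FO Uz.
have H := has_WM_mulr (v0 C n) (has_WM_mulr J (has_WM_mull J (has_WM_tr (lift_has_WM oU sF Uz)))).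
apply: eq_has_WM H.
- rewrite E1 (so_flip _ (I1_sq _ _) (mc_so oU sF FO Uz)) mulNmx /pulled.
  by rewrite -/J !mulmxA.
- rewrite E2 (so_flip _ (I1_sq _ _) (mcbar_so Uz)) mulNmx /pulled.
  by rewrite -/J !mulmxA.
Qed.

Lemma pulled_real z : map_mx conjc (pulled z) = pulled z.
Proof.
rewrite /pulled !conj_mulmx -matrix.map_trmx conj_cmx /J -(cmx_I1 R (4 + n)) !conj_cmx; congr (_ *m _).
apply/matrixP => i j; rewrite /v0 !mxE; case: (fintype.split i) => k; rewrite !mxE ?conjc0//.
by case: ifP => _; rewrite ?conjc1 ?conjc0.
Qed.

Lemma pulled_low z : w2 z = (cmx ((v4 R)^T *m I1 R 4 *m ursubmx (F z)))^T.
Proof.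
have E : pulled z = J *m ((v0 C n)^T *m J *m cmx (F z))^T.
  by rewrite /pulled !trmx_mul trmxK I1_tr !mulmxA.
rewrite /w2 E v0_I1 /J I1_block -[in LHS](hsubmxK (usubmx (cmx (F z)))) mul_mx_row tr_row_mx.
rewrite mul_block_col !mul0mx !mul1mx add0r col_mxKd; congr (_^T).
apply/rowP => j; rewrite v4_I1 [RHS]mxE v4_I1 !mxE.
by rewrite rmorphB.
Qed.

Lemma conj_dlsubmx (A : 'M[C]_(4 + n)) : map_mx conjc (dlsubmx A) = dlsubmx (map_mx conjc A).
Proof. by apply/matrixP => i j; rewrite !mxE. Qed.

Lemma s_conj z : U z -> dlsubmx (Q z) *m w1 z = map_mx conjc (s z).
Proof.
move=> Uz; rewrite /s conj_mulmx conj_dlsubmx (mc_conj oU sF FO Uz); congr (_ *m _).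
by rewrite /w1 -{1}(pulled_real z); apply/matrixP => i j; rewrite !mxE.
Qed.

Lemma Q_pulled z : Q z *m pulled z =
  col_mx (ulsubmx (Q z) *m w1 z + ursubmx (Q z) *m w2 z)
         (dlsubmx (Q z) *m w1 z + drsubmx (Q z) *m w2 z).
Proof.
by rewrite -[in LHS](submxK (Q z)) -[in LHS](vsubmxK (pulled z)) mul_block_col.
Qed.

(** In the derivative of [s], the [w1] terms given by flatness cancel those from the derivative of
    [w1]. In the derivative of [w2], [w1] enters only through [conjc s], because [pulled] is real
    and the two coefficient blocks are conjugate. The system in [(w2, s)] is thus closed, though
    only real linear, which suffices for an inequality. *)
Lemma w_has_WM z : U z ->
  (exists X, has_WM w2 z X (- (map_mx conjc (s z) + drsubmx (Q z) *m w2 z))) /\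
  (exists X, has_WM s z X (- (drsubmx (Q z) *m s z + (dlsubmx (P z) *m ursubmx (Q z)) *m w2 z))).
Proof.
move=> Uz; have Hp := eq_has_WM erefl (congr1 -%R (Q_pulled z)) (pulled_has_WM Uz).
have [eu ed] := neg_col_mx (ulsubmx (Q z) *m w1 z + ursubmx (Q z) *m w2 z)
  (dlsubmx (Q z) *m w1 z + drsubmx (Q z) *m w2 z).
have H1 := eq_has_WM erefl eu (has_WM_usub Hp).
have H2 := eq_has_WM erefl ed (has_WM_dsub Hp).
split.
  by eexists; rewrite -(s_conj Uz); exact: H2.
have Vz : V (ofC z) by rewrite /V /= toCK.
have HP : has_WM (fun w => dlsubmx (P w)) z (dz (fun w => dlsubmx (P w)) z) (dzbar (fun w => dlsubmx (P w)) z).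
  apply: (CkMx_has_WM oV Vz) => i j.
  have -> : (fun w => dlsubmx (P w) i j) = (fun w => P w (rshift 4 i) (lshift n j)).
    by apply/funext => w; rewrite !mxE.
  exact: (mc_CkMx oU sF FO).
eexists; apply: eq_has_WM (has_WM_mul HP H1); first reflexivity.
rewrite (harmonic_dl oU sF FO flat Uz) -/P -/Q /s -/(w1 z).
move: (dlsubmx (P z)) (ulsubmx (Q z)) (drsubmx (Q z)) (ursubmx (Q z)) (w1 z) (w2 z) => A B D E x y.
rewrite mulmxBl mulmxN mulmxDr !mulmxA !opprD.
by move: (A *m B *m x) (D *m A *m x) (A *m E *m y) => a d e; rewrite addrACA subrr add0r.
Qed.

Definition lightlike_part z := (v4 R)^T *m I1 R 4 *m ursubmx (F z).

Lemma w2_eq0 z : w2 z = 0 <-> lightlike_part z = 0.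
Proof.
rewrite pulled_low -/(lightlike_part z); split=> [h|->]; last first.
  by apply/matrixP => i j; rewrite !mxE rmorph0.
apply/rowP => j; have := congr1 (fun M : 'cV[C]_n => M j 0) h; rewrite !mxE.
by move/(congr1 (@complex.Re R)).
Qed.

Lemma w_CkMx : CkMx 2 V w2 /\ CkMx 2 V s.
Proof.
have Hp : CkMx 2 V pulled.
  apply: (CkMx_mul oV); last exact: CkMx_cst.
  apply: (CkMx_mul oV); last exact: CkMx_cst.
  by apply: (CkMx_mul oV (CkMx_cst _ _ _)); apply: CkMx_tr; exact: lift_CkMx.
have H1 : CkMx 2 V w1.
  move=> i j; have -> : (fun w => w1 w i j) = (fun w => pulled w (lshift n i) j).
    by apply/funext => w; rewrite mxE.
  exact: Hp.
split.
  move=> i j; have -> : (fun w => w2 w i j) = (fun w => pulled w (rshift 4 i) j).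
    by apply/funext => w; rewrite mxE.
  exact: Hp.
apply: (CkMx_mul oV) H1 => i j.
have -> : (fun w => dlsubmx (P w) i j) = (fun w => P w (rshift 4 i) (lshift n j)).
  by apply/funext => w; rewrite !mxE.
exact: (mc_CkMx oU sF FO).
Qed.

Let coef1 z := drsubmx (Q z).
Let coef2 z := dlsubmx (P z) *m ursubmx (Q z).

Lemma coef_CkMx : CkMx 0 V coef1 /\ CkMx 0 V coef2.
Proof.
split.
  move=> i j; have -> : (fun w => coef1 w i j) = (fun w => Q w (rshift 4 i) (rshift 4 j)).
    by apply/funext => w; rewrite !mxE.
  exact: (mcbar_CkMx oU sF FO).
apply: (CkMx_mul oV) => i j.
  have -> : (fun w => dlsubmx (P w) i j) = (fun w => P w (rshift 4 i) (lshift n j)).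
    by apply/funext => w; rewrite !mxE.
  exact: (mc_CkMx oU sF FO).
have -> : (fun w => ursubmx (Q w) i j) = (fun w => Q w (lshift n i) (rshift 4 j)).
  by apply/funext => w; rewrite !mxE.
exact: (mcbar_CkMx oU sF FO).
Qed.

(* (w2, s) satisfies |dbar (w2, s)| <= K |(w2, s)|. *)
Lemma lightlike_local_continuation z0 : U z0 -> exists2 r : R, 0 < r &
  (forall z : C, `|z - z0| < r%:C -> U z) /\
  forall c : C, `|c - z0| < r%:C -> (\forall z \near c, lightlike_part z = 0) ->
    forall z : C, `|z - z0| < r%:C -> lightlike_part z = 0.
Proof.
move=> Uz0; have Vz0 : V (ofC z0) by rewrite /V /= toCK.
have [C1 C2] := coef_CkMx.
have [M1 M10 B1] := near_bounded_mx oV Vz0 C1.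
have [M2 M20 B2] := near_bounded_mx oV Vz0 C2.
have nU : \forall z \near z0, U z by exact: open_nbhs_nbhs.
have : \forall z \near z0, [/\ U z, forall i j, N1 (coef1 z i j) <= M1 & forall i j, N1 (coef2 z i j) <= M2].
  by near=> z; split; near: z.
move=> /nbhs_ballP[_ /posC[r r0 ->] Hr].
have {}Hr z : `|z - z0| < r%:C -> [/\ U z, forall i j, N1 (coef1 z i j) <= M1 & forall i j, N1 (coef2 z i j) <= M2].
  by move=> zr; apply: Hr; rewrite /ball /= distrC.
(* Any [c] in the ball of radius [r / 3] can serve as centre: its ball of radius [2 * r / 3]
   contains that ball and stays in the region where the coefficients are bounded. *)
have r3 : 0 < r / 3 by rewrite divr_gt0.
exists (r / 3) => //.
have sub (c z : C) : `|c - z0| < (r / 3)%:C -> `|z - c| < (2 * r / 3)%:C -> `|z - z0| < r%:C.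
  move=> h1 h2; have -> : z - z0 = (z - c) + (c - z0) by rewrite subrKA.
  apply: le_lt_trans (ler_normD _ _) _; apply: lt_le_trans (ltrD h2 h1) _.
  by rewrite -rmorphD lecE /= eqxx /=; lra.
have c0 (c : C) : `|c - c| < (2 * r / 3)%:C by rewrite subrr normr0 posC_gt0; lra.
split; first by move=> z zr; have [] := Hr z (sub z z zr (c0 z)).
move=> c cz L0 z zz.
pose u (i : 'I_n + 'I_n) z := match i with inl j => w2 z j 0 | inr j => s z j 0 end.
pose q (i : 'I_n + 'I_n) z := match i with
  | inl j => (- (map_mx conjc (s z) + drsubmx (Q z) *m w2 z)) j 0
  | inr j => (- (drsubmx (Q z) *m s z + (dlsubmx (P z) *m ursubmx (Q z)) *m w2 z)) j 0 end.
have r23 : 0 < 2 * r / 3 by lra.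
pose K := M1 + M2 + 1; have K0 : 0 <= K by rewrite addr_ge0// addr_ge0.
have sumE z' : \sum_j N1 (u j z') = \sum_j N1 (w2 z' j 0) + \sum_j N1 (s z' j 0).
  by rewrite big_sumType.
have H := @unique_continuation_dbar R ('I_n + 'I_n)%type u q c (2 * r / 3) K r23 K0.
have main : forall z, `|z - c| < (2 * r / 3)%:C -> forall i, u i z = 0.
  apply: H.
  - move=> i; have SV : [set p | `|toC p - c| < (2 * r / 3)%:C] `<=` V.
      by move=> p /= pc; have [] := Hr _ (sub c _ cz pc).
    have [D1 D2] := w_CkMx; case: i => j /=.
    + by have [h1 h2] := D1 j 0; split; exact: Ck_sub SV _.
    + by have [h1 h2] := D2 j 0; split; exact: Ck_sub SV _.
  - move=> z' zc; have [Uz _ _] := Hr _ (sub c _ cz zc).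
    have [[X1 H1] [X2 H2]] := w_has_WM Uz; case=> j /=.
    + by exists (X1 j 0); exact: H1.
    + by exists (X2 j 0); exact: H2.
  - move=> z' zc; have [Uz b1 b2] := Hr _ (sub c _ cz zc); rewrite sumE.
    set S1 := \sum_j N1 (w2 z' j 0); set S2 := \sum_j N1 (s z' j 0).
    have S10 : 0 <= S1 by apply: sumr_ge0 => j _; exact: N1_ge0.
    have S20 : 0 <= S2 by apply: sumr_ge0 => j _; exact: N1_ge0.
    have p1 := mulr_ge0 M10 S10; have p2 := mulr_ge0 M10 S20.
    have p3 := mulr_ge0 M20 S10; have p4 := mulr_ge0 M20 S20.
    case=> j /=; rewrite mxE N1N mxE; apply: le_trans (N1D _ _) _.
    + have A := N1_mulmx (w2 z') j b1; rewrite -/S1 in A.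
      have B : N1 (map_mx conjc (s z') j 0) <= S2.
        rewrite mxE N1J /S2 (bigD1 j)//= lerDl.
        by apply: sumr_ge0 => k _; exact: N1_ge0.
      by apply: le_trans (lerD B A) _; rewrite /K !mulrDl !mulrDr !mul1r; clear -S10 S20 p1 p2 p3 p4; lra.
    + have A := N1_mulmx (s z') j b1; rewrite -/S2 in A.
      have B := N1_mulmx (w2 z') j b2; rewrite -/S1 in B.
      by apply: le_trans (lerD A B) _; rewrite /K !mulrDl !mulrDr !mul1r; clear -S10 S20 p1 p2 p3 p4; lra.
  (* Near [c] the derivatives of [w2] vanish along with [w2], and its equation then forces
     [s = 0]. *)
  - have nz : \forall z \near c, w2 z = 0.
      by apply: filterS L0 => z' /w2_eq0.
    have nn : \forall z \near c, \forall w \near z, w2 w = 0 by exact: near_join.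
    have nUc : \forall z \near c, U z.
      by apply: open_nbhs_nbhs; split=> //; have [] := Hr c (sub c c cz (c0 c)).
    near=> z'.
    have Uz : U z' by near: z'.
    have wz : w2 z' = 0 by near: z'.
    have wn : \forall w \near z', w2 w = 0 by near: z'.
    have [[X1 H1] _] := w_has_WM Uz.
    case=> j /=; first by rewrite wz mxE.
    have [] := has_W_near0 (H1 j 0) _.
      by apply: filterS wn => w ->; rewrite mxE.
    move=> _; rewrite wz mulmx0 addr0 !mxE => /eqP; rewrite oppr_eq0 => /eqP h.
    by rewrite -[LHS]conjcKK h conjc0.
apply/w2_eq0; apply/matrixP => j k; rewrite ord1 [RHS]mxE; apply: (main z _ (inl j)).
have -> : z - c = (z - z0) - (c - z0) by rewrite opprB addrA subrK.
apply: le_lt_trans (ler_normB _ _) _; apply: lt_le_trans (ltrD zz cz) _.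
by rewrite -rmorphD lecE /= eqxx /=; lra.
Unshelve. all: by end_near.
Qed.

End Lift.
End LightlikeContinuation.

(** * From the base point to the whole domain *)

Section Propagation.
Variable R : realType.
Local Notation C := (Cplane R).

(** A one-dimensional use of [bisection], with a dummy second coordinate: the implication from the
    point at [a] to the point at [a + s] composes over two halves and holds for short steps. *)
Lemma segment_propagate (Z : C -> Prop) (z0 z : C) :
  (forall t : R, 0 <= t <= 1 -> exists2 r : R, 0 < r & forall c w : C,
     `|c - (z0 + t%:C * (z - z0))| < r%:C -> `|w - (z0 + t%:C * (z - z0))| < r%:C -> Z c -> Z w) ->
  Z z0 -> Z z.
Proof.
move=> loc Z0; pose g (t : R) : C := z0 + t%:C * (z - z0).
have H : (fun a (_ s : R) => Z (g a) -> Z (g (a + s))) 0 0 1.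
  apply: (@bisection _ (fun a (_ s : R) => Z (g a) -> Z (g (a + s))) 0 0 1 1) => //=.
    move=> a _ s _ _ _ _ _ h; have h1 := h false false; have h2 := h true false.
    move: h1 h2; rewrite /= !mul0r !mul1r !mulr1 addr0 -addrA -splitr => h1 h2 h3.
    exact/h2/h1.
  move=> x y0 /andP[x0 x1] _; rewrite add0r in x1.
  have [|r r0 Hr] := loc x; first by rewrite x0.
  pose M := complex.Re `|z - z0| + 1.
  have zM : `|z - z0| < M%:C by rewrite [X in X < _](_ : _ = (complex.Re `|z - z0|)%:C) ?ltcR ?ltrDl// normc_def.
  have M0 : 0 < M by rewrite -ltcR (le_lt_trans (normr_ge0 _) zM).
  exists (r / M); first by rewrite divr_gt0.
  have close a : `|a - x| < r / M -> `|g a - g x| < r%:C.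
    move=> ax; have -> : g a - g x = (a - x)%:C * (z - z0).
      by rewrite /g rmorphB mulrBl opprD addrACA subrr add0r.
    rewrite normrM normc_def /= expr0n addr0 sqrtr_sqr.
    have := ax; rewrite ltr_pdivlMr// => ax'.
    apply: le_lt_trans (_ : `|a - x|%:C * M%:C < _).
      by apply: ler_wpM2l; [rewrite lecR|exact: ltW].
    by rewrite -rmorphM ltcR.
  move=> a _ s s0 sd /andP[ax xa] _; apply: Hr; apply: close.
    by rewrite ler0_norm ?opprB; lra.
  by rewrite ger0_norm; lra.
by move: H; rewrite /= /g add0r mul0r addr0 mul1r addrC subrK => /(_ Z0).
Qed.

Lemma near_ball (c z : C) (r : R) : `|c - z| < r%:C -> \forall t \near c, `|t - z| < r%:C.
Proof.
move=> h; apply/nbhs_ballP; exists (r%:C - `|c - z|); first by rewrite /= subr_gt0.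
move=> t; rewrite /ball /= distrC => tc; rewrite -(subrK c t) -addrA.
by apply: le_lt_trans (ler_normD _ _) _; rewrite -ltrBrDr.
Qed.

Lemma cont_punctured (h : C -> R) (z : C) : {for ofC z, continuous (fun p => h (toC p))} ->
  (\forall w \near z, w != z -> h w = 0) -> h z = 0.
Proof.
move=> hc /near_box[d d0 Hd]; apply: contrapT => /eqP hz.
have [|d' d'0 Hd'] := (cont2_epsP _ _).1 hc `|h z|; first by rewrite normr_gt0.
pose t := Num.min d d' / 2; have t0 : 0 < t by rewrite divr_gt0// lt_min d0.
have td : t < d by rewrite /t; have m1 : Num.min d d' <= d; [by rewrite ge_min lexx|clear -d0 m1; lra].
have td' : t < d' by rewrite /t; have m1 : Num.min d d' <= d'; [by rewrite ge_min lexx orbT|clear -d'0 m1; lra].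
have := Hd' (complex.Re z + t) (complex.Im z); rewrite /= addrC addKr subrr normr0.
rewrite addrC gtr0_norm// => /(_ td' d'0).
rewrite (Hd (toC (complex.Re z + t, complex.Im z))) /=.
- by rewrite toCK addr0 normrN ltxx.
- by rewrite addrC addKr gtr0_norm.
- by rewrite subrr normr0.
- by apply/eqP => /(congr1 (@complex.Re R)) /= /eqP; rewrite -subr_eq0 addrC addKr gt_eqF.
Qed.

Variable n : nat.

Lemma one_Ksub : Ksub (1%:M : 'M[R]_(4 + n)).
Proof.
exists 1%:M, 1%:M; split; last by rewrite -scalar_mx_block.
  by apply: connected_component_refl; split; rewrite /O1 /= ?det1// trmx1 mul1mx mulmx1.
by split; rewrite ?det1// trmx1 mulmx1.
Qed.

(** [v0] lies in the span of the first four columns exactly when the last [n] entries of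
    [G^-1 *m v0] vanish, and by [O1 G] these are the Lorentz products of [v0] with the last [n]
    columns. *)
Lemma subspace_v0 (G : 'M[R]_(4 + n)) : O1 G ->
  subspace_of (Kcoset G) (v0 R n) <-> (v4 R)^T *m I1 R 4 *m ursubmx G = 0.
Proof.
move=> oG; have E : (v4 R)^T *m I1 R 4 *m ursubmx G = rsubmx ((v0 R n)^T *m I1 R (4 + n) *m G).
  by rewrite v0_I1 -[in RHS](hsubmxK (usubmx G)) mul_mx_row row_mxKr.
rewrite E; split.
  move=> [_ [c [[_ [A [B [_ _ ->]]] <-] ->]]].
  have -> : lsubmx (G *m block_mx A 0 0 B) *m c = G *m col_mx (A *m c) 0.
    transitivity (G *m (block_mx A 0 0 B *m col_mx c 0)).
      by rewrite mulmxA -[in RHS](hsubmxK (G *m _)) mul_row_col mulmx0 addr0.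
    by rewrite mul_block_col !mulmx0 mul0mx !addr0.
  rewrite trmx_mul -!mulmxA (mulmxA (G^T)) oG I1_block tr_col_mx trmx0 mul_row_block.
  by rewrite row_mxKr mulmx0 mul0mx addr0.
set X := (v0 R n)^T *m _ *m _ => h; exists G, (I1 R 4 *m (lsubmx X)^T); split.
  by exists 1%:M; [exact: one_Ksub|rewrite mulmx1].
transitivity (G *m (I1 R (4 + n) *m X^T)).
  rewrite /X !trmx_mul trmxK I1_tr !mulmxA -(mulmxA G) -(mulmxA G).
  by have [_ ->] := O1_inv oG; rewrite mul1mx.
rewrite -[in LHS](hsubmxK X) h tr_row_mx trmx0 I1_block mul_block_col !mulmx0 mul0mx !addr0.
by rewrite -[in LHS](hsubmxK G) mul_row_col mulmx0 addr0.
Qed.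

Lemma lightlike_partE (F : C -> 'M[R]_(4 + n)) z j :
  lightlike_part F z 0 j = F z (lshift n 1) (rshift 4 j) - F z (lshift n 0) (rshift 4 j).
Proof. by rewrite /lightlike_part v4_I1 !mxE. Qed.

Variables (D : set (Rsphere R)) (FF : Rsphere R -> set 'M[R]_(4 + n)).
Hypothesis harm : Defs.harmonic D FF.

(** Unique continuation transports vanishing on a neighbourhood, not at a point, so this is the
    property moved along segments. *)
Let Zv (c : C) := \forall z \near c, subspace_of (FF (Some z)) (v0 R n).

Lemma lightlike_local (z : C) : D (Some z) -> exists2 r : R, 0 < r & forall c w : C,
  `|c - z| < r%:C -> `|w - z| < r%:C -> Zv c -> Zv w.
Proof.
move=> Dz; have [smo flat] := harm.
have [U [F [HF Uz]]] := smo false z Dz; have [oU UD sF HU] := HF.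
have FO w : U w -> O1 (F w) by move=> /HU[/SO1plus_O1].
have [r r0 [H1 H2]] := lightlike_local_continuation oU sF FO (flat _ _ _ HF) Uz.
have S w : U w -> subspace_of (FF (Some w)) (v0 R n) <-> lightlike_part F w = 0.
  by move=> Uw; have [_ e] := HU _ Uw; rewrite [FF _]e; exact: subspace_v0 (FO _ Uw).
exists r; first exact: r0.
move=> c w cz wz Zc.
have H3 : forall w, `|w - z| < r%:C -> lightlike_part F w = 0.
  apply: (H2 c cz); have nU : \forall z \near c, U z by apply: open_nbhs_nbhs; split=> //; exact: H1.
  by near=> t; apply: (S _ _).1; near: t.
have nb := near_ball wz.
by apply: filterS nb => t tz; apply: (S _ _).2; [exact: H1|exact: H3].
Unshelve. all: by end_near.
Qed.

Hypothesis hD : is_sphere_plane_or_disk D.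

Lemma domain_segment (z : C) (t : R) : 0 <= t <= 1 -> D (Some z) -> D (Some (0 + t%:C * (z - 0) : C)).
Proof.
rewrite add0r subr0 => /andP[t0 t1]; case: hD => ->.
- by [].
- by move=> _; exists (t%:C * z).
- move=> [w /= w1 [<-]]; exists (t%:C * w) => //=; rewrite normrM.
  apply: le_lt_trans w1; rewrite ler_piMl// normc_def /= expr0n addr0 sqrtr_sqr ger0_norm//.
  by rewrite lecE /= eqxx.
Qed.

(** The finite part of each of the three domains is star-shaped about 0; the point at infinity is
    reached by continuity of a lift in the chart [1 / z]. *)
Lemma contains_v0 : Zv 0 -> forall q, D q -> subspace_of (FF q) (v0 R n).
Proof.
move=> Z0; have fin z : D (Some z) -> Zv z.
  move=> Dz; apply: (segment_propagate _ Z0) => t t01.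
  have [r r0 Hr] := lightlike_local (domain_segment t01 Dz).
  by exists r.
case=> [z /fin /nbhs_singleton//|Dn].
have [smo _] := harm; have D0 : D (chart true 0) by rewrite /= eqxx.
have [U [F [[oU UD sF HU] U0]]] := smo true 0 D0.
have FO w : U w -> O1 (F w) by move=> /HU[/SO1plus_O1].
have := (HU _ U0).2; rewrite /= eqxx => ->; apply: (subspace_v0 (FO _ U0)).2.
have Z w : U w -> w != 0 -> lightlike_part F w = 0.
  move=> Uw w0; have [_ e] := HU _ Uw; apply: (subspace_v0 (FO _ Uw)).1; rewrite -e.
  have := UD _ Uw; rewrite /= (negbTE w0) => Dw.
  exact: nbhs_singleton (fin _ Dw).
apply/rowP => j; rewrite [RHS]mxE -/(lightlike_part F 0) lightlike_partE.
have cF i k : {for ofC (0 : C), continuous (fun p => F (toC p) i k)}.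
  by apply: (Ck_cont (smooth_on_Ck 0 (sF i k))); rewrite /= toCK.
have := cont_punctured (h := fun w => F w (lshift n 1) (rshift 4 j) - F w (lshift n 0) (rshift 4 j)) (continuousB (cF _ _) (cF _ _)).
apply; have nU : \forall w \near (0 : Cplane R), U w by exact: (open_nbhs_nbhs (conj oU U0)).
apply: filterS nU => w Uw w0; have /rowP/(_ j) := Z w Uw w0.
by rewrite [X in _ = X -> _]mxE lightlike_partE.
Qed.

End Propagation.

Section LightlikeVector.
Variables (R : realType) (n : nat).
Local Notation C := (Cplane R).

Lemma Bhat_rows01 (f : nat -> nat -> Rsphere R -> C) q j :
  Bhat n f q 1 j = Bhat n f q 0 j.
Proof. by rewrite !mxE. Qed.

(** The first two rows of [Bhat] agree, so their difference, the row [v4^T *m I1 *m Bhat], is zero;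
    this settles the lower left block, and the upper right block meets only the zero part of
    [v0]. *)
Lemma potential_v0 (f : nat -> nat -> Rsphere R -> C) q :
  potential_mx (Bhat n f q) *m v0 C n = 0.
Proof.
rewrite /potential_mx /v0 mul_block_col !mul0mx mulmx0 !addr0 -[0 in RHS]col_mx0 mulNmx.
congr col_mx; apply/colP => j; rewrite [LHS]mxE [RHS]mxE.
have := v4_I1 (Bhat n f q) j; rewrite Bhat_rows01 subrr => /eqP; rewrite -oppr_eq0 => /eqP <-; congr (- _).
have e : (Bhat n f q)^T *m I1 C 4 *m v4 C = ((v4 C)^T *m I1 C 4 *m Bhat n f q)^T.
  by rewrite !trmx_mul trmxK I1_tr mulmxA.
by rewrite e [LHS]mxE.
Qed.

Lemma v0_neq0 : v0 R n != 0.
Proof.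
apply/eqP => /(congr1 (fun M : 'cV[R]_(4 + n) => M (lshift n 0) 0)).
by rewrite col_mxEu !mxE /= => /eqP; rewrite oner_eq0.
Qed.

Lemma v0_null : (v0 R n)^T *m I1 R (4 + n) *m v0 R n = 0.
Proof.
rewrite /v0 I1_block tr_col_mx trmx0 mul_row_block !mul0mx !mulmx0 !addr0 mul_row_col mulmx0 addr0.
by apply/rowP => j; rewrite (ord1 j) v4_I1 !mxE /= subrr.
Qed.

Variables (D : set (Rsphere R)) (FF : Rsphere R -> set 'M[R]_(4 + n)).
Variable f : nat -> nat -> Rsphere R -> C.
Hypothesis harm : Defs.harmonic D FF.
Hypothesis hD : is_sphere_plane_or_disk D.
Hypothesis heta : is_normalized_potential D FF (fun q => potential_mx (Bhat n f q)).

Lemma v0_everywhere q : D q -> subspace_of (FF q) (v0 R n).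
Proof.
move: q; apply: (contains_v0 harm hD).
have [_ [U [F0 [F [Fm [Fp [[_ U0 lF0 F00] HF HFmp HFm]]]]]]] := heta.
have [oU UD sF0 F0G] := lF0.
have F0O z : U z -> O1 (F0 z) by move=> /F0G[/SO1plus_O1].
have [r r0 Hr] := lightlike_near_base oU U0 sF0 F0O F00 HF HFmp HFm (fun z => potential_v0 f (Some z)).
have z0 : `|(0 : C) - 0| < r%:C by rewrite subr0 normr0 posC_gt0.
apply: filterS (near_ball z0) => z; rewrite subr0 => zr.
have [Uz e] := Hr z zr; have [_ ->] := F0G z Uz.
exact: (subspace_v0 (F0O z Uz)).2.
Qed.

Lemma constant_lightlike : contains_constant_lightlike D FF.
Proof. by exists (v0 R n); split; [exact: v0_neq0|exact: v0_null|exact: v0_everywhere]. Qed.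

End LightlikeVector.

(** * Conformal coordinates and stereographic projection *)

Section Charts.
Variable R : realType.
Local Notation C := (Cplane R).
Local Notation S := (Rsphere R).

Lemma chart_swap b (w : C) : w != 0 -> chart b w = chart (~~ b) (w^-1 : C) :> S.
Proof.
move=> w0; case: b => /=; first by rewrite (negbTE w0).
by rewrite invr_eq0 (negbTE w0) invrK.
Qed.

Lemma chart_inj b (w w' : C) : chart b w = chart b w' :> S -> w = w'.
Proof.
case: b => /=; last by case.
by case: eqP => [->|_]; case: eqP => // _ [] /invr_inj.
Qed.

Lemma chart_eq_swap b (w w' : C) : chart b w = chart (~~ b) w' :> S -> w != 0 /\ w' = w^-1.
Proof.
case: b => /=; first by case: eqP => // _ [->].
by case: eqP => // /eqP w0 [->]; rewrite invr_eq0 invrK w0.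
Qed.

Lemma near_neq (w : C) : w != 0 -> \forall t \near w, t != 0.
Proof.
rewrite -normr_gt0 => w0; have [r _ e] := posC w0; have ww : `|w - w| < r%:C by rewrite subrr normr0 -e.
apply: filterS (near_ball ww) => t; rewrite -e => tw; apply/eqP => t0.
by move: tw; rewrite t0 sub0r normrN ltxx.
Qed.

Lemma compact_box (M : R) : compact [set z : C | `|complex.Re z| <= M /\ `|complex.Im z| <= M].
Proof.
have -> : [set z : C | `|complex.Re z| <= M /\ `|complex.Im z| <= M] =
    @toC R @` (`[- M, M] `*` `[- M, M]).
  apply/seteqP; split=> [z /= [h1 h2]|_ [[x y] /= [h1 h2] <-]] /=.
    by exists (ofC z); rewrite ?toCK//=; rewrite !in_itv /= -!ler_norml.
  by move: h1 h2; rewrite !in_itv /= -!ler_norml.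
apply: continuous_compact; last by apply: compact_setX; exact: segment_compact.
apply: continuous_subspaceT => p A /near_box[d d0 Hd].
apply/nbhs_ballP; exists d => // q [/= h1 h2]; apply: Hd => /=.
  by rewrite distrC.
by rewrite distrC.
Qed.

Lemma compact_bounded_plane (K : set C) : compact K -> exists2 M : R, 0 < M & forall z, K z -> `|z| < M%:C.
Proof.
move=> /compact_near_coveringP cK.
have /(cK R +oo (fun M z => `|z| < M%:C)) H : forall x : C, K x -> \forall x' \near x & M \near +oo, `|x'| < (M : R)%:C.
  move=> x _; pose M := complex.Re `|x| + 1.
  have xM : `|x - 0| < M%:C.
    by rewrite subr0 [X in X < _](_ : _ = (complex.Re `|x|)%:C) ?ltcR ?ltrDl// normc_def.
  exists ([set t : C | `|t - 0| < M%:C], [set N : R | M < N]) => /=.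
    by split; [exact: near_ball|exact: (nbhs_pinfty_gt (num_real M))].
  by move=> [t N] /= [h1 h2]; rewrite -[t]subr0 (lt_trans h1)// ltcR.
near +oo_R => M; exists M; first by near: M; exact: (nbhs_pinfty_gt (num_real 0)).
near: M; exact: H.
Unshelve. all: by end_near.
Qed.

(** Away from 0 the charts differ by inversion, which is continuous. At 0 in the second chart,
    complements of compact sets correspond to small discs, because compact sets are bounded and
    closed boxes are compact. *)
Lemma nbhs_chart b (w : C) (A : set S) : nbhs (chart b w : S) A <-> nbhs w (chart b @^-1` A).
Proof.
case: b; last by [].
have [->|w0] := eqVneq w 0; last first.
  rewrite (chart_swap true w0) /=; split=> H.
    have nz := near_neq w0.
    have {}H : \forall t \near w, A (Some t^-1) by exact: (inv_continuous w0 H).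
    apply: filterS2 H nz => t At t0.
    by rewrite /= (negbTE t0).
  have iw0 : w^-1 != 0 :> C by rewrite invr_eq0.
  have nz := near_neq iw0.
  have {}H : \forall t \near w^-1, A (chart true t^-1).
    have H' : nbhs (w^-1^-1) (chart true @^-1` A) by rewrite invrK.
    exact: (inv_continuous iw0 H').
  apply: filterS2 H nz => t At t0.
  by move: At; rewrite /= invr_eq0 (negbTE t0) invrK.
have -> : chart true 0 = None :> S by rewrite /= eqxx.
split=> [[K [cK _] HK]|/nbhs_ballP[e /posC[d d0 ->] Hd]].
  have [M M0 KM] := compact_bounded_plane cK.
  have i0 : `|(0 : C) - 0| < (M^-1)%:C by rewrite subrr normr0 posC_gt0 invr_gt0.
  apply: filterS (near_ball i0) => t; rewrite subr0 /= => tM.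
  case: eqP => [_|/eqP t0]; first by apply: HK; right.
  apply: HK; left; exists t^-1 => // /KM tK.
  have := ltr_pM (normr_ge0 _) (normr_ge0 _) tM tK.
  by rewrite -normrM mulfV// normr1 -rmorphM mulVf ?gt_eqF// rmorph1 ltxx.
exists [set z : C | `|complex.Re z| <= 2 / d /\ `|complex.Im z| <= 2 / d].
  by split; [exact: compact_box|apply: compact_closed; [exact: norm_hausdorff|exact: compact_box]].
move=> q [[z zK <-]|->]; last by have := Hd 0; rewrite /= eqxx; apply; rewrite /ball /= subrr normr0 posC_gt0.
have dz : (2 / d)%:C < `|z|.
  have en : `|z| = (complex.Re `|z|)%:C by rewrite normc_def.
  rewrite en ltcR ltNge; apply/negP => le; apply: zK.
  by split; [apply: absRe_le|apply: absIm_le]; rewrite en lecR.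
have z0 : z != 0 by rewrite -normr_gt0; apply: lt_trans dz; rewrite posC_gt0 divr_gt0.
have := Hd (z^-1); rewrite /= invr_eq0 (negbTE z0) invrK; apply.
rewrite /ball /= sub0r normrN normfV -[d]invrK (@fmorphV _ _ (@real_complex R)).
rewrite ltf_pV2 ?posrE ?normr_gt0 ?posC_gt0 ?invr_gt0//; apply: lt_trans dz.
by rewrite ltcR ltr_pdivlMr// mulVf ?gt_eqF//; lra.
Qed.

Lemma chart_surj (q : S) : exists b w, q = chart b w.
Proof. by case: q => [z|]; [exists false, z|exists true, 0; rewrite /= eqxx]. Qed.

Lemma open_near_chart (O : set S) b w : open O -> O (chart b w) -> \forall t \near w, O (chart b t).
Proof. by move=> oO Ow; apply/nbhs_chart; exact: open_nbhs_nbhs. Qed.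

Lemma open_of_charts (O : set S) : (forall b w, O (chart b w) -> \forall t \near w, O (chart b t)) ->
  open O.
Proof.
move=> H; rewrite openE => q Oq; have [b [w e]] := chart_surj q; rewrite e in Oq *.
by apply/nbhs_chart; exact: H.
Qed.

Lemma domain_open (D : set S) : is_sphere_plane_or_disk D -> open D.
Proof.
case=> ->; first exact: openT.
  by apply: one_point_compactification_open_some; exact: openT.
apply: one_point_compactification_open_some; rewrite openE => z /= z1.
have z1' : `|z - 0| < (1 : R)%:C by rewrite subr0.
by apply: filterS (near_ball z1') => t; rewrite subr0.
Qed.

Lemma dense_chart (D M : set S) b (w : C) (A : set C) : D `<=` closure M -> D (chart b w) ->
  nbhs w A -> exists2 t, A t & M (chart b t).
Proof.
move=> DM Dw nA; pose A' : set S := [set q | exists2 t, A t & q = chart b t].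
have nA' : nbhs (chart b w : S) A'.
  by apply/nbhs_chart; apply: filterS nA => t At; exists t.
by have [q [Mq [t At e]]] := DM _ Dw _ nA'; exists t; rewrite -?e.
Qed.

End Charts.

Section InnerProducts.
Variables (R : realType) (k : nat).
Implicit Types f g h : 'I_k -> R.

Definition ipp f g : R := \sum_i f i * g i.

Lemma ippC f g : ipp f g = ipp g f.
Proof. by apply: eq_bigr => i _; rewrite mulrC. Qed.

Lemma ippD f g h : ipp (fun i => f i + g i) h = ipp f h + ipp g h.
Proof. by rewrite /ipp -big_split; apply: eq_bigr => i _; rewrite /= mulrDl. Qed.

Lemma ippZ (c : R) f h : ipp (fun i => c * f i) h = c * ipp f h.
Proof. by rewrite /ipp mulr_sumr; apply: eq_bigr => i _; rewrite mulrA. Qed.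

Lemma eq_ipp f g h : f =1 g -> ipp f h = ipp g h.
Proof. by move=> e; apply: eq_bigr => i _; rewrite e. Qed.

Implicit Types F G : 'I_k -> R * R -> R.

Lemma has_D_ipp F G p : (forall i, ddf (F i) p) -> (forall i, ddf (G i) p) ->
  has_D (fun q => ipp (F^~ q) (G^~ q)) p
    (ipp (fun i => D1 (F i) p) (G^~ p) + ipp (F^~ p) (fun i => D1 (G i) p))
    (ipp (fun i => D2 (F i) p) (G^~ p) + ipp (F^~ p) (fun i => D2 (G i) p)).
Proof.
move=> hF hG; rewrite /ipp -!big_split /=.
by apply: has_D_sum => i; apply: has_D_mul; exact: ddf_has_D.
Qed.

Lemma ipp_lin (a b c : R) f g h : ipp (fun j => a * f j + c * g j) (fun j => b * f j + c * h j) =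
  a * b * ipp f f + a * c * ipp h f + b * c * ipp g f + c ^+ 2 * ipp g h.
Proof.
rewrite /ipp !mulr_sumr -!big_split; apply: eq_bigr => i _ /=; ring.
Qed.

End InnerProducts.

Lemma D_eq_has (R : realType) (U : set (R * R)) (f g : R * R -> R) p (a b c d : R) : open U ->
  (forall q, U q -> f q = g q) -> U p -> has_D f p a b -> has_D g p c d -> a = c /\ b = d.
Proof. by move=> oU fg Up [_ <- <-] [_ <- <-]; have [] := D_eq_on oU fg Up. Qed.

(** * Conformal maps into the sphere *)

Section SphereEquation.
Variables (R : realType) (k : nat) (U : set (R * R)) (h : 'I_k.+1 -> R * R -> R).
Hypothesis oU : open U.
Hypothesis hC : forall i, Ck 3 U (h i).

Let u p i := D1 (h i) p.
Let v p i := D2 (h i) p.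
Let L p i := D1 (D1 (h i)) p + D2 (D2 (h i)) p.
Let x p i := h i p.

Hypothesis unit : forall p, U p -> ipp (x p) (x p) = 1.

Lemma unit_normal p : U p -> ipp (u p) (x p) = 0 /\ ipp (v p) (x p) = 0.
Proof.
move=> Up; have dh i : ddf (h i) p := Ck_ddf (hC i) Up.
have [e1 e2] := D_eq_has oU unit Up (has_D_ipp dh dh) (has_D_cst p 1).
move: e1 e2; rewrite !(ippC (fun i => h i p)) -/(u p) -/(v p) -/(x p).
by move: (ipp _ _) (ipp _ _) => A B e1 e2; split; lra.
Qed.

Section Conformal.
Hypothesis conf1 : forall p, U p -> ipp (u p) (u p) = ipp (v p) (v p).
Hypothesis conf2 : forall p, U p -> ipp (u p) (v p) = 0.

(** Differentiate [<u, x> = <v, x> = 0], [<u, u> = <v, v>] and [<u, v> = 0], and exchange the mixed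
    derivatives. *)
Lemma laplacian_products p : U p ->
  [/\ ipp (L p) (x p) = - (2 * ipp (u p) (u p)), ipp (L p) (u p) = 0 & ipp (L p) (v p) = 0].
Proof.
move=> Up; have dh i : ddf (h i) p := Ck_ddf (hC i) Up.
have du i : ddf (D1 (h i)) p := Ck_ddf (CkD1 (hC i)) Up.
have dv i : ddf (D2 (h i)) p := Ck_ddf (CkD2 (hC i)) Up.
have cl i : D1 (D2 (h i)) p = D2 (D1 (h i)) p := clairaut oU (CkW (hC i)) Up.
have [a1 _] := D_eq_has oU (fun q Uq => (unit_normal Uq).1) Up (has_D_ipp du dh) (has_D_cst p 0).
have [_ a2] := D_eq_has oU (fun q Uq => (unit_normal Uq).2) Up (has_D_ipp dv dh) (has_D_cst p 0).
have [b1 b2] := D_eq_has oU conf1 Up (has_D_ipp du du) (has_D_ipp dv dv).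
have [c1 c2] := D_eq_has oU conf2 Up (has_D_ipp du dv) (has_D_cst p 0).
have e := conf1 Up.
rewrite (eq_ipp _ cl) (ippC _ (fun i => D1 (D2 (h i)) p)) (eq_ipp _ cl) in b1.
rewrite (ippC _ (fun i => D1 (D2 (h i)) p)) (eq_ipp _ cl) in c1.
rewrite (ippC (fun i => D1 (h i) p) (fun i => D1 (D1 (h i)) p)) in b1.
rewrite (ippC (fun i => D1 (h i) p) (fun i => D2 (D1 (h i)) p)) in b2.
rewrite (ippC (fun i => D2 (h i) p) (fun i => D2 (D2 (h i)) p)) in b2.
rewrite (ippC (fun i => D1 (h i) p) (fun i => D2 (D2 (h i)) p)) in c2.
rewrite /L !ippD; move: a1 a2 b1 b2 c1 c2 e; rewrite /u /v /x.
by move=> a1 a2 b1 b2 c1 c2 e; split; lra.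
Qed.

(** Pairing the hypothesis with [x], [u] and [v] expresses [1 - x ord0], [u ord0] and [v ord0]
    through [b], [c], [d], which thereby disappear. The resulting equation contains no division, so
    it extends by continuity to points where no such coefficients are known. *)
Lemma pole_equation p (b c d : R) : U p ->
  (forall i, (i == ord0)%:R = x p i + b * L p i + c * u p i + d * v p i) ->
  forall i, (1 - x p ord0) * L p i =
    2 * ipp (u p) (u p) * ((i == ord0)%:R - x p i) - 2 * (u p ord0 * u p i + v p ord0 * v p i).
Proof.
move=> Up H; have [l1 l2 l3] := laplacian_products Up; have [n1 n2] := unit_normal Up.
have e := conf1 Up; have e' := conf2 Up; have un := unit Up.
have P w : w ord0 = ipp (x p) w + b * ipp (L p) w + c * ipp (u p) w + d * ipp (v p) w.
  rewrite -!ippZ -!ippD -(eq_ipp _ H) /ipp big_ord_recl eqxx mul1r big1 ?addr0// => i _.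
  by rewrite eq_sym (negbTE (neq_lift _ _)) mul0r.
have := P (x p); rewrite un l1 n1 n2 !mulr0 !addr0 => E0.
have := P (u p); rewrite (ippC (x p)) n1 l2 (ippC (v p)) e' !mulr0 add0r addr0 add0r => E1.
have := P (v p); rewrite (ippC (x p)) n2 l3 -e e' !mulr0 !add0r => E2.
move=> i; rewrite (H i) E0 E1 E2; ring.
Qed.

End Conformal.
End SphereEquation.

(** * Stereographic projection from the pole *)

Section Stereographic.
Variables (R : realType) (k : nat) (U : set (R * R)) (h : 'I_k.+1 -> R * R -> R).
Hypothesis oU : open U.
Hypothesis hC : forall i, Ck 3 U (h i).

Lemma has_D_inv (f : R * R -> R) p a b : f p != 0 -> has_D f p a b ->
  has_D (fun q => (f q)^-1) p (- (f p)^-1 ^+ 2 * a) (- (f p)^-1 ^+ 2 * b).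
Proof.
move=> f0 [[d1 d2] <- <-]; rewrite D1.unlock D2.unlock; split.
- by split; [apply: (derivableV f0 d1)|apply: (derivableV f0 d2)].
- by rewrite D1.unlock; apply: etrans (deriveV f0 d1) _; rewrite exprVn.
- by rewrite D2.unlock; apply: etrans (deriveV f0 d2) _; rewrite exprVn.
Qed.

Let u p i := D1 (h i) p.
Let v p i := D2 (h i) p.
Let L p i := D1 (D1 (h i)) p + D2 (D2 (h i)) p.
Let x p i := h i p.

Hypothesis unit : forall p, U p -> ipp (x p) (x p) = 1.
Hypothesis off_pole : forall p, U p -> 1 - x p ord0 != 0.

Let X (j : 'I_k) p := (1 - x p ord0)^-1 * x p (lift ord0 j).
Let s p := (1 - x p ord0)^-1.

Lemma has_D_s p : U p -> has_D s p (s p ^+ 2 * u p ord0) (s p ^+ 2 * v p ord0).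
Proof.
move=> Up; have H := has_D_inv (off_pole Up) (has_D_sub (has_D_cst p 1) (ddf_has_D (Ck_ddf (hC ord0) Up))).
by move: H; rewrite !sub0r !mulrNN.
Qed.

Lemma has_D_X j p : U p -> has_D (X j) p
  (s p ^+ 2 * u p ord0 * x p (lift ord0 j) + s p * u p (lift ord0 j))
  (s p ^+ 2 * v p ord0 * x p (lift ord0 j) + s p * v p (lift ord0 j)).
Proof. by move=> Up; apply: has_D_mul (has_D_s Up) (ddf_has_D (Ck_ddf (hC _) Up)). Qed.

Lemma stereo_D1 j p : U p -> D1 (X j) p = s p ^+ 2 * u p ord0 * x p (lift ord0 j) + s p * u p (lift ord0 j).
Proof. by case/(has_D_X j). Qed.

Lemma stereo_D2 j p : U p -> D2 (X j) p = s p ^+ 2 * v p ord0 * x p (lift ord0 j) + s p * v p (lift ord0 j).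
Proof. by case/(has_D_X j). Qed.

(** Conformality of the projection: the two vectors are the images of the tangent vectors [a] and
    [b] under its differential, and [s p] is the conformal factor. *)
Lemma stereo_ipp p (a b : 'I_k.+1 -> R) : U p -> ipp a (x p) = 0 -> ipp b (x p) = 0 ->
  ipp (fun j => s p ^+ 2 * a ord0 * x p (lift ord0 j) + s p * a (lift ord0 j))
      (fun j => s p ^+ 2 * b ord0 * x p (lift ord0 j) + s p * b (lift ord0 j)) =
  s p ^+ 2 * ipp a b.
Proof.
move=> Up ax bx; have q0 := off_pole Up; have un := unit Up; move: ax bx un.
have tl (f g : 'I_k.+1 -> R) : ipp f g = f ord0 * g ord0 + ipp (f \o lift ord0) (g \o lift ord0).
  by rewrite /ipp big_ord_recl.
rewrite !tl (ipp_lin _ _ _ (x p \o lift ord0) (a \o lift ord0) (b \o lift ord0)).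
set A := ipp (a \o _) _; set B := ipp (b \o _) _; set Q := ipp (a \o _) (b \o _); set Y := ipp (x p \o _) _.
move=> /eqP; rewrite addrC addr_eq0 => /eqP -> /eqP; rewrite addrC addr_eq0 => /eqP ->.
move=> /(canRL (addKr _)) ->; rewrite /s.
by field.
Qed.

(** The hypothesis gives the Laplacians of the coordinates of [h] through their first derivatives;
    substituted into the Laplacian of the quotient [X j], all terms cancel. *)
Lemma stereo_laplacian j p : U p ->
  (forall i, (1 - x p ord0) * L p i =
    2 * ipp (u p) (u p) * ((i == ord0)%:R - x p i) - 2 * (u p ord0 * u p i + v p ord0 * v p i)) ->
  D1 (D1 (X j)) p + D2 (D2 (X j)) p = 0.
Proof.
move=> Up H; have [e1 _ _] := D_eq_on oU (fun q Uq => stereo_D1 j Uq) Up.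
have [_ e2 _] := D_eq_on oU (fun q Uq => stereo_D2 j Uq) Up.
have Hs := has_D_s Up; have hd i := ddf_has_D (Ck_ddf (hC i) Up).
have h1 i := ddf_has_D (Ck_ddf (CkD1 (hC i)) Up); have h2 i := ddf_has_D (Ck_ddf (CkD2 (hC i)) Up).
have [_ f1 _] := has_D_add (has_D_mul (has_D_mul (has_D_mul Hs Hs) (h1 ord0)) (hd (lift ord0 j)))
  (has_D_mul Hs (h1 (lift ord0 j))).
have [_ _ f2] := has_D_add (has_D_mul (has_D_mul (has_D_mul Hs Hs) (h2 ord0)) (hd (lift ord0 j)))
  (has_D_mul Hs (h2 (lift ord0 j))).
rewrite (etrans e1 f1) (etrans e2 f2).
have := H ord0; have := H (lift ord0 j); rewrite eqxx eq_sym (negbTE (neq_lift _ _)) /L.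
have := off_pole Up; rewrite /s /u /v /x.
move: (D1 (D1 (h (lift ord0 j))) p) (D2 (D2 (h (lift ord0 j))) p) (D1 (D1 (h ord0)) p) (D2 (D2 (h ord0)) p).
move: (D1 (h ord0) p) (D2 (h ord0) p) (D1 (h (lift ord0 j)) p) (D2 (h (lift ord0 j)) p).
move: (h ord0 p) (h (lift ord0 j) p) (ipp _ _) => a b E c d e f A B F G q0 H1 H2.
have -> : B = (2 * E * (0 - b) - 2 * (c * e + d * f)) / (1 - a) - A.
  by rewrite -H1; field.
have -> : G = (2 * E * (1 - a) - 2 * (c * c + d * d)) / (1 - a) - F.
  by rewrite -H2; field.
by field.
Qed.

End Stereographic.

(** * The conformal Gauss map and minimality *)

Lemma near_open (R : realType) (w : Cplane R) (P : Cplane R -> Prop) : (\forall t \near w, P t) ->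
  exists2 W : set (Cplane R), open W /\ W w & forall t, W t -> P t.
Proof.
move=> h; have : nbhs w (P : set (Cplane R)) by [].
by rewrite nbhsE => -[W [oW Ww] H]; exists W.
Qed.

Section Coordinates.
Variables (R : realType) (N : nat).
Local Notation C := (Cplane R).
Implicit Types H : C -> 'cV[R]_N.

Definition co H i (p : R * R) : R := H (toC p) i 0.

Lemma dumx_co H w i : dumx H w i 0 = D1 (co H i) (ofC w).
Proof. by rewrite mxE duE. Qed.

Lemma dvmx_co H w i : dvmx H w i 0 = D2 (co H i) (ofC w).
Proof. by rewrite mxE dvE. Qed.

Lemma co_dumx H i : co (dumx H) i = D1 (co H i).
Proof. by apply/funext => p; rewrite /co dumx_co ofCK. Qed.

Lemma co_dvmx H i : co (dvmx H) i = D2 (co H i).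
Proof. by apply/funext => p; rewrite /co dvmx_co ofCK. Qed.

Lemma dot_ipp (x y : 'cV[R]_N) : dot x y = ipp (x^~ 0) (y^~ 0).
Proof. by rewrite /dot mxE; apply: eq_bigr => i _; rewrite mxE. Qed.

Lemma ipp_self_eq0 (f : 'I_N -> R) : ipp f f = 0 -> forall i, f i = 0.
Proof.
move=> /eqP; rewrite psumr_eq0 => [/allP H i|i _]; last by rewrite -expr2 sqr_ge0.
by have := H i; rewrite mem_index_enum => /(_ isT) /=; rewrite mulf_eq0 orbb => /eqP.
Qed.

Lemma dot_self_eq0 (a : 'cV[R]_N) : dot a a = 0 -> a = 0.
Proof.
by rewrite dot_ipp => /ipp_self_eq0 h; apply/matrixP => i j; rewrite (ord1 j) h mxE.
Qed.

Lemma rank_gram (a b : 'cV[R]_N) c : c != 0 -> dot a a = c -> dot b b = c -> dot a b = 0 ->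
  \rank (row_mx a b) = 2%N.
Proof.
move=> c0 aa bb ab; have ba : dot b a = 0 by rewrite dot_ipp ippC -dot_ipp.
have M (x y : 'cV[R]_N) : x^T *m y = (dot x y)%:M.
  by apply/matrixP => i j; rewrite !ord1 [RHS]mxE /= mulr1n.
have G : (row_mx a b)^T *m row_mx a b = c%:M.
  rewrite tr_row_mx mul_col_row; do 4! rewrite M.
  by rewrite aa bb ab ba raddf0 -scalar_mx_block.
apply/eqP; rewrite eqn_leq rank_leq_col /=.
have <- : \rank ((row_mx a b)^T *m row_mx a b) = 2%N.
  by rewrite G mxrank_unit// unitmxE det_scalar unitrX// unitfE.
exact: mxrankM_maxr.
Qed.

Lemma immersion_dot_neq0 H w : conformal_at H w -> immersion_at H w ->
  dot (dumx H w) (dumx H w) != 0.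
Proof.
rewrite /conformal_at /immersion_at /tangent; move: (dumx H w) (dvmx H w) => a b [c1 c2] im.
apply/eqP => e; have e' := esym c1; rewrite e in e'.
by move: im; rewrite (dot_self_eq0 e) (dot_self_eq0 e') row_mx0 mxrank0.
Qed.

Lemma dot_neq0_immersion H w : conformal_at H w -> dot (dumx H w) (dumx H w) != 0 ->
  immersion_at H w.
Proof.
rewrite /conformal_at /immersion_at /tangent; move: (dumx H w) (dvmx H w) => a b [c1 c2] e0.
exact: rank_gram e0 erefl (esym c1) c2.
Qed.

(** The chain rule for inversion, whose derivative [c] multiplies the conformal factor by the
    nonzero number [|c| ^ 2]. It is needed because [immersion_at_point] speaks of both charts. *)
Lemma conformal_swap H1 H2 (U : set (R * R)) (w : C) : w != 0 -> open U -> U (ofC w^-1) ->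
  (forall i, Ck 1 U (co H2 i)) -> (\forall t \near w, H1 t = H2 t^-1) -> conformal_at H2 w^-1 ->
  dot (dumx H2 w^-1) (dumx H2 w^-1) != 0 -> dot (dumx H1 w) (dumx H1 w) != 0.
Proof.
move=> w0 oU Uw HC near12 [c1 c2] e0.
have idd : derivable (fun z : C => z) w 1 by exact: derivable_id.
have [h1 h2] := has_W_holo (DeriveDef (derivableV w0 idd) (deriveV w0 idd)).
rewrite derive_id addr0 subr0 in h1 h2.
set c := - w ^- 2 *: 1 in h1 h2.
have c0 : c != 0 by rewrite scaler_eq0 oner_eq0 orbF oppr_eq0 invr_eq0 expf_eq0.
have E i : D1 (co H1 i) (ofC w) = complex.Re c * D1 (co H2 i) (ofC w^-1) + complex.Im c * D2 (co H2 i) (ofC w^-1).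
  have L : lin_approx (co H2 i) (rp (fun z => z^-1) (ofC w), ip (fun z => z^-1) (ofC w))
      (D1 (co H2 i) (ofC w^-1)) (D2 (co H2 i) (ofC w^-1)).
    by rewrite /rp /ip toCK; exact: Ck1_lin_approx oU (HC i) Uw.
  have /lin_approx_ddf[_ d1 _] := lin_approx_comp L h1 h2.
  rewrite (mulrC (complex.Re c)) (mulrC (complex.Im c)) -d1.
  have [W [oW Ww] HW] := near_open near12.
  have q12 q : (@toC R @^-1` W) q -> co H1 i q = co H2 i (rp (fun z => z^-1) q, ip (fun z => z^-1) q).
    by move=> Wq; rewrite /co HW//; congr (H2 _ i 0); rewrite /rp /ip; case: (_^-1).
  have Ww' : (@toC R @^-1` W) (ofC w) by rewrite /= toCK.
  by have [-> _ _] := D_eq_on (open_toC oW) q12 Ww'.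
have Ev : dumx H1 w = complex.Re c *: dumx H2 w^-1 + complex.Im c *: dvmx H2 w^-1.
  by apply/matrixP => i j; rewrite (ord1 j) dumx_co E -dumx_co -dvmx_co; move: (dumx H2 _) (dvmx H2 _) => a b; rewrite !mxE.
rewrite Ev; move: c1 c2 e0; move: (dumx H2 _) (dvmx H2 _) => a b c1 c2 e0.
have -> : dot (complex.Re c *: a + complex.Im c *: b) (complex.Re c *: a + complex.Im c *: b) =
    (complex.Re c ^+ 2 + complex.Im c ^+ 2) * dot a a.
  have ba : dot b a = 0 by rewrite dot_ipp ippC -dot_ipp.
  rewrite mulrDl {2}c1; move: c2 ba; rewrite !dot_ipp => c2 ba.
  rewrite (@eq_ipp _ _ _ (fun i => complex.Re c * a i 0 + complex.Im c * b i 0)); last by move=> i; rewrite !mxE.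
  rewrite ippC (@eq_ipp _ _ _ (fun i => complex.Re c * a i 0 + complex.Im c * b i 0)); last by move=> i; rewrite !mxE.
  rewrite ippD !ippZ !(ippC _ (fun i => _ + _)) !ippD !ippZ c2 ba; ring.
rewrite mulf_neq0//; apply: contra c0 => /eqP h; apply/eqP/eqC => /=.
- have := sqr_ge0 (complex.Re c); have := sqr_ge0 (complex.Im c) => h3 h4.
  by apply/eqP; rewrite -sqrf_eq0; apply/eqP; clear -h h3 h4; lra.
- have := sqr_ge0 (complex.Re c); have := sqr_ge0 (complex.Im c) => h3 h4.
  by apply/eqP; rewrite -sqrf_eq0; apply/eqP; clear -h h3 h4; lra.
Qed.

End Coordinates.

(** * The frame of the conformal Gauss map *)

Section GaussMap.
Variables (R : realType) (n : nat).
Local Notation C := (Cplane R).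

Lemma smoothR_cst (U : set C) (c : R) : smoothR U (fun=> c).
Proof.
move=> s p Up; have [c' ->] : exists c', iter_deriv s ((fun=> c) \o @toC R) = fun=> c'.
  elim: s => [|v s [c' /= ->]]; first by exists c.
  by exists 0; apply/funext => q /=; exact: derive_cst.
by split=> [|v]; [exact: cst_continuous|exact: derivable_cst].
Qed.

Lemma v0_entry i : v0 R n i 0 = (i < 2)%N%:R.
Proof.
rewrite /v0 !mxE; case: (fintype.splitP i) => j ij; rewrite !mxE.
  by rewrite -[val i]/(nat_of_ord i) ij; case: ifP.
by rewrite -[val i]/(nat_of_ord i) ij.
Qed.

(** Representatives of one coset differ by an invertible block acting on the first four columns, and
    a positive determinant makes the columns of [V] a basis. *)
Lemma span_subspace (G : 'M[R]_(4 + n)) a V : subspace_of (Kcoset G) a -> oriented_span (Kcoset G) V ->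
  exists c, a = V *m c.
Proof.
move=> [_ [c [[_ [A [B [_ _ ->]]] <-] ->]]] [_ [P [[_ [A' [B' [hA _ ->]]] <-] dP ->]]].
have L X Y : lsubmx (G *m block_mx X 0 0 Y) = lsubmx G *m X.
  rewrite -[in LHS](hsubmxK G) mul_row_block !mulmx0 addr0 add0r row_mxKl.
  by [].
have uP : P \in unitmx by rewrite unitmxE unitfE gt_eqF.
have [h1 h2] := O1_inv (SO1plus_O1 hA).
exists (invmx P *m ((I1 R 4 *m A'^T *m I1 R 4) *m A *m c)).
by rewrite !L !mulmxA mulmxK// -!mulmxA; congr (_ *m _); rewrite !mulmxA -(mulmxA A') -(mulmxA A') h2 mul1mx.
Qed.

Lemma mul_row4 N (a b d e : 'cV[R]_N) (c : 'cV[R]_((1 + 1) + (1 + 1))) i :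
  (row_mx (row_mx a b) (row_mx d e) *m c) i 0 =
  a i 0 * usubmx (usubmx c) 0 0 + b i 0 * dsubmx (usubmx c) 0 0
  + d i 0 * usubmx (dsubmx c) 0 0 + e i 0 * dsubmx (dsubmx c) 0 0.
Proof.
rewrite -{1}[c]vsubmxK -{1}(vsubmxK (usubmx c)) -{1}(vsubmxK (dsubmx c)) !mul_row_col.
move: (usubmx (usubmx c)) (dsubmx (usubmx c)) (usubmx (dsubmx c)) (dsubmx (dsubmx c)) => c0 c1 c2 c3.
by rewrite !mxE !big_ord1 !addrA.
Qed.

(** With [rho = 0] the first coordinate of [Y] is constantly 1 and its derivatives vanish, which
    forces the coefficient of [Y] to be 1; the remaining coordinates of [v0] are those of the
    pole. *)
Lemma gauss_frame_relation (H : C -> 'cV[R]_(3 + n)) (w : C) c :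
    v0 R n = gauss_frame (fun=> 0) H w *m c ->
  exists b g d, forall j : 'I_(2 + n).+1, (j == ord0)%:R = H w j 0 +
    b * (D1 (D1 (co H j)) (ofC w) + D2 (D2 (co H j)) (ofC w)) + g * D1 (co H j) (ofC w) + d * D2 (co H j) (ofC w).
Proof.
rewrite /gauss_frame; set Y := light_lift _ H.
have YE : Y = fun z => col_mx (1%:M : 'cV[R]_1) (H z) by apply/funext => z; rewrite /Y /light_lift oppr0 expR0 scale1r.
move=> E.
have [c0 [c1 [c2 [c3 E']]]] : exists c0 c1 c2 c3 : R, forall i, v0 R n i 0 = Y w i 0 * c0
   + 4^-1 * (D1 (D1 (co Y i)) (ofC w) + D2 (D2 (co Y i)) (ofC w)) * c1
   + D1 (co Y i) (ofC w) * c2 + D2 (co Y i) (ofC w) * c3.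
  exists (usubmx (usubmx (c : 'cV[R]_((1 + 1) + (1 + 1)))) 0 0), (dsubmx (usubmx (c : 'cV[R]_((1 + 1) + (1 + 1)))) 0 0).
  exists (usubmx (dsubmx (c : 'cV[R]_((1 + 1) + (1 + 1)))) 0 0), (dsubmx (dsubmx (c : 'cV[R]_((1 + 1) + (1 + 1)))) 0 0).
  move=> i; rewrite -!co_dumx -!co_dvmx /co toCK.
  apply: etrans (congr1 (fun M : 'cV_(4 + n) => M i 0) E) _; apply: etrans (mul_row4 _ _ _ _ _ _) _.
  move: (dumx (dumx Y) w) (dvmx (dvmx Y) w) => e f.
  by congr (_ + _ * _ + _ + _); rewrite !mxE.
have Yu z : Y z (lshift (3 + n) (ord0 : 'I_1)) 0 = 1.
  by rewrite YE; apply: etrans (col_mxEu (1%:M : 'cV[R]_1) (H z) ord0 0) _; rewrite mxE.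
have Yd z j : Y z (rshift 1 j) 0 = H z j 0.
  by rewrite YE; exact: (col_mxEd (1%:M : 'cV[R]_1) (H z) j 0).
have co0 : co Y (lshift (3 + n) (ord0 : 'I_1)) = fun=> 1 by apply/funext => p; exact: Yu.
have coS j : co Y (rshift 1 j) = co H j by apply/funext => p; exact: Yd.
have D10 : D1 (fun _ : R * R => 1 : R) = fun=> 0.
  by apply/funext => p; have [_ -> _] := has_D_cst p 1.
have D20 : D2 (fun _ : R * R => 1 : R) = fun=> 0.
  by apply/funext => p; have [_ _ ->] := has_D_cst p 1.
have Z1 p : D1 (fun _ : R * R => 0 : R) p = 0 by have [_ -> _] := has_D_cst p 0.
have Z2 p : D2 (fun _ : R * R => 0 : R) p = 0 by have [_ _ ->] := has_D_cst p 0.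
have c00 : c0 = 1.
  have := E' (lshift (3 + n) (ord0 : 'I_1)); rewrite co0 D10 D20 Z1 Z2 v0_entry Yu /=.
  by rewrite addr0 mulr0 !mul0r !addr0 mul1r.
exists (4^-1 * c1), c2, c3 => j.
have := E' (rshift 1 j); rewrite coS v0_entry Yd c00 mulr1 /= => e.
have -> : (j == ord0)%:R = (1 + j < 2)%N%:R :> R by congr (_%:R); case: j e => [[]].
by rewrite e; ring.
Qed.

End GaussMap.

Lemma conformal_ipp (R : realType) N (H : Cplane R -> 'cV[R]_N) p : conformal_at H (toC p) <->
  ipp (fun i => D1 (co H i) p) (fun i => D1 (co H i) p) = ipp (fun i => D2 (co H i) p) (fun i => D2 (co H i) p) /\
  ipp (fun i => D1 (co H i) p) (fun i => D2 (co H i) p) = 0.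
Proof.
have e1 : (fun i => dumx H (toC p) i 0) = fun i => D1 (co H i) p.
  by apply/funext => i; rewrite dumx_co ofCK.
have e2 : (fun i => dvmx H (toC p) i 0) = fun i => D2 (co H i) p.
  by apply/funext => i; rewrite dvmx_co ofCK.
by rewrite /conformal_at; move: (dumx H (toC p)) (dvmx H (toC p)) e1 e2 => a b <- <-; rewrite !dot_ipp.
Qed.

(** In conformal coordinates the mean curvature vector is a multiple of the normal part of the
    Laplacian. *)
Lemma conformal_harmonic_minimal (R : realType) N (H : Cplane R -> 'cV[R]_N) w c : c != 0 ->
  dot (dumx H w) (dumx H w) = c -> dot (dvmx H w) (dvmx H w) = c -> dot (dumx H w) (dvmx H w) = 0 ->
  (forall j, D1 (D1 (co H j)) (ofC w) + D2 (D2 (co H j)) (ofC w) = 0) -> minimal_immersion_at H w.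
Proof.
move=> c0 uu vv uv harm; have {harm} : dumx (dumx H) w + dvmx (dvmx H) w = 0.
  apply/matrixP => j k; rewrite (ord1 k).
  have a := dumx_co (dumx H) w j; have b := dvmx_co (dvmx H) w j.
  rewrite (co_dumx H) in a; rewrite (co_dvmx H) in b.
  move: (dumx (dumx H) w) (dvmx (dvmx H) w) a b => A B a b.
  by rewrite !mxE a b.
move: c0 uu vv uv.
rewrite /minimal_immersion_at /immersion_at /mean_curvature.
move: (nproj _) (det_metric _ _) (dumx (dumx H) w) (dvmx (dvmx H) w) (dumx (dvmx H) w) => P d a b e.
rewrite /tangent; move: (dumx H w) (dvmx H w) => u v c0 uu vv uv lap.
split; first exact: rank_gram c0 uu vv uv.
by rewrite uu vv uv mulr0 scale0r subr0 -scalerDr lap scaler0 mulmx0 scaler0.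
Qed.

(** * Minimality of the stereographic projection *)

Section Minimal.
Variables (R : realType) (n : nat).
Local Notation C := (Cplane R).
Local Notation S := (Rsphere R).
Variables (D M : set S) (y : S -> 'cV[R]_(3 + n)) (FF : S -> set 'M[R]_(4 + n)).
Hypothesis hD : is_sphere_plane_or_disk D.
Hypothesis hy : smooth_sphere_map D y.
Hypotheses (oM : open M) (MD : M `<=` D) (DM : D `<=` closure M).
Hypothesis immM : forall q, M q -> immersion_at_point y q.
Hypothesis confM : forall b w, M (chart b w) -> conformal_at (y \o chart b) w.
Hypothesis smo : smooth_GKmap D FF.
Hypothesis gauss : is_conformal_gauss_map M y FF.
Hypothesis hv : forall q, D q -> subspace_of (FF q) (v0 R n).

Let V b := (@toC R) @^-1` (chart b @^-1` D).
Let W b := (@toC R) @^-1` (chart b @^-1` M).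
Let h b (i : 'I_(2 + n).+1) : R * R -> R := co (y \o chart b) i.

Let open_pre (A : set S) b : open A -> open ((@toC R) @^-1` (chart b @^-1` A)).
Proof.
move=> oA; apply: open_toC; rewrite openE => w Aw; exact: open_near_chart oA Aw.
Qed.

Let oV b : open (V b) := open_pre (domain_open hD).
Let oW b : open (W b) := open_pre oM.

Arguments oV : clear implicits.
Arguments oW : clear implicits.

Let hC k b i : Ck k (V b) (h b i).
Proof. by apply: smooth_on_Ck; exact: (hy.2 b i 0). Qed.

Let WV b : W b `<=` V b. Proof. by move=> p; exact: MD. Qed.

Let hCW k b i : Ck k (W b) (h b i). Proof. exact: Ck_sub (@WV b) (hC k b i). Qed.

Lemma unit_coord b p : V b p -> ipp (fun i => h b i p) (fun i => h b i p) = 1.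
Proof. by move=> Vp; have := hy.1 _ Vp; rewrite /unit_sphere /= dot_ipp. Qed.

Lemma conf_coord b p : W b p ->
  ipp (fun i => D1 (h b i) p) (fun i => D1 (h b i) p) = ipp (fun i => D2 (h b i) p) (fun i => D2 (h b i) p) /\
  ipp (fun i => D1 (h b i) p) (fun i => D2 (h b i) p) = 0.
Proof.
by move=> Wp; apply/conformal_ipp; exact: confM Wp.
Qed.

Let L b p i := D1 (D1 (h b i)) p + D2 (D2 (h b i)) p.

Lemma pole_coord b p : W b p -> exists be g d, forall i : 'I_(2 + n).+1,
  (i == ord0)%:R = h b i p + be * L b p i + g * D1 (h b i) p + d * D2 (h b i) p.
Proof.
move=> Wp; have Dp := MD Wp; have := gauss (@smoothR_cst _ _ 0) Wp; have := hv Dp.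
have [U [G [[_ _ _ HG] Up]]] := smo Dp; have [_ ->] := HG _ Up.
move=> sv gs; have [c e] := span_subspace sv gs.
have [be [g [d H]]] := gauss_frame_relation e; rewrite ofCK in H.
by exists be, g, d.
Qed.

(** Identities are proved on [M], where the Gauss map is spanned by its frame, but they are needed
    at every immersed point of [D]. *)
Lemma density_coord b (f : R * R -> R) : Ck 0 (V b) f -> (forall p, W b p -> f p = 0) ->
  forall p, V b p -> f p = 0.
Proof.
move=> [cf _] f0 p Vp; apply: contrapT => /eqP fp.
have [|d d0 Hd] := (cont2_epsP _ _).1 (cf p Vp) `|f p|; first by rewrite normr_gt0.
have nA : \forall t \near toC p, `|f (ofC t) - f p| < `|f p|.
  by apply/near_box; exists d => // t; case: p {Vp fp} Hd => p1 p2 Hd; exact: Hd.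
have [t At Mt] := dense_chart DM Vp nA.
by move: At; rewrite /= f0 ?sub0r ?normrN ?ltxx// /W /= toCK.
Qed.

Lemma Ck_ipp k U m (F G : 'I_m -> R * R -> R) : open U -> (forall i, Ck k U (F i)) ->
  (forall i, Ck k U (G i)) -> Ck k U (fun p => ipp (F^~ p) (G^~ p)).
Proof. by move=> oU HF HG; apply: Ck_sum => // i; exact: CkM. Qed.

Lemma conf_ext b p : V b p ->
  ipp (fun i => D1 (h b i) p) (fun i => D1 (h b i) p) = ipp (fun i => D2 (h b i) p) (fun i => D2 (h b i) p) /\
  ipp (fun i => D1 (h b i) p) (fun i => D2 (h b i) p) = 0.
Proof.
have c1 i : Ck 0 (V b) (D1 (h b i)) by apply: CkD1; exact: hC.
have c2 i : Ck 0 (V b) (D2 (h b i)) by apply: CkD2; exact: hC.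
move=> Vp; split.
  apply/eqP; rewrite -subr_eq0; apply/eqP.
  apply: (density_coord (CkB (oV b) (Ck_ipp (oV b) c1 c1) (Ck_ipp (oV b) c2 c2)) _ Vp) => q Wq.
  by rewrite (conf_coord Wq).1 subrr.
by apply: (density_coord (Ck_ipp (oV b) c1 c2) _ Vp) => q Wq; rewrite (conf_coord Wq).2.
Qed.

Lemma pole_ext b p : V b p -> forall i, (1 - h b ord0 p) * L b p i =
  2 * ipp (fun i => D1 (h b i) p) (fun i => D1 (h b i) p) * ((i == ord0)%:R - h b i p)
  - 2 * (D1 (h b ord0) p * D1 (h b i) p + D2 (h b ord0) p * D2 (h b i) p).
Proof.
move=> Vp i; have c1 j : Ck 0 (V b) (D1 (h b j)) by apply: CkD1; exact: hC.
have c2 j : Ck 0 (V b) (D2 (h b j)) by apply: CkD2; exact: hC.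
have c11 j : Ck 0 (V b) (D1 (D1 (h b j))) by do 2! apply: CkD1; exact: hC.
have c22 j : Ck 0 (V b) (D2 (D2 (h b j))) by do 2! apply: CkD2; exact: hC.
have o := oV b; apply/eqP; rewrite -subr_eq0; apply/eqP.
pose lhs := fun p => (1 - h b ord0 p) * L b p i.
pose rhs := fun p => 2 * ipp (fun i => D1 (h b i) p) (fun i => D1 (h b i) p) * ((i == ord0)%:R - h b i p)
  - 2 * (D1 (h b ord0) p * D1 (h b i) p + D2 (h b ord0) p * D2 (h b i) p).
have C1 : Ck 0 (V b) lhs.
  apply: (CkM o); last exact: (CkD o (c11 i) (c22 i)).
  by apply: (CkB o); [exact: Ck_cst|exact: hC].
have C2 : Ck 0 (V b) rhs.
  apply: (CkB o); apply: (CkM o).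
  - by apply: (CkM o); [exact: Ck_cst|exact: Ck_ipp].
  - by apply: (CkB o); [exact: Ck_cst|exact: hC].
  - exact: Ck_cst.
  - by apply: (CkD o); exact: CkM.
apply: (density_coord (CkB o C1 C2) _ Vp) => q Wq; apply/eqP; rewrite subr_eq0; apply/eqP.
have [be [g [d H]]] := pole_coord Wq.
exact: (pole_equation (oW b) (hCW 3 b) (fun p Wp => unit_coord (WV Wp))
  (fun p Wp => (conf_coord Wp).1) (fun p Wp => (conf_coord Wp).2) Wq H).
Qed.

Lemma conformal_D b w : D (chart b w) -> conformal_at (y \o chart b) w.
Proof.
move=> Dw; have Vw : V b (ofC w) by rewrite /V /= toCK.
by rewrite -[w]toCK; apply/conformal_ipp; exact: conf_ext Vw.
Qed.

Lemma moebius1 (x : 'cV[R]_(3 + n)) : moebius 1%:M x = x.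
Proof.
by rewrite /moebius mul1mx col_mxKu col_mxKd mxE invr1 scale1r.
Qed.

Lemma pole_entry i : pole R n i 0 = (i == ord0 :> 'I_(2 + n).+1)%:R.
Proof.
have -> : pole R n i 0 = (col_mx (1%:M : 'cV[R]_1) (0 : 'cV[R]_(2 + n))) i 0 by [].
rewrite mxE; case: (fintype.splitP (i : 'I_(1 + (2 + n)))) => j ij; rewrite !mxE.
  by rewrite (ord1 j) /= mulr1n (_ : i == ord0)//; apply/eqP/val_inj; rewrite /= ij (ord1 j).
by rewrite (_ : i == ord0 = false)//; apply/eqP => e; move: ij; rewrite e.
Qed.

Lemma eq_pole b p : V b p -> (y (chart b (toC p)) = pole R n) <-> (1 - h b ord0 p = 0).
Proof.
move=> Vp; split=> [e|/eqP].
  by rewrite /h /co /= e pole_entry eqxx subrr.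
rewrite subr_eq0 => /eqP e; have := unit_coord Vp; rewrite /ipp big_ord_recl -e mulr1.
move=> /(canRL (addKr _)); rewrite addNr => /ipp_self_eq0 z.
apply/matrixP => i j; rewrite (ord1 j) pole_entry.
have [->|ni] := eqVneq (i : 'I_(2 + n).+1) ord0; first by rewrite [LHS](esym e).
have [k ->] : exists k, i = lift ord0 k :> 'I_(2 + n).+1.
  by have := @unlift_some _ ord0 i; rewrite eq_sym => /(_ ni)[k -> _]; exists k.
exact: z.
Qed.

Let M' := [set q | [/\ D q, immersion_at_point y q & moebius 1%:M (y q) <> pole R n]].

(** The map is conformal on all of [D], so being an immersion amounts to one inner product being
    nonzero, an open condition; by [conformal_swap] the chart at hand decides for both. *)
Lemma minimal_domainP b w : M' (chart b w) <-> [/\ D (chart b w),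
  dot (dumx (y \o chart b) w) (dumx (y \o chart b) w) != 0 & 1 - h b ord0 (ofC w) != 0].
Proof.
rewrite /M' /= moebius1.
split=> [[Dw im np]|[Dw E0 q0]]; have Vw : V b (ofC w) by rewrite /V /= toCK.
  split=> //; first exact: immersion_dot_neq0 (conformal_D Dw) (im _ _ erefl).
  by apply/eqP => /(eq_pole Vw); rewrite toCK.
split=> //; last by move=> e; move/eqP: q0; apply; apply/(eq_pole Vw); rewrite toCK.
move=> b' w' e; have Dw' : D (chart b' w') by rewrite e.
apply: dot_neq0_immersion (conformal_D Dw') _.
have [eb|nb] := eqVneq b' b; first by rewrite -eb in e E0; rewrite (chart_inj e).
have eb : b = ~~ b' by move: nb; case: (b); case: (b').
rewrite eb in e E0 Vw Dw; have [w0 ew] := chart_eq_swap e; rewrite ew in E0 Vw Dw.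
apply: (@conformal_swap _ _ (y \o chart b') (y \o chart (~~ b')) _ _ w0 (oV (~~ b')) Vw (fun i => hC 1 _ i) _ (conformal_D Dw) E0).
by apply: filterS (near_neq w0) => t t0 /=; rewrite (chart_swap b' t0).
Qed.

Lemma minimal_domain_near b w : M' (chart b w) -> \forall t \near w, M' (chart b t).
Proof.
move=> /minimal_domainP[Dw E0 q0]; have Vw : V b (ofC w) by rewrite /V /= toCK.
have nD := open_near_chart (domain_open hD) Dw.
have c1 i : Ck 0 (V b) (D1 (h b i)) by apply: CkD1; exact: hC.
have CE : Ck 0 (V b) (fun p => ipp (fun i => D1 (h b i) p) (fun i => D1 (h b i) p) * (1 - h b ord0 p)).
  apply: (CkM (oV b) (Ck_ipp (oV b) c1 c1)); apply: (CkB (oV b)); [exact: Ck_cst|exact: hC].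
have EE t : dot (dumx (y \o chart b) t) (dumx (y \o chart b) t) =
    ipp (fun i => D1 (h b i) (ofC t)) (fun i => D1 (h b i) (ofC t)).
  by rewrite dot_ipp; congr ipp; apply/funext => i; rewrite dumx_co.
rewrite EE in E0; have P0 := mulf_neq0 E0 q0.
have [|d d0 Hd] := (cont2_epsP _ _).1 (Ck_cont CE Vw) `|ipp (fun i => D1 (h b i) (ofC w)) (fun i => D1 (h b i) (ofC w)) * (1 - h b ord0 (ofC w))|.
  by rewrite normr_gt0.
have nA : \forall t \near w, ipp (fun i => D1 (h b i) (ofC t)) (fun i => D1 (h b i) (ofC t)) * (1 - h b ord0 (ofC t)) != 0.
  apply/near_box; exists d => // t h1 h2; apply/eqP => e; have := Hd _ _ h1 h2.
  by rewrite -[(_, _)]/(ofC t) e sub0r normrN ltxx.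
apply: filterS2 nD nA => t Dt; rewrite mulf_eq0 negb_or => /andP[Et qt].
by apply/minimal_domainP; split; rewrite ?EE.
Qed.

(** Density could fail only if [y] were constantly the pole on a nonempty open part of [M], where it
    is an immersion. *)
Lemma minimal_domain_open_dense : open_dense_in D M'.
Proof.
split; first by apply: open_of_charts => b w; exact: minimal_domain_near.
  by move=> q [].
move=> q Dq B nB; have [b [w e]] := chart_surj q; rewrite e in Dq nB.
have /near_open[B' [oB' B'w] HB'] := (nbhs_chart b w B).1 nB.
have [t B't Mt] := dense_chart DM Dq (open_nbhs_nbhs (conj oB' B'w)).
apply: contrapT => H; have Vt : V b (ofC t) by rewrite /V /= toCK; exact: MD.
have EM s : M (chart b s) -> dot (dumx (y \o chart b) s) (dumx (y \o chart b) s) != 0.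
  by move=> Ms; apply: immersion_dot_neq0 (confM Ms) (immM Ms erefl).
have [U [oU Ut] HU] := near_open (filterI (open_near_chart oM Mt) (open_nbhs_nbhs (conj oB' B't))).
have yp s : U s -> y (chart b s) = pole R n.
  move=> Us; have [Ms Bs] := HU s Us; apply: contrapT => np; apply: H.
  exists (chart b s); split; last exact: HB'.
  by split; [exact: MD|exact: immM|rewrite moebius1].
have := EM t Mt; rewrite (_ : dumx (y \o chart b) t = 0) ?/dot ?mulmx0 ?mxE ?eqxx//.
apply/matrixP => i j; rewrite (ord1 j) dumx_co [RHS]mxE.
have q12 r : (@toC R @^-1` U) r -> co (y \o chart b) i r = pole R n i 0.
  by move=> Uq; rewrite /co /= yp.
have Ut' : (@toC R @^-1` U) (ofC t) by rewrite /= toCK.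
have [-> _ _] := D_eq_on (open_toC oU) q12 Ut'.
by have [_ -> _] := has_D_cst (ofC t) (pole R n i 0).
Qed.

Let O b := [set p | V b p /\ 1 - h b ord0 p != 0].

Lemma oO b : open (O b).
Proof.
rewrite openE => p [Vp q0]; have c : {for p, continuous (fun p => 1 - h b ord0 p)}.
  by apply: (@Ck_cont _ 0 (V b)) Vp; apply: (CkB (oV b)); [exact: Ck_cst|exact: hC].
have n1 := open_nbhs_nbhs (conj (oV b) Vp).
have [|d d0 Hd] := (cont2_epsP _ _).1 c `|1 - h b ord0 p|; first by rewrite normr_gt0.
have n2 : \forall p' \near p, 1 - h b ord0 p' != 0.
  apply/nbhs_ballP; exists d => // -[p1 p2] [/= b1 b2]; apply/eqP => e.
  by have := Hd p1 p2; rewrite e sub0r normrN ltxx (distrC p1) (distrC p2) => /(_ b1 b2).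
by apply: filterS2 n1 n2 => p' ? ?; split.
Qed.

Lemma stereo_minimal b w : M' (chart b w) ->
  minimal_immersion_at (fun w' => stereographic (moebius 1%:M (y (chart b w')))) w.
Proof.
move=> /minimal_domainP[Dw E0 q0]; have Vw : V b (ofC w) by rewrite /V /= toCK.
have Ow : O b (ofC w) by [].
have hCO i : Ck 3 (O b) (h b i) by apply: Ck_sub (hC 3 b i) => p [].
have uO p : O b p -> ipp (fun i => h b i p) (fun i => h b i p) = 1 by case=> Vp _; exact: unit_coord.
have oO' p : O b p -> 1 - h b ord0 p != 0 by case.
set x := fun w' => _.
have xE : x = fun t => stereographic (y (chart b t)) by apply/funext => t; rewrite /x moebius1.
have coE j : co x j = fun p => (1 - h b ord0 p)^-1 * h b (lift ord0 j) p.
  apply/funext => p; rewrite /co xE /stereographic /= !mxE; congr ((1 - _)^-1 * _).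
    by rewrite /h /co /=; congr (y _ _ _); exact: val_inj.
  by rewrite /h /co /=; congr (y _ _ _); exact: val_inj.
have d1 j := stereo_D1 hCO oO' j Ow; have d2 j := stereo_D2 hCO oO' j Ow.
have [c1 c2] := conf_ext Vw; have [n1 n2] := unit_normal (@oO b) hCO uO Ow.
set s := (1 - h b ord0 (ofC w))^-1.
have s0 : s != 0 by rewrite invr_eq0.
pose E := s ^+ 2 * ipp (fun i => D1 (h b i) (ofC w)) (fun i => D1 (h b i) (ofC w)).
have xu : (fun j => dumx x w j 0) = fun j => s ^+ 2 * D1 (h b ord0) (ofC w) * h b (lift ord0 j) (ofC w)
    + s * D1 (h b (lift ord0 j)) (ofC w).
  by apply/funext => j; rewrite dumx_co coE; exact: d1.
have xv : (fun j => dvmx x w j 0) = fun j => s ^+ 2 * D2 (h b ord0) (ofC w) * h b (lift ord0 j) (ofC w)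
    + s * D2 (h b (lift ord0 j)) (ofC w).
  by apply/funext => j; rewrite dvmx_co coE; exact: d2.
have guu : dot (dumx x w) (dumx x w) = E.
  by rewrite dot_ipp xu; exact: (stereo_ipp uO oO' Ow n1 n1).
have gvv : dot (dvmx x w) (dvmx x w) = E.
  by rewrite dot_ipp xv /E c1; exact: (stereo_ipp uO oO' Ow n2 n2).
have guv : dot (dumx x w) (dvmx x w) = 0.
  apply: etrans (etrans (dot_ipp _ _) (f_equal2 (@ipp R _) xu xv)) _.
  by apply: etrans (stereo_ipp uO oO' Ow n1 n2) _; rewrite c2 mulr0.
have E1 : E != 0.
  rewrite mulf_neq0 ?expf_neq0//; apply: contra E0 => /eqP e; apply/eqP; rewrite dot_ipp -[RHS]e.
  by congr ipp; apply/funext => i; rewrite dumx_co.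
apply: (conformal_harmonic_minimal E1 guu gvv guv).
move=> j; rewrite (coE j); exact: (stereo_laplacian (@oO b) hCO oO' j Ow (pole_ext Vw)).
Qed.

(** The constant lightlike vector is already [(1, pole)], so the Moebius transformation can be the
    identity. *)
Theorem minimal_from_lightlike : moebius_equivalent_to_minimal D y.
Proof.
exists 1%:M; first by rewrite /O1 /= trmx1 mul1mx mulmx1.
by split; [exact: minimal_domain_open_dense|exact: stereo_minimal].
Qed.

End Minimal.

(** * Generic rank of a meromorphic matrix *)

Section RankOne.
Variable F : fieldType.

Lemma rank_le1_minors m n (B : 'M[F]_(m, n)) : (\rank B <= 1)%N ->
  forall a a' c c', B a c * B a' c' - B a c' * B a' c = 0.
Proof.
move=> r1 a a' c c'; rewrite -(mulmx_base B).
move: (col_base B) (row_base B); case: (\rank B) r1 => [|[|//]] _ L Q; rewrite !mxE.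
  by rewrite !big_ord0 mul0r subrr.
by rewrite !big_ord1; ring.
Qed.

(** If the entry at [(a, c)] is nonzero, [B] is a multiple of its column [c] times its row [a]. *)
Lemma minors_rank_le1 m n (B : 'M[F]_(m, n)) :
  (forall a a' c c', B a c * B a' c' - B a c' * B a' c = 0) -> (\rank B <= 1)%N.
Proof.
move=> H; have [->|/matrix0Pn[a [c ac0]]] := eqVneq B 0; first by rewrite mxrank0.
have -> : B = ((B a c)^-1 *: col c B) *m row a B.
  apply/matrixP => i j; rewrite !mxE big_ord1 !mxE.
  have /eqP := H a i c j; rewrite subr_eq0 => /eqP e.
  by rewrite -mulrA (mulrC (B i c)) -e mulKf.
by apply: leq_trans (mxrankM_maxl _ _) _; exact: rank_leq_col.
Qed.

Lemma rank_antidiag m n (B : 'M[F]_(m, n)) (A : 'M[F]_(n, m)) :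
  \rank (block_mx 0 B A 0) = (\rank B + \rank A)%N.
Proof.
pose T p q : 'M[F]_(p + q, q + p) := block_mx 0 1%:M 1%:M 0.
have TT p q : T p q *m T q p = 1%:M.
  by rewrite mulmx_block !mul0mx !mulmx0 !mul1mx !add0r !addr0 -scalar_mx_block.
have -> : block_mx 0 B A 0 = block_mx B 0 0 A *m T n m.
  by rewrite mulmx_block !mulmx0 !mul0mx !mulmx1 !add0r !addr0.
rewrite mxrankMfree ?rank_diag_block_mx//.
by apply/row_freeP; exists (T m n).
Qed.

End RankOne.

(** * The identity theorem for meromorphic functions *)

Section Meromorphic.
Variable R : realType.
Local Notation C := (Cplane R).
Local Notation S := (Rsphere R).

Lemma near_ne (w z : C) : w != z -> \forall t \near w, t != z.
Proof.
rewrite -subr_eq0 -normr_gt0 => /posC[r r0 e].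
have ww : `|w - w| < r%:C by rewrite subrr normr0 posC_gt0.
apply: filterS (near_ball ww) => t; rewrite -e => tw; apply/eqP => t0.
by move: tw; rewrite t0 distrC ltxx.
Qed.

Lemma near_exists_neq (w : C) (P : C -> Prop) : (\forall t \near w, P t) -> exists2 t, t != w & P t.
Proof.
move=> /near_box[d d0 H]; exists (w + (d / 2)%:C).
  by rewrite -subr_eq0 addrC addKr fmorph_eq0 gt_eqF// divr_gt0.
have d2 : 0 < d / 2 by rewrite divr_gt0.
apply: H.
  by rewrite !ReImE /= addrC addKr gtr0_norm//; clear -d0; lra.
by rewrite !ReImE /= addrC addKr normr0.
Qed.

Lemma cont_punctured0 (f : C -> C) (w : C) : {for w, continuous f} ->
  (\forall t \near w, t != w -> f t = 0) -> f w = 0.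
Proof.
move=> fc H; apply: contrapT => /eqP f0.
have nf : \forall t \near w, f t != 0 by exact: fc (near_neq f0).
have [t tw [Ht ft]] := near_exists_neq (filterI H nf).
by move: ft; rewrite Ht// eqxx.
Qed.

Lemma holomorphic_at_cont (f : S -> C) b w0 : holomorphic_at f (chart b w0) ->
  \forall w \near w0, {for w, continuous (f \o chart b)}.
Proof. by move=> /(_ b w0 erefl); apply: filterS => w; exact: derivable_contC. Qed.

Lemma meromorphicM (D : set S) (f g : S -> C) : meromorphic D f -> meromorphic D g ->
  meromorphic D (fun q => f q * g q).
Proof.
move=> mf mg q Dq b w0 e; have [k [u [du fu]]] := mf q Dq b w0 e.
have [l [v [dv gv]]] := mg q Dq b w0 e.
exists (k + l)%N, (fun w => u w * v w); split.
  by apply: filterS2 du dv => w; exact: derivableM.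
apply: filterS2 fu gv => w fw gw w0'; rewrite fw// gw// exprD invfM; ring.
Qed.

Lemma meromorphicB (D : set S) (f g : S -> C) : meromorphic D f -> meromorphic D g ->
  meromorphic D (fun q => f q - g q).
Proof.
move=> mf mg q Dq b w0 e; have [k [u [du fu]]] := mf q Dq b w0 e.
have [l [v [dv gv]]] := mg q Dq b w0 e.
exists (k + l)%N, (fun w => u w * (w - w0) ^+ l - v w * (w - w0) ^+ k); split.
  have dp j w : derivable (fun w => (w - w0) ^+ j : C) w 1.
    by apply: derivable_expC; apply: derivableB; [exact: derivable_id|exact: derivable_cst].
  apply: filterS2 du dv => w duw dvw.
  exact: (derivableB (derivableM duw (dp l w)) (derivableM dvw (dp k w))).
apply: filterS2 fu gv => w fw gw w0'; rewrite fw// gw// exprD.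
have := w0'; rewrite -subr_eq0 => /(expf_neq0 k); have := w0'; rewrite -subr_eq0 => /(expf_neq0 l).
by move: ((w - w0) ^+ k) ((w - w0) ^+ l) => x y ? ?; field; apply/andP.
Qed.

(** Punctured neighbourhoods, because the value of a meromorphic function at a pole is arbitrary. *)
Let Zp (f : S -> C) (c : C) := \forall t \near c, t != c -> f (Some t) = 0.

Lemma meromorphic_local (D : set S) (f : S -> C) z : meromorphic D f -> D (Some z) ->
  exists2 r : R, 0 < r & forall c w : C, `|c - z| < r%:C -> `|w - z| < r%:C -> Zp f c -> Zp f w.
Proof.
move=> mf Dz; have [k [g [dg fg]]] := mf _ Dz false z erefl.
have /nbhs_ballP[_ /posC[r r0 ->] Hr] : nbhs z ([set w | derivable g w 1] `&`
    [set w | w != z -> f (chart false w) = g w / (w - z) ^+ k]) by exact: filterI.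
have {}Hr w : `|w - z| < r%:C -> derivable g w 1 /\ (w != z -> f (Some w) = g w / (w - z) ^+ k).
  by move=> wz; have := Hr w; rewrite /ball /= distrC => /(_ wz).
have r3 : 0 < r / 3 by rewrite divr_gt0.
have sub w : `|w - z| < (r / 3)%:C -> `|w - z| < r%:C.
  by move=> h; apply: lt_trans h _; rewrite ltcR; clear -r0; lra.
exists (r / 3) => // c w cz wz Zc.
have nn (x : C) : \forall t \near x, t != x -> t != z.
  have [->|xz] := eqVneq x z; first by near=> t.
  by apply: filterS (near_ne xz) => t.
have nP : \forall t \near c, \forall s \near t, [/\ s != c -> f (Some s) = 0, `|s - z| < (r / 3)%:C & s != c -> s != z].
  by apply: near_join; near=> s; split; near: s; [exact: Zc|exact: near_ball|exact: nn].
have [c' c'c nc'] := near_exists_neq nP.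
have c'r : `|c' - z| < (r / 3)%:C by have [] := nbhs_singleton nc'.
have g0 : \forall s \near c', g s = 0.
  apply: filterS2 nc' (near_ne c'c) => s [h1 h2 h3] sc.
  have [_ /(_ (h3 sc))] := Hr s (sub s h2); rewrite (h1 sc) => /esym/eqP.
  by rewrite mulf_eq0 invr_eq0 expf_eq0 subr_eq0 (negbTE (h3 sc)) andbF orbF => /eqP.
have G := identity_ball_open (fun w wz => (Hr w wz).1) c'r g0.
apply: filterS2 (near_ball wz) (nn w) => t tz tn tw.
by have [_ ->] := Hr t (sub t tz); rewrite ?tn// G ?mul0r.
Unshelve. all: by end_near.
Qed.

Variables (D : set S) (f : S -> C).
Hypothesis hD : is_sphere_plane_or_disk D.
Hypothesis mf : meromorphic D f.

(** The finite part of the domain is star-shaped about 0, so two segments suffice, from [z1] to 0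
    and from 0 to [z]. *)
Lemma meromorphic_propagate z1 : D (Some z1) -> Zp f z1 -> forall z, D (Some z) -> Zp f z.
Proof.
move=> D1 Z1; have loc z t : D (Some z) -> 0 <= t <= 1 -> exists2 r : R, 0 < r & forall c w : C,
    `|c - (0 + t%:C * (z - 0))| < r%:C -> `|w - (0 + t%:C * (z - 0))| < r%:C -> Zp f c -> Zp f w.
  by move=> Dz t01; exact: meromorphic_local mf (domain_segment hD t01 Dz).
have Z0 : Zp f 0.
  apply: (@segment_propagate _ _ z1 0 _ Z1) => t t01.
  have t01' : 0 <= 1 - t <= 1 by lra.
  have [r r0 Hr] := loc z1 (1 - t) D1 t01'; exists r => // c w.
  rewrite (_ : z1 + t%:C * (0 - z1) = 0 + (1 - t)%:C * (z1 - 0)); first exact: Hr.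
  rewrite rmorphB rmorph1; ring.
by move=> z Dz; apply: (@segment_propagate _ _ 0 z _ Z0) => t t01; exact: loc.
Qed.

(** At a point of holomorphy the value is the limit of the values nearby. Infinity takes two such
    limits: [f] first vanishes at the finite points around it, where it is holomorphic too, and then
    at infinity. *)
Lemma meromorphic_vanish z1 q : D (Some z1) -> Zp f z1 -> D q -> holomorphic_at f q -> f q = 0.
Proof.
move=> D1 Z1; have fin := meromorphic_propagate D1 Z1.
case: q => [z|] Dq hq.
  have hq' : holomorphic_at f (chart false z) by [].
  exact: (cont_punctured0 (nbhs_singleton (holomorphic_at_cont hq')) (fin z Dq)).
have e0 : None = chart true 0 :> S by rewrite /= eqxx.
rewrite e0 in hq *; have hc := holomorphic_at_cont hq.
apply: (cont_punctured0 (nbhs_singleton hc)).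
have nD : \forall t \near 0, D (chart true t) by apply: open_near_chart; [exact: domain_open|rewrite -e0].
apply: filterS2 hc nD => w cw Dw w0; apply: (cont_punctured0 cw).
rewrite /= (negbTE w0) in Dw.
have H : \forall t \near w, t^-1 != w^-1 -> f (Some t^-1) = 0 := inv_continuous w0 (fin _ Dw).
apply: filterS2 H (near_neq w0) => t Ht t0 tw.
by rewrite /= (negbTE t0) Ht//; apply: contra tw => /eqP/invr_inj ->.
Qed.

End Meromorphic.

Section GenericRank.
Variable R : realType.
Local Notation C := (Cplane R).
Local Notation S := (Rsphere R).

Lemma near_inv (P : C -> Prop) (w : C) : w != 0 -> (\forall t \near (w^-1 : C), P t) -> \forall t \near w, P t^-1.
Proof. by move=> w0; exact: (inv_continuous w0). Qed.

(** [holomorphic_at] tests both charts; a nonzero point lies in both, and inversion carries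
    differentiability from one to the other. *)
Lemma holomorphic_at_of_chart (f : S -> C) (z : C) : z != 0 ->
  (\forall w \near z, derivable (f \o chart false) w 1) -> holomorphic_at f (Some z).
Proof.
move=> z0 df [] w0 e; last first.
  by rewrite (chart_inj (e : chart false w0 = chart false z)).
have [w00 ew] := chart_eq_swap (e : chart true w0 = chart (~~ true) z).
have H : \forall w \near w0, derivable (f \o chart false) w^-1 1.
  by rewrite ew in df; exact: (near_inv w00 df).
have nz : \forall w \near w0, \forall t \near w, t != 0 by exact: near_join (near_neq w00).
apply: filterS2 H nz => w dw wn; have w1 : w != 0 := nbhs_singleton wn.
have D : derivable (fun t : C => (f \o chart false) t^-1) w 1.
  by apply: derivable_compC dw; apply: derivableV w1 _; exact: derivable_id.
apply: near_eq_derivableC D.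
by apply: filterS wn => t t0; rewrite /= (negbTE t0).
Qed.

(** Every 2 x 2 minor is meromorphic and vanishes near [z1], hence at all regular points. The
    generic rank is 1 if some regular point attains it, and otherwise 0, which [z1] attains. *)
Lemma generic_rank_le1 (D : set S) m n (B : S -> 'M[C]_(m, n)) z1 :
  is_sphere_plane_or_disk D -> (forall i j, meromorphic D (fun q => B q i j)) ->
  D (Some z1) -> z1 != 0 -> (forall i j, \forall w \near z1, derivable (fun w => B (Some w) i j) w 1) ->
  (\forall w \near z1, (\rank (B (Some w)) <= 1)%N) ->
  exists2 r, is_generic_rank D B r & (r <= 1)%N.
Proof.
move=> hD mB Dz z0 dB rB.
have reg1 : D (Some z1) /\ forall i j, holomorphic_at (fun s => B s i j) (Some z1).
  by split=> // i j; apply: holomorphic_at_of_chart z0 (dB i j).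
have all1 q : D q -> (forall i j, holomorphic_at (fun s => B s i j) q) -> (\rank (B q) <= 1)%N.
  move=> Dq hq; apply: minors_rank_le1 => a a' c c'.
  pose f q := B q a c * B q a' c' - B q a c' * B q a' c.
  apply: (@meromorphic_vanish _ D f hD _ _ _ Dz _ Dq).
  - exact: (meromorphicB (meromorphicM (mB a c) (mB a' c')) (meromorphicM (mB a c') (mB a' c))).
  - by apply: filterS rB => w rw _; exact: rank_le1_minors.
  - move=> b w0 e; have H1 := hq a c b w0 e; have H2 := hq a' c' b w0 e.
    have H3 := hq a c' b w0 e; have H4 := hq a' c b w0 e.
    apply: filterS2 (filterI H1 H2) (filterI H3 H4) => w [d1 d2] [d3 d4].
    exact: (derivableB (derivableM d1 d2) (derivableM d3 d4)).
have [[x [Dx hx] rx]|no] := pselect (exists2 x, D x /\ (forall i j, holomorphic_at (fun s => B s i j) x) &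
    \rank (B x) = 1%N).
  by exists 1%N => //; split; [exists x|move=> q [Dq hq]; exact: all1].
have all0 q : D q /\ (forall i j, holomorphic_at (fun s => B s i j) q) -> \rank (B q) = 0%N.
  move=> [Dq hq]; have := all1 q Dq hq; case E : (\rank (B q)) => [|[|//]] // _.
  by case: no; exists q.
exists 0%N => //; split; first by exists (Some z1) => //; exact: all0.
by move=> q /all0 ->.
Qed.

End GenericRank.

(** * The gauge identity of the normalized potential *)

Section UniformTaylor.
Variable R : realType.
Local Notation C := (Cplane R).

Lemma taylor1_bound (f df : R -> R) (c w T : R) : 0 <= T ->
  (forall s, 0 <= s <= T -> is_derive s (1 : R) f (df s)) ->
  (forall s, 0 <= s <= T -> `|df s - c| <= w) -> `|f T - f 0 - T * c| <= w * T.
Proof.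
move=> T0 Hf Hw.
have lin (a : R) s : is_derive s (1 : R) (fun s : R => s * a) a.
  by have := is_derive1_mulr a (is_derive_id s 1); rewrite mul1r.
have key (e : R) : e = 1 \/ e = -1 -> e * (f T - f 0 - T * c) <= w * T.
  move=> He; have D s : 0 <= s <= T ->
      is_derive s (1 : R) (fun s => s * w - (f s * e - s * (c * e))) (w - (df s * e - c * e)).
    move=> sT.
    exact: (is_deriveB (lin w s) (is_deriveB (is_derive1_mulr e (Hf s sT)) (lin (c * e) s))).
  have := nondecr_deriv D _ (lexx 0) T0 (lexx T).
  have P s : 0 <= s <= T -> 0 <= w - (df s * e - c * e).
    move=> /Hw; rewrite ler_norml => /andP[h1 h2].
    by case: He => ->; clear -h1 h2; lra.
  by move=> /(_ P); rewrite !mul0r; clear; nra.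
by rewrite ler_norml; have := key 1 (or_introl erefl); have := key (-1) (or_intror erefl); clear; lra.
Qed.

Lemma is_derive1_sum (J : Type) (r : seq J) (F : J -> R -> R) (dF : J -> R) t :
  (forall i, is_derive t (1 : R) (F i) (dF i)) ->
  is_derive t (1 : R) (fun s => \sum_(i <- r) F i s) (\sum_(i <- r) dF i).
Proof.
move=> H; elim: r => [|i r IH].
  rewrite big_nil (_ : (fun s => _) = fun=> 0); first exact: is_derive_cst.
  by apply/funext => s; rewrite big_nil.
rewrite big_cons (_ : (fun s => _) = F i + fun s => \sum_(j <- r) F j s); first exact: is_deriveD.
by apply/funext => s; rewrite big_cons.
Qed.

Variable I : finType.

(** Gronwall's inequality, applied to the sum of squares [q] because the sum of the [N1] need not be
    differentiable. *)
Lemma growth_bound (p dp : I -> R -> C) (K T : R) : 0 <= K -> 0 <= T <= 1 ->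
  (forall i s, 0 <= s <= T -> is_derive s (1 : R) (fun t => complex.Re (p i t)) (complex.Re (dp i s)) /\
     is_derive s (1 : R) (fun t => complex.Im (p i t)) (complex.Im (dp i s))) ->
  (forall i s, 0 <= s <= T -> N1 (dp i s) <= K * \sum_j N1 (p j s)) ->
  forall i s, 0 <= s <= T -> N1 (p i s) <= 2 * expR (4 * K * #|I|%:R) * \sum_j N1 (p j 0).
Proof.
move=> K0 /andP[T0 T1] Hd Hb i s sT.
pose q t := \sum_j (complex.Re (p j t) ^+ 2 + complex.Im (p j t) ^+ 2).
pose dq t := \sum_j (2 * (complex.Re (p j t) * complex.Re (dp j t) + complex.Im (p j t) * complex.Im (dp j t))).
pose S t := \sum_j N1 (p j t).
(* The rate results from [dq <= 2 * K * S ^+ 2] and [S ^+ 2 <= 2 * #|I|%:R * q]. *)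
pose k := 4 * K * #|I|%:R.
have k0 : 0 <= k by rewrite !mulr_ge0.
have S0 t : 0 <= S t by apply: sumr_ge0 => j _; exact: N1_ge0.
have q0 t : 0 <= q t by apply: sumr_ge0 => j _; rewrite addr_ge0 ?sqr_ge0.
have Sq t : S t ^+ 2 <= 2 * #|I|%:R * q t.
  apply: le_trans (sum_sqr_le _) _; rewrite (mulrC 2) -mulrA; apply: ler_wpM2l => //.
  by rewrite mulr_sumr; apply: ler_sum => j _; have [_] := N1_sqr_bounds (p j t).
have Nq j t : N1 (p j t) ^+ 2 <= 2 * q t.
  have [_ h] := N1_sqr_bounds (p j t); apply: le_trans h _.
  rewrite ler_pM2l// /q (bigD1 j)//= lerDl.
  by apply: sumr_ge0 => l _; rewrite addr_ge0 ?sqr_ge0.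
have qS t : q t <= S t ^+ 2.
  apply: (@le_trans _ _ (\sum_j N1 (p j t) ^+ 2)).
    by apply: ler_sum => j _; have [] := N1_sqr_bounds (p j t).
  rewrite expr2 {1}/S mulr_suml; apply: ler_sum => j _; rewrite expr2.
  by apply: ler_wpM2l; [exact: N1_ge0|rewrite /S (bigD1 j)//= lerDl; apply: sumr_ge0 => l _; exact: N1_ge0].
have Dq t : 0 <= t <= T -> is_derive t (1 : R) q (dq t).
  move=> tT; have D j : is_derive t (1 : R) (fun t => complex.Re (p j t) ^+ 2 + complex.Im (p j t) ^+ 2)
      (2 * (complex.Re (p j t) * complex.Re (dp j t) + complex.Im (p j t) * complex.Im (dp j t))).
    have [h1 h2] := Hd j t tT.
    apply: (is_derive_eq (is_deriveD (is_deriveM h1 h1) (is_deriveM h2 h2))).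
    rewrite /GRing.scale /=; ring.
  exact: is_derive1_sum.
have dqk t : 0 <= t <= T -> dq t <= k * q t.
  move=> tT; apply: (@le_trans _ _ (2 * K * S t ^+ 2)); last first.
    by apply: (le_trans (ler_wpM2l _ (Sq t))); [rewrite mulr_ge0|rewrite /k; lra].
  rewrite /dq expr2 mulrA /S mulr_sumr; apply: ler_sum => j _.
  have h := Hb j t tT; rewrite -/(S t) in h *.
  have n1 := N1_ge0 (p j t).
  apply: (@le_trans _ _ (2 * (N1 (p j t) * N1 (dp j t)))); last first.
    by have := ler_wpM2l n1 h; clear; lra.
  rewrite ler_pM2l// /N1; move: (complex.Re (p j t)) (complex.Im (p j t)) (complex.Re (dp j t)) (complex.Im (dp j t)).
  move=> a b c d; have := ler_norm (a * c); have := ler_norm (b * d); rewrite !normrM.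
  have := mulr_ge0 (normr_ge0 a) (normr_ge0 d); have := mulr_ge0 (normr_ge0 b) (normr_ge0 c).
  by rewrite mulrDl !mulrDr; clear; lra.
have E t : is_derive t (1 : R) (fun t => expR (t * - k)) (- k * expR (t * - k)).
  have h : is_derive t (1 : R) (fun t : R => t * - k) (- k).
    by have := is_derive1_mulr (- k) (is_derive_id t 1); rewrite mul1r.
  by apply: (is_derive_eq (is_derive1_comp (is_derive_expR _) h)); rewrite /GRing.scale /= mulrC.
have /andP[s0 s1] := sT.
have mono : q s * expR (s * - k) <= q 0.
  have D t : 0 <= t <= s -> is_derive t (1 : R) (fun t => q t * expR (t * - k) * -1)
      ((dq t * expR (t * - k) + q t * (- k * expR (t * - k))) * -1).
    move=> /andP[t0 ts]; have tT : 0 <= t <= T by rewrite t0 (le_trans ts).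
    apply: is_derive1_mulr; apply: (is_derive_eq (is_deriveM (Dq t tT) (E t))).
    by rewrite /GRing.scale /= addrC (mulrC (expR _)).
  have P t : 0 <= t <= s -> 0 <= (dq t * expR (t * - k) + q t * (- k * expR (t * - k))) * -1.
    move=> /andP[t0 ts]; have tT : 0 <= t <= T by rewrite t0 (le_trans ts).
    have -> : (dq t * expR (t * - k) + q t * (- k * expR (t * - k))) * -1 = (k * q t - dq t) * expR (t * - k) by ring.
    by rewrite mulr_ge0 ?expR_ge0// subr_ge0 dqk.
  have := nondecr_deriv D P (lexx 0) s0 (lexx s).
  by rewrite !mulrN1 lerN2 mul0r expR0 mulr1.
have e1 : 1 <= expR k by rewrite -expR0 ler_expR.
have es : expR (s * k) <= expR k by rewrite ler_expR ler_piMl// (le_trans s1).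
have q1 : q s <= expR k * q 0.
  have : q s * expR (s * - k) * expR (s * k) <= q 0 * expR (s * k).
    by apply: ler_wpM2r mono; exact: expR_ge0.
  rewrite -mulrA -expRD mulrN addNr expR0 mulr1 => h; apply: le_trans h _.
  by rewrite mulrC; apply: ler_wpM2r.
have := Nq i s; have := qS 0; have := S0 0; have := q0 0; have := N1_ge0 (p i s).
rewrite -/(S 0) -/k; move: (expR k) (N1 (p i s)) (S 0) (q 0) (q s) q1 e1 => ek x y z w q1 e1 x0 z0 y0 zy xw.
rewrite -(@ler_pXn2r _ 2)// ?nnegrE ?mulr_ge0//; last exact: le_trans e1.
have h1 : ek * z <= ek * y ^+ 2 by apply: ler_wpM2l zy; exact: le_trans e1.
have h2 : ek * y ^+ 2 <= ek * (ek * y ^+ 2).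
  by apply: ler_wpM2l; [exact: le_trans e1|rewrite ler_peMl// sqr_ge0].
have h3 : 0 <= ek * y ^+ 2 by rewrite mulr_ge0 ?sqr_ge0// (le_trans _ e1).
have -> : (2 * ek * y) ^+ 2 = 4 * (ek * (ek * y ^+ 2)) by ring.
by clear -h1 h2 h3 xw q1; lra.
Qed.

End UniformTaylor.

Section MatrixTaylor.
Variable R : realType.
Local Notation C := (Cplane R).

Lemma N1_mulmx_le m n p (A : 'M[C]_(m, n)) (B : 'M[C]_(n, p)) (a b : R) i j : 0 <= a ->
  (forall i j, N1 (A i j) <= a) -> (forall i j, N1 (B i j) <= b) -> N1 ((A *m B) i j) <= n%:R * (a * b).
Proof.
move=> a0 HA HB; rewrite mxE; apply: le_trans (N1_sum _ _) _.
have -> : n%:R * (a * b) = \sum_(k < n) (a * b) by rewrite sumr_const card_ord mulr_natl.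
apply: ler_sum => k _; apply: le_trans (N1M _ _) _.
by apply: ler_pM; rewrite ?N1_ge0.
Qed.

(** The constant is chosen before [f], [A] and [B], so that one [c] serves all loop parameters on
    the circle. Gronwall bounds the entries of [f] by [c1], hence those of its derivative by [M]; up
    to time [T] the derivative then varies by at most a multiple of [d + T]. *)
Lemma uniform_taylor N (K P : R) : 0 <= K -> 0 <= P -> exists2 c : R, 0 <= c &
  forall (f A B : R -> 'M[C]_N) (d T : R), 0 <= d -> 0 <= T <= 1 ->
  (forall s, 0 <= s <= T -> forall i j,
     is_derive s (1 : R) (fun t => complex.Re (f t i j)) (complex.Re ((A s *m f s + f s *m B s) i j)) /\
     is_derive s (1 : R) (fun t => complex.Im (f t i j)) (complex.Im ((A s *m f s + f s *m B s) i j))) ->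
  (forall s, 0 <= s <= T -> forall i j, [/\ N1 (A s i j) <= K, N1 (B s i j) <= K,
     N1 ((A s - A 0) i j) <= d & N1 ((B s - B 0) i j) <= d]) ->
  (forall i j, N1 (f 0 i j) <= P) ->
  forall i j, N1 (f T i j - f 0 i j - T%:C * (A 0 *m f 0 + f 0 *m B 0) i j) <= c * (d + T) * T.
Proof.
move=> K0 P0; have [c1 [c10 c1E]] : exists c1, 0 <= c1 /\
    2 * expR (4 * (2 * K) * #|{: 'I_N * 'I_N}|%:R) * (\sum_(k : 'I_N * 'I_N) P) = c1.
  by eexists; split; last reflexivity; rewrite mulr_ge0 ?mulr_ge0 ?expR_ge0//; apply: sumr_ge0.
have [M [M0 ME]] : exists M, 0 <= M /\ 2 * (N%:R * (K * c1)) = M.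
  by eexists; split; last reflexivity; rewrite !mulr_ge0.
exists (4 * N%:R * (c1 + 2 * K * M)) => [|f A B d T d0 T01 Hd Hb Hf i j].
  by rewrite !mulr_ge0// addr_ge0// !mulr_ge0.
have /andP[T0 T1] := T01.
pose X s := A s *m f s + f s *m B s.
have fb s : 0 <= s <= T -> forall i j, N1 (f s i j) <= c1.
  move=> sT k l.
  have := @growth_bound R ('I_N * 'I_N)%type (fun k t => f t k.1 k.2) (fun k t => X t k.1 k.2) (2 * K) T.
  move=> /(_ _ T01 _ _ (k, l) s sT) /= H; apply: le_trans (H _ _ _) _.
  - by rewrite mulr_ge0.
  - by move=> m t tT; exact: Hd.
  - move=> [a b] t tT /=.
    (* A single row or column is part of all the entries; each of the two products contributes [K]
       to the rate [2 * K]. *)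
    have S1 (g : 'I_N -> 'I_N * 'I_N) : injective g ->
        \sum_m N1 (f t (g m).1 (g m).2) <= \sum_(m : 'I_N * 'I_N) N1 (f t m.1 m.2).
      move=> gi; rewrite -(big_imset (fun m => N1 (f t m.1 m.2)) (h := g) (A := predT)) /=; last by move=> x y _ _; exact: gi.
      rewrite [leRHS](bigID (mem (g @: predT))) /= lerDl.
      by apply: sumr_ge0 => m _; exact: N1_ge0.
    rewrite /X mxE; apply: le_trans (N1D _ _) _; rewrite mulr2n mulrDl mulrDl !mul1r; apply: lerD.
    + rewrite mxE; apply: le_trans (N1_sum _ _) _.
      apply: (@le_trans _ _ (K * \sum_m N1 (f t m b))).
        rewrite mulr_sumr; apply: ler_sum => m _; apply: le_trans (N1M _ _) _.
        by apply: ler_wpM2r; [exact: N1_ge0|have [] := Hb t tT a m].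
      by apply: (ler_wpM2l K0); apply: (S1 (fun m => (m, b))) => x y [].
    + rewrite mxE; apply: le_trans (N1_sum _ _) _.
      apply: (@le_trans _ _ (K * \sum_m N1 (f t a m))).
        rewrite mulr_sumr; apply: ler_sum => m _; apply: le_trans (N1M _ _) _.
        by rewrite mulrC; apply: ler_wpM2r; [exact: N1_ge0|have [] := Hb t tT m b].
      by apply: (ler_wpM2l K0); apply: (S1 (fun m => (a, m))) => x y [].
  - by rewrite -c1E; apply: ler_wpM2l; [rewrite mulr_ge0// expR_ge0|apply: ler_sum].
have Xb s : 0 <= s <= T -> forall i j, N1 (X s i j) <= M.
  move=> sT k l; rewrite /X mxE -ME; apply: le_trans (N1D _ _) _.
  have h1 := @N1_mulmx_le _ _ _ (A s) (f s) K c1 k l K0 (fun i j => let: And4 h _ _ _ := Hb s sT i j in h) (fb s sT).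
  have h2 := @N1_mulmx_le _ _ _ (f s) (B s) c1 K k l c10 (fb s sT) (fun i j => let: And4 _ h _ _ := Hb s sT i j in h).
  by rewrite (mulrC c1) in h2; clear -h1 h2; lra.
have n1 (a b : C) w : `|complex.Re a - complex.Re b| <= w -> `|complex.Im a - complex.Im b| <= w -> N1 (a - b) <= 2 * w.
  by rewrite /N1 !ReImE; clear; lra.
have df s : 0 <= s <= T -> forall i j, N1 ((f s - f 0) i j) <= 2 * (M * T).
  move=> /andP[s0 sT] k l.
  have Hs t : 0 <= t <= s -> 0 <= t <= T by move=> /andP[-> ts]; exact: le_trans sT.
  have Xr t : 0 <= t <= s -> `|complex.Re (X t k l) - 0| <= M /\ `|complex.Im (X t k l) - 0| <= M.
    move=> /Hs/Xb/(_ k l); rewrite !subr0 /N1; have := normr_ge0 (complex.Re (X t k l)); have := normr_ge0 (complex.Im (X t k l)).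
    by clear; split; lra.
  have Ms : M * s <= M * T by exact: ler_wpM2l.
  have h1 := taylor1_bound s0 (fun t ht => (Hd t (Hs t ht) k l).1) (fun t ht => (Xr t ht).1).
  have h2 := taylor1_bound s0 (fun t ht => (Hd t (Hs t ht) k l).2) (fun t ht => (Xr t ht).2).
  rewrite [(f s - f 0) k l]mxE [(- f 0) k l]mxE; apply: n1.
    by move: h1; rewrite mulr0 subr0 => h1; exact: le_trans h1 Ms.
  by move: h2; rewrite mulr0 subr0 => h2; exact: le_trans h2 Ms.
pose w := 2 * (N%:R * (d * c1 + K * (2 * (M * T)))).
have Xd s : 0 <= s <= T -> N1 (X s i j - X 0 i j) <= w.
  move=> sT; have zT : 0 <= (0 : R) <= T by rewrite lexx.
  have -> : X s i j - X 0 i j = ((A s - A 0) *m f s + A 0 *m (f s - f 0)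
      + (f s *m (B s - B 0) + (f s - f 0) *m B 0)) i j.
    rewrite !mulmxBl !mulmxBr /X.
    move: (A s *m f s) (A 0 *m f 0) (f s *m B s) (f 0 *m B 0) (A 0 *m f s) (f s *m B 0) => a b e g h l.
    by rewrite !mxE; ring.
  rewrite mxE [X in X + _]mxE [X in _ + X]mxE.
  have m0 : 0 <= 2 * (M * T) by rewrite !mulr_ge0.
  have h1 := @N1_mulmx_le _ _ _ (A s - A 0) (f s) d c1 i j d0 (fun i j => let: And4 _ _ h _ := Hb s sT i j in h) (fb s sT).
  have h2 := @N1_mulmx_le _ _ _ (A 0) (f s - f 0) K _ i j K0 (fun i j => let: And4 h _ _ _ := Hb 0 zT i j in h) (df s sT).
  have h3 := @N1_mulmx_le _ _ _ (f s) (B s - B 0) c1 d i j c10 (fb s sT) (fun i j => let: And4 _ _ _ h := Hb s sT i j in h).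
  have h4 := @N1_mulmx_le _ _ _ (f s - f 0) (B 0) _ K i j m0 (df s sT) (fun i j => let: And4 _ h _ _ := Hb 0 zT i j in h).
  apply: le_trans (N1D _ _) _; apply: le_trans (lerD (N1D _ _) (N1D _ _)) _.
  apply: le_trans (lerD (lerD h1 h2) (lerD h3 h4)) _.
  by rewrite /w (mulrC c1) (mulrC (2 * (M * T)) K) mulrDr; clear; lra.
have Xr t : 0 <= t <= T -> `|complex.Re (X t i j) - complex.Re (X 0 i j)| <= w /\ `|complex.Im (X t i j) - complex.Im (X 0 i j)| <= w.
  move=> /Xd; rewrite /N1 !ReImE; move: (complex.Re _ - _) (complex.Im _ - _) => a b.
  by have := normr_ge0 a; have := normr_ge0 b; clear; split; lra.
have h1 := taylor1_bound T0 (fun t ht => (Hd t ht i j).1) (fun t ht => (Xr t ht).1).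
have h2 := taylor1_bound T0 (fun t ht => (Hd t ht i j).2) (fun t ht => (Xr t ht).2).
apply: (@le_trans _ _ (2 * (w * T))).
  have e : forall x y z : C, complex.Re (x - y - T%:C * z) = complex.Re x - complex.Re y - T * complex.Re z /\
      complex.Im (x - y - T%:C * z) = complex.Im x - complex.Im y - T * complex.Im z.
    by move=> x y z; rewrite !ReImE /= !mul0r; clear; split; ring.
  have [e1 e2] := e (f T i j) (f 0 i j) (X 0 i j); rewrite /N1 e1 e2.
  by clear -h1 h2; lra.
rewrite mulrA; apply: (ler_wpM2r T0).
have g1 := mulr_ge0 (mulr_ge0 K0 M0) d0; have g2 := mulr_ge0 c10 T0.
have -> : 2 * w = 4 * N%:R * (d * c1 + K * (2 * (M * T))) by rewrite /w; ring.
rewrite -(mulrA (4 * N%:R) (c1 + _)); apply: ler_wpM2l; first by rewrite mulr_ge0.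
by move: g1 g2; clear; nra.
Qed.

End MatrixTaylor.

Section MatrixContinuity.
Variable R : realType.
Local Notation C := (Cplane R).

Definition mcont m n (f : C -> 'M[C]_(m, n)) (z : C) : Prop :=
  forall e : R, 0 < e -> \forall w \near z, forall i j, N1 ((f w - f z) i j) <= e.

Lemma mcont_entries m n (f : C -> 'M[C]_(m, n)) z :
  (forall i j (e : R), 0 < e -> \forall w \near z, N1 (f w i j - f z i j) <= e) -> mcont f z.
Proof.
move=> H e e0; apply: (filterS _ (filter_forall _ (fun i => filter_forall _ (fun j => H i j e e0)))).
by move=> w Hw i j; have h := Hw i j; rewrite [X in N1 X]mxE [X in N1 (_ + X)]mxE.
Qed.

Lemma mcont_CkMx V m n (f : C -> 'M[C]_(m, n)) z : V (ofC z) -> CkMx 0 V f -> mcont f z.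
Proof.
move=> Vz Hf; apply: mcont_entries => i j e e0; have [h1 h2] := Hf i j.
have e2 : 0 < e / 2 by rewrite divr_gt0.
have [d1 d10 H1] := (cont2_epsP _ _).1 (Ck_cont h1 Vz) _ e2.
have [d2 d20 H2] := (cont2_epsP _ _).1 (Ck_cont h2 Vz) _ e2.
apply/near_box; exists (Num.min d1 d2); first by rewrite lt_min d10.
move=> w; rewrite !lt_min => /andP[a1 a2] /andP[b1 b2].
have A := H1 _ _ a1 b1; have B := H2 _ _ a2 b2.
have Ez : toC (complex.Re w, complex.Im w) = w by case: (w).
rewrite /rp /ip Ez toCK in A B.
by rewrite /N1 !ReImE (splitr e) lerD// ltW.
Qed.

Lemma mcont_derivable m n (f : C -> 'M[C]_(m, n)) z :
  (forall i j, derivable (fun w => f w i j : C) z 1) -> mcont f z.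
Proof.
move=> df; apply: mcont_entries => i j e e0.
have := derivable_contC (df i j); have e2 : 0 < (e / 2)%:C :> C by rewrite posC_gt0 divr_gt0.
move=> /cvgrPdist_lt/(_ _ e2); apply: filterS => w; rewrite distrC => h.
have h1 := absRe_lt h; have h2 := absIm_lt h.
by rewrite /N1 (splitr e) lerD// ltW.
Qed.

Lemma mcont_bounded m n (f : C -> 'M[C]_(m, n)) z : mcont f z ->
  exists2 k : R, 0 <= k & forall w (e : R), (forall i j, N1 ((f w - f z) i j) <= e) -> e <= 1 ->
    forall i j, N1 (f w i j) <= k.
Proof.
move=> _; exists (\sum_i \sum_j N1 (f z i j) + 1).
  by rewrite addr_ge0//; apply: sumr_ge0 => i _; apply: sumr_ge0 => j _; exact: N1_ge0.
move=> w e H e1 i j; have := N1D ((f w - f z) i j) (f z i j).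
have -> : (f w - f z) i j + f z i j = f w i j by rewrite !mxE subrK.
have : N1 (f z i j) <= \sum_i \sum_j N1 (f z i j).
  rewrite (bigD1 i)//= (bigD1 j)//= -addrA lerDl addr_ge0//.
    by apply: sumr_ge0 => l _; exact: N1_ge0.
  by apply: sumr_ge0 => k _; apply: sumr_ge0 => l _; exact: N1_ge0.
by have := H i j; move: (\sum_i _) => S; clear -e1; lra.
Qed.

Lemma N1_le2 (z : C) (M : R) : `|z| <= M%:C -> N1 z <= 2 * M.
Proof. by move=> h; have := absRe_le h; have := absIm_le h; rewrite /N1; clear; lra. Qed.

Lemma N1_unit (l : C) : `|l| = 1 -> N1 l <= 2.
Proof.
by move=> l1; have := @N1_le2 l 1; rewrite mulr1; apply; rewrite l1.
Qed.

Lemma N1_scale_unit m n (l : C) (A : 'M[C]_(m, n)) (e : R) i j : `|l| = 1 -> N1 (A i j) <= e ->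
  N1 ((l *: A) i j) <= 2 * e.
Proof.
move=> /N1_unit l2 Ae; rewrite mxE; apply: le_trans (N1M _ _) _.
by apply: ler_pM => //; exact: N1_ge0.
Qed.

(** On the circle [l] and [l^-1] enter only through [N1 l <= 2], so the estimates are uniform in
    [l]; the four terms of [B] give [6 = 2 + 1 + 2 + 1]. *)
Lemma pencil_bounds N (p0 k0 p1 k1 eta : C -> 'M[C]_N) z :
  mcont p0 z -> mcont k0 z -> mcont p1 z -> mcont k1 z -> mcont eta z ->
  let A w l := - (l^-1 *: eta w) in
  let B w l := l^-1 *: p0 w + k0 w + (l *: p1 w + k1 w) in
  exists2 k : R, 0 <= k & forall e : R, 0 < e -> e <= 1 -> \forall w \near z,
  forall l : C, `|l| = 1 -> forall i j,
  [/\ N1 (A w l i j) <= k, N1 (B w l i j) <= k, N1 ((A w l - A z l) i j) <= 6 * e &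
      N1 ((B w l - B z l) i j) <= 6 * e].
Proof.
move=> c0 c1 c2 c3 c4 A B.
have [b1 b10 Hb1] := mcont_bounded c0; have [b2 b20 Hb2] := mcont_bounded c1.
have [b3 b30 Hb3] := mcont_bounded c2; have [b4 b40 Hb4] := mcont_bounded c3.
have [b5 b50 Hb5] := mcont_bounded c4.
exists (2 * (b1 + b2 + b3 + b4 + b5)); first by rewrite mulr_ge0// !addr_ge0.
move=> e e0 e1.
have n4 (a b c d : 'M[C]_N) (x y u v : R) i j : N1 (a i j) <= x -> N1 (b i j) <= y -> N1 (c i j) <= u ->
    N1 (d i j) <= v -> N1 ((a + b + (c + d)) i j) <= x + y + (u + v).
  move=> h1 h2 h3 h4; rewrite [X in N1 X]mxE; apply: le_trans (N1D _ _) _.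
  rewrite [X in N1 X + _]mxE [X in _ + N1 X]mxE.
  by apply: le_trans (lerD (N1D _ _) (N1D _ _)) _; apply: lerD; apply: lerD.
apply: filterS2 (filterI (c0 e e0) (c1 e e0)) (filterI (filterI (c2 e e0) (c3 e e0)) (c4 e e0)).
move=> w [h1 h2] [[h3 h4] h5] l l1 i j.
have g1 := Hb1 w e h1 e1; have g2 := Hb2 w e h2 e1; have g3 := Hb3 w e h3 e1.
have g4 := Hb4 w e h4 e1; have g5 := Hb5 w e h5 e1.
have l1' : `|l^-1| = 1 by rewrite normfV l1 invr1.
rewrite /A /B; split.
- rewrite [X in N1 X]mxE N1N; apply: le_trans (N1_scale_unit l1' (g5 i j)) _.
  by clear -b10 b20 b30 b40; lra.
- apply: le_trans (n4 _ _ _ _ _ _ _ _ i j (N1_scale_unit l1' (g1 i j)) (g2 i j) (N1_scale_unit l1 (g3 i j)) (g4 i j)) _.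
  by clear -b10 b20 b30 b40 b50; lra.
- have -> : - (l^-1 *: eta w) - - (l^-1 *: eta z) = - (l^-1 *: (eta w - eta z)) by rewrite scalerBr opprD.
  rewrite [X in N1 X]mxE N1N.
  by apply: le_trans (N1_scale_unit l1' (h5 i j)) _; clear -e0; lra.
- have -> : l^-1 *: p0 w + k0 w + (l *: p1 w + k1 w) - (l^-1 *: p0 z + k0 z + (l *: p1 z + k1 z)) =
      l^-1 *: (p0 w - p0 z) + (k0 w - k0 z) + (l *: (p1 w - p1 z) + (k1 w - k1 z)).
    rewrite !scalerBr opprD [in LHS]addrACA; congr (_ + _).
      by rewrite opprD addrACA.
    by rewrite opprD addrACA.
  apply: le_trans (n4 _ _ _ _ _ _ _ _ i j (N1_scale_unit l1' (h1 i j)) (h2 i j) (N1_scale_unit l1 (h3 i j)) (h4 i j)) _.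
  by clear; lra.
Qed.

Lemma partB n (M M' : 'M[C]_(4 + n)) :
  ppart (M - M') = ppart M - ppart M' /\ kpart (M - M') = kpart M - kpart M'.
Proof.
have s : sigma (M - M') = sigma M - sigma M' by rewrite /sigma mulmxBr mulmxBl.
rewrite /ppart /kpart s; move: (sigma M) (sigma M') => S S'; rewrite -!scalerBr.
split; congr (_ *: _).
  by rewrite !opprB addrACA [RHS]addrACA [- S + _]addrC.
by rewrite opprD addrACA.
Qed.

Lemma part_entry n (M : 'M[C]_(4 + n)) i j :
  N1 (ppart M i j) <= N1 (M i j) /\ N1 (kpart M i j) <= N1 (M i j).
Proof.
have N10 : N1 (0 : C) = 0 by rewrite /N1 /= normr0 addr0.
have [-> ->] := kppart_block M; rewrite -{3 6}(submxK M); split.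
  rewrite /block_mx !mxE; case: (fintype.split i) => k; rewrite !mxE; case: (fintype.split j) => l; rewrite !mxE ?N10 ?N1_ge0//.
rewrite /block_mx !mxE; case: (fintype.split i) => k; rewrite !mxE; case: (fintype.split j) => l; rewrite !mxE ?N10 ?N1_ge0//.
Qed.

Lemma disc_holo_mulmx m n p (A : C -> 'M[C]_(m, n)) (B : C -> 'M[C]_(n, p)) i j :
  (forall i j, disc_holo (fun l => A l i j)) -> (forall i j, disc_holo (fun l => B l i j)) ->
  disc_holo (fun l => (A l *m B l) i j).
Proof.
move=> HA HB; have -> : (fun l => (A l *m B l) i j) = fun l => \sum_k A l i k * B l k j.
  by apply/funext => l; rewrite mxE.
by apply: disc_holo_sum => k; exact: disc_holoM.
Qed.

End MatrixContinuity.

Lemma taylor_const (R : realType) (c d e T : R) : 0 <= c -> 0 < d -> T <= d ->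
  12 * (c + 1) * d <= e -> c * (6 * d + T) <= e.
Proof.
move=> c0 d0 Td; have h := ler_wpM2l c0 Td; have h2 := mulr_ge0 c0 (ltW d0).
by rewrite mulrDr mulrDr mulrDl; lra.
Qed.

Section Pencil.
Variables (R : realType) (N : nat).
Local Notation C := (Cplane R).
Implicit Types f E a b c d : 'M[C]_N.

(** Multiplication by [l] clears the pole at 0: the left-hand side makes sense on the whole disc. *)
Lemma pencil_scale f E a b c d (l : C) : l != 0 ->
  - E *m f + f *m (a + l *: (b + d) + (l * l) *: c) =
  l *: (- (l^-1 *: E) *m f + f *m (l^-1 *: a + b + (l *: c + d))).
Proof.
move=> l0; rewrite [RHS]scalerDr [X in _ = X + _]scalemxAl [X in _ = _ + X]scalemxAr scalerN scalerA mulfV// scale1r.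
congr (_ + _ *m _); rewrite !scalerDr !scalerA mulfV// scale1r.
by rewrite -!addrA; congr (_ + (_ + _)); rewrite addrC.
Qed.

Lemma pencil_frame f E g a b :
  - (E *m g) *m f + g *m (f *m a) = - E *m (g *m f) + g *m f *m (a + b) - g *m f *m b.
Proof. by rewrite mulmxDr addrA addrK !mulNmx !mulmxA. Qed.

Lemma disc_holo_pencil (f : C -> 'M[C]_N) E a b c i j : (forall i j, disc_holo (fun l => f l i j)) ->
  disc_holo (fun l => (- E *m f l + f l *m (a + l *: b + (l * l) *: c)) i j).
Proof.
move=> hf; have -> : (fun l => (- E *m f l + f l *m (a + l *: b + (l * l) *: c)) i j) =
    fun l => (- E *m f l) i j + (f l *m (a + l *: b + (l * l) *: c)) i j.
  by apply/funext => l; rewrite mxE.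
apply: disc_holoD.
  by apply: (@disc_holo_mulmx _ _ _ _ (fun=> - E) f); [move=> k m; exact: disc_holo_cst|exact: hf].
apply: (@disc_holo_mulmx _ _ _ _ f (fun l => a + l *: b + (l * l) *: c)); [exact: hf|move=> k m].
have -> : (fun l => (a + l *: b + (l * l) *: c) k m) = fun l => a k m + l * b k m + (l * l) * c k m.
  by apply/funext => l; rewrite !mxE.
apply: disc_holoD; last by apply: disc_holoM; [apply: disc_holoM; exact: disc_holo_id|exact: disc_holo_cst].
by apply: disc_holoD; [exact: disc_holo_cst|apply: disc_holoM; [exact: disc_holo_id|exact: disc_holo_cst]].
Qed.

End Pencil.

Section GaugeIdentity.
Variables (R : realType) (n : nat).
Local Notation C := (Cplane R).
Variables (U : set C) (F0 : C -> 'M[R]_(4 + n)) (F Fm Fp : C -> C -> 'M[C]_(4 + n)).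
Variable eta : C -> 'M[C]_(4 + n).
Hypothesis oU : open U.
Hypothesis sF0 : smoothRmx U F0.
Hypothesis F0O : forall z, U z -> O1 (F0 z).
Hypothesis HF : is_extended_frame U F0 F.
Hypothesis HFmp : forall z, U z -> [/\ minus_loop_based (Fm z), plus_loop (Fp z) &
  forall l : C, `|l| = 1 -> F z l = Fm z l *m Fp z l].
Hypothesis HFm : forall z, U z -> forall l : C, `|l| = 1 -> forall i j,
  is_derive z 1 (fun w => Fm w l i j : C) ((Fm z l *m (l^-1 *: eta z)) i j).
Hypothesis eta_so : forall z, I1 C (4 + n) *m eta z + (eta z)^T *m I1 C (4 + n) = 0.

Let J := I1 C (4 + n).
(** On the circle this is [F_-^-1 F], that is [F_+], written with factors whose derivatives in [z]
    are given. *)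
Let G z l := J *m (Fm z l)^T *m J *m F z l.
Let A z l := - (l^-1 *: eta z).
(** The sum of the [dz] and [dzbar] coefficients is the derivative in the real direction, the only
    direction in which difference quotients are taken. *)
Let B z l := alpha_z F0 l z + alpha_zbar F0 l z.

Lemma plus_factorE z l : U z -> `|l| = 1 -> G z l = Fp z l.
Proof.
move=> Uz l1; have [mz _ FF] := HFmp Uz; rewrite /G FF//.
have [e _] := O1_inv (minus_loop_O1 mz l1).
by rewrite mulmxA e mul1mx.
Qed.

Lemma plus_factor_has_WM z l : U z -> `|l| = 1 ->
  exists Q, has_WM (G^~ l) z (A z l *m G z l + G z l *m B z l - Q) Q.
Proof.
move=> Uz l1; exists (G z l *m alpha_zbar F0 l z).
have H1 := has_WM_mulr J (has_WM_mull J (has_WM_tr (minus_has_WM HFm Uz l1))).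
have H := has_WM_mul H1 (frame_has_WM oU HF Uz l1).
apply: eq_has_WM H.
  have e : J *m (l^-1 *: eta z) + (l^-1 *: eta z)^T *m J = 0.
    have eT : (l^-1 *: eta z)^T = l^-1 *: (eta z)^T by rewrite linearZ.
    by rewrite eT -scalemxAr -scalemxAl -scalerDr eta_so scaler0.
  rewrite (so_flip (Fm z l) (I1_sq _ _) e); exact: pencil_frame.
by rewrite trmx0 mulmx0 !mul0mx add0r mulmxA.
Qed.

Lemma plus_factor_deriv z l (t : R) : U (z + t%:C) -> `|l| = 1 ->
  let X := A (z + t%:C) l *m G (z + t%:C) l + G (z + t%:C) l *m B (z + t%:C) l in forall i j,
  is_derive t (1 : R) (fun s : R => complex.Re (G (z + s%:C) l i j)) (complex.Re (X i j)) /\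
  is_derive t (1 : R) (fun s : R => complex.Im (G (z + s%:C) l i j)) (complex.Im (X i j)).
Proof.
move=> Uz l1 X i j; have [Q /(_ i j)] := plus_factor_has_WM Uz l1.
rewrite -/X; move: X => X [h1 h2].
have e : (X - Q) i j + Q i j = X i j by rewrite !mxE subrK.
rewrite e in h1 h2.
have d1 : is_derive t (1 : R) (fun s : R => complex.Re z + s) 1.
  by have := is_deriveD (is_derive_cst (complex.Re z) t 1) (is_derive_id t (1 : R)); rewrite add0r.
have d2 : is_derive t (1 : R) (fun s : R => complex.Im z) 0 := is_derive_cst _ _ _.
have et s : toC (complex.Re z + s, complex.Im z) = z + s%:C.
  by apply: eqC; rewrite !ReImE /= ?addr0.
have eo : ofC (z + t%:C) = (complex.Re z + t, complex.Im z).
  by rewrite /ofC !ReImE /= addr0.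
rewrite eo in h1 h2.
have k1 := lin_approx_curve h1 d1 d2; have k2 := lin_approx_curve h2 d1 d2.
rewrite mulr0 addr0 mulr1 in k1; rewrite mulr0 addr0 mulr1 in k2; split.
  have -> : (fun s : R => complex.Re (G (z + s%:C) l i j)) = fun s => rp (fun w => G w l i j) (complex.Re z + s, complex.Im z).
    by apply/funext => s; rewrite /rp et.
  exact: k1.
have -> : (fun s : R => complex.Im (G (z + s%:C) l i j)) = fun s => ip (fun w => G w l i j) (complex.Re z + s, complex.Im z).
  by apply/funext => s; rewrite /ip et.
exact: k2.
Qed.

Variable z1 : C.
Hypothesis Uz1 : U z1.
Hypothesis eta_cont : mcont eta z1.

Let V := (@toC R) @^-1` U.
Let oV : open V := open_toC oU.
Let Vz1 : V (ofC z1). Proof. by rewrite /V /= toCK. Qed.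

Lemma parts_mcont (f : C -> 'M[C]_(4 + n)) : CkMx 0 V f ->
  mcont (fun z => ppart (f z)) z1 /\ mcont (fun z => kpart (f z)) z1.
Proof.
move=> /(mcont_CkMx Vz1) Hf; split=> e e0; apply: filterS (Hf e e0) => w H i j.
  by rewrite -(partB _ _).1; apply: le_trans (H i j); exact: (part_entry _ _ _).1.
by rewrite -(partB _ _).2; apply: le_trans (H i j); exact: (part_entry _ _ _).2.
Qed.

Lemma alpha_bounds : exists2 k : R, 0 <= k & forall e : R, 0 < e -> e <= 1 -> \forall w \near z1,
  forall l : C, `|l| = 1 -> forall i j,
  [/\ N1 (A w l i j) <= k, N1 (B w l i j) <= k, N1 ((A w l - A z1 l) i j) <= 6 * e &
      N1 ((B w l - B z1 l) i j) <= 6 * e].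
Proof.
have c0 : CkMx 0 V (mc_z F0) := mc_CkMx oU sF0 F0O 0.
have c1 : CkMx 0 V (mc_zbar F0) := mcbar_CkMx oU sF0 F0O 0.
have [p0 k0] := parts_mcont c0; have [p1 k1] := parts_mcont c1.
exact: (pencil_bounds p0 k0 p1 k1 eta_cont).
Qed.

Let X z l := A z l *m G z l + G z l *m B z l.

(** All loop parameters on the circle share a bound [P] on the entries of [F_+] at [z1], by
    compactness, and the estimates of [alpha_bounds]; so a single step [T] works for all of them. *)
Lemma uniform_quotient (e : R) : 0 < e -> exists2 T : R, 0 < T & U (z1 + T%:C) /\
  forall l : C, `|l| = 1 -> forall i j,
  N1 (Fp (z1 + T%:C) l i j - Fp z1 l i j - T%:C * X z1 l i j) <= e * T.
Proof.
move=> e0; have [k k0 Hk] := alpha_bounds.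
have [_ pz _] := HFmp Uz1; have [_ _ ph pc] := pz.
have bnd (ij : 'I_(4 + n) * 'I_(4 + n)) : exists M : R, 0 <= M /\ forall l : C, `|l| = 1 -> N1 (Fp z1 l ij.1 ij.2) <= 2 * M.
  have [M M0 HM] := disc_holo_bounded (conj (ph ij.1 ij.2) (pc ij.1 ij.2)).
  by exists M; split=> // l /HM h; exact: N1_le2.
have [M HM] := choice bnd.
pose P := \sum_ij 2 * M ij.
have P0 : 0 <= P by apply: sumr_ge0 => ij _; rewrite mulr_ge0//; have [] := HM ij.
have PM i j l : `|l| = 1 -> N1 (Fp z1 l i j) <= P.
  move=> l1; have [_ /(_ l l1) h] := HM (i, j); apply: le_trans h _.
  rewrite /P (bigD1 (i, j))//= lerDl; apply: sumr_ge0 => ij _; rewrite mulr_ge0//.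
  by have [] := HM ij.
clearbody P.
have [c c0 Hc] := @uniform_taylor R (4 + n) k P k0 P0.
(* The factor [12 * (c + 1)] leaves room for [c * (6 * d + T)] with [T <= d]. *)
pose d := Num.min 1 (e / (12 * (c + 1))).
have c10 : 0 < c + 1 by rewrite ltr_wpDl.
have d0 : 0 < d by rewrite lt_min ltr01 divr_gt0// mulr_gt0.
have d1 : d <= 1 by rewrite ge_min lexx.
have de : 12 * (c + 1) * d <= e.
  rewrite mulrC -ler_pdivlMr ?mulr_gt0//.
  by rewrite ge_min lexx orbT.
have nU : \forall w \near z1, U w by exact: (open_nbhs_nbhs (conj oU Uz1)).
have nUk : \forall w \near z1, U w /\ forall l : C, `|l| = 1 -> forall i j,
    [/\ N1 (A w l i j) <= k, N1 (B w l i j) <= k, N1 ((A w l - A z1 l) i j) <= 6 * d &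
        N1 ((B w l - B z1 l) i j) <= 6 * d] by exact: filterI nU (Hk d d0 d1).
have [r r0 Hr] := (near_box _ _).1 nUk.
pose T := Num.min (r / 2) d.
have T0 : 0 < T by rewrite lt_min d0 divr_gt0.
have Tr : T < r.
  have m : T <= r / 2 by rewrite ge_min lexx.
  by apply: le_lt_trans m _; rewrite ltr_pdivrMr// ltr_pMr// ltr1n.
have Td : T <= d by rewrite ge_min lexx orbT.
have nr (s : R) : 0 <= s <= T -> U (z1 + s%:C) /\ forall l : C, `|l| = 1 -> forall i j,
    [/\ N1 (A (z1 + s%:C) l i j) <= k, N1 (B (z1 + s%:C) l i j) <= k,
        N1 ((A (z1 + s%:C) l - A z1 l) i j) <= 6 * d &
        N1 ((B (z1 + s%:C) l - B z1 l) i j) <= 6 * d].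
  move=> /andP[s0 sT]; apply: Hr; rewrite !ReImE /= addrC addKr ?normr0//.
  by rewrite ger0_norm//; exact: le_lt_trans Tr.
have U0 : U (z1 + T%:C) by have [] := nr T; rewrite ?lexx ?ltW.
exists T => //; split=> // l l1 i j.
have z0 : z1 + (0 : R)%:C = z1 by rewrite addr0.
have := Hc (fun s => G (z1 + s%:C) l) (fun s => A (z1 + s%:C) l) (fun s => B (z1 + s%:C) l) (6 * d) T.
move=> /(_ _ _ _ _ _ i j) H; apply: le_trans (le_trans (H _ _ _ _ _) _).
- by rewrite z0 -(plus_factorE U0 l1) -(plus_factorE Uz1 l1); exact: lexx.
- by rewrite mulr_ge0// ltW.
- by rewrite (ltW T0) (le_trans Td).
- by move=> s sT i' j'; have [Us _] := nr s sT; exact: plus_factor_deriv Us l1 i' j'.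
- by move=> s sT i' j'; rewrite z0; have [_ /(_ l l1)] := nr s sT.
- by move=> i' j'; rewrite z0 (plus_factorE Uz1 l1); exact: PM.
- apply: (ler_wpM2r (ltW T0)).
  exact: taylor_const c0 d0 Td de.
Qed.

Lemma disc_holo_plus z i j : U z -> disc_holo (fun l => Fp z l i j).
Proof. by move=> Uz; have [_ [_ _ ph pc] _] := HFmp Uz; split; [exact: ph|exact: pc]. Qed.

(* The holomorphic function l (F_+(z + T, l) - F_+(z, l)) vanishes at l = 0, and
   as T tends to 0 its quotient by T tends, uniformly on the circle, to a
   function that extends holomorphically to the disc. *)
Lemma gauge_identity : eta z1 *m Fp z1 0 = Fp z1 0 *m ppart (mc_z F0 z1).
Proof.
(* On the circle this is [l] times the derivative of [F_+] in the real direction, written without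
   negative powers of [l]; its value at [l = 0] is the difference of the two sides of the claim. *)
pose Y l := - eta z1 *m Fp z1 l + Fp z1 l *m (ppart (mc_z F0 z1) + l *: (kpart (mc_z F0 z1) + kpart (mc_zbar F0 z1))
   + (l * l) *: ppart (mc_zbar F0 z1)).
have YX l : `|l| = 1 -> Y l = l *: X z1 l.
  move=> l1; have l0 : l != 0 by rewrite -normr_gt0 l1.
  rewrite /X (plus_factorE Uz1 l1); exact: pencil_scale.
have hY i j : disc_holo (fun l => Y l i j).
  by apply: disc_holo_pencil => i' j'; exact: disc_holo_plus.
have Y0 i j : Y 0 i j = 0.
  have H (e : R) : 0 < e -> `|complex.Re (Y 0 i j)| <= e /\ `|complex.Im (Y 0 i j)| <= e.
    move=> e0; have [T T0 [UT HT]] := uniform_quotient e0.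
    (* At [l = 0] the uncontrolled difference of [F_+] is multiplied by 0, so [h 0] is [- T] times
       the entry of [Y 0], while [h] is bounded by [e * T] on the circle. *)
    pose h l := l * (Fp (z1 + T%:C) l i j + - Fp z1 l i j) + (- T%:C) * Y l i j.
    have hh : disc_holo h.
      apply: disc_holoD; apply: disc_holoM; [exact: disc_holo_id| |exact: disc_holo_cst|exact: hY].
      by apply: disc_holoD; [exact: disc_holo_plus|apply: disc_holoN; exact: disc_holo_plus].
    have hb l : `|l| = 1 -> `|h l| <= (e * T)%:C.
      move=> l1; rewrite /h (YX l l1) [(l *: X z1 l) i j]mxE.
      have -> : l * (Fp (z1 + T%:C) l i j + - Fp z1 l i j) + - T%:C * (l * X z1 l i j) =
          l * (Fp (z1 + T%:C) l i j - Fp z1 l i j - T%:C * X z1 l i j) by ring.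
      rewrite normrM l1 mul1r; apply: le_trans (normC_le_abs _) _; rewrite lecR.
      exact: HT.
    have := disc_holo_mean_le hh hb.
    rewrite /h mul0r add0r; move: (Y 0 i j) => y.
    have -> : complex.Re (- T%:C * y) = - T * complex.Re y by rewrite !ReImE /= oppr0 mul0r subr0.
    have -> : complex.Im (- T%:C * y) = - T * complex.Im y by rewrite !ReImE /= oppr0 mul0r addr0.
    rewrite !normrM normrN (gtr0_norm T0) => -[h1 h2].
    by split; rewrite -(ler_pM2l T0) (mulrC T e).
  have Z (x : R) : (forall e : R, 0 < e -> `|x| <= e) -> x = 0.
    by move=> hx; apply/eqP; rewrite -normr_le0; apply/ler_addgt0Pr => e /hx; rewrite add0r.
  by apply: eqC; apply: Z => e e0; have [] := H e e0.
have /matrixP E : Y 0 = 0 by apply/matrixP => i j; rewrite Y0 mxE.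
have {}E : Y 0 = 0 by apply/matrixP.
move: E; rewrite /Y mul0r !scale0r !addr0 mulNmx addrC => /eqP.
by rewrite subr_eq0 => /eqP.
Qed.

End GaugeIdentity.

(** * The rank of the potential *)

(** The scalar computation behind dz dzbar = Laplacian / 4, with [z] in the place of the mixed
    derivative. *)
Lemma quarter_laplacian (R : realType) (x y z : R) :
  2^-1 * (2^-1 * (x%:C - 'i * z%:C) + 'i * (2^-1 * (z%:C - 'i * y%:C))) = (4^-1 * (x + y))%:C :> R[i].
Proof.
have A (a b c : R[i]) : 2^-1 * (2^-1 * (a - 'i * c) + 'i * (2^-1 * (c - 'i * b))) = 2^-1 * 2^-1 * (a + b).
  transitivity (2^-1 * 2^-1 * (a - 'i * 'i * b)); first by ring.
  by rewrite i_sqr; ring.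
have B : (4^-1 * (x + y))%:C = 2^-1 * 2^-1 * (x%:C + y%:C) :> R[i].
  rewrite (rmorphM (real_complex R)) (rmorphD (real_complex R)) (fmorphV (real_complex R)).
  by rewrite (rmorph_nat (real_complex R) 4) (_ : 4%:R = 2 * 2) ?invfM// -natrM.
exact: etrans (A _ _ _) (esym B).
Qed.

Section RealColumns.
Variables (R : realType) (N : nat).
Local Notation C := (Cplane R).
Implicit Types H : C -> 'cV[R]_N.

Lemma CkMx_cmx k V H : (forall i, Ck k V (co H i)) -> CkMx k V (fun w => cmx (H w)).
Proof.
move=> HC i j; split.
  have -> : rp (fun w => cmx (H w) i j) = co H i.
    by apply/funext => p; rewrite /rp /co mxE (ord1 j).
  exact: HC.
have -> : ip (fun w => cmx (H w) i j) = fun=> 0.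
  by apply/funext => p; rewrite /ip mxE.
exact: Ck_cst.
Qed.

Lemma dz_cmx H w : dz (fun w => cmx (H w)) w = 2^-1 *: (cmx (dumx H w) - 'i *: cmx (dvmx H w)) /\
  dzbar (fun w => cmx (H w)) w = 2^-1 *: (cmx (dumx H w) + 'i *: cmx (dvmx H w)).
Proof.
have [D10 D20] : D1 (fun _ : R * R => 0 : R) (ofC w) = 0 /\ D2 (fun _ : R * R => 0 : R) (ofC w) = 0.
  by have [_ -> ->] := has_D_cst (ofC w) (0 : R).
have eu i j : duC (fun w => cmx (H w) i j) w = (dumx H w i j)%:C.
  have er : (fun w => complex.Re (cmx (H w) i j)) = fun w => H w i j by apply/funext => t; rewrite mxE.
  have ei : (fun w => complex.Im (cmx (H w) i j)) = fun=> 0 by apply/funext => t; rewrite mxE.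
  rewrite /duC er ei; apply: eqC; first by rewrite /= [dumx H w i j]mxE.
  by rewrite /= duE; exact: D10.
have ev i j : dvC (fun w => cmx (H w) i j) w = (dvmx H w i j)%:C.
  have er : (fun w => complex.Re (cmx (H w) i j)) = fun w => H w i j by apply/funext => t; rewrite mxE.
  have ei : (fun w => complex.Im (cmx (H w) i j)) = fun=> 0 by apply/funext => t; rewrite mxE.
  rewrite /dvC er ei; apply: eqC; first by rewrite /= [dvmx H w i j]mxE.
  by rewrite /= dvE; exact: D20.
split; apply/matrixP => i j; rewrite [LHS]mxE eu ev; move: (dumx H w) (dvmx H w) => a b; rewrite !mxE.
  by [].
by [].
Qed.

(** Applied to the light lift, this identifies the [dz] derivative of [Y_zbar] with the second
    column of [gauss_frame]. *)
Lemma dz_dzbar_cmx V H w : open V -> V (ofC w) -> (forall i, Ck 3 V (co H i)) ->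
  has_WM (fun w => dzbar (fun w => cmx (H w)) w) w
    (cmx (4^-1 *: (dumx (dumx H) w + dvmx (dvmx H) w))) (dzbar (fun w => dzbar (fun w => cmx (H w)) w) w).
Proof.
move=> oV Vw HC.
have H1 : CkMx 1 V (fun w => cmx (dumx H w)).
  by apply: CkMx_cmx => i; rewrite co_dumx; apply: CkW; apply: CkD1; exact: HC.
have H2 : CkMx 1 V (fun w => cmx (dvmx H w)).
  by apply: CkMx_cmx => i; rewrite co_dvmx; apply: CkW; apply: CkD2; exact: HC.
have K1 := CkMx_has_WM oV Vw H1; have K2 := CkMx_has_WM oV Vw H2.
have K := has_WM_scale 2^-1 (has_WM_add K1 (has_WM_scale 'i K2)).
have E : (fun w => dzbar (fun w => cmx (H w)) w) = fun w => 2^-1 *: (cmx (dumx H w) + 'i *: cmx (dvmx H w)).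
  by apply/funext => t; have [_ ->] := dz_cmx H t.
rewrite E; have [_ e2] := has_WM_dz K; rewrite e2; apply: (eq_has_WM _ erefl K).
have [-> _] := dz_cmx (dumx H) w; have [-> _] := dz_cmx (dvmx H) w.
have cl : dumx (dvmx H) w = dvmx (dumx H) w.
  apply/matrixP => i j; rewrite (ord1 j).
  have a := dumx_co (dvmx H) w i; have b := dvmx_co (dumx H) w i.
  rewrite (co_dvmx H) in a; rewrite (co_dumx H) in b.
  apply: etrans a (etrans _ (esym b)).
  by apply: (clairaut oV _ Vw); apply: CkW; exact: HC.
rewrite cl; move: (dumx (dumx H) w) (dvmx (dvmx H) w) (dvmx (dumx H) w) => a b d.
by apply/matrixP => i j; rewrite !mxE; exact: quarter_laplacian.
Qed.

End RealColumns.

(** * Vectors annihilated by the p-part of the frame *)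

Section Annihilator.
Variables (R : realType) (n : nat).
Local Notation C := (Cplane R).
Variables (U : set C) (F0 : C -> 'M[R]_(4 + n)).
Hypothesis oU : open U.
Hypothesis sF0 : smoothRmx U F0.
Hypothesis F0O : forall z, U z -> O1 (F0 z).

Lemma mul_lsubmx (T : nzRingType) m k a b (A : 'M[T]_(m, k)) (B : 'M[T]_(k, a + b)) :
  lsubmx (A *m B) = A *m lsubmx B /\ rsubmx (A *m B) = A *m rsubmx B.
Proof. by rewrite -[B]hsubmxK mul_mx_row !row_mxKl !row_mxKr. Qed.

Lemma has_WM_rsub m a b (f : C -> 'M[C]_(m, a + b)) z P Q : has_WM f z P Q ->
  has_WM (fun w => rsubmx (f w)) z (rsubmx P) (rsubmx Q).
Proof.
move=> h i j; have -> : (fun w => rsubmx (f w) i j) = (fun w => f w i (rshift a j)).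
  by apply/funext => w; rewrite mxE.
by rewrite [rsubmx P i j]mxE [rsubmx Q i j]mxE.
Qed.

Lemma orth_blocks (A : 'M[C]_(4 + n)) (c : 'cV[C]_4) : A^T *m I1 C (4 + n) *m A = I1 C (4 + n) ->
  A^T *m I1 C (4 + n) *m (lsubmx A *m c) = col_mx (I1 C 4 *m c) 0.
Proof.
move=> h; have -> : lsubmx A *m c = A *m col_mx c 0.
  by rewrite -[in RHS](hsubmxK A) mul_row_col mulmx0 addr0.
by rewrite mulmxA h I1_block mul_block_col !mul0mx !mulmx0 !addr0.
Qed.

Lemma orth_rsub (A : 'M[C]_(4 + n)) (c : 'cV[C]_4) : A^T *m I1 C (4 + n) *m A = I1 C (4 + n) ->
  (rsubmx A)^T *m I1 C (4 + n) *m (lsubmx A *m c) = 0.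
Proof.
move=> h; have /(congr1 dsubmx) := orth_blocks c h.
by rewrite col_mxKd -[in X in X -> _](hsubmxK A) tr_row_mx hsubmxK !mul_col_mx col_mxKd.
Qed.

Lemma rsub_annihilator (A P : 'M[C]_(4 + n)) (c c' : 'cV[C]_4) : A^T *m I1 C (4 + n) *m A = I1 C (4 + n) ->
  (rsubmx (A *m P))^T *m I1 C (4 + n) *m (lsubmx A *m c) + (rsubmx A)^T *m I1 C (4 + n) *m (lsubmx A *m c') =
  (ursubmx P)^T *m I1 C 4 *m c.
Proof.
move=> h; rewrite (orth_rsub c' h) addr0 (mul_lsubmx _ _).2 trmx_mul.
rewrite -(mulmxA (rsubmx P)^T) -(mulmxA (rsubmx P)^T) (orth_blocks c h).
by rewrite -[in LHS](submxK P) block_mxEh row_mxKr tr_col_mx mul_row_col mulmx0 addr0 mulmxA.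
Qed.

(* Differentiating <last n columns of F, X> = 0. *)
Lemma tangent_annihilator z (X : C -> 'cV[C]_(4 + n)) (c c' : 'cV[C]_4) Xb : U z ->
  (\forall w \near z, exists c, X w = lsubmx (cmx (F0 w)) *m c) ->
  X z = lsubmx (cmx (F0 z)) *m c -> has_WM X z (lsubmx (cmx (F0 z)) *m c') Xb ->
  (ursubmx (mc_z F0 z))^T *m I1 C 4 *m c = 0.
Proof.
move=> Uz nX Xz HX; have H0 := has_WM_rsub (lift_has_WM oU sF0 Uz); have [E1 _] := mc_lift F0O Uz.
rewrite E1 in H0; have H := has_WM_mul (has_WM_mulr (I1 C (4 + n)) (has_WM_tr H0)) HX.
have nU : \forall w \near z, U w by exact: (open_nbhs_nbhs (conj oU Uz)).
have n0 : \forall w \near z, (rsubmx (cmx (F0 w)))^T *m I1 C (4 + n) *m X w = 0.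
  by apply: filterS2 nX nU => w [cw ->] Uw; exact: orth_rsub (cmx_O1 (F0O Uw)).
have e := rsub_annihilator (mc_z F0 z) c c' (cmx_O1 (F0O Uz)); rewrite -Xz in e.
apply/matrixP => i j; rewrite [RHS]mxE.
have [] := has_W_near0 (H i j) _; first by apply: filterS n0 => w ->; rewrite mxE.
by move=> + _; rewrite e.
Qed.

(** Membership in the Lorentz Lie algebra determines the lower left block by the upper right one. *)
Lemma mc_z_potential z : U z -> ppart (mc_z F0 z) = potential_mx (ursubmx (mc_z F0 z)).
Proof.
move=> Uz; have := mc_so oU sF0 F0O Uz; have [-> _] := kppart_block (mc_z F0 z).
move: (mc_z F0 z) => P; rewrite -[in X in X -> _](submxK P) I1_block tr_block_mx !mulmx_block add_block_mx.
move=> /(congr1 dlsubmx); rewrite block_mxKdl !mul0mx !mul1mx !mulmx0 !add0r addr0 => /eqP.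
have -> : dlsubmx (0 : 'M[C]_(4 + n)) = 0 by apply/matrixP => ? ?; rewrite !mxE.
by rewrite addr_eq0 => /eqP ->.
Qed.

Lemma rank_potential (B : 'M[C]_(4, n)) : \rank (potential_mx B) = (\rank B + \rank B)%N.
Proof.
rewrite /potential_mx rank_antidiag; congr (_ + _)%N; rewrite mxrank_opp mxrankMfree ?mxrank_tr//.
by apply/row_freeP; exists (I1 C 4); exact: I1_sq.
Qed.

(** [B^T *m I1] has four columns, so a kernel of dimension at least 3 leaves rank at most 1. *)
Lemma rank_le1_annihilator (B : 'M[C]_(4, n)) (c1 c2 c3 : 'cV[C]_4) :
  B^T *m I1 C 4 *m c1 = 0 -> B^T *m I1 C 4 *m c2 = 0 -> B^T *m I1 C 4 *m c3 = 0 ->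
  (3 <= \rank (row_mx (row_mx c1 c2) c3))%N -> (\rank B <= 1)%N.
Proof.
move=> h1 h2 h3 r3.
have := @mulmx0_rank_max _ _ _ _ (B^T *m I1 C 4) (row_mx (row_mx c1 c2) c3).
rewrite !mul_mx_row h1 h2 h3 !row_mx0 => /(_ erefl).
rewrite mxrankMfree ?mxrank_tr; last by apply/row_freeP; exists (I1 C 4); exact: I1_sq.
by move=> h; rewrite -(leq_add2r 3) (leq_trans (leq_add (leqnn _) r3) h).
Qed.

End Annihilator.

(** Pairing with [x] removes the tangential term and gives [a + b * x ord0 = 0]; together with
    [a + b = 0] this is [a * (1 - x ord0) = 0]. What remains is [c] times a vector that is nonzero
    because [u] is. *)
Lemma span_independent (R : realType) k (x u v : 'I_k.+1 -> R) (a b c : R[i]) :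
  ipp x x = 1 -> ipp u x = 0 -> ipp v x = 0 -> ipp u u != 0 -> 1 - x ord0 != 0 -> a + b = 0 ->
  (forall j, a * (x j)%:C + b * (j == ord0)%:R + c * (2^-1 * ((u j)%:C + 'i * (v j)%:C)) = 0) ->
  [/\ a = 0, b = 0 & c = 0].
Proof.
move=> xx ux vx uu x0 ab H.
have S : a * (ipp x x)%:C + b * (x ord0)%:C + c * (2^-1 * ((ipp u x)%:C + 'i * (ipp v x)%:C)) = 0.
  have -> : (x ord0)%:C = \sum_j (j == ord0)%:R * (x j)%:C.
    rewrite big_ord_recl eqxx mul1r big1 ?addr0// => i _.
    by rewrite eq_sym (negbTE (neq_lift _ _)) mul0r.
  have E (f g : 'I_k.+1 -> R) : (ipp f g)%:C = \sum_j (f j)%:C * (g j)%:C :> R[i].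
    by rewrite /ipp (rmorph_sum (real_complex R)); apply: eq_bigr => j _; rewrite (rmorphM (real_complex R)).
  rewrite !E !mulr_sumr -!big_split /= !mulr_sumr -big_split /= big1// => j _.
  by rewrite -[RHS](mul0r (x j)%:C) -(H j); ring.
move: S; rewrite xx ux vx mulr0 addr0 mulr0 mulr0 addr0 rmorph1 mulr1 => S.
have eb : b = - a by apply/eqP; rewrite -addr_eq0 addrC ab.
have a0 : a = 0.
  have : a * (1 - x ord0)%:C = 0 by rewrite rmorphB rmorph1 mulrBr mulr1 -S eb; ring.
  by move/eqP; rewrite mulf_eq0 fmorph_eq0 (negbTE x0) orbF => /eqP.
have b0 : b = 0 by rewrite eb a0 oppr0.
split=> //; apply: contrapT => /eqP c0; move/eqP: uu; apply; rewrite /ipp big1// => j _.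
have := H j; rewrite a0 b0 !mul0r !add0r => /eqP; rewrite mulf_eq0 (negbTE c0) /= mulf_eq0 invr_eq0 pnatr_eq0 /=.
by move/eqP/(congr1 (@complex.Re R)); rewrite !ReImE /= !mul0r mulr0 subrr addr0 => ->; rewrite mul0r.
Qed.

Section GaussRank.
Variables (R : realType) (n : nat).
Local Notation C := (Cplane R).
Local Notation S := (Rsphere R).

Lemma span_lift (G : 'M[R]_(4 + n)) V : oriented_span (Kcoset G) V -> exists Q, V = lsubmx G *m Q.
Proof.
move=> [_ [P [[_ [A [B [_ _ ->]]] <-] _ ->]]]; exists (A *m P).
have -> : lsubmx (G *m block_mx A 0 0 B) = lsubmx G *m A.
  by rewrite -[in LHS](hsubmxK G) mul_row_block !mulmx0 addr0 add0r row_mxKl.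
by rewrite mulmxA.
Qed.

Lemma subspace_lift (G : 'M[R]_(4 + n)) a : subspace_of (Kcoset G) a -> exists c, a = lsubmx G *m c.
Proof.
move=> [_ [c [[_ [A [B [_ _ ->]]] <-] ->]]]; exists (A *m c).
have -> : lsubmx (G *m block_mx A 0 0 B) = lsubmx G *m A.
  by rewrite -[in LHS](hsubmxK G) mul_row_block !mulmx0 addr0 add0r row_mxKl.
by rewrite mulmxA.
Qed.

Lemma row4_columns N m (a b c d : 'cV[R]_N) (L : 'M[R]_(N, m)) (Q : 'M[R]_(m, (1 + 1) + (1 + 1))) :
  row_mx (row_mx a b) (row_mx c d) = L *m Q ->
  exists q0 q1 q2 q3, [/\ a = L *m q0, b = L *m q1, c = L *m q2 & d = L *m q3].
Proof.
rewrite -[Q]hsubmxK -[lsubmx Q]hsubmxK -[rsubmx Q]hsubmxK !mul_mx_row.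
move=> /eq_row_mx[/eq_row_mx[-> ->] /eq_row_mx[-> ->]].
by do 4! eexists.
Qed.

Lemma cmx_lsub (G : 'M[R]_(4 + n)) (q : 'cV[R]_4) : cmx (lsubmx G *m q) = lsubmx (cmx G) *m cmx q.
Proof. by rewrite /cmx map_mxM; congr (_ *m _); apply/matrixP => i j; rewrite !mxE. Qed.

Lemma cmx_lsub_comb (G : 'M[R]_(4 + n)) (a b : 'cV[R]_4) (x1 x2 : 'cV[R]_(4 + n)) (k l : C) :
  x1 = lsubmx G *m a -> x2 = lsubmx G *m b ->
  k *: (cmx x1 + l *: cmx x2) = lsubmx (cmx G) *m (k *: (cmx a + l *: cmx b)).
Proof. by move=> -> ->; rewrite !cmx_lsub -scalemxAr mulmxDr -scalemxAr. Qed.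

Section LightLift.
Variable H : C -> 'cV[R]_(3 + n).
Let Y := light_lift (fun=> 0) H.

Lemma light_lift_head z : Y z (lshift (3 + n) (ord0 : 'I_1)) 0 = 1.
Proof.
rewrite /Y /light_lift oppr0 expR0 scale1r.
by apply: etrans (col_mxEu (1%:M : 'cV[R]_1) (H z) ord0 0) _; rewrite mxE.
Qed.

Lemma light_lift_tail z j : Y z (rshift 1 j) 0 = H z j 0.
Proof.
rewrite /Y /light_lift oppr0 expR0 scale1r.
exact: (col_mxEd (1%:M : 'cV[R]_1) (H z) j 0).
Qed.

Lemma co_light_head : co Y (lshift (3 + n) (ord0 : 'I_1)) = fun=> 1.
Proof. by apply/funext => p; exact: light_lift_head. Qed.

Lemma co_light_tail j : co Y (rshift 1 j) = co H j.
Proof. by apply/funext => p; exact: light_lift_tail. Qed.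

Lemma Ck_light k V : (forall j, Ck k V (co H j)) -> forall i, Ck k V (co Y i).
Proof.
move=> HC i; have [j e|j e] := split_ordP (i : 'I_(1 + (3 + n))).
  by rewrite (_ : co Y i = fun=> 1); [exact: Ck_cst|rewrite e (ord1 j) -co_light_head].
by rewrite (_ : co Y i = co H j); [exact: HC|rewrite e -co_light_tail].
Qed.

End LightLift.

Variables (D M : set S) (y : S -> 'cV[R]_(3 + n)) (FF : S -> set 'M[R]_(4 + n)).
Hypothesis hD : is_sphere_plane_or_disk D.
Hypothesis hy : smooth_sphere_map D y.
Hypotheses (oM : open M) (MD : M `<=` D).
Hypothesis immM : forall q, M q -> immersion_at_point y q.
Hypothesis confM : forall b w, M (chart b w) -> conformal_at (y \o chart b) w.
Hypothesis gauss : is_conformal_gauss_map M y FF.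
Hypothesis hv : forall q, D q -> subspace_of (FF q) (v0 R n).
Variables (U : set C) (F0 : C -> 'M[R]_(4 + n)).
Hypothesis lF0 : is_lift D FF false U F0.

(** The fields to test are those that lie in the 4-space together with their [dz] derivative: [Y]
    with derivative [Y_z], the constant [v0], and [Y_zbar], whose derivative is the frame vector
    [Y_(z zbar)]. The field [Y_z] would not do, since nothing places [Y_zz] in the 4-space. *)
Lemma gauss_rank_le1 z : U z -> M (Some z) -> 1 - co (y \o chart false) (ord0 : 'I_(2 + n).+1) (ofC z) != 0 ->
  (\rank (ursubmx (mc_z F0 z)) <= 1)%N.
Proof.
move=> Uz Mz np; have [oU UD sF0 F0G] := lF0.
have F0O w : U w -> O1 (F0 w) by move=> /F0G[/SO1plus_O1].
pose H := y \o chart false; pose Y := light_lift (fun=> 0) H.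
pose V := (@toC R) @^-1` (chart false @^-1` M).
have oV : open V.
  by apply: open_toC; rewrite openE => w Aw; exact: open_near_chart oM Aw.
have Vz : V (ofC z) by rewrite /V /= toCK.
have hC k i : Ck k V (co H i).
  by apply: Ck_sub (smooth_on_Ck k (hy.2 false i 0)) => p; exact: MD.
have YC k i : Ck k V (co Y i) by apply: Ck_light; exact: hC.
have cols w : U w -> M (Some w) -> exists q0 q1 q2 q3, [/\ Y w = lsubmx (F0 w) *m q0,
    4^-1 *: (dumx (dumx Y) w + dvmx (dvmx Y) w) = lsubmx (F0 w) *m q1,
    dumx Y w = lsubmx (F0 w) *m q2 & dvmx Y w = lsubmx (F0 w) *m q3].
  move=> Uw Mw; have := gauss (@smoothR_cst _ _ 0) (Mw : M (chart false w)).
  have [_ ->] := F0G w Uw; move=> /span_lift[Q E].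
  exact: row4_columns E.
have nUM : \forall w \near z, U w /\ M (Some w).
  have n1 : \forall w \near z, U w by exact: (open_nbhs_nbhs (conj oU Uz)).
  by apply: filterS2 n1 (open_near_chart oM (Mz : M (chart false z))).
have [q0 [q1 [q2 [q3 [e0 e1 e2 e3]]]]] := cols z Uz Mz.
have [dY bY] := dz_cmx Y z.
have A1 : (ursubmx (mc_z F0 z))^T *m I1 C 4 *m cmx q0 = 0.
  apply: (tangent_annihilator (X := fun w => cmx (Y w)) (c' := 2^-1 *: (cmx q2 + (- 'i) *: cmx q3)) oU sF0 F0O Uz).
  - by apply: filterS nUM => w [Uw Mw]; have [p0 [? [? [? [-> _ _ _]]]]] := cols w Uw Mw; exists (cmx p0); rewrite cmx_lsub.
  - by rewrite e0 cmx_lsub.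
  - rewrite -(cmx_lsub_comb _ _ e2 e3) scaleNr -dY.
    exact: CkMx_has_WM oV Vz (CkMx_cmx (YC 1%N)).
have [a ea] : exists a, v0 R n = lsubmx (F0 z) *m a.
  by apply: subspace_lift; have [_ <-] := F0G z Uz; exact: hv (MD Mz).
have A2 : (ursubmx (mc_z F0 z))^T *m I1 C 4 *m cmx a = 0.
  apply: (tangent_annihilator (X := fun=> cmx (v0 R n)) (c' := 0) oU sF0 F0O Uz).
  - apply: filterS nUM => w [Uw Mw]; have [aw ->] : exists a, v0 R n = lsubmx (F0 w) *m a.
      by apply: subspace_lift; have [_ <-] := F0G w Uw; exact: hv (MD Mw).
    by exists (cmx aw); rewrite cmx_lsub.
  - by rewrite ea cmx_lsub.
  - by rewrite mulmx0; exact: has_WM_cst.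
have A3 : (ursubmx (mc_z F0 z))^T *m I1 C 4 *m (2^-1 *: (cmx q2 + 'i *: cmx q3)) = 0.
  apply: (tangent_annihilator (X := fun w => dzbar (fun w => cmx (Y w)) w) (c' := cmx q1) oU sF0 F0O Uz).
  - apply: filterS nUM => w [Uw Mw]; have [? [? [p2 [p3 [_ _ E2 E3]]]]] := cols w Uw Mw.
    exists (2^-1 *: (cmx p2 + 'i *: cmx p3)); have [_ ->] := dz_cmx Y w.
    exact: cmx_lsub_comb E2 E3.
  - exact: etrans bY (cmx_lsub_comb _ _ e2 e3).
  - by rewrite -cmx_lsub -e1; exact: dz_dzbar_cmx oV Vz (YC 3%N).
apply: (rank_le1_annihilator A1 A2 A3).
(* The coefficient vectors in the frame are independent because their images in the ambient space
   are. *)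
apply: leq_trans (mxrankM_maxr (lsubmx (cmx (F0 z))) _).
rewrite !mul_mx_row -(cmx_lsub_comb _ _ e2 e3) -!cmx_lsub -e0 -ea -mxrank_tr.
suff /eqP -> : row_free (row_mx (row_mx (cmx (Y z)) (cmx (v0 R n))) (2^-1 *: (cmx (dumx Y z) + 'i *: cmx (dvmx Y z))))^T by [].
apply: inj_row_free => v; rewrite -[v]hsubmxK -[lsubmx v]hsubmxK.
move: (lsubmx (lsubmx v)) (rsubmx (lsubmx v)) (rsubmx v) => ca cb cc.
rewrite !tr_row_mx !mul_row_col => E.
have Ei i : ca 0 0 * (Y z i 0)%:C + cb 0 0 * (v0 R n i 0)%:C
    + cc 0 0 * (2^-1 * ((D1 (co Y i) (ofC z))%:C + 'i * (D2 (co Y i) (ofC z))%:C)) = 0.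
  have := congr1 (fun M : 'rV_(4 + n) => M 0 i) E.
  rewrite -(dumx_co Y z i) -(dvmx_co Y z i); move: (Y z) (v0 R n) (dumx Y z) (dvmx Y z) => p q r s.
  by rewrite !mxE !big_ord1 !mxE.
have ab : ca 0 0 + cb 0 0 = 0.
  have := Ei (lshift (3 + n) (ord0 : 'I_1)); rewrite light_lift_head v0_entry co_light_head.
  have [_ -> ->] := has_D_cst (ofC z) (1 : R); rewrite /= => <-.
  by rewrite !(rmorph0 (real_complex R), rmorph1 (real_complex R)) mulr0 addr0 !mulr0 addr0 !mulr1.
have unitV p : V p -> ipp (fun i => co H i p) (fun i => co H i p) = 1.
  by move=> Vp; have := hy.1 _ (MD Vp); rewrite /unit_sphere /= dot_ipp.
have [n1 n2] := @unit_normal R (2 + n) V (co H) oV (hC 3%N) unitV (ofC z) Vz.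
have Euu : ipp (fun i => D1 (co H i) (ofC z)) (fun i => D1 (co H i) (ofC z)) != 0.
  have := immersion_dot_neq0 (confM (Mz : M (chart false z))) (immM Mz (erefl : chart false z = Some z)).
  rewrite dot_ipp; apply: contra => /eqP e; apply/eqP; rewrite -[RHS]e.
  by congr ipp; apply/funext => i; rewrite dumx_co.
have Sp (j : 'I_(2 + n).+1) : ca 0 0 * (co H j (ofC z))%:C + cb 0 0 * (j == ord0)%:R
    + cc 0 0 * (2^-1 * ((D1 (co H j) (ofC z))%:C + 'i * (D2 (co H j) (ofC z))%:C)) = 0.
  have := Ei (rshift 1 j); rewrite light_lift_tail v0_entry co_light_tail => <-.
  congr (_ * _ + _ * _ + _); first by rewrite /co toCK.
  have -> : (j == ord0)%:R = (1 + j < 2)%N%:R :> C by congr (_%:R); case: j => [[]].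
  by case: (_ < 2)%N; rewrite /= ?(rmorph0 (real_complex R)) ?(rmorph1 (real_complex R)).
have [a0 b0 c0] := span_independent (unitV _ Vz) n1 n2 Euu np ab Sp.
have z1 (m : 'M[C]_1) : m 0 0 = 0 -> m = 0.
  by move=> h; apply/matrixP => i j; rewrite !ord1 h mxE.
by rewrite (z1 _ a0) (z1 _ b0) (z1 _ c0) !row_mx0.
Qed.

End GaussRank.

(** * Conclusions for strong Willmore maps *)

Section Conclusion.
Variables (R : realType) (n : nat).
Local Notation C := (Cplane R).
Local Notation S := (Rsphere R).

Lemma potential_so (B : 'M[C]_(4, n)) :
  I1 C (4 + n) *m potential_mx B + (potential_mx B)^T *m I1 C (4 + n) = 0.
Proof.
have e : (- (B^T *m I1 C 4))^T = - (I1 C 4 *m B) by rewrite linearN /= trmx_mul trmxK I1_tr.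
rewrite /potential_mx I1_block tr_block_mx e !trmx0 !mulmx_block add_block_mx.
rewrite !mul0mx !mulmx0 !mul1mx !mulmx1 !addr0 !add0r.
by rewrite subrr addNr -[RHS]block_mx0.
Qed.

Lemma potential_entry (B : 'M[C]_(4, n)) i j : potential_mx B (lshift n i) (rshift 4 j) = B i j.
Proof. exact: block_mxEur. Qed.

Lemma rank_potential_le1 (A B : 'M[C]_(4, n)) :
  \rank (potential_mx A) = \rank (potential_mx B) -> (\rank B <= 1)%N -> (\rank A <= 1)%N.
Proof.
have h (x y a b : nat) : x = (a + a)%N -> y = (b + b)%N -> x = y -> (b <= 1)%N -> (a <= 1)%N.
  by move=> -> ->; rewrite !addnn => /double_inj ->.
exact: (h _ _ _ _ (rank_potential A) (rank_potential B)).
Qed.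

(** Meromorphy says nothing about the value at the base point itself, hence the puncture. *)
Lemma meromorphic_derivable (D : set S) (f : S -> C) : meromorphic D f -> D (Some (0 : C)) ->
  \forall w \near (0 : C), w != 0 -> derivable (fun w : C => f (Some w)) w 1.
Proof.
move=> mf D0; have [k [g [dg fg]]] := mf _ D0 false 0 erefl.
have nfg : \forall w \near (0 : C), \forall t \near w, t != 0 -> f (chart false t) = g t / (t - 0) ^+ k.
  exact: near_join.
apply: filterS2 dg nfg => w dw nw w0.
apply: (@near_eq_derivableC _ (fun t : C => g t / (t - 0) ^+ k)).
  by apply: filterS2 nw (near_ne w0) => t h t0; rewrite -h.
apply: derivableM dw _; apply: derivableV; first by rewrite subr0 expf_neq0.
have d1 : derivable (fun t : C => t - 0) w 1.
  rewrite (_ : (fun t : C => t - 0) = id); first exact: derivable_id.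
  by apply/funext => t; rewrite subr0.
exact: (derivable_expC d1).
Qed.

Variables (D : set S) (FF : S -> set 'M[R]_(4 + n)) (f : nat -> nat -> S -> C).
Hypothesis hD : is_sphere_plane_or_disk D.
Hypothesis harm : Defs.harmonic D FF.
Hypothesis heta : is_normalized_potential D FF (fun q => potential_mx (Bhat n f q)).
Variables (M : set S) (y : S -> 'cV[R]_(3 + n)).
Hypothesis hy : smooth_sphere_map D y.
Hypotheses (oM : open M) (MD : M `<=` D) (DM : D `<=` closure M).
Hypothesis immM : forall q, M q -> immersion_at_point y q.
Hypothesis confM : forall b w, M (chart b w) -> conformal_at (y \o chart b) w.
Hypothesis gauss : is_conformal_gauss_map M y FF.

Lemma strong_willmore_minimal : moebius_equivalent_to_minimal D y.
Proof.
exact: (minimal_from_lightlike hD hy oM MD DM immM confM harm.1 gauss (v0_everywhere harm hD heta)).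
Qed.

(** Near the base point the invertible matrix [F_+(z, 0)] conjugates the potential to the p-part of
    the frame, whose rank [gauss_rank_le1] controls. This is done on a small open set that avoids 0,
    so that the potential is holomorphic there, and that meets the conditions of immersion and of
    avoiding the pole. *)
Lemma potential_rank_le1 : exists2 r, is_generic_rank D (Bhat n f) r & (r <= 1)%N.
Proof.
have hv := v0_everywhere harm hD heta.
have [mer [U [F0 [F [Fm [Fp [[_ U0 lF0 F00] HF HFmp HFm]]]]]]] := heta.
have [oU UD sF0 F0G] := lF0.
have F0O w : U w -> O1 (F0 w) by move=> /F0G[/SO1plus_O1].
have D0 : D (Some (0 : C)) := UD 0 U0.
pose eta (w : C) := potential_mx (Bhat n f (Some w)).
have nd : \forall w \near (0 : C), forall i j, w != 0 -> derivable (fun w : C => eta w i j : C) w 1.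
  exact: (filter_forall _ (fun i => filter_forall _ (fun j => meromorphic_derivable (mer i j) D0))).
have nU : \forall w \near (0 : C), U w by exact: (open_nbhs_nbhs (conj oU U0)).
have [W [oW W0] HW] := near_open (filterI nU nd).
pose M' := [set q | [/\ D q, immersion_at_point y q & moebius 1%:M (y q) <> pole R n]].
have [oM' _ DM'] : open_dense_in D M' := minimal_domain_open_dense hD hy oM MD DM immM confM.
have [t Wt Mt] := dense_chart DM (D0 : D (chart false 0)) (open_nbhs_nbhs (conj oW W0)).
have [W2 [oW2 W2t] HW2] := near_open (filterI (open_nbhs_nbhs (conj oW Wt)) (open_near_chart oM Mt)).
have [t2 W2t2 Mt2] := dense_chart DM' (MD Mt) (open_nbhs_nbhs (conj oW2 W2t)).
have nQ : \forall w \near t2, \forall s \near w, W2 s /\ M' (chart false s).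
  by apply: near_join; exact: filterI (open_nbhs_nbhs (conj oW2 W2t2)) (open_near_chart oM' Mt2).
(* The point [t2] may happen to be 0; then a neighbour of it is taken. *)
have [z1 z10 nz1] : exists2 z1, z1 != 0 & \forall s \near z1, W2 s /\ M' (chart false s).
  have [e|t20] := eqVneq t2 0; last by exists t2 => //; exact: nbhs_singleton nQ.
  by have [z1 z1t nz1] := near_exists_neq nQ; exists z1 => //; rewrite -e.
have P w : w != 0 -> W2 w -> [/\ U w, M (Some w) & forall i j, derivable (fun w : C => eta w i j : C) w 1].
  by move=> w0 /HW2[/HW[Uw dw] Mw]; split=> // i j; exact: dw.
have [W2z1 _] := nbhs_singleton nz1; have [_ Mz1 _] := P z1 z10 W2z1.
have ed i j : (fun w : C => Bhat n f (Some w) i j) = fun w => eta w (lshift n i) (rshift 4 j).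
  by apply/funext => w; rewrite /eta potential_entry.
apply: (generic_rank_le1 hD _ (MD Mz1) z10).
- move=> i j; rewrite (_ : (fun q => _) = fun q => potential_mx (Bhat n f q) (lshift n i) (rshift 4 j)).
    exact: mer.
  by apply/funext => q; rewrite potential_entry.
- move=> i j; apply: filterS2 nz1 (near_ne z10) => w [W2w _] w0; rewrite ed.
  by have [_ _] := P w w0 W2w; apply.
- apply: filterS2 nz1 (near_ne z10) => w [W2w M'w] w0; have [Uw Mw dw] := P w w0 W2w.
  have [_ _ np] := (minimal_domainP hD hy DM confM false w).1 M'w.
  have r1 := gauss_rank_le1 hy oM MD immM confM gauss hv lF0 Uw Mw np.
  have [_ pw _] := HFmp w Uw.
  have e0 : `|(0 : C)| <= 1 by rewrite normr0.
  have [_ uF] := O1_invmx (plus_loop_O1 pw e0).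
  have G := gauge_identity oU sF0 F0O HF HFmp HFm (fun z => potential_so _) Uw (mcont_derivable dw).
  have : \rank (eta w) = \rank (potential_mx (ursubmx (mc_z F0 w))).
    have ru : row_free (Fp w 0) by rewrite row_free_unit.
    have fu : row_full (Fp w 0) by rewrite row_full_unit.
    rewrite -(mc_z_potential oU sF0 F0O Uw) -(mxrankMfree (eta w) ru) G.
    by rewrite (eqmxMfull _ fu).
  by move=> e; exact: (rank_potential_le1 e r1).
Qed.

End Conclusion.

Theorem theorem1p4 (R : realType) (m : nat) (hm : (3 <= m)%N)
    (D : set (Rsphere R)) (hD : is_sphere_plane_or_disk D)
    (FF : Rsphere R -> set 'M[R]_(4 + (m.*2 - 4)))
    (hFF : strongly_conformally_harmonic D FF)
    (hbase : FF (Some (0%R : Cplane R)) = Kcoset (1%:M)%R)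
    (f : nat -> nat -> Rsphere R -> Cplane R)
    (hf : forall i j, (1 <= i <= m - 2)%N -> (1 <= j <= 4)%N ->
            meromorphic D (f i j))
    (heta : is_normalized_potential D FF
              (fun q => potential_mx (Bhat (m.*2 - 4) f q))) :
  contains_constant_lightlike D FF /\
  (forall y : Rsphere R -> 'cV[R]_(3 + (m.*2 - 4)),
     strong_Willmore_with_gauss_map D y FF ->
     (exists2 r : nat, is_generic_rank D (Bhat (m.*2 - 4) f) r & (r <= 1)%N) /\
     moebius_equivalent_to_minimal D y).
Proof.
have [harm _] := hFF; split; first exact: (constant_lightlike harm hD heta).
move=> y [hy [M [[oM MD DM] [immM confM _] _ gauss]]]; split.
  exact: (potential_rank_le1 hD harm heta hy oM MD DM immM confM gauss).
exact: (strong_willmore_minimal hD harm heta hy oM MD DM immM confM gauss).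
Qed.
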